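(* Let $T>0$, let $W=(W_t)_{0\le t\le T}$ and $B=(B_t)_{0\le t\le T}$ be standard Brownian motions and let $X=(X_t)_{0\le t\le T}$ be a finite variation real L\'evy process with characteristics $(\lambda,0,\nu)$ and $\int_{\mathbb R\setminus\{0\}}|x|\,\nu(\mathrm dx)<\infty$, with $B$, $X$, $W$ independent. Set $Y_t=B_t+X_t$ and $$\hat\eta^T_t=W_t-\frac tT W_T+\frac tT Y_t,\qquad 0\le t\le T.$$ Let $\mathcal N$ be the Poisson random measure associated with (the jumps of) $X$. Then the process $(\hat m^T_t,\ 0\le t\le T)$ given by $$\hat m^T_t=\hat\eta^T_t-\int_0^t\frac{\left(\lambda-\int_{|x|<1}x\,\nu(\mathrm dx)\right)s+T\sum_{0<u\le s}\frac{\Delta\hat\eta^T_u}{u}+\mathfrak R^{\hat\eta^T}(s,T)-\hat\eta^T_s}{T-s}\,\mathrm ds-\frac{t^2}{2T}\left(\lambda+\int_{|x|\ge1}x\,\nu(\mathrm dx)\right)$$ is a martingale with respect to the natural filtration $\mathbb F^{\hat\eta^T}$ of $\hat\eta^T$, where, for $0\le s<T$, $$\begin{aligned} \mathfrak R^{\hat\eta^T}(s,T)={}&\frac{T-s}{T-s+s\tan^{-1}\left(\frac sT\right)}\Bigg[\int_0^s\left(\frac{Tu}{u^2+T^2}+\tan^{-1}\left(\frac uT\right)\right)\mathrm d\hat\eta^T_u\\ &\quad-\frac1T\int_0^s\int_{\mathbb R}\left(\frac{Tu^2}{u^2+T^2}+u\tan^{-1}\left(\frac uT\right)\right)x\,\mathcal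 N(\mathrm du,\mathrm dx)\\ &\quad-\int_0^s\left(\frac{Tu}{u^2+T^2}+\tan^{-1}\left(\frac uT\right)\right)\left(\sum_{0<v\le u}\frac{\Delta\hat\eta^T_v}{v}\right)\mathrm du\Bigg]\\ &+\frac{s\tan^{-1}\left(\frac sT\right)}{T-s+s\tan^{-1}\left(\frac sT\right)}\Bigg[\hat\eta^T_s-\int_0^s\int_{\mathbb R}\frac{ux}{T}\,\mathcal N(\mathrm du,\mathrm dx)-\int_0^s\left(\sum_{0<v\le u}\frac{\Delta\hat\eta^T_v}{v}\right)\mathrm du\Bigg]\\ &-\left(\lambda-\int_{|x|<1}x\,\nu(\mathrm dx)\right)\frac{Ts(T-s)+\left(Ts^2+T^2(s-T)\right)\tan^{-1}\left(\frac sT\right)}{T\left[T-s+s\tan^{-1}\left(\frac sT\right)\right]}. \end{aligned}$$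
   Context: The L\'evy process $X$ (c\`adl\`ag, $X_0=0$) with characteristics $(\lambda,0,\nu)$ and finite variation has the L\'evy--It\^o form $$X_t=\left(\lambda-\int_{|x|<1}x\,\nu(\mathrm dx)\right)t+\sum_{s\le t}\Delta X_s,$$ where $\nu$ is the L\'evy measure and $\lambda\in\mathbb R$ is the drift coefficient relative to the truncation function $x\mathbf 1_{\{|x|<1\}}$. For a c\`adl\`ag process $Z$, $\Delta Z_u=Z_u-Z_{u-}$. The jump measure is $\mathcal N(\mathrm du,\mathrm dx)=\sum_{r:\Delta X_r\ne0}\delta_{(r,\Delta X_r)}(\mathrm du,\mathrm dx)$, a Poisson random measure with intensity $\mathrm du\,\nu(\mathrm dx)$. Integrals against $\mathrm d\hat\eta^T$ are stochastic integrals with respect to the semimartingale $\hat\eta^T$. $\tan^{-1}$ is the arctangent. The natural filtration $\mathbb F^{\hat\eta^T}$ is the filtration generated by $\hat\eta^T$, completed with the null sets. *)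

(* Defs.v *)
From HB Require Import structures.
From mathcomp Require Import all_boot all_order all_algebra.
From mathcomp Require Import all_classical all_reals all_analysis.
Set Implicit Arguments.
Unset Strict Implicit.
Unset Printing Implicit Defensive.
Import Order.TTheory GRing.Theory Num.Theory.
Import numFieldNormedType.Exports.
Local Open Scope classical_set_scope.
Local Open Scope ring_scope.

(* All processes are maps [R -> Omega -> R]; only the times in [0, T] matter. *)

Section paths.
Context {R : realType}.
Implicit Types (z : R -> R) (T u : R).

Definition cadlag T z :=
  (forall t : R, 0 <= t < T -> z s @[s --> t^'+] --> z t) /\
  (forall t : R, 0 < t <= T -> cvg (z s @[s --> t^'-])).

Definition jump z u : R := z u - lim (z s @[s --> u^'-]).

(* Sum of an absolutely summable real family over an arbitrary index set (such
   a family has countable support); no meaning otherwise. *)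
Definition abs_sum (D : set R) (f : R -> R) : R :=
  fine (\esum_(u in D) (f^\+ u)%:E) - fine (\esum_(u in D) (f^\- u)%:E).

End paths.

Section jump_measure.
Context {R : realType}.
Local Open Scope ereal_scope.

Definition jump_times (T : R) (x : R -> R) : set R :=
  [set r | (0 < r <= T)%R /\ jump x r != 0%R].

Definition jump_measure (T : R) (x : R -> R) (A : set (R * R)) : \bar R :=
  \esum_(r in jump_times T x) \d_((r, jump x r) : R * R) A.

Variables (T : R) (x : R -> R).

Let jump_measure0 : jump_measure T x set0 = 0.
Proof. by rewrite /jump_measure esum1// => r _; rewrite measure0. Qed.

Let jump_measure_ge0 A : 0 <= jump_measure T x A.
Proof. by apply: esum_ge0 => r _; exact: measure_ge0. Qed.

Let jump_measure_sigma_additive : semi_sigma_additive (jump_measure T x).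
Proof.
move=> F mF tF mU.
rewrite [X in _ --> X](_ : _ = \sum_(i <oo) jump_measure T x (F i)).
  by apply: is_cvg_nneseries => n _ _; exact: jump_measure_ge0.
rewrite nneseries_esumT; last by move=> n; exact: jump_measure_ge0.
rewrite /jump_measure.
transitivity (\esum_(r in jump_times T x) \esum_(n in [set: nat])
    (\d_((r, jump x r) : R * R) (F n) : \bar R)).
  apply: eq_esum => r _; rewrite measure_semi_bigcup//.
  by rewrite nneseries_esumT.
rewrite esum_esum; last by move=> *; exact: measure_ge0.
rewrite esum_esum; last by move=> *; exact: measure_ge0.
rewrite (reindex_esum (setT `*`` (fun=> jump_times T x)) _
  (fun p => (p.2, p.1)))//.
split => //=.
- by move=> [n r] [].
- by move=> [n r] [n' r'] _ _ [-> ->].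
- by move=> [r n] [/= jr _]; exists (n, r).
Qed.

HB.instance Definition _ := isMeasure.Build _ _ _ (jump_measure T x)
  jump_measure0 jump_measure_ge0 jump_measure_sigma_additive.

End jump_measure.

Section processes.
Context {R : realType} {d : measure_display} {Omega : measurableType d}.
Variable P : probability Omega R.
Implicit Types (T : R) (Z : R -> Omega -> R) (F : R -> set (set Omega)).

Definition process T Z :=
  forall t : R, 0 <= t <= T -> measurable_fun setT (Z t).

Definition sigma_process T Z : set (set Omega) :=
  <<s [set A | exists2 s : R, 0 <= s <= T &
       exists2 C : set R, measurable C & A = Z s @^-1` C] >>.

(* Mutual independence of three sigma-algebras: since each of them contains
   [setT], the product rule for pairs is included. *)
Definition independent3 (G1 G2 G3 : set (set Omega)) :=
  forall A1 A2 A3, G1 A1 -> G2 A2 -> G3 A3 ->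
    P (A1 `&` A2 `&` A3) = (P A1 * P A2 * P A3)%E.

Definition independent_increments T Z :=
  forall (n : nat) (t : nat -> R) (C : nat -> set R),
    (forall i, (i <= n)%N -> 0 <= t i <= T) ->
    (forall i, (i < n)%N -> t i <= t i.+1) ->
    (forall i, measurable (C i)) ->
    P (\bigcap_(i < n) [set w | C i (Z (t i.+1) w - Z (t i) w)]) =
    (\prod_(i < n) P [set w | C i (Z (t i.+1) w - Z (t i) w)%R])%E.

(* [normal_prob] takes the standard deviation as second parameter. *)
Definition standard_brownian_motion T Z :=
  [/\ process T Z,
      {ae P, forall w, Z 0 w = 0},
      independent_increments T Z,
      (forall s t : R, 0 <= s -> s < t -> t <= T ->
        forall C : set R, measurable C ->
          pushforward P (fun w => Z t w - Z s w) C =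
          normal_prob 0 (Num.sqrt (t - s)) C) &
      {ae P, forall w, {within `[0, T], continuous (Z ^~ w)}}].

Definition stationary_increments T Z :=
  forall s t : R, 0 <= s -> s <= t -> t <= T ->
    forall C : set R, measurable C ->
      pushforward P (fun w => Z t w - Z s w) C = pushforward P (Z (t - s)) C.

Definition levy_process T Z :=
  [/\ process T Z,
      {ae P, forall w, Z 0 w = 0},
      independent_increments T Z,
      stationary_increments T Z &
      {ae P, forall w, cadlag T (Z ^~ w)}].

Definition levy_measure (nu : {measure set R -> \bar R}) :=
  nu [set 0] = 0%E /\
  (\int[nu]_x (Num.min 1 (x ^+ 2))%:E < +oo)%E.

(* Real and imaginary parts of the Levy-Khintchine exponent
   psi(u) = i l u - a u^2 / 2 + int (exp(iux) - 1 - iux 1_{|x|<1}) nu(dx). *)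
Definition levy_exponent_re (a : R) (nu : {measure set R -> \bar R}) (u : R) : R :=
  - (a * u ^+ 2 / 2) + \int[nu]_x (cos (u * x) - 1).

Definition levy_exponent_im (l : R) (nu : {measure set R -> \bar R}) (u : R) : R :=
  l * u +
  \int[nu]_x (sin (u * x) - u * x * \1_[set y : R | `|y| < 1] x).

(* Levy-Khintchine formula E[exp(iu Z_t)] = exp(t psi(u)), split into its real
   and imaginary parts. *)
Definition has_characteristics T (l a : R) (nu : {measure set R -> \bar R}) Z :=
  [/\ 0 <= a, levy_measure nu &
   forall t u : R, 0 <= t <= T ->
    \int[P]_w cos (u * Z t w) =
      expR (t * levy_exponent_re a nu u) * cos (t * levy_exponent_im l nu u) /\
    \int[P]_w sin (u * Z t w) =
      expR (t * levy_exponent_re a nu u) * sin (t * levy_exponent_im l nu u)].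

Definition natural_filtration Z (t : R) : set (set Omega) :=
  <<s [set A | exists2 s : R, 0 <= s <= t &
       exists2 C : set R, measurable C & A = Z s @^-1` C]
      `|` P.-negligible >>.

Definition measurable_wrt (G : set (set Omega)) (f : Omega -> R) :=
  forall C : set R, measurable C -> G (f @^-1` C).

(* [V] is a version of E[U | G]. *)
Definition is_cond_exp (G : set (set Omega)) (U V : Omega -> R) :=
  [/\ measurable_wrt G V, P.-integrable setT (EFin \o V) &
   forall A, G A ->
     (\int[P]_(w in A) (V w)%:E = \int[P]_(w in A) (U w)%:E)%E].

Definition martingale T F (M : R -> Omega -> R) :=
  [/\ forall t : R, 0 <= t <= T -> measurable_wrt (F t) (M t),
      forall t : R, 0 <= t <= T -> P.-integrable setT (EFin \o M t) &
      forall s t : R, 0 <= s -> s <= t -> t <= T -> is_cond_exp (F s) (M t) (M s)].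

Definition stopping_time T F (tau : Omega -> R) :=
  (forall w, 0 <= tau w <= T) /\
  (forall t : R, 0 <= t <= T -> F t [set w | tau w <= t]).

Definition stopped_sigma T F (tau : Omega -> R) : set (set Omega) :=
  [set A | forall t : R, 0 <= t <= T -> F t (A `&` [set w | tau w <= t])].

(* sum_(i < n) H_i 1_(]tau_i, tau_(i+1)]] *)
Record simple_predictable T F := SimplePredictable {
  sp_size : nat ;
  sp_time : nat -> Omega -> R ;
  sp_coef : nat -> Omega -> R ;
  sp_stopping : forall i, (i <= sp_size)%N -> stopping_time T F (sp_time i) ;
  sp_mono : forall i w, (i < sp_size)%N -> sp_time i w <= sp_time i.+1 w ;
  sp_measurable : forall i, (i < sp_size)%N ->
    measurable_wrt (stopped_sigma T F (sp_time i)) (sp_coef i) }.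

Definition simple_eval T F (H : simple_predictable T F) (t : R) (w : Omega) : R :=
  \sum_(i < sp_size H)
    sp_coef H i w * (sp_time H i w < t <= sp_time H i.+1 w)%R%:R.

Definition simple_integral T F (H : simple_predictable T F) Z
    (t : R) (w : Omega) : R :=
  \sum_(i < sp_size H) sp_coef H i w *
    (Z (Num.min (sp_time H i.+1 w) t) w - Z (Num.min (sp_time H i w) t) w).

(* Convergence in probability, uniformly over the times in [D]; the event [A]
   plays the role of {sup_D |U n - U| > e}, whose measurability is not needed. *)
Definition ucp_cvg (D : set R) (U_ : nat -> R -> Omega -> R) (U : R -> Omega -> R) :=
  forall e del : R, 0 < e -> 0 < del ->
    \forall n \near \oo, exists A : set Omega,
      [/\ measurable A, (P A <= del%:E)%E &
       forall w, ~ A w -> forall t, D t -> `|U_ n t w - U t w| <= e].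

(* [I] is a version of the process t |-> int_(]0, t]) H dZ, for a left-continuous
   integrand H with right limits and a semimartingale Z: the cadlag adapted
   process given by the continuous extension, for uniform convergence in
   probability, of the integral of simple predictable processes. *)
Definition is_stochastic_integral T F Z (H I : R -> Omega -> R) :=
  [/\ forall t : R, 0 <= t <= T -> measurable_wrt (F t) (I t),
      {ae P, forall w, cadlag T (I ^~ w)} &
      forall H_ : nat -> simple_predictable T F,
        ucp_cvg `]0, T] (fun n => simple_eval (H_ n)) H ->
        ucp_cvg `[0, T] (fun n => simple_integral (H_ n) Z) I].

End processes.

Section objects.
Context {R : realType}.
Variable T : R.

Definition etahat {Omega : Type} (W Y : R -> Omega -> R) (t : R) (w : Omega) : R :=
  W t w - t / T * W T w + t / T * Y t w.

Definition drift0 (lam : R) (nu : {measure set R -> \bar R}) : R :=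
  lam - \int[nu]_(x in [set x : R | `|x| < 1]) x.

Definition jump_ratio_sum (e : R -> R) (s : R) : R :=
  abs_sum `]0, s] (fun v => jump e v / v).

Definition kern (u : R) : R := T * u / (u ^+ 2 + T ^+ 2) + atan (u / T).

(* [b] is the drift, [x] and [e] are paths of X and of etahat, and [i] is the
   path of s |-> int_0^s kern d etahat. *)
Definition frakR (b : R) (x e i : R -> R) (s : R) : R :=
  let D := T - s + s * atan (s / T) in
  (T - s) / D *
    (i s
     - T^-1 * \int[jump_measure T x]_(p in `]0, s] `*` setT)
         ((T * p.1 ^+ 2 / (p.1 ^+ 2 + T ^+ 2) + p.1 * atan (p.1 / T)) * p.2)
     - \int[lebesgue_measure]_(u in `[0, s])
         (kern u * jump_ratio_sum e u))
  + s * atan (s / T) / D *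
    (e s
     - \int[jump_measure T x]_(p in `]0, s] `*` setT) (p.1 * p.2 / T)
     - \int[lebesgue_measure]_(u in `[0, s]) jump_ratio_sum e u)
  - b * ((T * s * (T - s) + (T * s ^+ 2 + T ^+ 2 * (s - T)) * atan (s / T))
         / (T * D)).

Definition mhat {Omega : Type} (lam : R) (nu : {measure set R -> \bar R})
    (X eta I : R -> Omega -> R) (t : R) (w : Omega) : R :=
  eta t w
  - \int[lebesgue_measure]_(s in `[0, t])
      ((drift0 lam nu * s + T * jump_ratio_sum (eta ^~ w) s
        + frakR (drift0 lam nu) (X ^~ w) (eta ^~ w) (I ^~ w) s
        - eta s w) / (T - s))
  - t ^+ 2 / (2 * T) *
    (lam + \int[nu]_(x in [set x : R | 1 <= `|x|]) x).

End objects.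

(* Main.v *)
(* Let [b = lam - int_{|x|<1} x nu(dx)], [m = lam + int_{|x|>=1} x nu(dx)] and
   [xi_t = W_t - t/T W_T + t/T B_t], so that [eta_t = xi_t + t/T X_t].

   Representation. The characteristic function gives [X_t = b t + sum_{s<=t} jump X s]
   almost surely: along fine grids, [sum_i e sin (increment_i / e)] tends in [L^2] to
   [b t] as [e -> 0], whereas pathwise it tends to the continuous part of [X_t]. Since
   [jump eta u / u = jump X u / T], the jump sums in the statement recover [X_s], and
   after integrating by parts everything in [R(s, T)] cancels except
   [(T - s)/D (K xi s) + s atan (s/T)/D xi_s], where [D = T - s + s atan (s/T)] and
   [K z s = int_0^s kern dz = kern s z_s - int_0^s z kern'].
   The integrand of the compensator is thus [X_s/T + (K xi s - xi_s)/D].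

   Martingale property. It is tested on [U = cos (sum_q a_q eta_{u_q} + c)] with
   [u_q <= s], which suffices because an integrable variable orthogonal to all these
   cosines is orthogonal to the completed sigma-algebra that the [eta_u] generate.
   For [r >= s], Stein's formula gives
   [E (xi_r U) = - (sum_q a_q cov r u_q) E (sin ...)], independent stationary increments give
   [E (X_r U) = E (X_s U) + (r - s) m E U], and [kern] is the kernel for which
   [K (cov . u) r - cov r u = D r (u^2/T^2 - u/T)] whenever [u <= r]. Hence
   [E (drift_r U)] is affine in [r], and the increment of the martingale candidate
   integrates to [0] against [U]. *)

Require Import Defs.
From HB Require Import structures.
From mathcomp Require Import all_boot all_order all_algebra.
From mathcomp Require Import all_classical all_reals all_analysis.
From mathcomp Require Import measurable_realfun ring lra.
Set Implicit Arguments.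
Unset Strict Implicit.
Unset Printing Implicit Defensive.
Import Order.TTheory GRing.Theory Num.Theory.
Import numFieldNormedType.Exports.
Local Open Scope classical_set_scope.
Local Open Scope ring_scope.

(** * Uniqueness from trigonometric integrals *)

(** About [X] the hypotheses give a characteristic function and almost sure path properties. First
    moments and the mean are therefore extracted from the Levy-Khintchine formula at small
    frequencies, the drift at large ones. The stochastic integral is known only through limits of
    simple predictable integrals; as [kern] is deterministic, step functions on a grid are
    admissible, their integrals are Riemann-Stieltjes sums, and the integral becomes a pathwise
    functional. Path regularity holds off a null set. Completeness makes that set measurable; the
    paths on it are replaced by 0, after which joint measurability and Fubini apply to every path.
    The denominator [T - s] of the compensator divides its numerator, so nothing blows up at the end
    point. Adaptedness is a real issue, because the integrand contains [X] while only [eta] is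
    observed and a sum over uncountably many candidate jump times is not visibly measurable. It is
    settled by an explicit measurable functional: the process [T * eta_u / u] has exactly the jumps
    of [X], and sums of its clipped increments isolate its continuous part. *)

Section integration_toolkit.
Context {d : measure_display} {Omega : measurableType d} {R : realType}.
Variable mu : {measure set Omega -> \bar R}.
Implicit Types f g h : Omega -> R.
Local Notation L1 D f := (mu.-integrable D (EFin \o f)).

Lemma L1_measurable D f : measurable D -> L1 D f -> measurable_fun D f.
Proof. by move=> mD /measurable_int/measurable_EFinP. Qed.

Lemma L1_le D f g : measurable D -> measurable_fun D f -> L1 D g ->
  (forall x, D x -> `|f x| <= g x) -> L1 D f.
Proof.
move=> mD mf ig fg; apply: le_integrable ig => //; first exact/measurable_EFinP.
by move=> x Dx /=; rewrite lee_fin (le_trans (fg x Dx))// ler_norm.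
Qed.

Lemma L1_bounded D f (M : R) : measurable D -> (mu D < +oo)%E ->
  measurable_fun D f -> (forall x, D x -> `|f x| <= M) -> L1 D f.
Proof.
move=> mD muD mf fM; apply: measurable_bounded_integrable => //.
exists M; split; first exact: num_real.
by move=> x Mx y Dy; apply: le_trans (fM y Dy) _; exact: ltW.
Qed.

Lemma L1D D f g : measurable D -> L1 D f -> L1 D g ->
  L1 D (fun x => f x + g x).
Proof. by move=> mD fi gi; apply: (integrableD mD fi gi). Qed.

Lemma L1B D f g : measurable D -> L1 D f -> L1 D g ->
  L1 D (fun x => f x - g x).
Proof. by move=> mD fi gi; apply: (integrableB mD fi gi). Qed.

Lemma L1Z D f (k : R) : measurable D -> L1 D f ->
  L1 D (fun x => k * f x).
Proof. by move=> mD fi; apply: (integrableZl mD k fi). Qed.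

Lemma L1_sum D (I : Type) (s : seq I) (f : I -> Omega -> R) : measurable D ->
  (forall i, L1 D (f i)) -> L1 D (fun x => \sum_(i <- s) f i x).
Proof.
move=> mD fi.
rewrite (_ : (EFin \o _) = (fun x => \sum_(i <- s) (f i x)%:E)%E); last first.
  by apply/funext => x /=; rewrite sumEFin.
by apply: integrable_sum => // i _; exact: fi.
Qed.

Lemma Rintegral_sum D (I : Type) (s : seq I) (f : I -> Omega -> R) : measurable D ->
  (forall i, L1 D (f i)) ->
  \int[mu]_(x in D) (\sum_(i <- s) f i x) = \sum_(i <- s) \int[mu]_(x in D) f i x.
Proof.
move=> mD fi; elim: s => [|i s IH].
  under eq_Rintegral do rewrite big_nil.
  by rewrite big_nil /Rintegral integral0.
under eq_Rintegral do rewrite big_cons.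
by rewrite RintegralD// ?big_cons ?IH//; exact: L1_sum.
Qed.

Lemma L1Mr D f g (M : R) : measurable D -> L1 D f ->
  measurable_fun D g -> (forall x, D x -> `|g x| <= M) ->
  L1 D (fun x => f x * g x).
Proof.
move=> mD fi mg gM.
have : L1 D (fun x => M * `|f x|) by apply: L1Z => //; exact: integrable_norm.
move=> /L1_le; apply => //.
  by apply: measurable_funM => //; exact: L1_measurable.
by move=> x Dx; rewrite normrM mulrC ler_wpM2r// gM.
Qed.

Lemma Rintegral_dominated D (f_ : nat -> Omega -> R) f g : measurable D ->
  (forall n, measurable_fun D (f_ n)) ->
  (forall x, D x -> f_ n x @[n --> \oo] --> f x) ->
  L1 D g -> (forall n x, D x -> `|f_ n x| <= g x) ->
  L1 D f /\ \int[mu]_(x in D) f_ n x @[n --> \oo] --> \int[mu]_(x in D) f x.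
Proof.
move=> mD mf_ cf ig fg.
have mf : measurable_fun D f by exact: measurable_fun_cvg mf_ cf.
have [] := @dominated_convergence _ _ R mu D mD (fun n => EFin \o f_ n)
  (EFin \o f) (EFin \o g).
- by move=> n; exact/measurable_EFinP.
- exact/measurable_EFinP.
- by apply: aeW => x Dx; apply: cvg_EFin; [exact: nearW|exact: cf].
- exact: ig.
- by apply: aeW => x n Dx /=; rewrite lee_fin fg.
move=> fi _ cv; split => //.
apply: fine_cvg; rewrite fineK//.
exact: integrable_fin_num.
Qed.

Lemma Rintegral_indic A f : measurable A -> 
  \int[mu]_(x in A) f x = \int[mu]_x (f x * \1_A x).
Proof.
move=> mA; rewrite Rintegral_mkcond; apply: eq_Rintegral => x _.
by rewrite patchE indicE; case: ifP => _; rewrite ?mulr1 ?mulr0.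
Qed.

Lemma ae_eq_Rintegral D f g : measurable D -> measurable_fun D f ->
  measurable_fun D g -> {ae mu, forall x, D x -> f x = g x} ->
  \int[mu]_(x in D) f x = \int[mu]_(x in D) g x.
Proof.
move=> mD mf mg fg; congr fine; apply: ae_eq_integral => //.
- exact/measurable_EFinP.
- exact/measurable_EFinP.
by apply: filterS fg => x h Dx; rewrite h.
Qed.

End integration_toolkit.

(** * Polynomials converging to the indicator of a half-line *)

Section step_polynomials.
Context {R : realType}.

Lemma bernoulli_ge (y : R) n : -1 <= y -> 1 + n%:R * y <= (1 + y) ^+ n.
Proof.
move=> y1; elim: n => [|n IH]; first by rewrite mul0r addr0 expr0.
rewrite exprS; apply: (@le_trans _ _ ((1 + y) * (1 + n%:R * y))).
  rewrite -subr_ge0 (_ : _ - _ = n%:R * y ^+ 2); last by rewrite -natr1; ring.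
  by rewrite mulr_ge0// sqr_ge0.
by rewrite ler_wpM2l//; lra.
Qed.

(** Upper companion of Bernoulli's inequality, kept as a product to avoid a division; the induction
    rests on [(1 - y) * (1 + (n + 1) * y) <= 1 + n * y]. *)
Lemma exp_onem_le (y : R) n : 0 <= y <= 1 -> (1 - y) ^+ n * (1 + n%:R * y) <= 1.
Proof.
move=> /andP[y0 y1]; elim: n => [|n IH]; first by rewrite mul0r addr0 expr0 mul1r.
apply: le_trans IH; rewrite exprS -mulrA mulrCA ler_wpM2l//.
  by apply: exprn_ge0; lra.
rewrite -subr_ge0 -natr1 (_ : _ - _ = (n%:R + 1) * y ^+ 2); last ring.
by rewrite mulr_ge0// ?sqr_ge0// addr_ge0.
Qed.

Lemma cvg_natmul_expr (q : R) : 0 <= q < 1 -> n%:R * q ^+ n @[n --> \oo] --> (0 : R).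
Proof.
move=> /andP[q0 q1]; have [->|qn0] := eqVneq q 0.
  apply: (@cvg_near_cst _ _ _ _ _); exists 1%N => //= n n0.
  by rewrite expr0n; case: n n0 => //= n _; rewrite mulr0.
have qp : 0 < q by rewrite lt_neqAle eq_sym qn0.
(* One factor [r ^ n] of [q ^ n] absorbs [n]: Bernoulli's inequality for [1 / r = 1 + dl] bounds
   [n * r ^ n] by [1 / dl]. The other factor tends to 0. *)
pose r := Num.sqrt q.
have rp : 0 < r by rewrite sqrtr_gt0.
have r1 : r < 1 by rewrite -[ltRHS]sqrtr1 ltr_sqrt.
have qr : q = r * r by rewrite -expr2 sqr_sqrtr.
pose dl := r^-1 - 1.
have dp : 0 < dl by rewrite subr_gt0 invf_gt1.
apply: (@squeeze_cvgr _ _ _ _ (fun=> 0) (fun n => dl^-1 * r ^+ n)).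
- near=> n; apply/andP; split; first by rewrite mulr_ge0// exprn_ge0.
  rewrite qr exprMn mulrA; apply: ler_wpM2r; first exact/exprn_ge0/ltW.
  rewrite -ler_pdivlMr ?exprn_gt0// -exprVn mulrC ler_pdivlMr//.
  have dl1 : -1 <= dl by lra.
  have := bernoulli_ge n dl1; rewrite {2}/dl (_ : 1 + (r^-1 - 1) = r^-1); [lra|ring].
- exact: cvg_cst.
- rewrite -[X in _ --> X](mulr0 dl^-1); apply: cvgM; first exact: cvg_cst.
  by apply: cvg_expr; rewrite ger0_norm// ltW.
Unshelve. all: by end_near. Qed.

(* The exponent is chosen so that the limit is an indicator also at [z = 1/2]. *)
Definition step_pol (n : nat) (z : R) : R := (1 - z ^+ n) ^+ (n * 2 ^ n).

Lemma step_pol_itv n z : 0 <= z <= 1 -> 0 <= step_pol n z <= 1.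
Proof.
move=> /andP[z0 z1]; have zn : 0 <= z ^+ n <= 1 by rewrite exprn_ge0// exprn_ile1.
by rewrite exprn_ge0 ?exprn_ile1//; lra.
Qed.

(** The exponent times [z ^ n] equals [n * (2 * z) ^ n]. Below [1/2] this tends to 0 and Bernoulli's
    inequality pushes the polynomial up to 1; from [1/2] on it is at least [n], and [exp_onem_le]
    keeps the polynomial below [1 / (n + 1)]. *)
Lemma cvg_step_pol (z : R) : 0 <= z <= 1 -> step_pol n z @[n --> \oo] --> ((z < 2^-1)%R%:R : R).
Proof.
move=> z01; have /andP[z0 z1] := z01.
have NE n : (n * 2 ^ n)%:R * z ^+ n = n%:R * (2 * z) ^+ n.
  by rewrite natrM natrX exprMn mulrA.
have zn n : 0 <= z ^+ n <= 1 by rewrite exprn_ge0// exprn_ile1.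
have [zh|zh] := ltP z 2^-1.
  apply: (@squeeze_cvgr _ _ _ _ (fun n => 1 - n%:R * (2 * z) ^+ n) (fun=> 1)).
  - near=> n; have /andP[_ ->] := @step_pol_itv n _ z01; rewrite andbT -NE.
    rewrite -mulrN; apply: bernoulli_ge.
    by have /andP[_] := zn n; lra.
  - rewrite -[X in _ --> X]subr0; apply: cvgB; first exact: cvg_cst.
    by apply: cvg_natmul_expr; apply/andP; split; lra.
  - exact: cvg_cst.
apply: (@squeeze_cvgr _ _ _ _ (fun=> 0) (fun n => n.+1%:R^-1)).
- near=> n; have /andP[-> _] /= := @step_pol_itv n _ z01.
  rewrite -[leRHS]mul1r ler_pdivlMr ?ltr0n//.
  apply: le_trans (@exp_onem_le (z ^+ n) (n * 2 ^ n) (zn n)).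
  rewrite ler_wpM2l//; first by have /andP[] := @step_pol_itv n _ z01.
  rewrite NE -natr1 addrC lerD2l ler_peMr// exprn_ege1//; lra.
- exact: cvg_cst.
- have := @cvg_harmonic R; apply: cvg_trans; apply: near_eq_cvg.
  by near=> n; rewrite /harmonic.
Unshelve. all: by end_near. Qed.

End step_polynomials.

(** * Uniqueness for one real variable *)

Section trigonometric_uniqueness.
Context {d : measure_display} {Omega : measurableType d} {R : realType}.
Variable P : probability Omega R.
Implicit Types f g h Z X : Omega -> R.
Local Notation L1 f := (P.-integrable setT (EFin \o f)).

Lemma measurable_cos_comp f : measurable_fun setT f ->
  measurable_fun setT (fun w => cos (f w)).
Proof.
by move=> mf; apply: (measurableT_comp (continuous_measurable_fun (@continuous_cos R)) mf).
Qed.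

Lemma measurable_sin_comp f : measurable_fun setT f ->
  measurable_fun setT (fun w => sin (f w)).
Proof.
by move=> mf; apply: (measurableT_comp (continuous_measurable_fun (@continuous_sin R)) mf).
Qed.

Lemma L1_cos Z f : L1 Z -> measurable_fun setT f -> L1 (fun w => Z w * cos (f w)).
Proof.
move=> iZ mf; apply: (@L1Mr _ _ _ _ _ _ _ 1) => //; first exact: measurable_cos_comp.
by move=> x _; rewrite ler_norml cos_le1 cos_geN1.
Qed.

Lemma cosM (a b : R) : cos a * cos b = 2^-1 * (cos (a + b) + cos (a - b)).
Proof. by rewrite cosD cosB; field. Qed.

Lemma sinM_cos (a b : R) :
  sin a * cos b = 2^-1 * (cos (a + b - pi / 2) + cos (a - b - pi / 2)).
Proof. by rewrite !cosB !cosD !sinD !sinN !cosN cos_pihalf sin_pihalf; field. Qed.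

Lemma measurable_affine X (t c : R) : measurable_fun setT X ->
  measurable_fun setT (fun w => t * X w + c).
Proof. by move=> mX; apply: measurable_funD => //; apply: measurable_funM. Qed.

Variables (Z X : Omega -> R).
Hypotheses (iZ : L1 Z) (mX : measurable_fun setT X).
Hypothesis Z0 : forall t c : R, \int[P]_w (Z w * cos (t * X w + c)) = 0.

Let L1_sinX_cos t c n t' c' : 
  L1 (fun w => Z w * (sin (t * X w + c)) ^+ n * cos (t' * X w + c')).
Proof.
apply: L1_cos; last exact: measurable_affine.
apply: (@L1Mr _ _ _ _ _ _ _ 1) => //.
  by apply: measurable_funX; apply: measurable_sin_comp; exact: measurable_affine.
by move=> x _; rewrite normrX exprn_ile1// ler_norml sin_le1 sin_geN1.
Qed.

(** Each factor [sin] is absorbed by the product formula; the shift by [pi / 2] turns the resulting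
    sines into cosines, so the induction never leaves the family covered by [Z0]. *)
Let int_sinX_cos t c n t' c' : 
  \int[P]_w (Z w * (sin (t * X w + c)) ^+ n * cos (t' * X w + c')) = 0.
Proof.
elim: n t' c' => [|n IH] t' c'.
  by under eq_Rintegral do rewrite expr0 mulr1; exact: Z0.
pose F (u v : R) w := Z w * (sin (t * X w + c)) ^+ n * cos (u * X w + v).
transitivity (\int[P]_w (2^-1 * (F (t + t') (c + c' - pi / 2) w +
                                 F (t - t') (c - c' - pi / 2) w))).
  apply: eq_Rintegral => w _; rewrite exprS.
  rewrite (_ : _ * _ * _ = Z w * sin (t * X w + c) ^+ n *
    (sin (t * X w + c) * cos (t' * X w + c'))); last ring.
  rewrite sinM_cos /F.
  rewrite (_ : t * X w + c + (t' * X w + c') - pi / 2 =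
    (t + t') * X w + (c + c' - pi / 2)); last ring.
  rewrite (_ : t * X w + c - (t' * X w + c') - pi / 2 =
    (t - t') * X w + (c - c' - pi / 2)); last ring.
  ring.
have iF u v : L1 (F u v) by exact: L1_sinX_cos.
have F0 u v : \int[P]_w F u v w = 0 by exact: IH.
rewrite RintegralZl ?RintegralD ?F0 ?addr0 ?mulr0 //.
exact: (L1D measurableT (iF _ _) (iF _ _)).
Qed.

Let int_poly_sin (p : {poly R}) t c : 
  \int[P]_w (Z w * p.[sin (t * X w + c)]) = 0.
Proof.
have L1i i : L1 (fun w => p`_i * (Z w * (sin (t * X w + c)) ^+ i * cos (0 * X w + 0))).
  exact/L1Z/L1_sinX_cos.
transitivity (\int[P]_w (\sum_(i < size p)
   (p`_i * (Z w * (sin (t * X w + c)) ^+ i * cos (0 * X w + 0))))).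
  apply: eq_Rintegral => w _; rewrite horner_coef mulr_sumr; apply: eq_bigr => i _.
  by rewrite mul0r addr0 cos0; ring.
rewrite Rintegral_sum//; by apply: big1 => i _; rewrite RintegralZl ?int_sinX_cos ?mulr0.
Qed.


Let mind_fun (A : set R) : measurable A -> measurable_fun setT (fun w => \1_A (X w) : R).
Proof. by move=> mA; exact: (measurableT_comp (measurable_indic mA) mX). Qed.

(** Step polynomials in [(1 + sin) / 2] are polynomials in the sine, hence have zero integral
    against [Z]. They are bounded by 1 and converge everywhere to the indicator of a negative sine,
    also where the sine vanishes. *)
Let int_sin_lt0 t c : 0 < t -> \int[P]_w (Z w * (sin (t * X w + c) < 0)%R%:R) = 0.
Proof.
move=> t0; pose z w := (1 + sin (t * X w + c)) / 2.
have z01 w : 0 <= z w <= 1.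
  by have := sin_le1 (t * X w + c); have := sin_geN1 (t * X w + c); rewrite /z; lra.
pose p n : {poly R} := (1 - (2^-1 *: (1 + 'X)) ^+ n) ^+ (n * 2 ^ n).
have pE n w : step_pol n (z w) = (p n).[sin (t * X w + c)].
  by rewrite /step_pol /p !hornerE/= /z mulrC.
have mz : measurable_fun setT (fun w => sin (t * X w + c)).
  by apply: measurable_sin_comp; exact: measurable_affine.
have [||||_] := @Rintegral_dominated _ _ R P setT
    (fun n w => Z w * step_pol n (z w)) (fun w => Z w * (sin (t * X w + c) < 0)%R%:R)
    (fun w => `|Z w|) measurableT.
- move=> n; apply: measurable_funM; first exact: (L1_measurable measurableT iZ).
  apply: measurable_funX; apply: measurable_funB => //.
  by apply: measurable_funX; apply: measurable_funM => //; apply: measurable_funD.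
- move=> w _; apply: cvgM; first exact: cvg_cst.
  rewrite (_ : (sin _ < 0) = (z w < 2^-1)); last first.
    by apply/idP/idP; rewrite /z; lra.
  exact: cvg_step_pol.
- exact: integrable_norm.
- move=> n w _; rewrite normrM ler_piMr//.
  by have /andP[? ?] := @step_pol_itv R n _ (z01 w); rewrite ger0_norm.
under eq_fun do under eq_Rintegral do rewrite pE.
under eq_fun do rewrite int_poly_sin.
by move=> /cvg_lim <- //; rewrite lim_cst.
Qed.

(** A low frequency makes the sine faithful to the sign: once [|X w - a| < pi * (n + 1)], the sine
    of [(X w - a) / (n + 1)] has the sign of [X w - a]. Dominated convergence then passes from
    periodic sets to a half-line. *)
Let int_lt a : \int[P]_w (Z w * \1_`]-oo, a[ (X w)) = 0.
Proof.
have tp n : 0 < n.+1%:R^-1 :> R by rewrite invr_gt0 ltr0n.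
have [||||_] := @Rintegral_dominated _ _ R P setT
    (fun n w => Z w * (sin (n.+1%:R^-1 * X w + - (n.+1%:R^-1 * a)) < 0)%R%:R)
    (fun w => Z w * \1_`]-oo, a[ (X w))
    (fun w => `|Z w|) measurableT.
- move=> n; apply: measurable_funM; first exact: (L1_measurable measurableT iZ).
  have -> : (fun w => (sin (n.+1%:R^-1 * X w + - (n.+1%:R^-1 * a)) < 0)%R%:R : R) =
    (\1_`]-oo, 0[ : R -> R) \o (fun w => sin (n.+1%:R^-1 * X w + - (n.+1%:R^-1 * a))).
    by apply/funext => w /=; rewrite indicE mem_setE in_itv.
  apply: measurableT_comp; first exact: measurable_indic.
  by apply: measurable_sin_comp; exact: measurable_affine.
- move=> w _; apply: cvgM; first exact: cvg_cst.
  apply: (@cvg_near_cst _ _ _ _ _).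
  near=> n; rewrite -mulrBr indicE mem_setE in_itv/=; congr (nat_of_bool _)%:R.
  have small : `|n.+1%:R^-1 * (X w - a)| < pi.
    rewrite normrM ger0_norm ?ltW// mulrC ltr_pdivrMr ?ltr0n//.
    rewrite mulrC -ltr_pdivrMr ?pi_gt0//.
    apply: (@lt_le_trans _ _ n%:R); last by rewrite ler_nat.
    by near: n; exact: nbhs_infty_gtr.
  have [Xa|Xa] := ltP (X w) a.
    rewrite -oppr_gt0 -sinN; apply: sin_gt0_pi; rewrite oppr_gt0.
    rewrite pmulr_rlt0// subr_lt0 Xa/= (le_lt_trans _ small)// -normrN ler_norm//.
  apply/negbTE; rewrite -leNgt; apply: sin_ge0_pi.
  rewrite mulr_ge0 ?subr_ge0//=.
  by rewrite ltW// (le_lt_trans _ small)// ler_norm.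
- exact: integrable_norm.
- by move=> n w _; rewrite normrM ler_piMr//; case: (_ < 0); rewrite ?normr1 ?normr0.
under eq_fun do rewrite int_sin_lt0//.
by move=> /cvg_lim <- //; rewrite lim_cst.
Unshelve. all: by end_near. Qed.

(** This is the uniqueness theorem for characteristic functions, for the signed measure [Z dP]
    transported by [X]. The half-lines form a pi-system generating the Borel sets, and the sets with
    zero integral form a Dynkin class; frequency 0 gives the whole space. *)
Lemma Rintegral_trig_uniqueness (C : set R) : measurable C ->
  \int[P]_w (Z w * \1_C (X w)) = 0.
Proof.
move=> mC.
have iZ0 : \int[P]_w Z w = 0.
  rewrite -[RHS](Z0 0 0); apply: eq_Rintegral => w _.
  by rewrite mul0r addr0 cos0 mulr1.
have GE := RGenInftyO.measurableE R; rewrite /measurable/= in GE.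
have : <<s @RGenInftyO.G R >> C by rewrite -GE; exact: mC.
move: C {mC}; apply: (@dynkin_induction _ _ (@RGenInftyO.G R) (fun C => \int[P]_w (Z w * \1_C (X w)) = 0)).
- exact: GE.
- move=> _ _ [x ->] [y ->]; exists (Num.min x y).
  by apply/seteqP; split => z/=; rewrite !in_itv/= lt_min => /andP.
- by under eq_Rintegral do rewrite indicT mulr1.
- by move=> _ [x ->]; exact: int_lt.
- move=> S mS S0; rewrite -[RHS](subrr (\int[P]_w (Z w))) {2}iZ0 -[in RHS]S0.
  rewrite -RintegralB//; last first.
    apply: (@L1Mr _ _ _ _ _ _ _ 1) => //; first exact: mind_fun.
    by move=> x _; rewrite indicE; case: (_ \in _); rewrite ?normr1 ?normr0.
  by apply: eq_Rintegral => w _; rewrite !indicE in_setC; case: (_ \in _); rewrite ?mulr0 ?mulr1 ?subrr ?subr0.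
- move=> F mF tF F0.
  have [||||_] := @Rintegral_dominated _ _ R P setT
    (fun n w => \sum_(i < n) (Z w * \1_(F i) (X w)))
    (fun w => Z w * \1_(\bigcup_k F k) (X w)) (fun w => `|Z w|) measurableT.
  + move=> n; apply: measurable_sum => i; apply: measurable_funM; last exact: mind_fun.
    exact: (L1_measurable measurableT iZ).
  + move=> w _; under eq_fun do rewrite -mulr_sumr.
    apply: cvgM; first exact: cvg_cst.
    apply: (@cvg_near_cst _ _ _ _ _).
    have [[k _ Fk]|nF] := pselect ((\bigcup_k F k) (X w)).
      exists k.+1 => // n /= kn; rewrite (bigD1 (Ordinal kn))//= big1 ?addr0.
        by rewrite !indicE !mem_set//; exists k.
      move=> i /negP ik; rewrite indicE memNset// => Fi; apply: ik; apply/eqP/val_inj => /=.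
      apply: (tF _ _ I I); by exists (X w).
    near=> n; rewrite big1 ?indicE ?memNset// => i _; rewrite indicE memNset// => Fi.
    by apply: nF; exists i.
  + exact: integrable_norm.
  + move=> n w _; rewrite -mulr_sumr normrM ler_piMr//.
    rewrite ger0_norm; last by apply: sumr_ge0 => i _; rewrite indicE.
    have [[i Fi]|nF] := pselect (exists i : 'I_n, F i (X w)).
      rewrite (bigD1 i)//= big1 ?addr0 ?indicE//; first by case: (_ \in _).
      move=> j /negP ij; rewrite indicE memNset// => Fj; apply: ij; apply/eqP/val_inj => /=.
      by apply: (tF _ _ I I); exists (X w).
    by rewrite big1// => i _; rewrite indicE memNset// => Fi; apply: nF; exists i.
  have Fi (i : nat) : L1 (fun w => Z w * \1_(F i) (X w)).
    apply: (@L1Mr _ _ _ _ _ _ _ 1) => //; first exact: mind_fun.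
    by move=> x _; rewrite indicE; case: (_ \in _); rewrite ?normr1 ?normr0.
  rewrite (_ : (fun n => _) = fun=> 0); first by move=> /cvg_lim <- //; rewrite lim_cst.
  apply/funext => n; rewrite (@Rintegral_sum _ _ _ P setT _ _
    (fun (i : 'I_n) w => Z w * \1_(F i) (X w)) measurableT (fun i => Fi i)).
  by rewrite big1.
Unshelve. all: by end_near. Qed.

End trigonometric_uniqueness.

(** * Uniqueness on a completed sigma-algebra generated by many variables *)

Section cylinder_sets.
Context {d : measure_display} {Omega : measurableType d} {R : realType}.
Variable P : probability Omega R.
Variables (I : Type) (Y : I -> Omega -> R).
Hypothesis mY : forall i, measurable_fun setT (Y i).
Local Notation L1 f := (P.-integrable setT (EFin \o f)).

Definition lincomb (l : seq (R * I)) (w : Omega) : R := \sum_(q <- l) q.1 * Y q.2 w.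

Fixpoint cylinder (s : seq (I * set R)) : set Omega :=
  if s is p :: s' then Y p.1 @^-1` p.2 `&` cylinder s' else setT.

Fixpoint measurable_bases (s : seq (I * set R)) : Prop :=
  if s is p :: s' then measurable p.2 /\ measurable_bases s' else True.

Lemma cylinder_cat s1 s2 : cylinder (s1 ++ s2) = cylinder s1 `&` cylinder s2.
Proof. by elim: s1 => [|p s IH] /=; rewrite ?setTI// IH setIA. Qed.

Lemma measurable_bases_cat s1 s2 : measurable_bases s1 -> measurable_bases s2 ->
  measurable_bases (s1 ++ s2).
Proof. by elim: s1 => [|p s IH] //= [? ?] ?; split => //; exact: IH. Qed.

Lemma measurable_preimage i (C : set R) : measurable C -> measurable (Y i @^-1` C).
Proof. by move=> mC; rewrite -[X in measurable X]setTI; exact: mY. Qed.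

Lemma measurable_cylinder s : measurable_bases s -> measurable (cylinder s).
Proof.
elim: s => [|p s IH] //= [mp ms]; apply: measurableI; last exact: IH.
exact: measurable_preimage.
Qed.

Lemma measurable_lincomb l : measurable_fun setT (lincomb l).
Proof.
by apply: measurable_sum => q; apply: measurable_funM => //; exact: mY.
Qed.

Variables (Z : Omega -> R).
Hypothesis iZ : L1 Z.
Hypothesis Z0 : forall l c, \int[P]_w (Z w * cos (lincomb l w + c)) = 0.

Let L1_ind f A : measurable A -> L1 f -> L1 (fun w => f w * \1_A w).
Proof.
move=> mA fi; apply: (@L1Mr _ _ _ _ _ _ _ 1) => //.
by move=> x _; rewrite indicE; case: (_ \in _); rewrite ?normr1 ?normr0.
Qed.

(** One base at a time: [Z] weighted by the remaining indicator and the cosine is a new integrable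
    variable, to which the one-dimensional uniqueness applies. Its trigonometric integrals vanish by
    the induction hypothesis because a product of two cosines is a sum of two cosines; this is why a
    cosine is carried along. *)
Let int_cylinder_cos s l c : measurable_bases s ->
  \int[P]_w (Z w * \1_(cylinder s) w * cos (lincomb l w + c)) = 0.
Proof.
elim: s l c => [|[i C] s IH] l c /=.
  by move=> _; rewrite -[RHS](Z0 l c); apply: eq_Rintegral => w _; rewrite indicT mulr1.
move=> [mC ms].
have mcs := measurable_cylinder ms.
pose Z' w := Z w * \1_(cylinder s) w * cos (lincomb l w + c).
have iZ' : L1 Z'.
  apply: L1_cos; first exact: L1_ind.
  by apply: measurable_funD => //; exact: measurable_lincomb.
transitivity (\int[P]_w (Z' w * \1_C (Y i w))).
  apply: eq_Rintegral => w _; rewrite /Z' indicI/= !indicE.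
  rewrite (_ : (w \in Y i @^-1` C) = (Y i w \in C)); first ring.
  by apply/idP/idP; rewrite !inE.
apply: Rintegral_trig_uniqueness => // t c'.
pose F (l' : seq (R * I)) (u : R) w := Z w * \1_(cylinder s) w * cos (lincomb l' w + u).
have iF l' u : L1 (F l' u).
  apply: L1_cos; first exact: L1_ind.
  by apply: measurable_funD => //; exact: measurable_lincomb.
have F0 l' u : \int[P]_w F l' u w = 0 by exact: IH.
transitivity (\int[P]_w (2^-1 * (F ((t, i) :: l) (c + c') w + F ((- t, i) :: l) (c - c') w))).
  apply: eq_Rintegral => w _; rewrite /Z' /F -mulrA cosM /lincomb !big_cons/=.
  rewrite (_ : _ + c + (t * Y i w + c') =
    t * Y i w + \sum_(q <- l) q.1 * Y q.2 w + (c + c')); last ring.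
  rewrite (_ : _ + c - (t * Y i w + c') =
    - t * Y i w + \sum_(q <- l) q.1 * Y q.2 w + (c - c')); last ring.
  ring.
rewrite RintegralZl ?RintegralD ?F0 ?addr0 ?mulr0 //.
exact: (L1D measurableT (iF _ _) (iF _ _)).
Qed.

Let int_cylinder s : measurable_bases s -> \int[P]_w (Z w * \1_(cylinder s) w) = 0.
Proof.
move=> ms; rewrite -[RHS](int_cylinder_cos [::] 0 ms); apply: eq_Rintegral => w _.
by rewrite /lincomb big_nil addr0 cos0 mulr1.
Qed.

Hypothesis Pcomplete : measure_is_complete P.

(** The pi-system consists of the cylinders together with the negligible sets: an intersection with
    a negligible set is negligible, so both kinds are treated by a single Dynkin argument, and
    completeness makes the negligible ones measurable. *)
Lemma Rintegral_sigma_trig_uniqueness (A : set Omega) :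
  <<s [set A | exists i, exists2 C : set R, measurable C & A = Y i @^-1` C]
      `|` P.-negligible >> A ->
  measurable A /\ \int[P]_w (Z w * \1_A w) = 0.
Proof.
pose G := [set A | (exists2 s, measurable_bases s & A = cylinder s) \/ P.-negligible A].
have mG B : G B -> measurable B.
  by move=> [[s ms ->]|/Pcomplete//]; exact: measurable_cylinder.
have GI : setI_closed G.
  move=> B C [[s ms ->]|nB] [[s' ms' ->]|nC].
  - left; exists (s ++ s'); last by rewrite cylinder_cat.
    exact: measurable_bases_cat.
  - by right; apply: negligibleS nC; exact: subIsetr.
  - by right; apply: negligibleS nB; exact: subIsetl.
  - by right; apply: negligibleS nB; exact: subIsetl.
suff : <<s G >> `<=` [set A | measurable A /\ \int[P]_w (Z w * \1_A w) = 0].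
  move=> H sA; apply: H; apply: sub_sigma_algebra2 sA => B [[i [C mC ->]]|nB].
    left; exists [:: (i, C)] => //=.
    by rewrite setIT.
  by right.
have iZ0 : \int[P]_w Z w = 0.
  have /= <- := @int_cylinder [::] Logic.I.
  by apply: eq_Rintegral => w _; rewrite indicT mulr1.
apply: lambda_system_subset => //.
- apply/dynkin_lambda_system; split.
  + split; first exact: measurableT.
    by under eq_Rintegral do rewrite indicT mulr1.
  + move=> B [mB B0]; split; first exact: measurableC.
    rewrite -[RHS](subrr (\int[P]_w (Z w))) {2}iZ0 -[in RHS]B0.
    rewrite -RintegralB//; last exact: L1_ind.
    apply: eq_Rintegral => w _; rewrite !indicE in_setC; case: (_ \in _);
      by rewrite ?mulr0 ?mulr1 ?subrr ?subr0.
  + move=> F tF mF0.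
    have mF n : measurable (F n) by have [] := mF0 n.
    have F0 n : \int[P]_w (Z w * \1_(F n) w) = 0 by have [] := mF0 n.
    split; first exact: bigcup_measurable.
    have mUF := bigcupT_measurable _ mF.
    have iZU := L1_ind mUF iZ.
    rewrite -Rintegral_indic// /Rintegral integral_bigcup//; last first.
      by apply: integrableS iZ.
    rewrite eseries0// => n _ _.
    have := F0 n; rewrite -Rintegral_indic// /Rintegral.
    move=> h; rewrite -[LHS]fineK ?h//.
    by apply: integrable_fin_num => //; apply: integrableS iZ.
- move=> B [[s ms ->]|nB]; split.
  + exact: measurable_cylinder.
  + exact: int_cylinder.
  + exact: Pcomplete.
  + rewrite -Rintegral_indic; last exact: Pcomplete.
    rewrite /Rintegral null_set_integral//; first exact: Pcomplete.
      exact/measurable_EFinP/measurable_funTS/(L1_measurable measurableT iZ).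
    have [C [mC C0 BC]] := nB; apply: subset_measure0 BC C0 => //; exact: Pcomplete.
Qed.

End cylinder_sets.

(** * Independence and Fubini *)

Section independence.
Context {d : measure_display} {Omega : measurableType d} {R : realType}.
Variable P : probability Omega R.
Local Notation L1 f := (P.-integrable setT (EFin \o f)).

Definition independent2 (G1 G2 : set (set Omega)) :=
  forall A B, G1 A -> G2 B -> P (A `&` B) = (P A * P B)%E.

Lemma independent2C (G1 G2 : set (set Omega)) :
  independent2 G1 G2 -> independent2 G2 G1.
Proof. by move=> h A B GA GB; rewrite setIC muleC h. Qed.

(** One side at a time: for a fixed [B] the events satisfying the product rule form a lambda-system.
    The two-sided version follows by symmetry. *)
Lemma independent2_sigmal (G1 G2 : set (set Omega)) :
  setI_closed G1 -> G1 `<=` measurable -> G2 `<=` measurable ->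
  independent2 G1 G2 -> independent2 <<s G1 >> G2.
Proof.
move=> I1 m1 m2 h A B sA GB.
suff : <<s G1 >> `<=` [set A | measurable A /\ P (A `&` B) = (P A * P B)%E].
  by move=> /(_ _ sA)[].
have mB := m2 _ GB.
have PBf : P B \is a fin_num by exact: fin_num_measure.
apply: lambda_system_subset => //; last first.
  by move=> C GC; split; [exact: m1|exact: h].
apply/dynkin_lambda_system; split.
- by split; [exact: measurableT|rewrite setTI probability_setT mul1e].
- move=> C [mC CB]; split; first exact: measurableC.
  rewrite probability_setC// muleBl//.
  rewrite mul1e -CB (setIC C) -measureD//; last by rewrite ltey_eq PBf.
  by congr (P _); rewrite setDE setIC.
- move=> F tF mF; have mFn n : measurable (F n) by have [] := mF n.
  split; first exact: bigcup_measurable.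
  rewrite setI_bigcupl measure_bigcup//; last 2 first.
  + by move=> n _; exact: measurableI.
  + by apply: trivIset_setIr.
  rewrite [in RHS]measure_bigcup// muleC -(fineK PBf) -nneseriesZl//.
  by apply: eq_eseriesr => n _; rewrite fineK// muleC; exact: (mF n).2.
Qed.

Lemma independent2_sigma (G1 G2 : set (set Omega)) :
  setI_closed G1 -> setI_closed G2 -> G1 `<=` measurable -> G2 `<=` measurable ->
  independent2 G1 G2 -> independent2 <<s G1 >> <<s G2 >>.
Proof.
move=> I1 I2 m1 m2 h; apply: independent2_sigmal => //.
  by apply: smallest_sub => //; exact: sigma_algebra_measurable.
by apply: independent2C; apply: independent2_sigmal => //; exact: independent2C.
Qed.

Section expectation_product.
Variables f g : Omega -> R.
Hypotheses (if_ : L1 f) (ig : L1 g).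
Hypothesis fg : forall A B : set R, measurable A -> measurable B ->
  P (f @^-1` A `&` g @^-1` B) = (P (f @^-1` A) * P (g @^-1` B))%E.

Let mf : measurable_fun setT f := L1_measurable measurableT if_.
Let mg : measurable_fun setT g := L1_measurable measurableT ig.

Let mfg : measurable_fun setT (fun w => (f w, g w)).
Proof. exact: measurable_fun_pair. Qed.

Let pf : {mfun Omega >-> R} := mfun_Sub (mem_set mf).
Let pg : {mfun Omega >-> R} := mfun_Sub (mem_set mg).

Let pfg : {mfun Omega >-> (R * R)%type} := mfun_Sub (mem_set mfg).

Let muf := distribution P pf.
Let mug := distribution P pg.
Let phi (z : R * R) : \bar R := (z.1 * z.2)%:E.

Let mphi : measurable_fun setT phi.
Proof. by apply/measurable_EFinP; apply: measurable_funM. Qed.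

Let prod_distribution (X : set (R * R)) : measurable X ->
  (muf \x mug)%E X = distribution P pfg X.
Proof.
move=> mX; apply: product_measure_unique => // A B mA mB.
Qed.

Let id_int (ph : {mfun Omega >-> R}) : L1 ph -> (distribution P ph).-integrable setT EFin.
Proof.
move=> ih; apply: integrable_pushforward => //.
Qed.

Let abs_fin (ph : {mfun Omega >-> R}) : L1 ph ->
  (\int[distribution P ph]_x `|x%:E| \is a fin_num)%E.
Proof.
move=> ih; apply: integrable_fin_num => //.
exact: (integrable_abse (id_int ih)).
Qed.

Let int_phi : (muf \x mug)%E.-integrable setT phi.
Proof.
apply/integrable12ltyP => //.
under eq_integral.
  move=> x _; under eq_integral.
    move=> y _; rewrite (_ : phi (x, y) = (x%:E * y%:E)%E)// abseM.
    over.
  rewrite ge0_integralZl//; last by apply/measurableT_comp => //; exact/measurable_EFinP.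
  over.
have fg_ := @abs_fin pg ig.
have ff_ := @abs_fin pf if_.
under eq_integral do rewrite -[X in (_ * X)%E](fineK fg_) muleC.
rewrite ge0_integralZl//; last 2 first.
- by apply/measurableT_comp => //; exact/measurable_EFinP.
- by rewrite fineK// integral_ge0.
by rewrite -(fineK ff_) -EFinM ltry.
Qed.

(** Independence makes the law of the pair the product of the laws, and on the product [x * y] is
    integrable by Tonelli. *)
Lemma L1_independentM : L1 (fun w => f w * g w).
Proof.
apply/integrableP; split; first by apply/measurable_EFinP; exact: measurable_funM.
rewrite -[X in (X < _)%E](@ge0_integral_distribution _ _ _ _ _ P pfg (fun z => `|phi z|%E))//.
  move/integrableP : int_phi => [_]; rewrite (eq_measure_integral (distribution P pfg))//.
  by move=> A mA _; exact: prod_distribution.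
exact: measurableT_comp.
Qed.

Lemma Rintegral_independentM :
  \int[P]_w (f w * g w) = (\int[P]_w f w) * (\int[P]_w g w).
Proof.
have -> : \int[P]_w (f w * g w) = fine (\int[distribution P pfg]_z phi z).
  by rewrite (integral_distribution mphi)//; exact: L1_independentM.
rewrite (eq_measure_integral (muf \x mug)%E); last by move=> A mA _; exact/esym/prod_distribution.
rewrite -integral12_prod_meas1//.
have iEg : (\int[mug]_y y%:E = \int[P]_w (g w)%:E)%E.
  by rewrite (integral_distribution (X := pg))//; exact/measurable_EFinP.
have iEf : (\int[muf]_y y%:E = \int[P]_w (f w)%:E)%E.
  by rewrite (integral_distribution (X := pf))//; exact/measurable_EFinP.
rewrite /fubini_F/=; under eq_integral.
  move=> x _; under eq_integral do rewrite /phi/= EFinM.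
  rewrite integralZl//; last exact: (@id_int pg ig).
  rewrite -/mug iEg -(@fineK _ (\int[P]_w (g w)%:E)%E) ?integrable_fin_num// muleC.
  over.
rewrite integralZl//; last exact: (@id_int pf if_).
by rewrite -/muf iEf -(@fineK _ (\int[P]_w (f w)%:E)%E) ?integrable_fin_num// mulrC.
Qed.

End expectation_product.
End independence.

(** * Joint measurability and exchange of expectation with time integrals *)

Section time_integrals.
Context {d : measure_display} {Omega : measurableType d} {R : realType}.
Implicit Types (Z : R -> Omega -> R) (a b s t K : R).
Local Notation lambda := (@lebesgue_measure R).

(** Next point of the grid of mesh [1 / (n + 1)], taken strictly to the right of [t] so that a right
    limit can be read along it. *)
Let dyadic (n : nat) (t : R) : R := (Num.floor (t * n.+1%:R) + 1)%:~R / n.+1%:R.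

Let dyadic_gt n t : t < dyadic n t.
Proof.
by rewrite /dyadic ltr_pdivlMr ?ltr0n//; have /andP[] := floor_itv (t * n.+1%:R).
Qed.

Let dyadic_le n t : dyadic n t <= t + n.+1%:R^-1.
Proof.
rewrite /dyadic ler_pdivrMr ?ltr0n// mulrDl mulVf// intrD lerD2r.
by have /andP[] := floor_itv (t * n.+1%:R).
Qed.

Let cvg_dyadic t : dyadic n t @[n --> \oo] --> t.
Proof.
apply: (@squeeze_cvgr _ _ _ _ (fun=> t) (fun n => t + n.+1%:R^-1)).
- by near=> n; rewrite ltW//= dyadic_le.
- exact: cvg_cst.
- rewrite -[X in _ --> X]addr0; apply: cvgD; first exact: cvg_cst.
  exact: cvg_harmonic.
Unshelve. all: by end_near. Qed.

Let measurable_dyadic n Z : (forall t, measurable_fun setT (Z t)) ->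
  measurable_fun setT (fun p : Omega * R => Z (dyadic n p.2) p.1).
Proof.
move=> mZ _ C mC; rewrite setTI.
rewrite (_ : _ @^-1` C = \bigcup_(k in [set: int])
   ((Z ((k + 1)%:~R / n.+1%:R) @^-1` C) `*` `[k%:~R / n.+1%:R, (k + 1)%:~R / n.+1%:R[)).
  apply: countable_bigcupT_measurable; first exact: countableP.
  move=> k; apply: measurableX => //.
  by rewrite -[X in measurable X]setTI; exact: mZ.
apply/seteqP; split => [[w t] /= Ct|[w t] /= [k _ [/= Ck]]].
  exists (Num.floor (t * n.+1%:R)) => //; split => //=.
  rewrite in_itv/= ler_pdivrMr ?ltr0n// ltr_pdivlMr ?ltr0n//.
  exact: floor_itv.
rewrite /dyadic in_itv/= ler_pdivrMr ?ltr0n// ltr_pdivlMr ?ltr0n// => /floor_def ->.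
exact: Ck.
Qed.

(** Sampling at the next grid point uses countably many times, so the sampled process is jointly
    measurable; right continuity makes [Z] the pointwise limit of such samples. *)
Lemma measurable_right_continuous Z : (forall t, measurable_fun setT (Z t)) ->
  (forall w t, Z s w @[s --> t^'+] --> Z t w) ->
  measurable_fun setT (fun p : Omega * R => Z p.2 p.1).
Proof.
move=> mZ rcZ; apply: (@measurable_fun_cvg _ _ _ _ (fun n p => Z (dyadic n p.2) p.1)).
  by move=> n; exact: measurable_dyadic.
move=> [w t] _ /=; have /cvg_at_rightP := rcZ w t; apply; split.
  by move=> n; exact: dyadic_gt.
exact: cvg_dyadic.
Qed.

Lemma measurable_section_time Z (w : Omega) :
  measurable_fun setT (fun p : Omega * R => Z p.2 p.1) ->
  measurable_fun setT (Z ^~ w).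
Proof.
move=> mZ; exact: (measurableT_comp mZ (pair1_measurable w)).
Qed.

Lemma measurable_time_integral Z (D : set R) : measurable D ->
  measurable_fun setT (fun p : Omega * R => Z p.2 p.1) ->
  measurable_fun setT (fun w => \int[lambda]_(s in D) Z s w).
Proof.
move=> mD mZ; apply: measurableT_comp => //.
pose f (p : Omega * R) : \bar R := (Z p.2 p.1 * \1_D p.2)%:E.
have mf : measurable_fun setT f.
  apply/measurable_EFinP/measurable_funM => //.
  exact: (measurableT_comp (measurable_indic mD) measurable_snd).
rewrite (_ : (fun w => _) = (fun w => \int[lambda]_s f^\+ (w, s) - \int[lambda]_s f^\- (w, s)))%E.
  apply: emeasurable_funB.
    by apply: (@measurable_fun_fubini_tonelli_F _ _ _ _ _ lambda) => //; exact: measurable_funepos.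
  by apply: (@measurable_fun_fubini_tonelli_F _ _ _ _ _ lambda) => //; exact: measurable_funeneg.
apply/funext => w; rewrite integral_mkcond integralE; congr (_ - _)%E;
  apply: eq_integral => s _; rewrite /f ?funeposE ?funenegE /= patchE indicE;
  by case: ifPn; rewrite ?mulr1 ?mulr0.
Qed.

Variable P : probability Omega R.
Local Notation L1 f := (P.-integrable setT (EFin \o f)).

Section fubini.
Variables (Z : R -> Omega -> R) (D : set R) (K : R).
Hypotheses (mD : measurable D) (lD : (lambda D < +oo)%E).
Hypothesis mZ : measurable_fun setT (fun p : Omega * R => Z p.2 p.1).
Hypothesis iZ : forall s, D s -> L1 (Z s).
Hypothesis ZK : forall s, D s -> \int[P]_w `|Z s w| <= K.

Let f (p : Omega * R) : \bar R := (Z p.2 p.1 * \1_D p.2)%:E.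

Let mf : measurable_fun setT f.
Proof.
apply/measurable_EFinP/measurable_funM => //.
exact: (measurableT_comp (measurable_indic mD) measurable_snd).
Qed.

(** On a set of finite length, a bound on the [L1] norms uniform in time is what Tonelli asks for.
    Gaussian processes satisfy such a bound although they have no uniform pathwise one. *)
Let int_f : (P \x lambda)%E.-integrable setT f.
Proof.
apply/integrable21ltyP => //.
apply: (@le_lt_trans _ _ (\int[lambda]_s (K * \1_D s)%:E)%E).
  apply: ge0_le_integral => //.
  - by move=> s _; exact: integral_ge0.
  - apply: (@measurable_fun_fubini_tonelli_G _ _ _ _ _ P (abse \o f)).
      exact: measurableT_comp.
    by move=> x; exact: abse_ge0.
  - by apply/measurable_EFinP/measurable_funM => //; exact: measurable_indic.
  - move=> s _; rewrite indicE /f/=; have [/set_mem Ds|Ds] := boolP (s \in D).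
      under eq_integral do rewrite indicE (mem_set Ds) mulr1.
      rewrite mulr1 (_ : (\int[P]_w _)%E = (\int[P]_w `|Z s w|)%:E) ?lee_fin ?ZK//.
      rewrite /Rintegral fineK//; apply: integrable_fin_num => //.
      exact: (integrable_norm (iZ Ds)).
    under eq_integral do rewrite indicE (negbTE Ds) mulr0 normr0.
    by rewrite integral0 mulr0.
rewrite (_ : (\int[lambda]_s (K * \1_D s)%:E)%E = (\int[lambda]_(s in D) K%:E)%E).
  apply: integrable_lty => //.
  exact: (@L1_bounded _ _ _ lambda D (fun=> K) `|K|).
rewrite [RHS]integral_mkcond; apply: eq_integral => s _; rewrite patchE indicE.
by case: ifPn; rewrite ?mulr1 ?mulr0.
Qed.

Let FE w : fubini_F lambda f w = (\int[lambda]_(s in D) (Z s w)%:E)%E.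
Proof.
rewrite [RHS]integral_mkcond; apply: eq_integral => s _.
by rewrite patchE /f/= indicE; case: ifPn; rewrite ?mulr1 ?mulr0.
Qed.

Lemma ae_integrable_time : {ae P, forall w, lambda.-integrable D (EFin \o Z ^~ w)}.
Proof.
apply: filterS (ae_integrable1 int_f) => w.
move=> /integrableP[mfw fw]; apply/integrableP; split.
  by apply/measurable_EFinP/measurable_funTS; exact: measurable_section_time.
apply: le_lt_trans fw; rewrite integral_mkcond le_eqVlt; apply/orP; left; apply/eqP.
apply: eq_integral => s _; rewrite patchE /f/= indicE.
by case: ifPn; rewrite ?mulr1 ?mulr0 ?normr0.
Qed.

Lemma L1_time_integral : L1 (fun w => \int[lambda]_(s in D) Z s w).
Proof.
have iF := integrable_fubini_F int_f.
apply: le_integrable iF => //.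
  by apply/measurable_EFinP; exact: measurable_time_integral.
move=> w _; rewrite FE /= /Rintegral.
by case: (integral _ _ _) => [r| |] //=; rewrite ?normr0 ?leey.
Qed.

Lemma Rintegral_time_integral :
  \int[P]_w (\int[lambda]_(s in D) Z s w) = \int[lambda]_(s in D) (\int[P]_w Z s w).
Proof.
have iF := integrable_fubini_F int_f.
have -> : \int[P]_w (\int[lambda]_(s in D) Z s w) = fine (\int[P]_w fubini_F lambda f w).
  rewrite /Rintegral; congr fine; apply: ae_eq_integral => //.
  - by apply: measurable_int L1_time_integral.
  - exact: measurable_int iF.
  - apply: filterS (integrable_ae measurableT iF) => w /(_ I) + _.
    by rewrite FE => h; rewrite fineK.
have e1 := integral12_prod_meas1 int_f; have e2 := integral21_prod_meas1 int_f.
rewrite e1 -e2; congr fine.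
rewrite [RHS]integral_mkcond; apply: eq_integral => s _; rewrite patchE /fubini_G /f/=.
rewrite indicE; case: ifPn => [/set_mem Ds|Ds].
  under eq_integral do rewrite mulr1.
  by rewrite /Rintegral fineK//; apply: integrable_fin_num => //; exact: iZ.
by under eq_integral do rewrite mulr0; rewrite integral0.
Qed.

End fubini.

Lemma Rintegral_time_integral_norm Z (D : set R) K :
  measurable D -> (lambda D < +oo)%E ->
  measurable_fun setT (fun p : Omega * R => Z p.2 p.1) ->
  (forall s, D s -> L1 (Z s)) ->
  (forall s, D s -> \int[P]_w `|Z s w| <= K) ->
  \int[P]_w `|\int[lambda]_(s in D) Z s w| <= K * fine (lambda D).
Proof.
move=> mD lD mZ iZ ZK.
have mZ' : measurable_fun setT (fun p : Omega * R => `|Z p.2 p.1|) by exact: measurableT_comp.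
have iZ' s : D s -> L1 (fun w => `|Z s w|) by move=> Ds; exact: integrable_norm (iZ s Ds).
have ZK' s : D s -> \int[P]_w `| `|Z s w| | <= K.
  by move=> Ds; under eq_Rintegral do rewrite normr_id; exact: ZK.
have iV := L1_time_integral mD lD mZ iZ ZK.
have iV' := L1_time_integral (Z := fun s w => `|Z s w|) mD lD mZ' iZ' ZK'.
apply: (@le_trans _ _ (\int[P]_w (\int[lambda]_(s in D) `|Z s w|))).
  rewrite /Rintegral fine_le//.
  - by apply: integrable_fin_num => //; exact: (integrable_norm iV).
  - exact: integrable_fin_num iV'.
  apply: ae_ge0_le_integral => //.
  - exact: measurable_int (integrable_norm iV).
  - by move=> w _; rewrite lee_fin; apply: Rintegral_ge0.
  - exact: measurable_int iV'.
  - apply: filterS (ae_integrable_time mD lD mZ iZ ZK) => w iw _.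
    by rewrite lee_fin; exact: le_normr_Rintegral.
rewrite (Rintegral_time_integral (Z := fun s w => `|Z s w|) mD lD mZ' iZ' ZK').
rewrite -Rintegral_cst//; apply: le_Rintegral => //.
- have := ae_integrable_time; move=> _.
  apply: (@L1_bounded _ _ _ lambda D _ K) => //.
    apply: measurable_funTS; apply: measurableT_comp => //.
    have mabs : measurable_fun setT (fun p : Omega * R => (`|Z p.2 p.1|%:E)).
      exact/measurable_EFinP.
    exact: (@measurable_fun_fubini_tonelli_G _ _ _ _ _ P _ mabs).
  move=> s Ds; rewrite ger0_norm; first exact: ZK.
  exact: Rintegral_ge0.
- by apply: (@L1_bounded _ _ _ lambda D _ `|K|) => // *; rewrite normr_id.
Qed.

(** The form in which the compensator meets a test variable: [U] is constant in time, so it enters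
    the inner integral for almost every path before Fubini is applied. *)
Lemma Rintegral_bounded_time_integral Z (D : set R) K (U : Omega -> R) M :
  measurable D -> (lambda D < +oo)%E ->
  measurable_fun setT (fun p : Omega * R => Z p.2 p.1) ->
  (forall s, D s -> L1 (Z s)) ->
  (forall s, D s -> \int[P]_w `|Z s w| <= K) ->
  measurable_fun setT U -> (forall w, `|U w| <= M) ->
  \int[P]_w (U w * \int[lambda]_(s in D) Z s w) =
  \int[lambda]_(s in D) \int[P]_w (U w * Z s w).
Proof.
move=> mD lD mZ iZ ZK mU UM.
have mZ' : measurable_fun setT (fun p : Omega * R => U p.1 * Z p.2 p.1).
  by apply: measurable_funM => //; exact: (measurableT_comp mU measurable_fst).
have iZ' s : D s -> L1 (fun w => U w * Z s w).
  move=> Ds; under [X in _.-integrable _ X]eq_fun do rewrite mulrC.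
  by apply: (@L1Mr _ _ _ _ _ _ _ M) => //; exact: iZ.
have ZK' s : D s -> \int[P]_w `|U w * Z s w| <= M * K.
  move=> Ds; have iZn := integrable_norm (iZ s Ds).
  (* [Omega] has probability 1, hence is inhabited, and any of its points shows that the bound is
     nonnegative. *)
  have M0 : 0 <= M.
    have [w _] : [set: Omega] !=set0.
      by apply/set0P/eqP => e; have := probability_setT P; rewrite e measure0 => /eqP; rewrite eqe eq_sym oner_eq0.
    by apply: le_trans (UM w).
  apply: le_trans (ler_wpM2l M0 (ZK s Ds)).
  rewrite -RintegralZl//; apply: le_Rintegral => //.
  - exact: (integrable_norm (iZ' s Ds)).
  - exact: L1Z.
  - by move=> w _; rewrite normrM ler_wpM2r.
rewrite -(Rintegral_time_integral (Z := fun s w => U w * Z s w) mD lD mZ' iZ' ZK').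
have iV := L1_time_integral mD lD mZ iZ ZK.
have iV' := L1_time_integral (Z := fun s w => U w * Z s w) mD lD mZ' iZ' ZK'.
apply: ae_eq_Rintegral => //.
- by apply: measurable_funM => //; exact: (L1_measurable measurableT iV).
- exact: (L1_measurable measurableT iV').
apply: filterS (ae_integrable_time mD lD mZ iZ ZK) => w iw _.
by rewrite RintegralZl.
Qed.

End time_integrals.

(** * Stein's formula for Brownian motion *)

Section density.
Context {d : measure_display} {Omega : measurableType d} {R : realType}.
Variable mu : {measure set Omega -> \bar R}.
Variable m : {measure set Omega -> \bar R}.
Variable p : Omega -> R.
Hypotheses (p0 : forall x, 0 <= p x) (mp : measurable_fun setT p).
Hypothesis mE : forall A, measurable A -> m A = (\int[mu]_(x in A) (p x)%:E)%E.
Local Open Scope ereal_scope.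

Let density_indic E : measurable E ->
  \int[m]_x (\1_E x)%:E = \int[mu]_x ((\1_E x)%:E * (p x)%:E).
Proof.
move=> mEE; rewrite integral_indic//= setIT mE// integral_mkcond.
apply: eq_integral => x _; rewrite patchE indicE.
by case: ifPn; rewrite ?mul1e ?mul0e.
Qed.

Import HBNNSimple.

Let density_nnsfun (f : {nnsfun Omega >-> R}) :
  \int[m]_x (f x)%:E = \int[mu]_x ((f x)%:E * (p x)%:E).
Proof.
under [LHS]eq_integral do rewrite fimfunE -fsumEFin//.
rewrite [LHS]ge0_integral_fsum//; last 2 first.
  - by move=> r; exact/measurable_EFinP/measurableT_comp.
  - by move=> n x _; rewrite EFinM nnfun_muleindic_ge0.
under [RHS]eq_integral.
  move=> x xD; rewrite fimfunE -fsumEFin// muleC ge0_mule_fsumr; last first.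
    by move=> r; rewrite EFinM nnfun_muleindic_ge0.
  over.
rewrite [RHS]ge0_integral_fsum//; last 2 first.
  - move=> r; apply: emeasurable_funM; first exact/measurable_EFinP.
    by apply/measurable_EFinP; apply/measurableT_comp.
  - move=> n x _; rewrite EFinM mule_ge0//; last by rewrite nnfun_muleindic_ge0.
    by rewrite lee_fin.
apply: eq_fsbigr => _ /set_mem[x0 _ <-].
rewrite !integralZl_indic_nnsfun//= density_indic//.
rewrite -ge0_integralZl//.
- by apply: eq_integral => x _; rewrite muleA -EFinM muleC.
- apply: emeasurable_funM; last exact/measurable_EFinP.
  by apply/measurable_EFinP; exact: measurable_indic.
- by move=> x _; rewrite mule_ge0// lee_fin.
- by rewrite lee_fin.
Qed.

Lemma ge0_integral_density f : measurable_fun setT f -> (forall x, 0 <= f x) ->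
  \int[m]_x f x = \int[mu]_x (f x * (p x)%:E).
Proof.
move=> mf f0.
pose f_ := nnsfun_approx measurableT mf.
transitivity (lim (\int[m]_x (f_ n x)%:E @[n --> \oo])).
  rewrite -monotone_convergence//=.
  - apply: eq_integral => ? /[!inE] xD; apply/esym/cvg_lim => //=.
    exact: cvg_nnsfun_approx.
  - by move=> n; exact/measurable_EFinP/measurable_funTS.
  - by move=> n ? _; rewrite lee_fin.
  - by move=> ? _ ? ? mn; rewrite lee_fin; exact/lefP/nd_nnsfun_approx.
rewrite [RHS](_ : _ = lim (\int[mu]_x ((f_ n x)%:E * (p x)%:E) @[n --> \oo])); last first.
  rewrite -monotone_convergence//=.
  - apply: eq_integral => x _; apply/esym/cvg_lim => //.
    apply: cvgeZr => //; exact: cvg_nnsfun_approx.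
  - move=> n; apply: emeasurable_funM; last exact/measurable_EFinP.
    exact/measurable_EFinP/measurable_funTS.
  - by move=> n x _; rewrite mule_ge0// lee_fin.
  - move=> x _ ? ? ?; rewrite lee_wpmul2r ?lee_fin//; exact/lefP/nd_nnsfun_approx.
by apply: congr_lim; apply/funext => n; exact: density_nnsfun.
Qed.

Lemma integrable_density f : measurable_fun setT f ->
  mu.-integrable setT (fun x => f x * (p x)%:E) -> m.-integrable setT f.
Proof.
move=> mf /integrableP[_ ip]; apply/integrableP; split => //.
rewrite ge0_integral_density//; last exact: measurableT_comp.
apply: le_lt_trans ip; rewrite le_eqVlt; apply/orP; left; apply/eqP.
by apply: eq_integral => x _; rewrite abseM [X in _ = _ * X]gee0_abs// lee_fin.
Qed.

Lemma integral_density f : measurable_fun setT f ->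
  \int[m]_x f x = \int[mu]_x (f x * (p x)%:E).
Proof.
move=> mf; rewrite integralE [RHS]integralE; congr (_ - _).
  rewrite ge0_integral_density//; last exact: measurable_funepos.
  apply: eq_integral => x _; rewrite !funeposE muleC [in RHS]muleC.
  by rewrite maxe_pMr ?mule0// lee_fin.
rewrite ge0_integral_density//; last exact: measurable_funeneg.
apply: eq_integral => x _; rewrite !funenegE muleC [in RHS]muleC -muleN.
by rewrite maxe_pMr ?mule0// lee_fin.
Qed.

End density.

Section density_transfer.
Context {d : measure_display} {Omega : measurableType d} {R : realType}.
Context {d1 : measure_display} {T1 : measurableType d1}.
Variable mu : {measure set T1 -> \bar R}.
Variable p : T1 -> R.
Hypotheses (p0 : forall x, 0 <= p x) (mp : measurable_fun setT p).
Variables (P : probability Omega R) (G : Omega -> T1).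
Hypothesis mG : measurable_fun setT G.
Hypothesis GE : forall A, measurable A -> P (G @^-1` A) = (\int[mu]_(x in A) (p x)%:E)%E.

Let pG : {mfun Omega >-> T1} := mfun_Sub (mem_set mG).

Lemma L1_density_comp (f : T1 -> R) : measurable_fun setT f ->
  mu.-integrable setT (fun x => (f x * p x)%:E) ->
  P.-integrable setT (EFin \o (f \o G)) /\
  \int[P]_w (f (G w)) = \int[mu]_x (f x * p x).
Proof.
move=> mf ifp; have mEf : measurable_fun setT (EFin \o f) by exact/measurable_EFinP.
have id := @integrable_density _ _ _ mu (distribution P pG) p p0 mp GE (EFin \o f) mEf ifp.
have iG : P.-integrable setT (EFin \o (f \o G)).
  move/integrableP : id => [_ h]; apply/integrableP; split.
    by apply/measurable_EFinP; exact: (measurableT_comp mf mG).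
  rewrite (@ge0_integral_distribution _ _ _ _ _ P pG (abse \o (EFin \o f))) in h => //.
    exact: measurableT_comp.
  by move=> y; exact: abse_ge0.
split => //; congr fine.
rewrite -(@integral_density _ _ _ mu (distribution P pG) p p0 mp GE (EFin \o f) mEf).
by rewrite (@integral_distribution _ _ _ _ _ P pG (EFin \o f)).
Qed.

End density_transfer.

(** * Gaussian integration by parts on the line *)

Section normal_stein.
Context {R : realType}.
Local Notation lambda := (@lebesgue_measure R).
Variable s : R.
Hypothesis s0 : s != 0.
Local Notation p := (normal_pdf 0 s).

Let pE x : p x = normal_peak s * expR (- (x - 0) ^+ 2 / (s ^+ 2 *+ 2)).
Proof. by rewrite normal_pdfE. Qed.

Let is_derive_p (x : R) : is_derive x 1 p (- (x / s ^+ 2) * p x).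
Proof.
rewrite (_ : p = fun x => normal_peak s * expR (- (x - 0) ^+ 2 / (s ^+ 2 *+ 2))).
  apply: is_derive_eq; rewrite /GRing.scale/= ?subr0.
  by field.
by apply/funext => y; rewrite pE.
Qed.

Let cvg_p : p x @[x --> +oo%R] --> (0 : R).
Proof.
have s2 : 0 < s ^+ 2 *+ 2 by rewrite mulrn_wgt0// exprn_even_gt0.
apply: (@squeeze_cvgr _ _ _ _ (fun=> 0) (fun x => normal_peak s * expR (- x))).
- near=> x; rewrite normal_pdf_ge0/= pE subr0 ler_wpM2l ?normal_peak_ge0//.
  rewrite ler_expR mulNr lerN2 ler_pdivlMr// expr2 ler_wpM2l//.
- exact: cvg_cst.
- by rewrite -[X in _ --> X](mulr0 (normal_peak s)); apply: cvgMr; exact: cvgr_expR.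
Unshelve. all: by end_near. Qed.

Let cont_p : continuous p. Proof. exact: continuous_normal_pdf. Qed.

Let sym_p x : p (- x) = p x.
Proof. by rewrite !pE !subr0 sqrrN. Qed.

Let mxp : measurable_fun setT (fun x : R => x * p x).
Proof. by apply: measurable_funM => //; exact: measurable_normal_pdf. Qed.

(** By symmetry this is twice the integral over the positive half-line, where [- s ^ 2 * p] is a
    primitive of [x * p]. *)
Lemma integral_normal_pdf_norm :
  (\int[lambda]_x (`|x| * p x)%:E = (2 * (s ^+ 2 * p 0))%:E)%E.
Proof.
rewrite (ge0_symfun_integralT (f := fun x => `|x| * p x)); last 3 first.
- by move=> x; rewrite mulr_ge0// normal_pdf_ge0.
- by move=> x; apply: cvgM; [exact: norm_continuous|exact: cont_p].
- by move=> x /=; rewrite normrN sym_p.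
rewrite (_ : [set x : R | 0 <= x] = `[0, +oo[%classic); last first.
  by apply/seteqP; split => x /=; rewrite in_itv/= andbT.
rewrite (_ : \int[lambda]_(x in _) _ = \int[lambda]_(x in `[0%R, +oo[) (x * p x)%:E)%E; last first.
  apply: eq_integral => x; rewrite inE/= in_itv/= andbT => x0.
  by rewrite ger0_norm.
rewrite (@ge0_continuous_FTC2y _ _ (fun x => - s ^+ 2 * p x) 0 0).
- by rewrite -EFinB -EFinM sub0r mulNr opprK.
- by move=> x x0; rewrite mulr_ge0// normal_pdf_ge0.
- by apply: continuous_subspaceT => x; apply: cvgM; [exact: cvg_id|exact: cont_p].
- by rewrite -[X in _ --> X](mulr0 (- s ^+ 2)); apply: cvgMr; exact: cvg_p.
- by move=> x _; apply: derivableM => //; have [] := is_derive_p x.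
- by apply: cvgMr; apply: cvg_at_right_filter; exact: cont_p.
- move=> x _; rewrite derive1E; have := is_derive_p x; move=> dp.
  have [_ ->//] : is_derive x 1 (fun y => - s ^+ 2 * p y) (x * p x).
  by apply: is_derive_eq; rewrite /GRing.scale/=; field.
Qed.

Lemma integrable_normal_pdf_id : lambda.-integrable setT (fun x : R => (x * p x)%:E).
Proof.
apply/integrableP; split; first exact/measurable_EFinP.
under eq_integral do rewrite /= normrM (ger0_norm (normal_pdf_ge0 _ _ _)).
by rewrite integral_normal_pdf_norm ltry.
Qed.

Let int_f (f : R -> R) M : continuous f -> (forall x, `|f x| <= M) ->
  lambda.-integrable setT (fun x => (f x * p x)%:E) /\
  lambda.-integrable setT (fun x => (x * f x * p x)%:E).
Proof.
move=> cf fM; have mf := continuous_measurable_fun cf.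
split.
  under eq_fun do rewrite mulrC.
  by apply: (@L1Mr _ _ _ lambda setT _ _ M) => //; exact: integrable_normal_pdf.
under eq_fun do rewrite mulrAC.
by apply: (@L1Mr _ _ _ lambda setT (fun x => x * p x) _ M) => //; exact: integrable_normal_pdf_id.
Qed.

(** The difference of the two sides is the integral of the derivative of [F], a bounded multiple of
    the density. Over [[-(n + 1), n + 1]] it is a boundary term, which vanishes as [n] grows. *)
Lemma normal_stein (t c : R) :
  \int[lambda]_x (x * cos (t * x + c) * p x) =
  - t * s ^+ 2 * \int[lambda]_x (sin (t * x + c) * p x).
Proof.
have ccos : continuous (fun x => cos (t * x + c)).
  move=> x; apply: continuous_comp; last exact: continuous_cos.
  by apply: cvgD; [apply: cvgMr; exact: cvg_id|exact: cvg_cst].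
have csin : continuous (fun x => sin (t * x + c)).
  move=> x; apply: continuous_comp; last exact: continuous_sin.
  by apply: cvgD; [apply: cvgMr; exact: cvg_id|exact: cvg_cst].
have [ic ixc] : lambda.-integrable setT (fun x => (cos (t * x + c) * p x)%:E) /\
    lambda.-integrable setT (fun x => (x * cos (t * x + c) * p x)%:E).
  by apply: (int_f (M := 1)) => // x; rewrite ler_norml cos_le1 cos_geN1.
have [is_ _] : lambda.-integrable setT (fun x => (sin (t * x + c) * p x)%:E) /\
    lambda.-integrable setT (fun x => (x * sin (t * x + c) * p x)%:E).
  by apply: (int_f (M := 1)) => // x; rewrite ler_norml sin_le1 sin_geN1.
pose g x := x * cos (t * x + c) * p x + (t * s ^+ 2) * (sin (t * x + c) * p x).
pose F x := - s ^+ 2 * cos (t * x + c) * p x.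
have ig : lambda.-integrable setT (EFin \o g).
  by apply: L1D => //; exact: L1Z.
have cg : continuous g.
  move=> x; apply: cvgD.
    apply: cvgM; last exact: cont_p.
    by apply: cvgM; [exact: cvg_id|exact: ccos].
  by apply: cvgM; [exact: cvg_cst|apply: cvgM; [exact: csin|exact: cont_p]].
have dF (x : R) : is_derive x 1 F (g x).
  have dp := is_derive_p x.
  apply: is_derive_eq; rewrite /g /GRing.scale/=.
  by field.
have cF : continuous F.
  by move=> x; apply: differentiable_continuous; apply/derivable1_diffP; have [] := dF x.
suff g0 : \int[lambda]_x g x = 0.
  have := g0; rewrite RintegralD//; last exact: L1Z.
  by rewrite RintegralZl// => /eqP; rewrite addr_eq0 => /eqP ->; rewrite !mulNr.
have iFTC n : \int[lambda]_(x in `[- n.+1%:R, n.+1%:R]) g x = F n.+1%:R - F (- n.+1%:R).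
  rewrite /Rintegral (@continuous_FTC2 _ g F)//.
  - by rewrite -subr_gt0 opprK addr_gt0.
  - exact: continuous_subspaceT.
  - split.
    + by move=> x _; have [] := dF x.
    + exact: cvg_at_right_filter (cF _).
    + exact: cvg_at_left_filter (cF _).
  - by move=> x _; rewrite derive1E; have [_ ->] := dF x.
have [||||_] := @Rintegral_dominated _ _ R lambda setT
    (fun n x => g x * \1_(`[- n.+1%:R, n.+1%:R]%classic : set R) x) g (fun x => `|g x|) measurableT.
- move=> n; apply: measurable_funM; first exact: continuous_measurable_fun.
  exact: measurable_indic.
- move=> x _; apply: (@cvg_near_cst _ _ _ _ _).
  near=> n; rewrite indicE mem_set ?mulr1//= in_itv/= -ler_norml.
  apply: (@le_trans _ _ n%:R); last by rewrite ler_nat.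
  by near: n; exact: nbhs_infty_ger.
- exact: integrable_norm.
- by move=> n x _; rewrite normrM ler_piMr// indicE; case: (_ \in _); rewrite ?normr1 ?normr0.
under eq_fun do rewrite -Rintegral_indic// iFTC.
move=> /cvg_lim <- //; apply/cvg_lim => //.
apply/norm_cvg0P; apply: (@squeeze_cvgr _ _ _ _ (fun=> 0) (fun n : nat => 2 * s ^+ 2 * p n.+1%:R)).
- near=> n; rewrite normr_ge0/=.
  have FN x : `|F x| <= s ^+ 2 * p x.
    rewrite /F 2!normrM normrN (ger0_norm (sqr_ge0 s)) (ger0_norm (normal_pdf_ge0 _ _ _)).
    rewrite ler_wpM2r ?normal_pdf_ge0// ler_piMr ?sqr_ge0//.
    by rewrite ler_norml cos_le1 cos_geN1.
  apply: le_trans (ler_normB _ _) _.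
  have := FN n.+1%:R; have := FN (- n.+1%:R); rewrite sym_p; lra.
- exact: cvg_cst.
- rewrite -[X in _ --> X](mulr0 (2 * s ^+ 2)); apply: cvgM; first exact: cvg_cst.
  apply: (cvg_comp _ _ _ cvg_p).
  apply/cvgryPge => A; near=> n.
  by apply: (@le_trans _ _ n%:R); [near: n; exact: nbhs_infty_ger|rewrite ler_nat].
Unshelve. all: by end_near. Qed.

End normal_stein.

Section generated_measurability.
Context {R : realType} {d : measure_display} {Omega : measurableType d}.
Implicit Types (G : set (set Omega)) (f : Omega -> R).

Lemma measurable_wrtP G f :
  measurable_wrt <<s G >> f <-> measurable_fun (setT : set (g_sigma_algebraType G)) f.
Proof.
split => h.
  by move=> _ C mC; rewrite setTI; exact: h.
by move=> C mC; rewrite -[X in <<s _ >> X]setTI; exact: h.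
Qed.

End generated_measurability.

Section independent_variables.
Context {R : realType} {d : measure_display} {Omega : measurableType d}.
Variable P : probability Omega R.
Local Notation L1 f := (P.-integrable setT (EFin \o f)).

Definition independent_rv (f g : Omega -> R) :=
  forall A B : set R, measurable A -> measurable B ->
    P (f @^-1` A `&` g @^-1` B) = (P (f @^-1` A) * P (g @^-1` B))%E.

Lemma independent_rv_comp (f g : Omega -> R) (u v : R -> R) :
  measurable_fun setT u -> measurable_fun setT v ->
  independent_rv f g -> independent_rv (u \o f) (v \o g).
Proof.
move=> mu mv h A B mA mB; apply: (h (u @^-1` A) (v @^-1` B)).
  by rewrite -[X in measurable X]setTI; exact: mu.
by rewrite -[X in measurable X]setTI; exact: mv.
Qed.

Let mcos (t c : R) : measurable_fun setT (fun x : R => cos (t * x + c)).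
Proof.
apply: continuous_measurable_fun => x; apply: continuous_comp; last exact: continuous_cos.
by apply: cvgD; [apply: cvgMr; exact: cvg_id|exact: cvg_cst].
Qed.

Let msin (t c : R) : measurable_fun setT (fun x : R => sin (t * x + c)).
Proof.
apply: continuous_measurable_fun => x; apply: continuous_comp; last exact: continuous_sin.
by apply: cvgD; [apply: cvgMr; exact: cvg_id|exact: cvg_cst].
Qed.

Lemma L1_bound1 (f : Omega -> R) : measurable_fun setT f -> (forall w, `|f w| <= 1) -> L1 f.
Proof.
move=> mf f1; apply: (@L1_bounded _ _ _ P setT _ 1) => //.
by apply: (@le_lt_trans _ _ 1%E); [exact: probability_le1|exact: ltry].
Qed.

Let ncos (x : R) : `|cos x| <= 1. Proof. by rewrite ler_norml cos_le1 cos_geN1. Qed.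
Let nsin (x : R) : `|sin x| <= 1. Proof. by rewrite ler_norml sin_le1 sin_geN1. Qed.

Section stein.
Variables (G y : Omega -> R) (s : R).
Hypotheses (s0 : 0 < s) (mG : measurable_fun setT G) (my : measurable_fun setT y).
Hypothesis GN : forall C : set R, measurable C -> P (G @^-1` C) = normal_prob 0 s C.

Let sn0 : s != 0. Proof. by rewrite gt_eqF. Qed.

Lemma L1_normal_comp (f : R -> R) : measurable_fun setT f ->
  lebesgue_measure.-integrable setT (fun x => (f x * normal_pdf 0 s x)%:E) ->
  L1 (f \o G) /\
  \int[P]_w (f (G w)) = \int[lebesgue_measure]_x (f x * normal_pdf 0 s x).
Proof.
move=> mf ifp.
exact: (@L1_density_comp _ _ _ _ (measurableTypeR R) lebesgue_measure _
  (normal_pdf_ge0 0 s) (measurable_normal_pdf 0 s) P G mG GN f mf ifp).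
Qed.

Lemma L1_normal : L1 G.
Proof.
by have [] := @L1_normal_comp id (@measurable_id _ _ _) (integrable_normal_pdf_id sn0).
Qed.

(** The exact value is [s * sqrt (2 / pi)]; a crude bound linear in [s] is enough, since it serves
    to bound Brownian first moments uniformly in time. *)
Lemma normal_norm_le : \int[P]_w `|G w| <= 2 * s.
Proof.
have ip : lebesgue_measure.-integrable setT (fun x : R => (`|x| * normal_pdf 0 s x)%:E).
  have := integrable_norm (integrable_normal_pdf_id sn0).
  by apply: eq_integrable => // x _ /=; rewrite normrM (ger0_norm (normal_pdf_ge0 _ _ _)).
have mn : measurable_fun setT (fun x : R => `|x|) by exact: measurableT_comp.
have [_ ->] := L1_normal_comp mn ip.
rewrite /Rintegral (integral_normal_pdf_norm sn0)/= ler_wpM2l//.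
rewrite normal_pdfE//= /normal_fun subr0 expr0n/= oppr0 mul0r expR0 mulr1 expr2 -mulrA.
rewrite ler_piMr ?(ltW s0)// /normal_peak.
have sp : s <= Num.sqrt (s ^+ 2 * pi *+ 2).
  rewrite -[leLHS](ger0_norm (ltW s0)) -sqrtr_sqr ler_wsqrtr//.
  rewrite -mulrnAr ler_peMr ?sqr_ge0//.
  by have := @pi_ge2 R; lra.
by rewrite ler_pdivrMr ?mul1r// (lt_le_trans s0).
Qed.

Hypothesis Gy : independent_rv G y.

(** The addition formula separates [G] from [y], with the phases 0 and [pi / 2] in front of [cos y]
    and [sin y]. Each product factorizes by independence, the one-dimensional formula applies to the
    factor in [G], and the sines recombine. *)
Lemma stein_independent (t : R) :
  \int[P]_w (G w * cos (t * G w + y w)) =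
  - t * s ^+ 2 * \int[P]_w sin (t * G w + y w).
Proof.
have iG := L1_normal.
have my' := measurable_affine.
have St (c : R) : \int[P]_w (G w * cos (t * G w + c)) =
    - t * s ^+ 2 * \int[P]_w sin (t * G w + c).
  have ib (f : R -> R) : measurable_fun setT f -> (forall x, `|f x| <= 1) ->
     lebesgue_measure.-integrable setT (fun x => (f x * normal_pdf 0 s x)%:E) /\
     lebesgue_measure.-integrable setT (fun x => (x * f x * normal_pdf 0 s x)%:E).
    move=> mf f1; split.
      under eq_fun do rewrite mulrC.
      by apply: (@L1Mr _ _ _ lebesgue_measure setT _ _ 1) => //; exact: integrable_normal_pdf.
    under eq_fun do rewrite mulrAC.
    apply: (@L1Mr _ _ _ lebesgue_measure setT (fun x => x * normal_pdf 0 s x) _ 1) => //.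
    exact: integrable_normal_pdf_id.
  have [_ i1] := ib _ (mcos t c) (fun x => ncos _).
  have [i2 _] := ib _ (msin t c) (fun x => nsin _).
  have mxc : measurable_fun setT (fun x : R => x * cos (t * x + c)).
    by apply: measurable_funM => //; exact: mcos.
  have [_ ->] := L1_normal_comp mxc i1.
  have [_ ->] := L1_normal_comp (msin t c) i2.
  exact: normal_stein.
have mGx (f : R -> R) : measurable_fun setT f -> measurable_fun setT (fun w => f (G w)).
  by move=> mf; exact: (measurableT_comp mf mG).
have myx (f : R -> R) : measurable_fun setT f -> measurable_fun setT (fun w => f (y w)).
  by move=> mf; exact: (measurableT_comp mf my).
have mc : measurable_fun setT (@cos R) by exact: (continuous_measurable_fun (@continuous_cos R)).
have ms : measurable_fun setT (@sin R) by exact: (continuous_measurable_fun (@continuous_sin R)).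
have icy : L1 (fun w => cos (y w)) by apply: L1_bound1 => //; exact: myx.
have isy : L1 (fun w => sin (y w)) by apply: L1_bound1 => //; exact: myx.
have iGc c : L1 (fun w => G w * cos (t * G w + c)).
  by apply: L1_cos => //; exact: measurable_affine.
have isG c : L1 (fun w => sin (t * G w + c)).
  by apply: L1_bound1 => //; apply: (mGx (fun x => sin (t * x + c))); exact: msin.
have ind (u v : R -> R) : measurable_fun setT u -> measurable_fun setT v ->
    L1 (fun w => u (G w)) -> L1 (fun w => v (y w)) ->
    L1 (fun w => u (G w) * v (y w)) /\
    \int[P]_w (u (G w) * v (y w)) = (\int[P]_w u (G w)) * (\int[P]_w v (y w)).
  move=> mu mv iu iv; have h := independent_rv_comp mu mv Gy.
  split; first exact: (L1_independentM iu iv h).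
  exact: (Rintegral_independentM iu iv h).
have mxc c : measurable_fun setT (fun x : R => x * cos (t * x + c)).
  by apply: measurable_funM => //; exact: mcos.
have [i1 e1] := ind (fun x => x * cos (t * x + 0)) _ (mxc 0) mc (iGc 0) icy.
have [i2 e2] := ind (fun x => x * cos (t * x + pi / 2)) _ (mxc (pi / 2)) ms (iGc (pi / 2)) isy.
have [i3 e3] := ind (fun x => sin (t * x + 0)) _ (msin t 0) mc (isG 0) icy.
have [i4 e4] := ind (fun x => sin (t * x + pi / 2)) _ (msin t (pi / 2)) ms (isG (pi / 2)) isy.
transitivity (\int[P]_w (G w * cos (t * G w + 0) * cos (y w) +
                        G w * cos (t * G w + pi / 2) * sin (y w))).
  apply: eq_Rintegral => w _; rewrite addr0 !cosD cos_pihalf sin_pihalf; ring.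
rewrite RintegralD// e1 e2 !St.
transitivity (- t * s ^+ 2 * \int[P]_w (sin (t * G w + 0) * cos (y w) +
                        sin (t * G w + pi / 2) * sin (y w))).
  by rewrite RintegralD// e3 e4; ring.
congr (_ * _); apply: eq_Rintegral => w _; rewrite addr0 !sinD cos_pihalf sin_pihalf; ring.
Qed.

End stein.
End independent_variables.

(** * Independence of one increment from all the others *)

Section increments.
Context {R : realType} {d : measure_display} {Omega : measurableType d}.
Variable P : probability Omega R.
Variables (T : R) (Z : R -> Omega -> R).
Hypotheses (pZ : process T Z) (iiZ : independent_increments P T Z).
Local Notation L1 f := (P.-integrable setT (EFin \o f)).

Variables (n : nat) (t : nat -> R).
Hypothesis tT : forall i, (i <= n)%N -> 0 <= t i <= T.
Hypothesis t_mono : forall i, (i < n)%N -> t i <= t i.+1.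

Definition incr (i : nat) (w : Omega) : R := Z (t i.+1) w - Z (t i) w.

Lemma measurable_incr i : (i < n)%N -> measurable_fun setT (incr i).
Proof.
by move=> ni; apply: measurable_funB; apply: pZ; apply: tT; rewrite // ltnW.
Qed.

Let sG := [set A | exists2 s : R, 0 <= s <= T &
       exists2 C : set R, measurable C & A = Z s @^-1` C].

Lemma sigma_process_measurable : sigma_process T Z `<=` measurable.
Proof.
apply: smallest_sub; first exact: sigma_algebra_measurable.
by move=> _ [s sT [C mC ->]]; rewrite -[X in measurable X]setTI; exact: pZ.
Qed.

Lemma measurable_wrt_process s : 0 <= s <= T -> measurable_wrt (sigma_process T Z) (Z s).
Proof. by move=> sT C mC; apply: sub_sigma_algebra; exists s => //; exists C. Qed.

Let sincr i : (i < n)%N -> measurable_wrt (sigma_process T Z) (incr i).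
Proof.
move=> ni; apply/measurable_wrtP; apply: measurable_funB; apply/measurable_wrtP.
  by apply: measurable_wrt_process; exact: tT.
by apply: measurable_wrt_process; apply: tT; rewrite ltnW.
Qed.

Variable y : Omega -> R.
Hypothesis my : measurable_fun setT y.
Hypothesis yZ : forall A B, sigma_process T Z A -> measurable B ->
  P (A `&` y @^-1` B) = (P A * P (y @^-1` B))%E.

Variable k : nat.
Hypothesis kn : (k < n)%N.

Let others (C : nat -> set R) (B : set R) : set Omega :=
  (\bigcap_(i < n) (incr i @^-1` C i)) `&` y @^-1` B.

(** Events about [y] and all increments except the [k]-th. Asking [C k = setT] instead of deleting
    the index keeps intersections and products over all [i < n], the shape of the product rule for
    increments. *)
Let G2 := [set A | exists C B, [/\ forall i, measurable (C i), measurable B,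
   C k = setT & A = others C B]].

Let mcap C : (forall i, measurable (C i)) -> 
  sigma_process T Z (\bigcap_(i < n) (incr i @^-1` C i)).
Proof.
move=> mC; apply: (@bigcap_measurable _ (g_sigma_algebraType sG)).
  by exists k.
by move=> i ni; exact: sincr.
Qed.

Let G2I : setI_closed G2.
Proof.
move=> _ _ [C [B [mC mB Ck ->]]] [C' [B' [mC' mB' Ck' ->]]].
exists (fun i => C i `&` C' i), (B `&` B'); split.
- by move=> i; exact: measurableI.
- exact: measurableI.
- by rewrite Ck Ck' setTI.
- apply/seteqP; split => w /=.
    by move=> [[h1 h2] [h3 h4]]; split => // i ni; split; [exact: h1|exact: h3].
  by move=> [h [h2 h4]]; split; split => // i ni; have [] := h i ni.
Qed.

Let G2m : G2 `<=` measurable.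
Proof.
move=> _ [C [B [mC mB _ ->]]]; apply: measurableI.
  by apply: sigma_process_measurable; exact: mcap.
by rewrite -[X in measurable X]setTI; exact: my.
Qed.

Let G1 := [set A | exists2 C : set R, measurable C & A = incr k @^-1` C].

Let prob_cap C : (forall i, measurable (C i)) ->
  P (\bigcap_(i < n) (incr i @^-1` C i)) = (\prod_(i < n) P (incr i @^-1` C i))%E.
Proof.
move=> mC; exact: (iiZ (fun i => tT (i := i)) t_mono mC).
Qed.

(** A constraint on the [k]-th increment fits in the empty slot [C k]; the product rule is then
    applied to both families and compared factor by factor. *)
Let indep_G : independent2 P G1 G2.
Proof.
move=> _ _ [A mA ->] [C [B [mC mB Ck ->]]].
pose C' i := if i == k then A else C i.
have mC' i : measurable (C' i) by rewrite /C'; case: ifP.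
have -> : incr k @^-1` A `&` others C B = (\bigcap_(i < n) (incr i @^-1` C' i)) `&` y @^-1` B.
  apply/seteqP; split => w /=.
    move=> [hA [hC hB]]; split => // i ni; rewrite /C'/=.
    by case: eqP => [->//|_]; exact: hC.
  move=> [h hB]; split; last split => //.
    by have := h k kn; rewrite /C' /= eqxx.
  move=> i ni; have := h i ni; rewrite /C' /=; case: eqP => [->|//].
  by rewrite Ck.
rewrite /others !yZ//; [|exact: mcap|exact: mcap].
rewrite !prob_cap//= muleA; congr (_ * _)%E.
rewrite (bigD1 (Ordinal kn))//= [in RHS](bigD1 (Ordinal kn))//=.
rewrite {1}/C' eqxx Ck preimage_setT probability_setT mul1e; congr (_ * _)%E.
by apply: eq_bigr => i ik; rewrite /C'; case: eqP => // e; move: ik; rewrite -(inj_eq val_inj)/= e eqxx.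
Qed.

Variable th : nat -> R.

Lemma incr_independent :
  independent_rv P (incr k) (fun w => \sum_(i < n | i != k :> nat) th i * incr i w + y w).
Proof.
have h : independent2 P <<s G1 >> <<s G2 >>.
  apply: independent2_sigma => //.
  - move=> _ _ [A mA ->] [B mB ->]; exists (A `&` B) => //; exact: measurableI.
  - by move=> _ [A mA ->]; rewrite -[X in measurable X]setTI; exact: measurable_incr.
move=> A B mA mB; apply: h.
  by apply: sub_sigma_algebra; exists A.
suff : measurable_wrt <<s G2 >> (fun w => \sum_(i < n | i != k :> nat) th i * incr i w + y w) by exact.
apply/measurable_wrtP; apply: measurable_funD; last first.
  apply/measurable_wrtP => C mC; apply: sub_sigma_algebra.
  exists (fun=> setT), C; split => //; rewrite /others bigcapT ?setTI//.
rewrite (_ : (fun w => _) = (fun w => \sum_(i < n) (if i != k :> nat then th i * incr i w else 0))); last first.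
  by apply/funext => w; rewrite big_mkcond.
apply: measurable_sum => i; have [_|ik] := eqVneq (i : nat) k; first exact: measurable_cst.
apply: measurable_funM; first exact: measurable_cst.
apply/measurable_wrtP => C mC; apply: sub_sigma_algebra.
exists (fun j : nat => if j == i then C else setT), setT; split => //.
- by move=> j; case: ifP.
- by rewrite /= eq_sym (negbTE ik).
- rewrite /others preimage_setT setIT; apply/seteqP; split => w /=.
    by move=> Cw j jn /=; case: eqP => // ->.
  by move=> /(_ i (ltn_ord i)) /=; rewrite eqxx.
Qed.

End increments.

(** * Linear combinations of values written through grid increments *)

Section process_on_grid.
Context {R : realType} {d : measure_display} {Omega : measurableType d}.
Variable P : probability Omega R.
Variables (T : R) (Z : R -> Omega -> R).
Hypotheses (pZ : process T Z) (iiZ : independent_increments P T Z).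
Hypothesis Z0 : {ae P, forall w, Z 0 w = 0}.
Local Notation L1 f := (P.-integrable setT (EFin \o f)).

Lemma telescope_indicator (f : nat -> R) n k : (k <= n)%N ->
  f k - f 0%N = \sum_(i < n) (i < k)%N%:R * (f i.+1 - f i).
Proof.
move=> kn; rewrite -telescope_sumr//.
rewrite big_mkord (big_ord_widen _ (fun i => f i.+1 - f i) kn) big_mkcond/=.
by apply: eq_bigr => i _; case: ifPn => _; rewrite ?mul1r ?mul0r.
Qed.

Definition time_comb (l : seq (R * R)) (w : Omega) : R := \sum_(q <- l) q.1 * Z q.2 w.

Definition times_in (a b : R) (l : seq (R * R)) := forall q, q \in l -> a <= q.2 <= b.

Lemma measurable_time_comb l : times_in 0 T l -> measurable_fun setT (time_comb l).
Proof.
elim: l => [|q l IH] lT.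
  by rewrite (_ : time_comb _ = cst 0) //; apply/funext => w; rewrite /time_comb big_nil.
rewrite (_ : time_comb _ = (fun w => q.1 * Z q.2 w + time_comb l w)).
  apply: measurable_funD; last by apply: IH => q' ql; apply: lT; rewrite inE ql orbT.
  by apply: measurable_funM => //; apply: pZ; apply: lT; rewrite mem_head.
by apply/funext => w; rewrite /time_comb big_cons.
Qed.

Section grid.
Variable s : seq R.
Hypotheses (ss : sorted <=%R s) (sT : forall r, r \in s -> 0 <= r <= T).
Hypotheses (s0 : nth T s 0 = 0) (s_gt0 : (0 < size s)%N).

Let t := nth T s.
Let n := (size s).-1.

Lemma grid_in i : (i <= n)%N -> 0 <= t i <= T.
Proof. by move=> ni; apply: sT; apply: mem_nth; rewrite -(prednK s_gt0) ltnS. Qed.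

Lemma grid_mono i : (i < n)%N -> t i <= t i.+1.
Proof.
move=> ni; apply: (sorted_leq_nth le_trans le_refl) => //; rewrite inE -(prednK s_gt0) ltnS//.
exact: ltnW.
Qed.

Lemma grid_index r : r \in s -> (index r s <= n)%N /\ t (index r s) = r.
Proof.
by move=> rs; rewrite /t nth_index//; split => //; rewrite -ltnS prednK// index_mem.
Qed.

(** Abel summation: the value at a grid time is the sum of the increments before it, so the [i]-th
    increment collects the weights of all times of index above [i]. *)
Definition grid_coef (l : seq (R * R)) (i : nat) : R :=
  \sum_(q <- l) q.1 * (i < index q.2 s)%N%:R.

Lemma time_comb_grid l w : (forall q, q \in l -> q.2 \in s) -> Z 0 w = 0 ->
  time_comb l w = \sum_(i < n) grid_coef l i * incr Z t i w.
Proof.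
move=> ls z0.
transitivity (\sum_(q <- l) \sum_(i < n) q.1 * ((i < index q.2 s)%N%:R * incr Z t i w)).
  rewrite /time_comb big_seq [RHS]big_seq; apply: eq_bigr => q ql.
  have [qn tq] := grid_index (ls q ql).
  rewrite -mulr_sumr -(telescope_indicator (fun i => Z (t i) w) qn) tq.
  by rewrite /t s0 z0 subr0.
rewrite exchange_big; apply: eq_bigr => i _; rewrite /grid_coef mulr_suml.
by apply: eq_bigr => q _; rewrite mulrA.
Qed.

End grid.

(** The time 0 is added so that the telescoping sums start from [Z 0], which is almost surely 0.
    Repetitions stay in the list and only create zero increments. *)
Definition time_grid (l : seq (R * R)) (u : R) : seq R := sort <=%R (0 :: u :: map snd l).

Lemma time_grid_props l u : 0 <= u <= T -> times_in 0 T l ->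
  [/\ sorted <=%R (time_grid l u), forall r, r \in time_grid l u -> 0 <= r <= T,
   nth T (time_grid l u) 0 = 0 & (0 < size (time_grid l u))%N].
Proof.
move=> uT lT.
have T0 : 0 <= T by have /andP[u0 uTT] := uT; exact: le_trans uTT.
have ss : sorted <=%R (time_grid l u) by apply: sort_sorted; exact: le_total.
have sT r : r \in time_grid l u -> 0 <= r <= T.
  rewrite mem_sort !inE => /or3P[/eqP ->|/eqP ->//|/mapP[q ql ->]].
    by rewrite lexx T0.
  exact: lT.
have sz : (0 < size (time_grid l u))%N by rewrite size_sort.
split => //; apply/eqP; rewrite eq_le; apply/andP; split; last first.
  by have /andP[] := sT _ (mem_nth T sz).
have z : 0 \in time_grid l u by rewrite mem_sort mem_head.
rewrite -[leRHS](nth_index T z); apply: (sorted_leq_nth le_trans le_refl) => //.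
by rewrite inE index_mem.
Qed.

Variable y : Omega -> R.
Hypothesis my : measurable_fun setT y.
Hypothesis yZ : forall A B, sigma_process T Z A -> measurable B ->
  P (A `&` y @^-1` B) = (P A * P (y @^-1` B))%E.

(** Appending [r] to a grid of times up to [s] makes [Z r - Z s] the last increment. No time of [l]
    lies beyond it, so its coefficient in the combination is 0 and it is independent of the rest. *)
Lemma future_increment_mean l s r (c : R) : 0 <= s -> s <= r -> r <= T -> times_in 0 s l ->
  L1 (fun w => Z r w - Z s w) ->
  \int[P]_w ((Z r w - Z s w) * cos (time_comb l w + y w + c)) =
  (\int[P]_w (Z r w - Z s w)) * \int[P]_w cos (time_comb l w + y w + c).
Proof.
move=> s0 sr rT ls iZ.
have sT : s <= T by exact: le_trans rT.
have lT : times_in 0 T l.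
  by move=> q /ls /andP[-> /= h]; exact: le_trans sT.
have [g1 g2 g3 g4] := @time_grid_props l s (introT andP (conj s0 sT)) lT.
pose g := rcons (time_grid l s) r.
have gs q : q \in time_grid l s -> q <= s.
  rewrite mem_sort !inE => /or3P[/eqP ->//|/eqP ->//|/mapP[q' ql ->]].
  by have /andP[] := ls _ ql.
have h1 : sorted <=%R g.
  rewrite /g; case e : (time_grid l s) g1 g4 gs => [//|a m] /= pm _ gs.
  rewrite rcons_path pm /= (le_trans _ sr)//; apply: gs; exact: mem_last.
have h2 q : q \in g -> 0 <= q <= T.
  by rewrite mem_rcons inE => /predU1P[->|/g2//]; rewrite (le_trans s0 sr).
have h3 : nth T g 0 = 0 by rewrite nth_rcons g4.
have h4 : (0 < size g)%N by rewrite size_rcons.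
pose k := (size (time_grid l s)).-1.
have kn : (k < (size g).-1)%N by rewrite size_rcons /= /k prednK.
have nE : (size g).-1 = k.+1 by rewrite size_rcons /= /k prednK.
have tk : nth T g k = s.
  rewrite nth_rcons /k prednK// leqnn; apply/eqP; rewrite eq_le; apply/andP; split.
    by apply: gs; apply: mem_nth; rewrite prednK.
  have z : s \in time_grid l s by rewrite mem_sort !inE eqxx orbT.
  rewrite -[leLHS](nth_index T z); apply: (sorted_leq_nth le_trans le_refl) => //.
  - by rewrite inE index_mem.
  - by rewrite inE prednK.
  - by rewrite -ltnS prednK// index_mem.
have tk1 : nth T g k.+1 = r by rewrite nth_rcons /k prednK// ltnn eqxx.
have lg q : q \in l -> q.2 \in g.
  move=> ql; rewrite mem_rcons inE; apply/orP; right.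
  by rewrite mem_sort !inE; apply/orP; right; apply/orP; right; apply/mapP; exists q.
(* [index] returns the first occurrence, which lies in the part of the grid before the appended time
   even when [r = s]. *)
have ck : grid_coef g l k = 0.
  rewrite /grid_coef big_seq big1// => q ql; rewrite ltnNge.
  rewrite (_ : (_ <= k)%N) ?mulr0//.
  have qt : q.2 \in time_grid l s.
    by rewrite mem_sort !inE; apply/orP; right; apply/orP; right; apply/mapP; exists q.
  by rewrite /g -cats1 index_cat qt -ltnS /k prednK// index_mem.
pose v w := \sum_(i < (size g).-1 | i != k :> nat) grid_coef g l i * incr Z (nth T g) i w + y w.
have ind : independent_rv P (incr Z (nth T g) k) v.
  exact: (incr_independent pZ iiZ (grid_in h2 h4) (grid_mono h1 h4) my yZ kn).
have incrE : incr Z (nth T g) k = (fun w => Z r w - Z s w).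
  by apply/funext => w; rewrite /incr tk tk1.
rewrite incrE in ind.
have vE : {ae P, forall w, time_comb l w + y w = v w}.
  apply: filterS Z0 => w z0; rewrite (time_comb_grid h3 h4 lg z0) /v; congr (_ + _).
  rewrite (bigD1 (Ordinal kn))//= ck mul0r add0r; apply: eq_bigl => i.
  by rewrite -(inj_eq val_inj).
have mtc := measurable_time_comb lT.
have mv : measurable_fun setT v.
  apply: measurable_funD => //.
  rewrite (_ : (fun w => _) = (fun w => \sum_(i < (size g).-1)
     (if i != k :> nat then grid_coef g l i * incr Z (nth T g) i w else 0))); last first.
    by apply/funext => w; rewrite big_mkcond.
  apply: measurable_sum => i; case: (_ != _) => //.
  apply: measurable_funM => //.
  exact: (measurable_incr pZ (grid_in h2 h4)).
have mZ := L1_measurable measurableT iZ.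
have mco : measurable_fun setT (fun x : R => cos (x + c)).
  by apply: measurable_cos_comp; exact: measurable_funD.
have mc1 : measurable_fun setT (fun w => cos (time_comb l w + y w + c)).
  by apply: measurable_cos_comp; do 2 apply: measurable_funD => //.
have mc2 : measurable_fun setT (fun w => cos (v w + c)).
  exact: (measurableT_comp mco mv).
have icv : L1 (fun w => cos (v w + c)).
  by apply: L1_bound1 => // w; rewrite ler_norml cos_le1 cos_geN1.
transitivity (\int[P]_w ((Z r w - Z s w) * cos (v w + c))).
  apply: ae_eq_Rintegral => //.
  - exact: measurable_funM.
  - exact: measurable_funM.
  - by apply: filterS vE => w -> _.
rewrite (@ae_eq_Rintegral _ _ _ P setT (fun w => cos (time_comb l w + y w + c)) (fun w => cos (v w + c)))//.
  apply: (Rintegral_independentM iZ icv).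
  exact: (independent_rv_comp (u := id) (v := fun x => cos (x + c)) _ mco ind).
by apply: filterS vE => w -> _.
Qed.

End process_on_grid.

Section brownian.
Context {R : realType} {d : measure_display} {Omega : measurableType d}.
Variable P : probability Omega R.
Variables (T : R) (Z : R -> Omega -> R).
Hypothesis bmZ : standard_brownian_motion P T Z.
Local Notation L1 f := (P.-integrable setT (EFin \o f)).

Let pZ : process T Z. Proof. by case: bmZ. Qed.
Let Z0 : {ae P, forall w, Z 0 w = 0}. Proof. by case: bmZ. Qed.
Let iiZ : independent_increments P T Z. Proof. by case: bmZ. Qed.

Lemma brownian_incr_normal a b : 0 <= a -> a < b -> b <= T ->
  forall C, measurable C -> P ((fun w => Z b w - Z a w) @^-1` C) =
    normal_prob 0 (Num.sqrt (b - a)) C.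
Proof. by move=> a0 ab bT C mC; have [_ _ _ h _] := bmZ; exact: h. Qed.

Let mincr a b : 0 <= a -> a <= b -> b <= T -> measurable_fun setT (fun w => Z b w - Z a w).
Proof.
move=> a0 ab bT; apply: measurable_funB; apply: pZ.
  by rewrite bT (le_trans a0 ab).
by rewrite a0 (le_trans ab bT).
Qed.

Lemma brownian_L1 u : 0 <= u <= T -> L1 (Z u) /\ \int[P]_w `|Z u w| <= 2 * Num.sqrt T.
Proof.
move=> /andP[u0 uT]; have mZu : measurable_fun setT (Z u) by apply: pZ; rewrite u0.
(* The normal law is given for increments over intervals of positive length; time 0 is covered by
   the initial condition. *)
have [->|un0] := eqVneq u 0.
  have T0 := le_trans u0 uT.
  have mZ0 : measurable_fun setT (Z 0) by apply: pZ; rewrite lexx.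
  split.
    apply/integrableP; split; first exact/measurable_EFinP.
    rewrite (@ae_eq_integral _ _ _ P _ (cst 0%E))//.
    - by rewrite integral0 ltry.
    - by apply/measurable_EFinP; exact: measurableT_comp.
    - by apply: filterS Z0 => w /= -> _; rewrite normr0.
  rewrite (@ae_eq_Rintegral _ _ _ P setT _ (cst 0))//.
  - by rewrite /Rintegral integral0 mulr_ge0// sqrtr_ge0.
  - exact: measurableT_comp.
  - by apply: filterS Z0 => w /= -> _; rewrite normr0.
have up : 0 < u by rewrite lt_neqAle eq_sym un0.
have sp : 0 < Num.sqrt (u - 0) by rewrite sqrtr_gt0 subr0.
have GN := brownian_incr_normal (lexx 0) up uT.
have iG := L1_normal sp (mincr (lexx 0) u0 uT) GN.
have GE : {ae P, forall w, Z u w - Z 0 w = Z u w}.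
  by apply: filterS Z0 => w ->; rewrite subr0.
split.
  move/integrableP : iG => [_ h]; apply/integrableP; split; first exact/measurable_EFinP.
  apply: le_lt_trans h; rewrite le_eqVlt; apply/orP; left; apply/eqP.
  apply: ae_eq_integral => //.
  - by apply/measurable_EFinP; exact: measurableT_comp.
  - by apply/measurable_EFinP; apply: measurableT_comp => //; exact: mincr.
  - by apply: filterS GE => w /= -> _.
rewrite (@ae_eq_Rintegral _ _ _ P setT _ (fun w => `|Z u w - Z 0 w|))//.
- apply: le_trans (normal_norm_le sp (mincr (lexx 0) u0 uT) GN) _.
  by rewrite ler_wpM2l// ler_wsqrtr// subr0.
- exact: measurableT_comp.
- by apply: measurableT_comp => //; exact: mincr.
- by apply: filterS GE => w -> _.
Qed.

Variable y : Omega -> R.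
Hypothesis my : measurable_fun setT y.
Hypothesis yZ : forall A B, sigma_process T Z A -> measurable B ->
  P (A `&` y @^-1` B) = (P A * P (y @^-1` B))%E.

Let stein_incr n (t : nat -> R) (th : nat -> R) k :
  (forall i, (i <= n)%N -> 0 <= t i <= T) -> (forall i, (i < n)%N -> t i <= t i.+1) ->
  (k < n)%N ->
  \int[P]_w (incr Z t k w * cos (\sum_(i < n) th i * incr Z t i w + y w)) =
  - th k * (t k.+1 - t k) * \int[P]_w sin (\sum_(i < n) th i * incr Z t i w + y w).
Proof.
move=> tT tm kn.
have tk := tm k kn; have /andP[tk0 _] := tT k (ltnW kn); have /andP[_ tk1] := tT _ kn.
(* A repeated grid time has no Gaussian density, but both sides vanish. *)
have [e|ne] := eqVneq (t k) (t k.+1).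
  rewrite e subrr mulr0 mul0r -[RHS](Rintegral_set0 P (cst 0)).
  rewrite [RHS]Rintegral_mkcond; apply: eq_Rintegral => w _.
  by rewrite /incr e subrr mul0r patchE; case: ifP.
have tlt : t k < t k.+1 by rewrite lt_neqAle ne.
have sp : 0 < Num.sqrt (t k.+1 - t k) by rewrite sqrtr_gt0 subr_gt0.
pose v w := \sum_(i < n | i != k :> nat) th i * incr Z t i w + y w.
have vE w : \sum_(i < n) th i * incr Z t i w + y w = th k * incr Z t k w + v w.
  rewrite /v addrA; congr (_ + _); rewrite (bigD1 (Ordinal kn))//=; congr (_ + _).
have mv : measurable_fun setT v.
  apply: measurable_funD => //.
  rewrite (_ : (fun w => _) = (fun w => \sum_(i < n)
     (if i != k :> nat then th i * incr Z t i w else 0))); last first.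
    by apply/funext => w; rewrite big_mkcond.
  apply: measurable_sum => i; case: (_ != _) => //.
  by apply: measurable_funM => //; exact: (measurable_incr pZ tT).
have ind : independent_rv P (incr Z t k) v := incr_independent pZ iiZ tT tm my yZ kn th.
have GN := brownian_incr_normal tk0 tlt tk1.
have := stein_independent sp (mincr tk0 tk tk1) mv GN ind (th k).
rewrite sqr_sqrtr ?subr_ge0// => st.
transitivity (\int[P]_w (incr Z t k w * cos (th k * incr Z t k w + v w))).
  by apply: eq_Rintegral => w _; rewrite vE.
rewrite st; congr (_ * _); apply: eq_Rintegral => w _; by rewrite vE.
Qed.

(** Both [Z u] and the combination are sums of independent increments. Stein's formula for the
    [i]-th increment brings out its coefficient times the length of its cell; the cells counted for
    both [u] and [q.2] are those before the earlier of the two, and their lengths add up to the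
    covariance [min u q.2]. *)
Lemma brownian_stein l u : 0 <= u <= T -> times_in 0 T l ->
  \int[P]_w (Z u w * cos (time_comb Z l w + y w)) =
  - (\sum_(q <- l) q.1 * Num.min u q.2) * \int[P]_w sin (time_comb Z l w + y w).
Proof.
move=> uT lT; have [g1 g2 g3 g4] := time_grid_props uT lT.
set g := time_grid l u in g1 g2 g3 g4.
pose t := nth T g; pose n := (size g).-1.
have tT := grid_in g2 g4; have tm := grid_mono T g1 g4.
have lg q : q \in l -> q.2 \in g.
  by move=> ql; rewrite mem_sort !inE; apply/orP; right; apply/orP; right; apply/mapP; exists q.
have ug : u \in g by rewrite mem_sort !inE eqxx orbT.
have mtc := measurable_time_comb pZ lT.
have ncos (x : R) : `|cos x| <= 1 by rewrite ler_norml cos_le1 cos_geN1.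
have mZu : measurable_fun setT (Z u) by exact: pZ.
pose v w := \sum_(i < n) grid_coef g l i * incr Z t i w + y w.
have mi i : (i < n)%N -> measurable_fun setT (incr Z t i) by exact: (measurable_incr pZ tT).
have mv : measurable_fun setT v.
  apply: measurable_funD => //; apply: measurable_sum => i.
  by apply: measurable_funM => //; exact: mi.
have vE : {ae P, forall w, time_comb Z l w + y w = v w}.
  by apply: filterS Z0 => w z0; rewrite (time_comb_grid g3 g4 lg z0).
pose k := index u g.
have [kn tk] := grid_index T g4 ug.
have ZuE : {ae P, forall w, Z u w = \sum_(i < n) (i < k)%N%:R * incr Z t i w}.
  apply: filterS Z0 => w z0.
  by rewrite -(telescope_indicator (fun i => Z (t i) w) kn) /t tk g3 z0 subr0.
have ii i : (i < n)%N -> L1 (incr Z t i).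
  move=> ni; apply: L1B => //; apply: (brownian_L1 _).1; apply: tT => //; exact: ltnW.
have iicos i : (i < n)%N -> L1 (fun w => incr Z t i w * cos (v w)).
  by move=> ni; apply: L1_cos => //; exact: ii.
transitivity (\int[P]_w (\sum_(i < n) ((i < k)%N%:R * (incr Z t i w * cos (v w))))).
  apply: ae_eq_Rintegral => //.
  - apply: measurable_funM => //; apply: measurable_cos_comp; exact: measurable_funD.
  - apply: measurable_sum => i; apply: measurable_funM => //.
    by apply: (L1_measurable measurableT); exact: iicos.
  - apply: (filterS2 _ _ vE ZuE) => w -> -> _; rewrite mulr_suml.
    by apply: eq_bigr => i _; rewrite mulrA.
rewrite Rintegral_sum//; last by move=> i; apply: L1Z => //; exact: iicos.
have -> : \int[P]_w sin (time_comb Z l w + y w) = \int[P]_w sin (v w).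
  apply: ae_eq_Rintegral => //.
  - by apply: measurable_sin_comp; exact: measurable_funD.
  - exact: measurable_sin_comp.
  - by apply: filterS vE => w -> _.
transitivity (\sum_(i < n) (i < k)%N%:R * (- grid_coef g l i * (t i.+1 - t i) * \int[P]_w sin (v w))).
  apply: eq_bigr => i _; rewrite RintegralZl//; last exact: iicos.
  by rewrite (stein_incr (grid_coef g l) tT tm).
under eq_bigr do rewrite !mulrA.
rewrite -mulr_suml; congr (_ * _).
transitivity (- \sum_(q <- l) \sum_(i < n) (q.1 * ((i < minn k (index q.2 g))%N%:R * (t i.+1 - t i)))).
  rewrite exchange_big -sumrN; apply: eq_bigr => i _.
  rewrite /grid_coef mulrN mulNr mulr_sumr mulr_suml; congr (- _).
  by apply: eq_bigr => q _; rewrite leq_min; case: (_ < k)%N; rewrite ?mul1r ?mul0r ?mulr0// mulrA.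
congr (- _); rewrite big_seq [RHS]big_seq; apply: eq_bigr => q ql.
have [qn tq] := grid_index T g4 (lg q ql).
have mn : (minn k (index q.2 g) <= n)%N by rewrite geq_min kn.
rewrite -mulr_sumr -(telescope_indicator t mn) {2}/t g3 subr0; congr (_ * _).
have tle (i j : nat) : (i <= j)%N -> (j <= n)%N -> t i <= t j.
  move=> ij jn; apply: (sorted_leq_nth le_trans le_refl) => //; rewrite inE -(prednK g4) ltnS//.
  exact: leq_trans jn.
rewrite /t in tk tq tle; have [kq|qk] := leqP k (index q.2 g).
  by rewrite [LHS]tk; apply/esym/min_idPl; rewrite -tk -[leRHS]tq; exact: tle.
by rewrite [LHS]tq; apply/esym/min_idPr; rewrite -tk -[leLHS]tq; apply: tle => //; exact: ltnW.
Qed.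

End brownian.

(** * Moments of Levy processes *)

Section elementary_bounds.
Context {R : realType}.
Implicit Types x y z : R.

Lemma lipschitz_MVT (f df : R -> R) (M : R) y z :
  (forall x, is_derive x 1 f (df x)) ->
  (forall x, Num.min y z <= x <= Num.max y z -> `|df x| <= M) ->
  `|f y - f z| <= M * `|y - z|.
Proof.
move=> dF; wlog zy : y z / z <= y => [H|] dfM.
  have [zy|/ltW yz] := leP z y; first exact: H.
  by rewrite distrC (distrC y); apply: H => // x; rewrite minC maxC; exact: dfM.
have cf : {within `[z, y], continuous f}.
  apply: continuous_subspaceT => x; apply: differentiable_continuous.
  by apply/derivable1_diffP; have [] := dF x.
have [c czy ->] := MVT_segment zy (fun x _ => dF x) cf.
rewrite normrM ler_wpM2r//; apply: dfM.
by move: czy; rewrite in_itv/= (min_idPr zy) (max_idPl zy).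
Qed.

Lemma sin_lipschitz y z : `|sin y - sin z| <= `|y - z|.
Proof.
rewrite -[leRHS]mul1r; apply: (@lipschitz_MVT _ cos) => x _; exact: cos_max.
Qed.

Lemma cos_lipschitz y z : `|cos y - cos z| <= `|y - z|.
Proof.
rewrite -[leRHS]mul1r; apply: (@lipschitz_MVT _ (fun x => - sin x)) => x _.
by rewrite normrN; exact: sin_max.
Qed.

Lemma sin_le_norm y : `|sin y| <= `|y|.
Proof. by have := sin_lipschitz y 0; rewrite sin0 !subr0. Qed.

Lemma onem_cos_ge0 y : 0 <= 1 - cos y. Proof. by rewrite subr_ge0 cos_le1. Qed.

Lemma onem_cos_le_norm y : 1 - cos y <= `|y|.
Proof.
have := cos_lipschitz 0 y; rewrite cos0 sub0r normrN; apply: le_trans; exact: ler_norm.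
Qed.

Lemma in_minmax0 x y : Num.min y 0 <= x <= Num.max y 0 -> `|x| <= `|y|.
Proof.
have [y0|y0] := leP y 0; move=> /andP[h1 h2].
  by rewrite !ler0_norm// ?lerN2.
by rewrite !ger0_norm// ltW.
Qed.

Lemma onem_cos_le_sqr y : 1 - cos y <= y ^+ 2.
Proof.
apply: le_trans (ler_norm _) _; rewrite -[X in `|X - _|]cos0 distrC -real_normK ?num_real//.
rewrite expr2 -[X in _ <= _ * `|X|]subr0.
apply: (@lipschitz_MVT _ (fun x => - sin x)) => x /in_minmax0 xy.
by rewrite normrN (le_trans (sin_le_norm x)).
Qed.

Lemma sin_sub_id_le_sqr y : `|sin y - y| <= y ^+ 2.
Proof.
have -> : sin y - y = (sin y - y) - (sin 0 - 0) by rewrite sin0 !subr0.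
rewrite -real_normK ?num_real// expr2 -[X in _ <= _ * `|X|]subr0.
apply: (@lipschitz_MVT (fun x => sin x - x) (fun x => cos x - 1)) => x /in_minmax0 xy.
by apply: le_trans xy; rewrite distrC (ger0_norm (onem_cos_ge0 x)) onem_cos_le_norm.
Qed.

Lemma onem_exp_cos_le (a b : R) : a <= 0 -> 1 - expR a * cos b <= - a + b ^+ 2.
Proof.
move=> a0; have e1 : expR a <= 1 by rewrite -expR0 ler_expR.
have ea := expR_ge1Dx a; have ep := expR_ge0 a.
rewrite (_ : 1 - _ = (1 - expR a) + expR a * (1 - cos b)); last ring.
apply: lerD; first lra.
apply: (@le_trans _ _ (1 - cos b)); last exact: onem_cos_le_sqr.
by rewrite ler_piMl// onem_cos_ge0.
Qed.

(* [12 x^2 / (1 + |x|)] is a supersolution of the recursion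
   [S (n+1) x = 1 - cos x + 2 S n (x / 2)]. *)
Definition dyadic_cos (n : nat) x : R := \sum_(k < n) 2 ^+ k * (1 - cos (2 ^- k * x)).

Lemma dyadic_cos_ge0 n x : 0 <= dyadic_cos n x.
Proof. by apply: sumr_ge0 => k _; rewrite mulr_ge0 ?onem_cos_ge0// exprn_ge0. Qed.

Lemma dyadic_cosS n x : dyadic_cos n.+1 x = 1 - cos x + 2 * dyadic_cos n (x / 2).
Proof.
rewrite /dyadic_cos big_ord_recl/= expr0 invr1 !mul1r mulr_sumr; congr (_ + _).
apply: eq_bigr => k _; rewrite (_ : bump 0 k = k.+1)// exprS -mulrA.
by congr (_ * (_ * (1 - cos _))); rewrite invfM; ring.
Qed.

Lemma dyadic_cos_le n x : dyadic_cos n x <= 12 * x ^+ 2 / (1 + `|x|).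
Proof.
elim: n x => [|n IH] x.
  by rewrite /dyadic_cos big_ord0 divr_ge0 ?addr_ge0// mulr_ge0// sqr_ge0.
rewrite dyadic_cosS; have := IH (x / 2); set S := dyadic_cos _ _ => IHx.
have c1 := onem_cos_le_sqr x; have c2 : 1 - cos x <= 2 by have := cos_geN1 x; lra.
have x2 : x ^+ 2 = `|x| ^+ 2 by rewrite real_normK ?num_real.
rewrite normrM (ger0_norm (_ : 0 <= 2^-1)) // in IHx.
have xa := normr_ge0 x; set a := `|x| in x2 xa IHx *.
rewrite (_ : (x / 2) ^+ 2 = a ^+ 2 / 4) in IHx; last by rewrite expr_div_n x2; field.
rewrite x2 in c1 *.
have d1 : 0 < 1 + a by lra.
have d2 : 0 < 1 + a / 2 by lra.
(* The right side is exactly what the supersolution loses in one step,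
   [12 * a^2 / (1 + a) - 12 * a^2 / (2 + a)]. The constant 12 is the value of [(2 + a) * (1 + a)] at
   [a = 2], where the bound [a^2] on [1 - cos] is exchanged for the bound 2. *)
have key : 1 - cos x <= 12 * a ^+ 2 / ((2 + a) * (1 + a)).
  rewrite ler_pdivlMr; last by apply: mulr_gt0; lra.
  have [a2|a2] := leP a 2.
    apply: (@le_trans _ _ (a ^+ 2 * ((2 + a) * (1 + a)))).
      by rewrite ler_wpM2r// mulr_ge0//; lra.
    by rewrite mulrC ler_wpM2r ?sqr_ge0//; nra.
  apply: (@le_trans _ _ (2 * ((2 + a) * (1 + a)))).
    by rewrite ler_wpM2r// mulr_ge0//; lra.
  nra.
apply: le_trans (lerD key (ler_wpM2l (ler0n _ 2) IHx)) _.
rewrite le_eqVlt; apply/orP; left; apply/eqP; field.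
by apply/andP; split; rewrite gt_eqF//; lra.
Qed.

Lemma dyadic_cos_le_norm n x : dyadic_cos n x <= 12 * `|x|.
Proof.
apply: le_trans (dyadic_cos_le n x) _; have xa := normr_ge0 x.
rewrite -(real_normK (num_real x)) ler_pdivrMr ?ltr_wpDr// -mulrA ler_wpM2l//.
rewrite expr2; nra.
Qed.

(** When [|x| >= 1], some scale [2^-m] brings [|x|] into [[1, 2)], inside the interval where the
    cosine decreases. There [1 - cos] is at least [1 - cos 1], so this single term already controls
    [|x|]. Together with the upper bound, it turns characteristic functions into first absolute
    moments. *)
Lemma norm_le_dyadic_cos n x : `|x| < 2 ^+ n ->
  `|x| <= 1 + 2 / (1 - cos 1) * dyadic_cos n x.
Proof.
have c1 : 0 < 1 - cos (1 : R).
  rewrite subr_gt0 -[ltRHS]cos0 ltr_cos ?in_itv/= ?lexx ?pi_ge0//.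
  by rewrite ler01/=; have := @pi_ge2 R; lra.
move=> xn; have [x1|x1] := ltP `|x| 1.
  by rewrite (le_trans (ltW x1))// lerDl mulr_ge0 ?dyadic_cos_ge0// divr_ge0// ltW.
have ex : exists m, `|x| < 2 ^+ m by exists n.
have [m xm mmin] := ex_minnP ex.
have mn : (m <= n)%N by exact: mmin.
case: m xm mmin mn => [|m] xm mmin mn; first by move: xm; rewrite expr0 ltNge x1.
have xm' : 2 ^+ m <= `|x|.
  by rewrite leNgt; apply/negP => h; have := mmin _ h; rewrite ltnn.
have p2 : 0 < 2 ^+ m :> R by rewrite exprn_gt0.
have y1 : 1 <= `|2 ^- m * x|.
  by rewrite normrM gtr0_norm ?invr_gt0// mulrC ler_pdivlMr// mul1r.
have y2 : `|2 ^- m * x| < 2.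
  by rewrite normrM gtr0_norm ?invr_gt0// mulrC ltr_pdivrMr// -exprS.
have cy : 1 - cos 1 <= 1 - cos (2 ^- m * x).
  rewrite lerD2l lerN2; have -> : cos (2 ^- m * x) = cos `|2 ^- m * x|.
    by have [_|_] := ger0P (2 ^- m * x); rewrite ?cosN.
  rewrite leNgt ltr_cos ?in_itv/= -?leNgt//.
  - by rewrite normr_ge0/= (le_trans (ltW y2))// pi_ge2.
  - by rewrite ler01/=; have := @pi_ge2 R; lra.
have le1 : 2 ^+ m * (1 - cos (2 ^- m * x)) <= dyadic_cos n x.
  rewrite /dyadic_cos (bigD1 (Ordinal mn))//= lerDl; apply: sumr_ge0 => k _.
  by rewrite mulr_ge0 ?onem_cos_ge0// exprn_ge0.
apply: (@le_trans _ _ (2 ^+ m.+1)); first exact: ltW.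
apply: (@le_trans _ _ (2 / (1 - cos 1) * dyadic_cos n x)); last by rewrite lerDr.
rewrite mulrAC ler_pdivlMr// exprS -mulrA ler_wpM2l//.
by apply: le_trans le1; rewrite ler_wpM2l// ltW.
Qed.

End elementary_bounds.

Lemma Rintegral_prob_cst d (Omega : measurableType d) (R : realType)
  (P : probability Omega R) (c : R) : \int[P]_w c = c.
Proof. by rewrite /Rintegral integral_cst// [X in (_ * X)%E]probability_setT mule1. Qed.

(** * First moment and mean from the characteristic function *)

Section levy_moments.
Context {R : realType} {d : measure_display} {Omega : measurableType d}.
Variable P : probability Omega R.
Variables (T lam : R) (nu : {measure set R -> \bar R}) (X : R -> Omega -> R).
Hypotheses (pX : process T X) (chX : has_characteristics P T lam 0 nu X).
Hypothesis nu_int : (\int[nu]_(x in [set~ 0%R]) `|x|%:E < +oo)%E.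
Local Notation L1 f := (P.-integrable setT (EFin \o f)).
Local Notation L1nu f := (nu.-integrable setT (EFin \o f)).

Lemma nu_id_integrable : L1nu (fun x => x).
Proof.
apply/integrableP; split; first exact/measurable_EFinP.
rewrite (_ : (\int[nu]_x _)%E = (\int[nu]_(x in [set~ 0%R]) `|x|%:E)%E)//.
rewrite [RHS]integral_mkcond; apply: eq_integral => x _; rewrite patchE.
case: ifPn => //; rewrite notin_setE => /contrapT -> /=; by rewrite normr0.
Qed.

Definition nu_norm : R := \int[nu]_x `|x|.

Lemma nu_norm_ge0 : 0 <= nu_norm. Proof. exact: Rintegral_ge0. Qed.

Let inn : L1nu (fun x => `|x|). Proof. exact: integrable_norm nu_id_integrable. Qed.

Lemma nu_L1_le (f : R -> R) (M : R) : measurable_fun setT f -> (forall x, `|f x| <= M * `|x|) ->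
  L1nu f /\ `|\int[nu]_x f x| <= M * nu_norm.
Proof.
move=> mf fM; have iM : L1nu (fun x => M * `|x|) by exact: L1Z.
have if_ : L1nu f by apply: (L1_le measurableT mf iM).
split => //; apply: le_trans (le_normr_Rintegral measurableT if_) _.
rewrite -RintegralZl//; apply: le_Rintegral => //.
exact: integrable_norm.
Qed.

Let mcosu u : measurable_fun setT (fun x : R => cos (u * x) - 1).
Proof.
by apply: measurable_funB => //; apply: measurable_cos_comp; exact: measurable_funM.
Qed.

Let msinu u : measurable_fun setT (fun x : R => sin (u * x)).
Proof. by apply: measurable_sin_comp; exact: measurable_funM. Qed.

Let small : R -> R := \1_[set y : R | `|y| < 1].

Let msmall_set : measurable [set y : R | `|y| < 1].
Proof.
rewrite (_ : [set y | _] = `]-1, 1[%classic).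
  exact: measurable_itv.
by apply/seteqP; split => y /=; rewrite in_itv/= ltr_norml.
Qed.

Let msmall : measurable_fun setT small. Proof. exact: measurable_indic. Qed.

Local Notation re := (levy_exponent_re 0 nu).
Local Notation im := (levy_exponent_im lam nu).

Lemma levy_reE u : re u = - \int[nu]_x (1 - cos (u * x)).
Proof.
have i1 : L1nu (fun x => 1 - cos (u * x)).
  apply: (nu_L1_le (M := `|u|) _ _).1.
    by under eq_fun do rewrite -opprB; apply: measurableT_comp => //; exact: mcosu.
  by move=> x; rewrite (ger0_norm (onem_cos_ge0 _)) -normrM onem_cos_le_norm.
rewrite /levy_exponent_re mul0r mul0r oppr0 add0r -[RHS]mulN1r -RintegralZl//.
by apply: eq_Rintegral => x _; rewrite mulN1r opprB.
Qed.

Lemma levy_re_le0 u : re u <= 0.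
Proof. by rewrite levy_reE oppr_le0; apply: Rintegral_ge0 => x _; exact: onem_cos_ge0. Qed.

Lemma levy_re_norm_le u : `|re u| <= `|u| * nu_norm.
Proof.
rewrite /levy_exponent_re mul0r mul0r oppr0 add0r.
apply: (nu_L1_le _ _).2 => // x.
by rewrite distrC ger0_norm ?onem_cos_ge0// -normrM onem_cos_le_norm.
Qed.

Let small01 x : 0 <= small x <= 1.
Proof. by rewrite /small indicE; case: (_ \in _); rewrite /= ?lexx ler01. Qed.

Lemma levy_im_integrand u : L1nu (fun x => sin (u * x) - u * x * small x) /\
  `|\int[nu]_x (sin (u * x) - u * x * small x)| <= 2 * `|u| * nu_norm.
Proof.
apply: nu_L1_le.
  by apply: measurable_funB => //; apply: measurable_funM => //; exact: measurable_funM.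
move=> x; apply: le_trans (ler_normB _ _) _.
have h1 := sin_le_norm (u * x).
have h2 : `|u * x * small x| <= `|u * x|.
  by rewrite normrM ler_piMr//; have /andP[? ?] := small01 x; rewrite ger0_norm.
by rewrite (_ : 2 * `|u| * `|x| = `|u * x| + `|u * x|) ?lerD// normrM; ring.
Qed.

Definition levy_im_bound : R := `|lam| + 2 * nu_norm.

Lemma levy_im_norm_le u : `|im u| <= levy_im_bound * `|u|.
Proof.
rewrite /levy_exponent_im; apply: le_trans (ler_normD _ _) _.
have [_ h] := levy_im_integrand u; rewrite normrM /levy_im_bound.
by move: h; rewrite /small; lra.
Qed.

Lemma levy_cos t u : 0 <= t <= T -> \int[P]_w cos (u * X t w) = expR (t * re u) * cos (t * im u).
Proof. by case: chX => _ _ h /(h t u)[]. Qed.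

Lemma levy_sin t u : 0 <= t <= T -> \int[P]_w sin (u * X t w) = expR (t * re u) * sin (t * im u).
Proof. by case: chX => _ _ h /(h t u)[]. Qed.

Let mXt t : 0 <= t <= T -> measurable_fun setT (X t). Proof. exact: pX. Qed.

Let L1cos t u : 0 <= t <= T -> L1 (fun w => 1 - cos (u * X t w)).
Proof.
move=> tT; apply: L1B => //.
  by apply: L1_bound1 => // w; rewrite normr1.
apply: L1_bound1 => [|w]; last exact: cos_max.
by apply: measurable_cos_comp; apply: measurable_funM => //; exact: mXt.
Qed.

Lemma levy_onem_cos_le t u : 0 <= t <= T ->
  \int[P]_w (1 - cos (u * X t w)) <= - (t * re u) + (t * im u) ^+ 2.
Proof.
move=> tT; have mX := mXt tT.
rewrite RintegralB//.
- rewrite levy_cos// Rintegral_prob_cst.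
  apply: onem_exp_cos_le; have /andP[t0 _] := tT.
  by rewrite mulr_ge0_le0// levy_re_le0.
- by apply: L1_bound1 => // w; rewrite normr1.
apply: L1_bound1 => [|w]; last exact: cos_max.
by apply: measurable_cos_comp; apply: measurable_funM.
Qed.

Definition levy_L1_bound : R :=
  1 + 2 / (1 - cos 1) * (T * (12 * nu_norm) + 2 * (T * levy_im_bound) ^+ 2).

(** At scale [2^-k] the real part of the exponent contributes the [nu]-integral of one term of
    [dyadic_cos], and these terms sum to at most [12 * |x|]. The imaginary part enters squared,
    hence like [4^-k], and after the weight [2^k] leaves a geometric series of sum below 2. *)
Let dyadic_bound t n : 0 <= t <= T ->
  \int[P]_w dyadic_cos n (X t w) <= T * (12 * nu_norm) + 2 * (T * levy_im_bound) ^+ 2.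
Proof.
move=> tT; have /andP[t0 tTT] := tT.
have i1 k : L1 (fun w => 2 ^+ k * (1 - cos (2 ^- k * X t w))) by apply: L1Z => //; exact: L1cos.
rewrite /dyadic_cos (Rintegral_sum _ measurableT (fun k : 'I_n => i1 k)).
have j1 k : L1nu (fun x => 1 - cos (2 ^- k * x)).
  apply: (nu_L1_le (M := `|2 ^- k|) _ _).1.
    by under eq_fun do rewrite -opprB; apply: measurableT_comp => //; exact: mcosu.
  by move=> x; rewrite (ger0_norm (onem_cos_ge0 _)) -normrM onem_cos_le_norm.
apply: (@le_trans _ _ (\sum_(k < n) (t * (2 ^+ k * \int[nu]_x (1 - cos (2 ^- k * x))) +
    (T * levy_im_bound) ^+ 2 * 2 ^- k))).
  apply: ler_sum => k _; rewrite RintegralZl//; last exact: L1cos.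
  apply: le_trans (ler_wpM2l _ (levy_onem_cos_le (2 ^- k) tT)) _; first by rewrite exprn_ge0.
  rewrite levy_reE mulrN opprK mulrDr mulrCA lerD2l.
  have h := levy_im_norm_le (2 ^- k).
  have p2 : 0 < 2 ^+ k :> R by rewrite exprn_gt0.
  have b0 : 0 <= levy_im_bound by rewrite addr_ge0// mulr_ge0// nu_norm_ge0.
  rewrite -(real_normK (num_real (t * _))) normrM (ger0_norm t0).
  rewrite (gtr0_norm (_ : 0 < 2 ^- k)) ?invr_gt0// in h.
  apply: (@le_trans _ _ (2 ^+ k * (T * (levy_im_bound * 2 ^- k)) ^+ 2)).
    apply: ler_wpM2l; first exact: ltW.
    have h0 : 0 <= t * `|im (2 ^- k)| by rewrite mulr_ge0.
    have h1 : t * `|im (2 ^- k)| <= T * (levy_im_bound / 2 ^+ k) by apply: ler_pM.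
    by rewrite ler_sqr ?nnegrE// (le_trans h0).
  rewrite (mulrA T) exprMn mulrCA; apply: ler_wpM2l; first exact: sqr_ge0.
  by rewrite expr2 mulrA divff ?mul1r// gt_eqF.
rewrite big_split/= -mulr_sumr; apply: lerD.
  apply: (@le_trans _ _ (t * (12 * nu_norm))); last first.
    by rewrite ler_wpM2r// mulr_ge0// nu_norm_ge0.
  rewrite ler_wpM2l//.
  rewrite [leLHS](_ : _ = \int[nu]_x dyadic_cos n x).
    apply: le_trans (ler_norm _) _; apply: (nu_L1_le _ _).2.
      apply: measurable_sum => k; apply: measurable_funM => //.
      exact: (L1_measurable measurableT (j1 k)).
    by move=> x; rewrite ger0_norm ?dyadic_cos_ge0// dyadic_cos_le_norm.
  transitivity (\sum_(k < n) \int[nu]_x (2 ^+ k * (1 - cos (2 ^- k * x)))).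
    by apply: eq_bigr => k _; rewrite RintegralZl.
  by apply/esym; exact: (Rintegral_sum _ measurableT (fun k : 'I_n => L1Z (2 ^+ k) measurableT (j1 k))).
rewrite -mulr_sumr mulrC ler_wpM2r ?sqr_ge0//.
suff -> : \sum_(k < n) 2 ^- k = 2 - 2 * 2 ^- n :> R.
  by rewrite lerBlDr lerDl mulr_ge0// invr_ge0 exprn_ge0.
elim: n {i1} => [|n IH]; first by rewrite big_ord0 expr0 invr1; lra.
rewrite big_ord_recr/= IH exprS invfM; lra.
Qed.

(** Truncation at [|X t w| < 2 ^ n] is the range in which [n] dyadic terms dominate [|X t w|]. The
    resulting bound is uniform in [n], and monotone convergence removes the truncation. *)
Lemma levy_L1 t : 0 <= t <= T -> L1 (X t) /\ \int[P]_w `|X t w| <= levy_L1_bound.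
Proof.
move=> tT; have mX := mXt tT.
pose A n := [set w | `|X t w| < 2 ^+ n].
have mA n : measurable (A n).
  rewrite /A -[X in measurable X]setTI.
  by apply: (measurable_fun_ltr (f := fun w => `|X t w|) (g := fun=> 2 ^+ n)) => //; exact: measurableT_comp.
pose g n w : \bar R := (`|X t w| * \1_(A n) w)%:E.
have mg n : measurable_fun setT (g n).
  apply/measurable_EFinP; apply: measurable_funM => //; exact: measurableT_comp.
have g0 n w : (0 <= g n w)%E by rewrite lee_fin mulr_ge0// indicE.
have gb n : (\int[P]_w g n w <= levy_L1_bound%:E)%E.
  have i1 : L1 (fun w => 1 + 2 / (1 - cos 1) * dyadic_cos n (X t w)).
    apply: L1D => //; first by apply: L1_bound1 => // w; rewrite normr1.
    apply: L1Z => //; apply: L1_sum => // k; apply: L1Z => //; exact: L1cos.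
  have ig : L1 (fun w => `|X t w| * \1_(A n) w).
    apply: (L1_le measurableT _ i1).
      by apply: measurable_funM => //; exact: measurableT_comp.
    move=> w _; rewrite normrM normr_id indicE; have [/set_mem Aw|_] /= := boolP (w \in A n).
      by rewrite normr1 mulr1; exact: norm_le_dyadic_cos.
    rewrite normr0 mulr0 addr_ge0// mulr_ge0 ?dyadic_cos_ge0// divr_ge0// onem_cos_ge0.
  have gE : (\int[P]_w g n w = (\int[P]_w (`|X t w| * \1_(A n) w))%:E)%E.
    by rewrite /Rintegral fineK//; exact: integrable_fin_num.
  rewrite gE lee_fin.
  apply: (@le_trans _ _ (\int[P]_w (1 + 2 / (1 - cos 1) * dyadic_cos n (X t w)))).
    apply: le_Rintegral => // w _; rewrite indicE; have [/set_mem Aw|_] /= := boolP (w \in A n).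
      by rewrite mulr1; exact: norm_le_dyadic_cos.
    by rewrite mulr0 addr_ge0// mulr_ge0 ?dyadic_cos_ge0// divr_ge0// onem_cos_ge0.
  have i2 : L1 (fun w => dyadic_cos n (X t w)).
    by apply: L1_sum => // k; apply: L1Z => //; exact: L1cos.
  rewrite RintegralD//.
  - rewrite RintegralZl// Rintegral_prob_cst lerD2l.
    by rewrite ler_wpM2l ?dyadic_bound// divr_ge0// onem_cos_ge0.
  - by apply: L1_bound1 => // w; rewrite normr1.
  - exact: L1Z.
have lim_g w : limn (g ^~ w) = (`|X t w|)%:E.
  apply/cvg_lim => //; apply: (@cvg_near_cst _ _ _ _ _).
  near=> n; rewrite /g indicE mem_set ?mulr1//=.
  apply: (@lt_le_trans _ _ n%:R); first by near: n; exact: nbhs_infty_gtr.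
  by rewrite -natrX ler_nat ltnW// ltn_expl.
have mon w : {homo g ^~ w : n m / (n <= m)%N >-> (n <= m)%E}.
  move=> n m nm; rewrite lee_fin ler_wpM2l// !indicE ler_nat.
  case: (boolP (w \in A n)) => // /set_mem h; rewrite (_ : w \in A m)//; apply/mem_set.
  by apply: (lt_le_trans h); rewrite ler_eXn2l// ltr1n.
have key : (\int[P]_w `|X t w|%:E <= levy_L1_bound%:E)%E.
  have -> : (\int[P]_w `|X t w|%:E = \int[P]_w limn (g ^~ w))%E.
    by apply: eq_integral => w _; rewrite lim_g.
  rewrite (monotone_convergence _ measurableT mg (fun n w _ => g0 n w) (fun w _ => mon w)).
  apply: lime_le; last by apply: nearW; exact: gb.
  apply: ereal_nondecreasing_is_cvgn => n m nm.
  by apply: ge0_le_integral => // w _; exact: mon.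
split.
  apply/integrableP; split; first exact/measurable_EFinP.
  by apply: le_lt_trans key _; rewrite ltry.
by rewrite -lee_fin /Rintegral fineK// ge0_fin_numE ?integral_ge0// (le_lt_trans key)// ltry.
Unshelve. all: by end_near. Qed.

Let inv1 n : 0 < n.+1%:R^-1 :> R. Proof. by rewrite invr_gt0 ltr0n. Qed.

Let cvg_inv1 : (n.+1%:R^-1 : R) @[n --> \oo] --> (0 : R). Proof. exact: cvg_harmonic. Qed.

Lemma cvg_sin_quotient (v : R -> R) (l : R) :
  v n.+1%:R^-1 / n.+1%:R^-1 @[n --> \oo] --> l ->
  sin (v n.+1%:R^-1) / n.+1%:R^-1 @[n --> \oo] --> l.
Proof.
move=> vl; have v0 : v n.+1%:R^-1 @[n --> \oo] --> (0 : R).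
  rewrite -(mul0r l) (_ : (fun n => v _) = (fun n => n.+1%:R^-1 * (v n.+1%:R^-1 / n.+1%:R^-1))).
    exact: (cvgM cvg_inv1 vl).
  by apply/funext => n; rewrite mulrC mulfVK// gt_eqF.
rewrite -[l]add0r.
rewrite (_ : (fun n => sin _ / _) = (fun n => (sin (v n.+1%:R^-1) - v n.+1%:R^-1) / n.+1%:R^-1 +
    v n.+1%:R^-1 / n.+1%:R^-1)); last by apply/funext => n; rewrite -mulrDl subrK.
apply: cvgD => //; apply/norm_cvg0P.
apply: (@squeeze_cvgr _ _ _ _ (fun=> 0) (fun n => `|v n.+1%:R^-1| * `|v n.+1%:R^-1 / n.+1%:R^-1|)).
- near=> n; rewrite normr_ge0/= !normrM mulrA ler_wpM2r//.
  by rewrite -expr2 real_normK ?num_real// sin_sub_id_le_sqr.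
- exact: cvg_cst.
- rewrite -[X in _ --> X](mul0r `|l|); apply: cvgM; last exact: cvg_norm.
  by rewrite -(normr0 R); exact: cvg_norm.
Unshelve. all: by end_near. Qed.

Let cvg_sin_mul (x : R) : sin (n.+1%:R^-1 * x) / n.+1%:R^-1 @[n --> \oo] --> x.
Proof.
apply: (cvg_sin_quotient (v := fun u => u * x)).
by under eq_fun do rewrite mulrAC divff ?gt_eqF// mul1r; exact: cvg_cst.
Qed.

Definition levy_mean : R := lam + \int[nu]_(x in [set x : R | 1 <= `|x|]) x.

Let mlarge : measurable [set x : R | 1 <= `|x|].
Proof.
rewrite (_ : [set x | _] = ~` [set y : R | `|y| < 1]); first exact: measurableC.
by apply/seteqP; split => x /=; rewrite leNgt => /negP.
Qed.

(** The derivative at 0 of the imaginary exponent: [sin (u * x) / u] tends to [x], dominated by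
    [|x|], and the truncation term cancels the part of [x] with [|x| < 1]. *)
Let cvg_levy_im : im n.+1%:R^-1 / n.+1%:R^-1 @[n --> \oo] --> levy_mean.
Proof.
have imE n : im n.+1%:R^-1 / n.+1%:R^-1 = lam +
   \int[nu]_x (sin (n.+1%:R^-1 * x) / n.+1%:R^-1 - x * small x).
  rewrite /levy_exponent_im mulrDl mulfK ?gt_eqF//; congr (_ + _).
  have [i1 _] := levy_im_integrand n.+1%:R^-1.
  rewrite -RintegralZr//; apply: eq_Rintegral => x _.
  rewrite mulrBl; congr (_ - _).
  by rewrite mulrAC (mulrAC _ x) divff ?gt_eqF// mul1r.
under eq_fun do rewrite imE.
apply: cvgD; first exact: cvg_cst.
rewrite (_ : \int[nu]_(x in _) x = \int[nu]_x (x - x * small x)); last first.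
  rewrite Rintegral_indic//; apply: eq_Rintegral => x _.
  rewrite -[X in X - _]mulr1 -mulrBr; congr (_ * _); rewrite /small !indicE.
  have [x1|x1] := ltP `|x| 1; last first.
    by rewrite mem_set// memNset ?subr0//= => /(le_lt_trans x1); rewrite ltxx.
  by rewrite memNset /= ?mem_set ?subrr// leNgt x1.
have [||||_] // := @Rintegral_dominated _ _ R nu setT
  (fun n x => sin (n.+1%:R^-1 * x) / n.+1%:R^-1 - x * small x)
  (fun x => x - x * small x) (fun x => 2 * `|x|) measurableT.
- move=> n; apply: measurable_funB; first exact: measurable_funM.
  exact: measurable_funM.
- move=> x _; apply: cvgB; last exact: cvg_cst.
  exact: cvg_sin_mul.
- exact: L1Z.
- move=> n x _; apply: le_trans (ler_normB _ _) _.
  rewrite (_ : 2 * `|x| = `|x| + `|x|); last ring.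
  apply: lerD.
    rewrite normrM (gtr0_norm (_ : 0 < n.+1%:R^-1^-1)) ?invr_gt0// ler_pdivrMr//.
    by apply: le_trans (sin_le_norm _) _; rewrite normrM gtr0_norm// mulrC.
  by rewrite normrM ler_piMr//; have /andP[? ?] := small01 x; rewrite ger0_norm.
Qed.

(** The imaginary part of the Levy-Khintchine formula is differentiated at frequency 0. On the
    probability side [sin (u * X) / u] is dominated by [|X|], integrable by [levy_L1]. *)
Lemma levy_mean_eq t : 0 <= t <= T -> \int[P]_w X t w = t * levy_mean.
Proof.
move=> tT; have mX := mXt tT; have [iX _] := levy_L1 tT.
have /andP[t0 tTT] := tT.
have [||||_] // := @Rintegral_dominated _ _ R P setT
  (fun n w => sin (n.+1%:R^-1 * X t w) / n.+1%:R^-1)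
  (X t) (fun w => `|X t w|) measurableT.
- move=> n; apply: measurable_funM => //.
  by apply: measurable_sin_comp; exact: measurable_funM.
- exact: integrable_norm.
- move=> n w _; rewrite normrM (gtr0_norm (_ : 0 < n.+1%:R^-1^-1)) ?invr_gt0// ler_pdivrMr//.
  by apply: le_trans (sin_le_norm _) _; rewrite normrM gtr0_norm// mulrC.
have i1 n : L1 (fun w => sin (n.+1%:R^-1 * X t w)).
  apply: L1_bound1 => [|w]; last exact: sin_max.
  by apply: measurable_sin_comp; exact: measurable_funM.
under eq_fun do rewrite RintegralZr// levy_sin//.
move=> cv.
suff cv' : expR (t * re n.+1%:R^-1) * sin (t * im n.+1%:R^-1) / n.+1%:R^-1 @[n --> \oo]
    --> 1 * (t * levy_mean).
  by rewrite mul1r in cv'; apply: (cvg_unique _ cv cv').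
under eq_fun do rewrite -mulrA.
apply: cvgM.
  rewrite -[X in _ --> X]expR0; apply: continuous_cvg; first exact: continuous_expR.
  apply/norm_cvg0P; apply: (@squeeze_cvgr _ _ _ _ (fun=> 0) (fun n => t * nu_norm * n.+1%:R^-1)).
  - near=> n; rewrite normr_ge0/= normrM (ger0_norm t0) -mulrA ler_wpM2l//.
    by have := levy_re_norm_le n.+1%:R^-1; rewrite (gtr0_norm (inv1 n)) mulrC.
  - exact: cvg_cst.
  - by rewrite -[X in _ --> X](mulr0 (t * nu_norm)); apply: cvgM; [exact: cvg_cst|exact: cvg_inv1].
apply: (cvg_sin_quotient (v := fun u => t * im u)).
under eq_fun do rewrite -mulrA.
by apply: cvgM; [exact: cvg_cst|exact: cvg_levy_im].
Unshelve. all: by end_near. Qed.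

End levy_moments.

(** * Jump sums and finite variation paths *)

Section esum_real.
Context {R : realType}.
Implicit Types (S : set R) (a : R -> R) (F : seq R).

Lemma esum_seq_ge S a F : uniq F -> (forall r, r \in F -> S r) ->
  ((\sum_(r <- F) a r)%:E <= \esum_(u in S) (a u)%:E)%E.
Proof.
move=> uF FS; apply: esum_ge; exists [set` F].
  by split; [exact: finite_seq|move=> r /= rF; exact: FS].
rewrite -sumEFin [leRHS](_ : _ = (\sum_(i <- F) (a i)%:E)%E)//.
rewrite (fsbig_finite _ _ (finite_seq F))/=; apply: perm_big.
apply: uniq_perm => //; first exact: finmap.fset_uniq.
by move=> r; rewrite (in_fset_set (finite_seq F)); apply/idP/idP; rewrite inE.
Qed.

Lemma esum_le_bound S a (M : R) :
  (forall F, uniq F -> (forall r, r \in F -> S r) -> \sum_(r <- F) a r <= M) ->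
  (\esum_(u in S) (a u)%:E <= M%:E)%E.
Proof.
move=> h; apply: ge_ereal_sup => _ [X [finX XS] <-].
rewrite (fsbig_finite _ _ finX)/= sumEFin lee_fin; apply: h; first exact: finmap.fset_uniq.
by move=> r; rewrite in_fset_set// inE; exact: XS.
Qed.

Lemma esum_approx S a (e : R) : 0 < e -> (forall r, S r -> 0 <= a r) ->
  (\esum_(u in S) (a u)%:E < +oo)%E ->
  exists F, [/\ uniq F, (forall r, r \in F -> S r) &
    (\esum_(u in S) (a u)%:E <= (\sum_(r <- F) a r + e)%:E)%E].
Proof.
move=> e0 a0 fin.
have fn : \esum_(u in S) (a u)%:E \is a fin_num.
  by rewrite ge0_fin_numE// esum_ge0// => r Sr; rewrite lee_fin a0.
have [_ [X [finX XS] <-] h] := ub_ereal_sup_adherent e0 fn.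
exists (finmap.enum_fset (fset_set X)); split.
- exact: finmap.fset_uniq.
- by move=> r; rewrite in_fset_set// inE; exact: XS.
move: h; rewrite (fsbig_finite _ _ finX)/= sumEFin -/(esum _ _) => h.
by rewrite EFinD -leeBlDr// ltW.
Qed.

Lemma le_esum_subset S S' a : S `<=` S' -> (forall r, 0 <= a r) ->
  (\esum_(u in S) (a u)%:E <= \esum_(u in S') (a u)%:E)%E.
Proof.
move=> SS' a0; apply: ge_ereal_sup => _ [X [finX XS] <-].
by apply: ereal_sup_ubound; exists X => //; split => //; exact: subset_trans SS'.
Qed.

End esum_real.

(** * Distribution function of a summable family of jumps *)

Section jump_family.
Context {R : realType}.
Variable a : R -> R.
Hypotheses (a0 : forall u, 0 <= a u) (afin : (\esum_(u in [set: R]) (a u)%:E < +oo)%E).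

Definition jump_sum (s : R) : R := fine (\esum_(u in [set u | u <= s]) (a u)%:E).

Definition jump_total : R := fine (\esum_(u in [set: R]) (a u)%:E).

Definition partial_jump_sum (F : seq R) (s : R) : R := \sum_(r <- F) a r * (r <= s)%R%:R.

Let fin S : (\esum_(u in S) (a u)%:E \is a fin_num)%E.
Proof.
rewrite ge0_fin_numE ?esum_ge0//; first exact: le_lt_trans (le_esum_subset (@subsetT _ S) a0) afin.
by move=> u _; rewrite lee_fin.
Qed.

Let Es S : R := fine (\esum_(u in S) (a u)%:E).

Let EsU S S' : [disjoint S & S'] -> Es (S `|` S') = Es S + Es S'.
Proof.
move=> /disj_setPS dS; rewrite /Es -fineD//; congr fine.
rewrite (esumID S); last by move=> u _; rewrite lee_fin.
congr (_ + _)%E; congr esum; apply/seteqP; split => u /=.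
- by case.
- by move=> Su; split => //; left.
- by move=> [[]].
- by move=> S'u; split; [right|move=> Su; exact: (dS u)].
Qed.

Let Es_seq S F : uniq F -> \sum_(r <- F | r \in S) a r <= Es S.
Proof.
move=> uF; rewrite -big_filter -lee_fin /Es fineK//; apply: esum_seq_ge.
  exact: filter_uniq.
by move=> r; rewrite mem_filter => /andP[/set_mem].
Qed.

Let split_sum s t : s <= t -> jump_sum t = jump_sum s + Es [set u | s < u <= t].
Proof.
move=> st; rewrite -EsU.
  congr Es; apply/seteqP; split => u /=.
    by move=> ut; have [us|su] := leP u s; [left|right; apply/andP].
  by move=> [us|/andP[_ //]]; exact: le_trans st.
by apply/disj_setPS => u /= [us /andP[su _]]; have := lt_le_trans su us; rewrite ltxx.
Qed.

Lemma jump_sum_mono s t : s <= t -> jump_sum s <= jump_sum t.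
Proof.
move=> st; rewrite (split_sum st) lerDl -lee_fin /Es fineK// esum_ge0// => u _.
by rewrite lee_fin.
Qed.

Lemma jump_sum_ge0 s : 0 <= jump_sum s.
Proof. by rewrite -lee_fin fineK// esum_ge0// => u _; rewrite lee_fin. Qed.

Lemma jump_sum_le s : jump_sum s <= jump_total.
Proof. by rewrite -lee_fin !fineK//; exact: le_esum_subset. Qed.

(** Finitely many jumps carry the total mass up to [e]; what remains is still a distribution
    function, hence monotone and within [[0, e]]. The prescribed time [u0] is put among the finite
    ones so that the jump at that time can be computed exactly. *)
Lemma jump_sum_decomp (e u0 : R) : 0 < e -> exists F, [/\ uniq F, u0 \in F,
  (forall s t, s <= t -> jump_sum s - partial_jump_sum F s <= jump_sum t - partial_jump_sum F t) &
  forall s, 0 <= jump_sum s - partial_jump_sum F s <= e].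
Proof.
move=> e0; have [F0 [uF0 _ HF0]] := esum_approx e0 (fun r _ => a0 r) afin.
pose F := if u0 \in F0 then F0 else u0 :: F0.
have uF : uniq F by rewrite /F; case: ifPn => //= ->.
have pE s : partial_jump_sum F s = \sum_(r <- F | r \in [set u | u <= s]) a r.
  rewrite /partial_jump_sum [RHS]big_mkcond; apply: eq_bigr => r _.
  rewrite (_ : (r \in _) = (r <= s)); last by apply/idP/idP; rewrite inE.
  by case: ifP; rewrite ?mulr1 ?mulr0.
have tF : jump_total <= \sum_(r <- F) a r + e.
  have h : jump_total <= \sum_(r <- F0) a r + e by rewrite -lee_fin fineK.
  apply: le_trans h _; rewrite lerD2r /F; case: ifP => // _.
  by rewrite big_cons lerDr.
exists F; split => //.
- by rewrite /F; case: ifPn => // _; rewrite mem_head.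
- move=> s t st; have := Es_seq [set u | s < u <= t] uF.
  rewrite (split_sum st).
  suff -> : \sum_(r <- F | r \in [set u | s < u <= t]) a r =
     partial_jump_sum F t - partial_jump_sum F s by lra.
  rewrite /partial_jump_sum -sumrB [LHS]big_mkcond; apply: eq_bigr => r _.
  rewrite (_ : (r \in _) = (s < r <= t)); last by apply/idP/idP; rewrite inE.
  rewrite ltNge; have [rs|sr] := leP r s; first by rewrite (le_trans rs st) subrr.
  by case: (r <= t); rewrite ?mulr1 ?mulr0 ?subr0.
move=> s; rewrite subr_ge0 {1}pE Es_seq//= lerBlDr.
have h : jump_total = jump_sum s + Es [set u | s < u].
  rewrite -EsU; last first.
    by apply/disj_setPS => u /= [us su]; have := lt_le_trans su us; rewrite ltxx.
  congr Es; apply/seteqP; split => u //= _.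
  by have [us|su] := leP u s; [left|right].
have h2 := Es_seq [set u | s < u] uF.
have h3 : \sum_(r <- F) a r = partial_jump_sum F s + \sum_(r <- F | r \in [set u | s < u]) a r.
  rewrite pE (bigID (fun r => r \in [set u | u <= s]))/=; congr (_ + _).
  apply: eq_bigl => r; rewrite (_ : (r \in [set u | s < u]) = (s < r)); last by apply/idP/idP; rewrite inE.
  by rewrite (_ : (r \in _) = (r <= s)) ?ltNge//; apply/idP/idP; rewrite inE.
by rewrite h h3 in tF; lra.
Qed.

Let near_gap_right (F : seq R) (u : R) :
  \forall s \near u^'+, forall r, r \in F -> (r <= s) = (r <= u).
Proof.
elim: F => [|r F IH]; first exact: nearW.
have h : \forall s \near u^'+, (r <= s) = (r <= u).
  have [ru|ur] := leP r u.
    by near=> s; rewrite (le_trans ru)// ltW.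
  by near=> s; apply/negbTE; rewrite -ltNge; near: s; exact: nbhs_right_lt.
by near=> s => r'; rewrite inE => /predU1P[->|]; [near: s|move: r'; near: s].
Unshelve. all: by end_near. Qed.

Let near_gap_left (F : seq R) (u : R) :
  \forall s \near u^'-, forall r, r \in F -> (r <= s) = (r < u).
Proof.
elim: F => [|r F IH]; first exact: nearW.
have h : \forall s \near u^'-, (r <= s) = (r < u).
  have [ru|ur] := ltP r u.
    by near=> s; near: s; exact: nbhs_left_ge.
  by near=> s; apply/negbTE; rewrite -ltNge (lt_le_trans _ ur).
by near=> s => r'; rewrite inE => /predU1P[->|]; [near: s|move: r'; near: s].
Unshelve. all: by end_near. Qed.

Lemma jump_sum_right u : jump_sum s @[s --> u^'+] --> jump_sum u.
Proof.
apply/cvgrPdist_le => e e0.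
have [F [uF _ Bm Be]] := jump_sum_decomp 0 e0.
near=> s.
have us : u < s by near: s; exact: nbhs_right_gt.
have pE : partial_jump_sum F s = partial_jump_sum F u.
  rewrite /partial_jump_sum big_seq [RHS]big_seq; apply: eq_bigr => r rF.
  congr (_ * _%:R); congr nat_of_bool; move: r rF; near: s; exact: near_gap_right.
have h1 := Bm _ _ (ltW us); have /andP[h2 _] := Be u; have /andP[_ h3] := Be s.
rewrite pE in h1 h3; rewrite distrC ger0_norm; lra.
Unshelve. all: by end_near. Qed.

Lemma jump_sum_left u : jump_sum s @[s --> u^'-] --> jump_sum u - a u.
Proof.
apply/cvgrPdist_le => e e0.
have [F [uF uinF Bm Be]] := jump_sum_decomp u e0.
near=> s.
have su : s < u by near: s; exact: nbhs_left_lt.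
have pE : partial_jump_sum F s = partial_jump_sum F u - a u.
  rewrite /partial_jump_sum (bigD1_seq u)//= [in RHS](bigD1_seq u)//=.
  rewrite lexx mulr1 addrAC subrr add0r leNgt su mulr0 add0r.
  rewrite big_seq_cond [RHS]big_seq_cond; apply: eq_bigr => r /andP[rF ru].
  rewrite (_ : (r <= u) = (r < u)); last by rewrite lt_neqAle ru.
  congr (_ * _%:R); congr nat_of_bool; move: r rF {ru}; near: s; exact: near_gap_left.
have h1 := Bm _ _ (ltW su); have /andP[_ h2] := Be u; have /andP[h3 _] := Be s.
rewrite pE in h1 h3; rewrite ger0_norm; lra.
Unshelve. all: by end_near. Qed.

Lemma measurable_jump_sum : measurable_fun setT jump_sum.
Proof. by apply: nondecreasing_measurable => // s t; exact: jump_sum_mono. Qed.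

End jump_family.

Section calculus.
Context {R : realType}.
Local Notation lambda := (@lebesgue_measure R).

Lemma norm_le_eps (x C : R) : (forall e, 0 < e -> `|x| <= C * e) -> x = 0.
Proof.
move=> h; apply/eqP; rewrite -normr_le0; apply/ler_addgt0Pr => e e0; rewrite add0r.
have C1 : 0 < `|C| + 1 by rewrite ltr_wpDl.
have := h _ (divr_gt0 e0 C1); move/le_trans; apply.
rewrite mulrA ler_pdivrMr// mulrC ler_wpM2l ?(ltW e0)//.
by rewrite (le_trans (ler_norm C))// lerDl.
Qed.

Lemma continuous_itv_bounded (f : R -> R) (a b : R) : a <= b ->
  {within `[a, b], continuous f} -> exists M, forall u, a <= u <= b -> `|f u| <= M.
Proof.
move=> ab cf.
have [c1 _ h1] := EVT_max ab cf; have [c2 _ h2] := EVT_min ab cf.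
exists (Num.max `|f c1| `|f c2|) => u uab.
have u' : u \in `[a, b] by rewrite in_itv.
have {h1}h1 := h1 _ u'; have {h2}h2 := h2 _ u'.
rewrite ler_norml; apply/andP; split.
  rewrite lerNl; apply: (@le_trans _ _ `|f c2|); last by rewrite le_max lexx orbT.
  by rewrite (le_trans (_ : _ <= - f c2))// ?lerN2// -normrN ler_norm.
by apply: (le_trans h1); rewrite le_max ler_norm.
Qed.

Lemma is_derive_continuous (f df : R -> R) : (forall x : R, is_derive x 1 f (df x)) -> continuous f.
Proof.
by move=> dF x; apply: differentiable_continuous; apply/derivable1_diffP; have [] := dF x.
Qed.

Lemma continuous_integrable_itv (f : R -> R) (a b : R) : continuous f ->
  lambda.-integrable `[a, b] (EFin \o f).
Proof.
move=> cf; apply: continuous_compact_integrable; first exact: segment_compact.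
exact: continuous_subspaceT.
Qed.

Lemma Rintegral_FTC (f df : R -> R) (a b : R) : a <= b ->
  (forall x : R, is_derive x 1 f (df x)) -> continuous df ->
  \int[lambda]_(x in `[a, b]) df x = f b - f a.
Proof.
move=> ab dF cdf; have cf := is_derive_continuous dF.
have [e|ne] := eqVneq a b.
  by rewrite e subrr set_itv1 Rintegral_set1.
rewrite /Rintegral (@continuous_FTC2 _ df f)//.
- by rewrite lt_neqAle ne.
- exact: continuous_subspaceT.
- split.
  + by move=> x _; have [] := dF x.
  + exact: cvg_at_right_filter (cf _).
  + exact: cvg_at_left_filter (cf _).
- by move=> x _; rewrite derive1E; have [_ ->] := dF x.
Qed.

Lemma lebesgue_itv_lty (a b : R) : (lambda `[a, b] < +oo)%E.
Proof. by rewrite /= lebesgue_measure_itv/=; case: ifP => _; rewrite ?ltry// -EFinB ltry. Qed.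

Lemma bounded_integrable_itv (f : R -> R) (a b M : R) : measurable_fun setT f ->
  (forall u, a <= u <= b -> `|f u| <= M) -> lambda.-integrable `[a, b] (EFin \o f).
Proof.
move=> mf fM; apply: (@L1_bounded _ _ _ lambda _ _ M) => //.
- exact: lebesgue_itv_lty.
- exact: measurable_funTS.
Qed.

Lemma Rintegral_itv_norm_le (f : R -> R) (a b M : R) : a <= b -> measurable_fun setT f ->
  (forall u, a <= u <= b -> `|f u| <= M) ->
  `|\int[lambda]_(x in `[a, b]) f x| <= M * (b - a).
Proof.
move=> ab mf fM; have if_ := bounded_integrable_itv mf fM.
apply: le_trans; first by apply: le_normr_Rintegral => //; exact: measurable_itv.
have -> : M * (b - a) = \int[lambda]_(x in `[a, b]) M.
  rewrite Rintegral_cst// /= lebesgue_measure_itv/= lte_fin.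
  by move: ab; rewrite le_eqVlt => /predU1P[->|->]//; rewrite ltxx subrr.
apply: le_Rintegral => //.
- exact: integrable_norm.
- by apply: (@bounded_integrable_itv _ _ _ `|M|).
Qed.

(** Integration by parts against a single unit jump at [r]. *)
Lemma Rintegral_FTC_from (f df : R -> R) (s r : R) : 0 <= r -> 0 <= s ->
  (forall x : R, is_derive x 1 f (df x)) -> continuous df ->
  \int[lambda]_(u in `[0, s]) (df u * (r <= u)%R%:R) = (r <= s)%R%:R * (f s - f r).
Proof.
move=> r0 s0 dF cdf; have [rs|sr] := leP r s.
  rewrite mul1r -(Rintegral_FTC rs dF cdf) Rintegral_mkcond [RHS]Rintegral_mkcond.
  apply: eq_Rintegral => u _; rewrite !patchE !mem_setE !in_itv/=.
  have [ru|ur] := leP r u; first by rewrite (le_trans r0 ru) mulr1.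
  by rewrite mulr0; case: ifP.
rewrite mul0r -[RHS](Rintegral_set0 lambda (cst 0)) [RHS]Rintegral_mkcond Rintegral_mkcond.
apply: eq_Rintegral => u _; rewrite !patchE !mem_setE !in_itv/= in_set0.
case: ifP => // /andP[_ us]; rewrite leNgt (le_lt_trans us sr) mulr0//.
Qed.

End calculus.

Section jump_integration_by_parts.
Context {R : realType}.
Local Notation lambda := (@lebesgue_measure R).
Variables (T : R) (a : R -> R).
Hypotheses (a0 : forall u, 0 <= a u) (afin : (\esum_(u in [set: R]) (a u)%:E < +oo)%E).
Hypothesis aT : forall u, ~~ (0 < u <= T) -> a u = 0.
Variables (f df : R -> R).
Hypotheses (dF : forall x : R, is_derive x 1 f (df x)) (cdf : continuous df).
Hypothesis f0 : forall u, 0 <= u <= T -> 0 <= f u.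

(** For finitely many jumps this is the fundamental theorem of calculus applied jump by jump; the
    remaining jumps have total mass at most [e] and change every term by a multiple of [e]. *)
Lemma jump_sum_by_parts s : 0 <= s <= T ->
  jump_sum (fun u => f u * a u) s + \int[lambda]_(u in `[0, s]) (df u * jump_sum a u) =
  f s * jump_sum a s.
Proof.
move=> /andP[s0 sT]; have T0 := le_trans s0 sT.
have cf := is_derive_continuous dF.
have [M fM] := continuous_itv_bounded T0 (continuous_subspaceT cf).
have [M' dfM] := continuous_itv_bounded T0 (continuous_subspaceT cdf).
have M0 : 0 <= M by apply: le_trans (fM 0 _); rewrite ?lexx.
have M'0 : 0 <= M' by apply: le_trans (dfM 0 _); rewrite ?lexx.
have fa0 u : 0 <= f u * a u.
  have [uT|uT] := boolP (0 < u <= T); last by rewrite aT ?mulr0.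
  by rewrite mulr_ge0// f0//; have /andP[/ltW -> ->] := uT.
have faM u : f u * a u <= M * a u.
  have [uT|uT] := boolP (0 < u <= T); last by rewrite aT ?mulr0.
  rewrite ler_wpM2r// (le_trans (ler_norm _))// fM//.
  by have /andP[/ltW -> ->] := uT.
apply/eqP; rewrite -subr_eq0; apply/eqP.
(* The three constants bound the effect of the small jumps on the weighted sum, on the integral and
   on the boundary term, in this order. *)
apply: (@norm_le_eps _ _ (M + M' * s + M)) => e e0.
have [F [uF _ Bm Be]] := jump_sum_decomp a0 afin 0 e0.
pose B u := jump_sum a u - partial_jump_sum a F u.
have mA := measurable_jump_sum a0 afin.
have mF : measurable_fun setT (partial_jump_sum a F).
  apply: measurable_sum => r; apply: measurable_funM => //.
  rewrite (_ : (fun u => _) = (\1_`[r, +oo[%classic : R -> R)).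
    by apply: measurable_indic.
  by apply/funext => u; rewrite indicE mem_setE in_itv/= andbT.
have mB : measurable_fun setT B by exact: measurable_funB.
have mdf := continuous_measurable_fun cdf.
pose SF := \sum_(r <- F) f r * a r * (r <= s)%R%:R.
have SFle : 0 <= jump_sum (fun u => f u * a u) s - SF <= M * e.
  have SFE : SF = \sum_(r <- [seq r <- F | r <= s]) f r * a r.
    rewrite big_filter [RHS]big_mkcond; apply: eq_bigr => r _.
    by case: ifP; rewrite ?mulr1 ?mulr0.
  have hi : (\esum_(u in [set u | (u <= s)%R]) (f u * a u)%:E <= (SF + M * e)%:E)%E.
    apply: esum_le_bound => F1 uF1 F1s.
    rewrite (bigID (fun r => r \in F))/=; apply: lerD.
      rewrite -big_filter /SF.
      apply: (@le_trans _ _ (\sum_(r <- F | r \in F1) f r * a r)).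
        rewrite -[leRHS]big_filter; rewrite (perm_big [seq r <- F | r \in F1])//.
        apply: uniq_perm; rewrite ?filter_uniq// => r; by rewrite !mem_filter andbC.
      rewrite big_mkcond; apply: ler_sum => r _; case: ifP => rF1.
        by rewrite (F1s _ rF1) mulr1.
      by rewrite mulr_ge0.
    apply: (@le_trans _ _ (M * \sum_(r <- F1 | r \notin F) a r)).
      by rewrite mulr_sumr; apply: ler_sum => r _.
    rewrite ler_wpM2l//.
    have uu : uniq ([seq r <- F1 | r \notin F] ++ [seq r <- F | r <= s]).
      rewrite cat_uniq !filter_uniq// andbT/=; apply/hasPn => r.
      by rewrite !mem_filter => /andP[_ rF]; rewrite rF.
    have := @esum_seq_ge _ [set u | (u <= s)%R] a _ uu.
    have fn : \esum_(u in [set u | (u <= s)%R]) (a u)%:E \is a fin_num.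
      rewrite ge0_fin_numE; first exact: le_lt_trans (le_esum_subset (@subsetT _ _) a0) afin.
      by apply: esum_ge0 => u _; rewrite lee_fin.
    rewrite -[X in (_ <= X)%E](fineK fn) lee_fin -/(jump_sum a s) big_cat/= !big_filter => hh.
    have pE : partial_jump_sum a F s = \sum_(r <- F | r <= s) a r.
      rewrite /partial_jump_sum [RHS]big_mkcond; apply: eq_bigr => r _.
      by case: ifP; rewrite ?mulr1 ?mulr0.
    have /andP[_ be] := Be s; rewrite pE in be.
    suff : \sum_(r <- F1 | r \notin F) a r + \sum_(r <- F | r <= s) a r <= jump_sum a s by lra.
    apply: hh => r; rewrite mem_cat !mem_filter => /orP[/andP[_ /F1s]//|/andP[]//].
  have fin : \esum_(u in [set u | (u <= s)%R]) (f u * a u)%:E \is a fin_num.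
    rewrite ge0_fin_numE; first exact: le_lt_trans hi (ltry _).
    by apply: esum_ge0 => u _; rewrite lee_fin.
  apply/andP; split.
    rewrite subr_ge0 -lee_fin fineK// SFE; apply: esum_seq_ge.
      exact: filter_uniq.
    by move=> r; rewrite mem_filter => /andP[].
  by rewrite lerBlDl -lee_fin fineK.
have intB : `|\int[lambda]_(u in `[0, s]) (df u * B u)| <= M' * s * e.
  rewrite -mulrA (mulrC s) mulrA -[X in _ * X]subr0; apply: Rintegral_itv_norm_le => //.
    exact: measurable_funM.
  move=> u /andP[u0 us]; rewrite normrM; apply: ler_pM => //.
    by apply: dfM; rewrite u0 (le_trans us).
  by have /andP[h1 h2] := Be u; rewrite ger0_norm.
have idf (r : R) : lambda.-integrable `[0, s] (EFin \o (fun u => df u * (r <= u)%R%:R)).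
  apply: (@bounded_integrable_itv _ _ _ _ M').
    apply: measurable_funM => //.
    rewrite (_ : (fun u => _) = (\1_`[r, +oo[%classic : R -> R)).
      by apply: measurable_indic.
    by apply/funext => u; rewrite indicE mem_setE in_itv/= andbT.
  move=> u /andP[u0 us]; rewrite normrM -[leRHS]mulr1; apply: ler_pM => //.
    by apply: dfM; rewrite u0 (le_trans us).
  by case: (leP r u) => _; rewrite ?normr1 ?normr0.
have iB : lambda.-integrable `[0, s] (EFin \o (fun u => df u * B u)).
  apply: (@bounded_integrable_itv _ _ _ _ (M' * e)); first exact: measurable_funM.
  move=> u /andP[u0 us]; rewrite normrM; apply: ler_pM => //.
    by apply: dfM; rewrite u0 (le_trans us).
  by have /andP[h1 h2] := Be u; rewrite ger0_norm.
have intA : \int[lambda]_(u in `[0, s]) (df u * jump_sum a u) =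
   f s * partial_jump_sum a F s - SF + \int[lambda]_(u in `[0, s]) (df u * B u).
  transitivity (\int[lambda]_(u in `[0, s]) (\sum_(r <- F) (a r * (df u * (r <= u)%R%:R)) + df u * B u)).
    apply: eq_Rintegral => u _; rewrite /B.
    rewrite (_ : \sum_(r <- F) _ = df u * partial_jump_sum a F u); first ring.
    by rewrite /partial_jump_sum mulr_sumr; apply: eq_bigr => r _; ring.
  rewrite RintegralD//; last first.
    by apply: L1_sum => // r; exact: L1Z.
  congr (_ + _); rewrite Rintegral_sum//; last by move=> r; exact: L1Z.
  rewrite /partial_jump_sum /SF mulr_sumr -sumrB; apply: eq_bigr => r _.
  rewrite RintegralZl//.
  have [rT|rT] := boolP (0 < r <= T); last by rewrite aT// !(mul0r, mulr0) subrr.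
  rewrite (Rintegral_FTC_from _ _ dF cdf)//; first ring.
  by have /andP[/ltW] := rT.
rewrite intA.
have fs : `|f s| <= M by apply: fM; rewrite s0.
have fB : `|f s * B s| <= M * e.
  by rewrite normrM; apply: ler_pM => //; have /andP[h1 h2] := Be s; rewrite ger0_norm.
have /andP[h1 h2] := SFle.
rewrite (_ : _ - _ = (jump_sum (fun u => f u * a u) s - SF) +
   \int[lambda]_(u in `[0, s]) (df u * B u) - f s * B s); last by rewrite /B; ring.
apply: le_trans (ler_normB _ _) _; apply: (le_trans (lerD (ler_normD _ _) fB)).
by rewrite (ger0_norm h1); move: intB h2; lra.
Qed.

End jump_integration_by_parts.

Section pure_jump.
Context {R : realType}.
Implicit Types (J c phi : R -> R).

(* [C] counts the finitely many large jumps, [B] dominates the variation of the rest. *)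
Definition pure_jump J := forall e : R, 0 < e -> exists (B C : R -> R) (N : R),
  [/\ forall s t : R, s <= t -> B s <= B t, forall s t : R, s <= t -> C s <= C t,
      forall s, 0 <= B s <= e, forall s, 0 <= C s <= N &
      forall s t : R, s <= t -> `|J t - J s| <= B t - B s \/ 1 <= C t - C s].

(** An interval that meets none of the finitely many large jump times sees only the monotone
    remainder; otherwise the counting function grows by at least 1. *)
Lemma pure_jump_jump_sum (a : R -> R) : (forall u, 0 <= a u) ->
  (\esum_(u in [set: R]) (a u)%:E < +oo)%E -> pure_jump (jump_sum a).
Proof.
move=> a0 afin e e0; have [F [uF _ Bm Be]] := jump_sum_decomp a0 afin 0 e0.
exists (fun s => jump_sum a s - partial_jump_sum a F s).
exists (fun s => \sum_(r <- F) (r <= s)%R%:R), (size F)%:R; split => //.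
- move=> s t st; apply: ler_sum => r _; rewrite ler_nat.
  by case: (boolP (r <= s)) => // rs; rewrite (le_trans rs st).
- move=> s; rewrite sumr_ge0//=.
  rewrite -sum1_size natr_sum; apply: ler_sum => r _; rewrite ler_nat; exact: leq_b1.
- move=> s t st.
  have [h|/allPn[r rF h]] := boolP (all (fun r => (r <= s) == (r <= t)) F).
    left; rewrite (_ : partial_jump_sum a F t = partial_jump_sum a F s).
      rewrite (_ : _ - _ - _ = jump_sum a t - jump_sum a s); last ring.
      by rewrite ger0_norm// subr_ge0 jump_sum_mono.
    rewrite /partial_jump_sum big_seq [RHS]big_seq; apply: eq_bigr => r rF.
    by have /eqP -> := allP h _ rF.
  right; rewrite -sumrB (bigD1_seq r)//=.
  have -> : ((r <= t)%R%:R - (r <= s)%R%:R : R) = 1.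
    have [rs|rs] := boolP (r <= s); first by move: h; rewrite rs (le_trans rs st).
    by move: h; rewrite (negbTE rs); case: (r <= t) => //; rewrite subr0.
  rewrite lerDl; apply: sumr_ge0 => r' _; rewrite subr_ge0 ler_nat.
  by case: (boolP (r' <= s)) => // rs; rewrite (le_trans rs st).
Qed.

Lemma pure_jumpB J1 J2 : pure_jump J1 -> pure_jump J2 -> pure_jump (fun s => J1 s - J2 s).
Proof.
move=> p1 p2 e e0; have e2 : 0 < e / 2 by lra.
have [B1 [C1 [N1 [b1 c1 be1 ce1 h1]]]] := p1 _ e2.
have [B2 [C2 [N2 [b2 c2 be2 ce2 h2]]]] := p2 _ e2.
exists (fun s => B1 s + B2 s), (fun s => C1 s + C2 s), (N1 + N2); split.
- by move=> s t st; rewrite lerD ?b1 ?b2.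
- by move=> s t st; rewrite lerD ?c1 ?c2.
- by move=> s; have := be1 s; have := be2 s; lra.
- by move=> s; have := ce1 s; have := ce2 s; lra.
move=> s t st; have cc1 := c1 _ _ st; have cc2 := c2 _ _ st.
case: (h1 _ _ st) => [k1|k1]; last by right; lra.
case: (h2 _ _ st) => [k2|k2]; last by right; lra.
left; rewrite (_ : _ - _ = (J1 t - J1 s) - (J2 t - J2 s)); last ring.
by apply: le_trans (ler_normB _ _) _; lra.
Qed.

(** On a cell without a large jump the Lipschitz bound costs the growth of [B], in total at most
    [e]. A cell with a large jump costs at most [2 * dl], and the growth of [C] limits such cells to
    [N] in number. The constant depends neither on the grid nor on [c] and [phi]. *)
Lemma pure_jump_lipschitz J (e : R) : pure_jump J -> 0 < e -> exists N : R, 0 <= N /\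
  forall c phi (t : nat -> R) n (dl : R), 0 <= dl -> (forall i, (i < n)%N -> t i <= t i.+1) ->
  (forall x z, `|phi x - phi z| <= `|x - z|) -> (forall x, `|phi x| <= dl) ->
  `|\sum_(i < n) phi (c (t i.+1) + J (t i.+1) - (c (t i) + J (t i))) -
    \sum_(i < n) phi (c (t i.+1) - c (t i))| <= e + N * dl.
Proof.
move=> pJ e0; have [B [C [N [bm cm be ce h]]]] := pJ _ e0.
have N0 : 0 <= N by have /andP[h1 h2] := ce 0; exact: le_trans h2.
exists (2 * N); split; first by rewrite mulr_ge0.
move=> c phi t n dl dl0 tm lip bd; rewrite -sumrB.
apply: le_trans (ler_norm_sum _ _ _) _.
apply: (@le_trans _ _ (\sum_(i < n) ((B (t i.+1) - B (t i)) + 2 * dl * (C (t i.+1) - C (t i))))).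
  apply: ler_sum => i _; have ti := tm i (ltn_ord i).
  have b1 := bm _ _ ti; have c1 := cm _ _ ti.
  case: (h _ _ ti) => k.
    apply: le_trans (lip _ _) _.
    rewrite (_ : _ - _ - _ = J (t i.+1) - J (t i)); last ring.
    by apply: (le_trans k); rewrite lerDl mulr_ge0 ?mulr_ge0 ?subr_ge0.
  apply: le_trans (ler_normB _ _) _.
  apply: (@le_trans _ _ (2 * dl)).
    have := bd (c (t i.+1) + J (t i.+1) - (c (t i) + J (t i))).
    by have := bd (c (t i.+1) - c (t i)); lra.
  have : 2 * dl * 1 <= 2 * dl * (C (t i.+1) - C (t i)) by rewrite ler_wpM2l// mulr_ge0.
  by lra.
rewrite big_split/= -mulr_sumr.
have tel (g : R -> R) : \sum_(i < n) (g (t i.+1) - g (t i)) = g (t n) - g (t 0%N).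
  by rewrite -(big_mkord predT (fun i => g (t i.+1) - g (t i))) (telescope_sumr (fun i => g (t i))).
rewrite !tel; have := be (t n); have := be (t 0%N); have := ce (t n); have := ce (t 0%N).
move=> /andP[q1 q2] /andP[q3 q4] /andP[q5 q6] /andP[q7 q8].
have : dl * (C (t n) - C (t 0%N)) <= dl * N by rewrite ler_wpM2l//; lra.
lra.
Qed.

End pure_jump.

(** * Regular subdivisions and limits of sums along them *)

Section subdivisions.
Context {R : realType}.
Implicit Types (c : R -> R) (a b : R).

Definition subdiv a b (n i : nat) : R := a + (b - a) * (i%:R / n%:R).

Lemma subdiv0 a b n : subdiv a b n 0 = a.
Proof. by rewrite /subdiv mul0r mulr0 addr0. Qed.

Lemma subdivn a b n : (0 < n)%N -> subdiv a b n n = b.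
Proof. by move=> n0; rewrite /subdiv divff ?pnatr_eq0 -?lt0n// mulr1 addrC subrK. Qed.

Lemma subdivS a b n i : subdiv a b n i.+1 - subdiv a b n i = (b - a) / n%:R.
Proof. by rewrite /subdiv -natr1; ring. Qed.

Lemma subdiv_mono a b n i : a <= b -> subdiv a b n i <= subdiv a b n i.+1.
Proof. by move=> ab; rewrite -subr_ge0 subdivS divr_ge0// subr_ge0. Qed.

Lemma subdiv_itv a b n i : a <= b -> (i <= n)%N -> a <= subdiv a b n i <= b.
Proof.
move=> ab lein; have ba : 0 <= b - a by rewrite subr_ge0.
have h0 : 0 <= i%:R / n%:R :> R by rewrite divr_ge0.
have h1 : i%:R / n%:R <= 1 :> R.
  case: n lein {h0} => [|n] lein; first by rewrite invr0 mulr0 ler01.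
  by rewrite ler_pdivrMr ?ltr0n// mul1r ler_nat.
have := ler_wpM2l ba h1; rewrite mulr1 => h2.
have h3 := mulr_ge0 ba h0.
by rewrite /subdiv; apply/andP; split; lra.
Qed.

Lemma cvg_div_natr (x : R) : (x / n%:R) @[n --> \oo] --> (0 : R).
Proof.
rewrite -(mulr0 x); apply: cvgMr; apply/cvgrPdist_lt => e e0.
near=> n; rewrite sub0r normrN ger0_norm// invf_plt ?posrE//; last first.
  by rewrite ltr0n; near: n; exact: nbhs_infty_gt.
by near: n; exact: nbhs_infty_gtr.
Unshelve. all: by end_near. Qed.

Lemma uniform_continuous_itv c a b (e : R) : continuous c -> 0 < e ->
  exists2 h : R, 0 < h & forall x y : R, a <= x <= b -> `|y - x| <= h -> `|c y - c x| <= e.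
Proof.
move=> cc e0; have e2 : 0 < e / 2 by lra.
have /compact_near_coveringP K := @segment_compact R a b.
have nearH : \forall h \near (0 : R)^'+, `[a, b]%classic `<=`
    [set x : R | forall y : R, `|y - x| <= h -> `|c y - c x| <= e].
  apply: K => x _.
  have /cvgrPdist_le/(_ _ e2)  := cc x => /nbhs_normP[r /= r0 hr].
  have r2 : 0 < r / 2 by lra.
  exists (ball x (r / 2), [set h : R | h < r / 2]); first split => /=.
  - exact: nbhsx_ballx.
  - exact: nbhs_right_lt.
  move=> [x' h] /= [xx' hr2] y yx'.
  have h1 : `|c x - c x'| <= e / 2 by apply: hr => /=; move: xx'; rewrite /ball/=; lra.
  have h2 : `|c x - c y| <= e / 2.
    apply: hr => /=; rewrite (_ : x - y = (x - x') - (y - x')); last ring.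
    by apply: le_lt_trans (ler_normB _ _) _; move: xx'; rewrite /ball/=; lra.
  rewrite (_ : _ - _ = (c x - c x') - (c x - c y)); last ring.
  by apply: le_trans (ler_normB _ _) _; lra.
near (0 : R)^'+ => h; exists h; first by near: h; exact: nbhs_right_gt.
have Hh : `[a, b]%classic `<=` [set x : R | forall y : R, `|y - x| <= h -> `|c y - c x| <= e].
  by near: h; exact: nearH.
by move=> x y xab; apply: Hh; rewrite /= in_itv.
Unshelve. all: by end_near. Qed.

Lemma continuous_subdiv_cell c a b (e : R) : continuous c -> a <= b -> 0 < e ->
  \forall n \near \oo, forall i u, (i < n)%N -> subdiv a b n i <= u <= subdiv a b n i.+1 ->
    `|c (subdiv a b n i.+1) - c u| <= e.
Proof.
move=> cc ab e0; have [h h0 Hh] := uniform_continuous_itv a b cc e0.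
have /cvgrPdist_le/(_ _ h0) := cvg_div_natr (b - a) => hn.
near=> n => i u ilt /andP[iu ui]; apply: Hh.
  have /andP[h1 _] := subdiv_itv ab (ltnW ilt); have /andP[_ h2] := subdiv_itv ab ilt.
  by rewrite (le_trans h1 iu) (le_trans ui h2).
rewrite ger0_norm ?subr_ge0//; apply: (@le_trans _ _ ((b - a) / n%:R)).
  by rewrite -(subdivS a b n i) lerB.
apply: le_trans (ler_norm _) _; rewrite -normrN -sub0r; near: n; exact: hn.
Unshelve. all: by end_near. Qed.

Lemma continuous_subdiv c a b (e : R) : continuous c -> a <= b -> 0 < e ->
  \forall n \near \oo, forall i, (i < n)%N ->
    `|c (subdiv a b n i.+1) - c (subdiv a b n i)| <= e.
Proof.
move=> cc ab e0; have := continuous_subdiv_cell cc ab e0; apply: filterS => n h i ilt.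
by apply: h => //; rewrite lexx subdiv_mono.
Qed.

End subdivisions.

Section riemann_type_sums.
Context {R : realType}.
Implicit Types (c J : R -> R) (phi : R -> R -> R).

(** The order of choices matters: the number of large jumps is fixed by [eta], then [e] is taken so
    small that these jumps contribute at most [eta / 4], and only then is the grid refined. *)
Lemma pure_jump_sum_limit J c phi a b (l : R) : pure_jump J -> a <= b ->
  (forall e, 0 < e -> (forall x z, `|phi e x - phi e z| <= `|x - z|) /\ forall x, `|phi e x| <= e) ->
  (forall e, 0 < e -> \sum_(i < n) phi e (c (subdiv a b n i.+1) - c (subdiv a b n i)) @[n --> \oo] --> l) ->
  forall eta : R, 0 < eta -> exists2 e0, 0 < e0 & forall e, 0 < e < e0 ->
  \forall n \near \oo, `|\sum_(i < n) phi e (c (subdiv a b n i.+1) + J (subdiv a b n i.+1) -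
      (c (subdiv a b n i) + J (subdiv a b n i))) - l| <= eta.
Proof.
move=> pJ ab Hphi Hl eta eta0.
have eta4 : 0 < eta / 4 by lra.
have [N [N0 HN]] := pure_jump_lipschitz pJ eta4.
exists (eta / 4 / (N + 1)); first by rewrite divr_gt0// ltr_wpDl.
move=> e /andP[e0 eN]; have [lip bd] := Hphi _ e0.
have /cvgrPdist_le/(_ _ eta4) := Hl _ e0 => hn.
near=> n; have h1 : `|l - \sum_(i < n) phi e (c (subdiv a b n i.+1) - c (subdiv a b n i))| <= eta / 4.
  by near: n; exact: hn.
have h2 := HN c (phi e) (subdiv a b n) n e (ltW e0) (fun i _ => subdiv_mono n i ab) lip bd.
have h3 : N * e <= eta / 4.
  move: eN; rewrite ltr_pdivlMr ?ltr_wpDl// => /ltW; apply: le_trans.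
  by rewrite mulrC ler_wpM2l ?(ltW e0)// lerDl.
rewrite -[X in `|X|](subrKA (\sum_(i < n) phi e (c (subdiv a b n i.+1) - c (subdiv a b n i)))).
apply: le_trans (ler_normD _ _) _; rewrite distrC in h1; lra.
Unshelve. all: by end_near. Qed.

Definition clip (e x : R) : R := Num.max (- e) (Num.min x e).

Lemma clip_spec e x : 0 < e ->
  [\/ clip e x = x /\ - e <= x <= e, clip e x = e /\ e <= x | clip e x = - e /\ x <= - e].
Proof.
move=> e0; rewrite /clip; have [xe|ex] := leP x e; last first.
  by apply: Or32; rewrite (ltW ex); split => //; apply/max_idPr; lra.
have [ex|xe'] := leP (- e) x; first by apply: Or31.
by apply: Or33; rewrite ltW.
Qed.

Lemma clip_lipschitz e x z : 0 < e -> `|clip e x - clip e z| <= `|x - z|.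
Proof.
move=> e0; rewrite ler_norml; have := ler_norm (x - z); have := ler_norm (z - x).
rewrite (distrC z).
by case: (clip_spec x e0) => -[-> ?]; case: (clip_spec z e0) => -[-> ?] *; lra.
Qed.

Lemma clip_norm_le e x : 0 < e -> `|clip e x| <= e.
Proof.
by move=> e0; rewrite ler_norml; case: (clip_spec x e0) => -[-> ?]; lra.
Qed.

Lemma clip_id e x : `|x| <= e -> clip e x = x.
Proof.
by rewrite ler_norml => /andP[h1 h2]; rewrite /clip (min_idPl _)// (max_idPr _).
Qed.

(** Clipping leaves small increments unchanged, so on a fine grid the sum for [c] telescopes.
    Continuity of [c] suffices, which lets Brownian bridges into the continuous part when [X] is
    recovered from [eta]. *)
Lemma clip_sum_limit J c a b : pure_jump J -> continuous c -> a <= b ->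
  forall eta : R, 0 < eta -> exists2 e0, 0 < e0 & forall e, 0 < e < e0 ->
  \forall n \near \oo, `|\sum_(i < n) clip e (c (subdiv a b n i.+1) + J (subdiv a b n i.+1) -
      (c (subdiv a b n i) + J (subdiv a b n i))) - (c b - c a)| <= eta.
Proof.
move=> pJ cc ab; apply: pure_jump_sum_limit => //.
  by move=> e e0; split => [x z|x]; [exact: clip_lipschitz|exact: clip_norm_le].
move=> e e0; apply: cvg_near_cst.
near=> n.
transitivity (\sum_(i < n) (c (subdiv a b n i.+1) - c (subdiv a b n i))).
  apply: eq_bigr => i _; apply: clip_id; move: i (ltn_ord i) => [i /= ii] _.
  by move: i ii; near: n; exact: continuous_subdiv.
rewrite -(big_mkord predT (fun i => c (subdiv a b n i.+1) - c (subdiv a b n i))).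
rewrite (telescope_sumr (fun i => c (subdiv a b n i)))//.
rewrite subdiv0 subdivn//; near: n; exact: nbhs_infty_gt.
Unshelve. all: by end_near. Qed.

(** The sine is the function whose expectation the Levy-Khintchine formula gives. It is not the
    identity near 0: each increment [x] of [c] costs at most [x^2 / e], and these errors add up to
    at most mesh oscillation times variation over [e]. Hence the variation bound on [c]. *)
Lemma sin_sum_limit J c H a b : pure_jump J -> continuous c -> a <= b ->
  (forall s t : R, s <= t -> `|c t - c s| <= H t - H s) ->
  forall eta : R, 0 < eta -> exists2 e0, 0 < e0 & forall e, 0 < e < e0 ->
  \forall n \near \oo, `|\sum_(i < n) e * sin ((c (subdiv a b n i.+1) + J (subdiv a b n i.+1) -
      (c (subdiv a b n i) + J (subdiv a b n i))) / e) - (c b - c a)| <= eta.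
Proof.
move=> pJ cc ab cH; apply: (@pure_jump_sum_limit J c (fun e x => e * sin (x / e))) => //.
  move=> e e0; split => [x z|x].
    rewrite -mulrBr normrM (gtr0_norm e0) mulrC -ler_pdivlMr//.
    by apply: le_trans (sin_lipschitz _ _) _; rewrite -mulrBl normrM (@gtr0_norm _ e^-1)// invr_gt0.
  by rewrite normrM (gtr0_norm e0) ler_piMr ?(ltW e0)// ler_norml sin_geN1 sin_le1.
move=> e e0; apply/cvgrPdist_le => eta eta0.
have H0 : 0 <= H b - H a by apply: le_trans (cH _ _ ab).
have d0 : 0 < eta * e / (H b - H a + 1) by rewrite divr_gt0 ?mulr_gt0// ltr_wpDl.
near=> n.
have n0 : (0 < n)%N by near: n; exact: nbhs_infty_gt.
have mesh : forall i, (i < n)%N ->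
    `|c (subdiv a b n i.+1) - c (subdiv a b n i)| <= eta * e / (H b - H a + 1).
  by near: n; exact: continuous_subdiv.
have tel (g : R -> R) : \sum_(i < n) (g (subdiv a b n i.+1) - g (subdiv a b n i)) = g b - g a.
  rewrite -(big_mkord predT (fun i => g (subdiv a b n i.+1) - g (subdiv a b n i))).
  by rewrite (telescope_sumr (fun i => g (subdiv a b n i)))// subdiv0 subdivn.
rewrite -tel -sumrB; apply: le_trans (ler_norm_sum _ _ _) _.
apply: (@le_trans _ _ (\sum_(i < n) (eta / (H b - H a + 1)) * (H (subdiv a b n i.+1) - H (subdiv a b n i)))).
  apply: ler_sum => i _; set x := c _ - c _.
  have h1 : `|x| <= eta * e / (H b - H a + 1) by exact: mesh.
  have h2 : `|x| <= H (subdiv a b n i.+1) - H (subdiv a b n i) by apply: cH; exact: subdiv_mono.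
  rewrite (_ : x - e * sin (x / e) = - (e * (sin (x / e) - x / e))); last first.
    by field; rewrite gt_eqF.
  rewrite normrN normrM (gtr0_norm e0).
  have h3 : `|sin (x / e) - x / e| <= (x / e) ^+ 2 by exact: sin_sub_id_le_sqr.
  apply: (le_trans (ler_wpM2l (ltW e0) h3)).
  rewrite (_ : e * (x / e) ^+ 2 = x ^+ 2 / e); last by field; rewrite gt_eqF.
  rewrite ler_pdivrMr// -[x ^+ 2]ger0_norm ?sqr_ge0// normrX expr2 mulrAC; apply: ler_pM => //.
  by rewrite mulrAC in h1.
rewrite -mulr_sumr tel mulrAC ler_pdivrMr ?ltr_wpDl// ler_wpM2l ?(ltW eta0)// lerDl//.
Unshelve. all: by end_near. Qed.

End riemann_type_sums.

Section finite_variation_paths.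
Context {R : realType}.
Variables (x G : R -> R) (L : R).
Hypotheses (xr : forall u : R, x s @[s --> u^'+] --> x u)
  (xl : forall u : R, cvg (x s @[s --> u^'-])).
Hypotheses (G0L : forall u, 0 <= G u <= L)
  (xG : forall s t : R, s <= t -> `|x t - x s| <= G t - G s).

Definition path_jumps (s : R) : R := jump_sum (jump x)^\+ s - jump_sum (jump x)^\- s.

Let Gm (s t : R) : s <= t -> G s <= G t.
Proof. by move=> st; rewrite -subr_ge0; apply: le_trans (xG st). Qed.

Lemma jump_left u : x s @[s --> u^'-] --> x u - jump x u.
Proof. by rewrite /jump opprB addrC subrK; exact: xl. Qed.

(** The list decreases, so the head is the latest jump time [u]. For [s] just before [u] the other
    jumps are bounded by [G s] and the increment from [s] to [u] by [G u - G s]; letting [s]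
    increase to [u] turns that increment into the jump. *)
Lemma sum_norm_jump_sorted F m : sorted >%R F -> (forall r, r \in F -> r <= m) ->
  \sum_(r <- F) `|jump x r| <= G m.
Proof.
elim: F m => [m _ _|u F IH m]; first by rewrite big_nil; have /andP[] := G0L m.
move=> /= uF Fm; apply: le_trans (_ : G u <= _); last by apply: Gm; apply: Fm; exact: mem_head.
have Fu r : r \in F -> r < u.
  by move=> rF; move: uF; rewrite (path_sortedE (rev_trans lt_trans)) => /andP[/allP/(_ _ rF)].
rewrite big_cons -lerBrDr.
have cj : `|x u - x s| @[s --> u^'-] --> `|jump x u|.
  rewrite -[X in `|X|](subKr (x u) (jump x u)); apply: cvg_norm.
  by apply: cvgB; [exact: cvg_cst|exact: jump_left].
apply: (@closed_cvg _ _ _ _ _ (fun y : R => y <= G u - \sum_(r <- F) `|jump x r|) _ _ _ cj).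
- exact: closed_le.
have nF : \forall s \near u^'-, forall r, r \in F -> r <= s.
  elim: {IH uF Fm cj} F Fu => [|r F IH] Fu; first by near=> s.
  have h := IH (fun q qF => Fu q (@mem_behead _ (r :: F) q qF)).
  have ru : r < u by apply: Fu; exact: mem_head.
  near=> s => q; rewrite inE => /predU1P[->|].
    near: s; exact: nbhs_left_ge.
  by move: q; near: s.
near=> s.
have su : s < u by near: s; exact: nbhs_left_lt.
have Fs r : r \in F -> r <= s by move: r; near: s.
have := IH _ (path_sorted uF) Fs; have := xG (ltW su); lra.
Unshelve. all: by end_near. Qed.

Lemma sum_norm_jump_le F : uniq F -> \sum_(r <- F) `|jump x r| <= L.
Proof.
move=> uF; rewrite (perm_big (rev (sort <=%R F))); last by rewrite perm_sym perm_rev; apply/permPl; exact: perm_sort.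
pose m := \big[Num.max/0]_(r <- F) r.
apply: le_trans (_ : G m <= _); last by have /andP[] := G0L m.
apply: sum_norm_jump_sorted.
  by rewrite rev_sorted sort_lt_sorted.
by move=> r; rewrite mem_rev mem_sort => rF; exact: le_bigmax_seq.
Qed.

Let summable (a : R -> R) : (forall r, a r <= `|jump x r|) ->
  (\esum_(u in [set: R]) (a u)%:E < +oo)%E.
Proof.
move=> aj; apply: (@le_lt_trans _ _ L%:E); last exact: ltry.
apply: esum_le_bound => F uF _; apply: le_trans (sum_norm_jump_le uF).
by apply: ler_sum => r _.
Qed.

Lemma jump_pos_ge0 u : 0 <= (jump x)^\+ u.
Proof. by rewrite /funrpos le_max lexx orbT. Qed.

Lemma jump_neg_ge0 u : 0 <= (jump x)^\- u.
Proof. by rewrite /funrneg le_max lexx orbT. Qed.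

Lemma jump_pos_summable : (\esum_(u in [set: R]) ((jump x)^\+ u)%:E < +oo)%E.
Proof. by apply: summable => r; rewrite /funrpos ge_max ler_norm normr_ge0. Qed.

Lemma jump_neg_summable : (\esum_(u in [set: R]) ((jump x)^\- u)%:E < +oo)%E.
Proof. by apply: summable => r; rewrite /funrneg ge_max -normrN ler_norm normr_ge0. Qed.

Let p0 := jump_pos_ge0.
Let n0 := jump_neg_ge0.
Let pf := jump_pos_summable.
Let nf := jump_neg_summable.

Lemma jump_posBneg u : (jump x)^\+ u - (jump x)^\- u = jump x u.
Proof.
rewrite /funrpos /funrneg; case: (leP (jump x u) 0) => h; case: (leP (- jump x u) 0) => h'; lra.
Qed.

Lemma pure_jump_path_jumps : pure_jump path_jumps.
Proof. by apply: pure_jumpB; exact: pure_jump_jump_sum. Qed.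

Lemma measurable_path_jumps : measurable_fun setT path_jumps.
Proof. by apply: measurable_funB; exact: measurable_jump_sum. Qed.

Lemma path_jumps_right u : path_jumps s @[s --> u^'+] --> path_jumps u.
Proof. by apply: cvgB; exact: jump_sum_right. Qed.

Lemma continuous_path_subr_jumps : continuous (fun s => x s - path_jumps s).
Proof.
move=> u; apply/left_right_continuousP; split.
  rewrite (_ : x u - path_jumps u = (x u - jump x u) -
    ((jump_sum (jump x)^\+ u - (jump x)^\+ u) - (jump_sum (jump x)^\- u - (jump x)^\- u))).
    apply: cvgB; first exact: jump_left.
    by apply: cvgB; exact: jump_sum_left.
  have := jump_posBneg u; rewrite /path_jumps; lra.
by apply: cvgB; [exact: xr|exact: path_jumps_right].
Qed.

Lemma path_subr_jumps_variation : exists H : R -> R, forall s t : R, s <= t ->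
  `|(x t - path_jumps t) - (x s - path_jumps s)| <= H t - H s.
Proof.
exists (fun s => G s + jump_sum (jump x)^\+ s + jump_sum (jump x)^\- s) => s t st.
have h1 := jump_sum_mono p0 pf st; have h2 := jump_sum_mono n0 nf st.
have := xG st; rewrite !ler_norml /path_jumps => /andP[h3 h4]; apply/andP; split; lra.
Qed.

Lemma path_jumps_norm_le s : `|path_jumps s| <= jump_total (jump x)^\+ + jump_total (jump x)^\-.
Proof.
have := jump_sum_ge0 p0 pf s; have := jump_sum_ge0 n0 nf s.
have := jump_sum_le p0 pf s; have := jump_sum_le n0 nf s.
by rewrite ler_norml /path_jumps; lra.
Qed.

End finite_variation_paths.

(** * The Levy-Ito form of a finite variation Levy process *)

Section iterated_limits.
Context {R : realType}.
Local Open Scope ereal_scope.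

Lemma limn_einf_ge (u : (\bar R)^nat) (a : \bar R) :
  (\forall n \near \oo, a <= u n) -> a <= limn_einf u.
Proof.
move=> [N _ h]; rewrite limn_einf_lim; apply: lime_ge; first exact: is_cvg_einfs.
exists N => // n /= Nn; apply: le_ereal_inf_tmp => _ [k /= nk <-]; apply: h => /=.
exact: leq_trans nk.
Qed.

Lemma limn_einf_le (u : (\bar R)^nat) (a : \bar R) :
  (\forall n \near \oo, u n <= a) -> limn_einf u <= a.
Proof.
move=> [N _ h]; rewrite limn_einf_lim; apply: lime_le; first exact: is_cvg_einfs.
exists N => // n /= Nn; apply: ge_ereal_inf; exists (u n); first by exists n => /=.
exact: h.
Qed.

Lemma measurable_limn_einf d (Omega : measurableType d) (f : nat -> Omega -> \bar R) :
  (forall n, measurable_fun setT (f n)) -> measurable_fun setT (fun w => limn_einf (f ^~ w)).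
Proof.
move=> mf; rewrite /limn_einf; 
apply: (@measurableT_comp _ _ _ _ _ _ -%E _ (fun w => limn_esup (fun n => - f n w))) => //.
by apply: measurable_fun_limn_esup => n; exact: (@measurableT_comp _ _ _ _ _ _ -%E).
Qed.

(** The iterated lower limit [H] dominates [g], and Fatou's lemma used twice gives it zero integral.
    The exceptional set is that of the measurable function [H], which suits a [g] built from jumps
    of paths or from uncountably many times. *)
Lemma iterated_fatou d (Omega : measurableType d) (P : {measure set Omega -> \bar R})
    (f : nat -> nat -> Omega -> R) (g : Omega -> R) :
  (forall m n, measurable_fun setT (f m n)) -> (forall m n w, (0 <= f m n w)%R) ->
  (forall w, (0 <= g w)%R) ->
  (forall e : R, (0 < e)%R -> \forall m \near \oo, \forall n \near \oo,
    \int[P]_w (f m n w)%:E <= e%:E) ->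
  {ae P, forall w, forall e : R, (0 < e)%R -> \forall m \near \oo, \forall n \near \oo,
    (g w - e <= f m n w)%R} ->
  {ae P, forall w, g w = 0%R}.
Proof.
move=> mf f0 g0 If fg.
pose h m w := limn_einf (fun n => (f m n w)%:E).
pose H w := limn_einf (fun m => h m w).
have h0 m w : 0 <= h m w by apply: limn_einf_ge; apply: nearW => n; rewrite lee_fin.
have H0 w : 0 <= H w by apply: limn_einf_ge; exact: nearW.
have mh m : measurable_fun setT (h m).
  by apply: measurable_limn_einf => n; exact/measurable_EFinP.
have mH : measurable_fun setT H by exact: measurable_limn_einf.
have Ih (e : R) : (0 < e)%R -> \forall m \near \oo, \int[P]_w h m w <= e%:E.
  move=> e0; have := If _ e0; apply: filterS => m hn.
  apply: (@le_trans _ _ (limn_einf (fun n => \int[P]_w (f m n w)%:E))); last exact: limn_einf_le.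
  by apply: fatou => // [n|n w _]; [exact/measurable_EFinP|rewrite lee_fin].
have IH0 : \int[P]_w H w = 0.
  apply/eqP; rewrite eq_le integral_ge0// andbT; apply/lee_addgt0Pr => e e0; rewrite add0e.
  apply: (@le_trans _ _ (limn_einf (fun m => \int[P]_w h m w))); first exact: fatou.
  by apply: limn_einf_le; exact: Ih.
have HE : ae_eq P setT H (cst 0).
  apply/(ae_eq_integral_abs P measurableT mH).
  by under eq_integral do rewrite gee0_abs//.
have : {ae P, forall w, H w = 0} by move: HE; apply: filterS => w; apply.
move: fg; apply: filterS2 => w gw Hw.
apply/eqP; rewrite eq_le g0 andbT; apply/ler_addgt0Pr => e e0; rewrite add0r.
have : (g w - e)%:E <= H w.
  apply: limn_einf_ge; have := gw _ e0; apply: filterS => m hn.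
  by apply: limn_einf_ge; move: hn; apply: filterS => n; rewrite lee_fin.
by rewrite Hw lee_fin; rewrite subr_le0.
Qed.

End iterated_limits.

Section variance.
Context {R : realType} {d : measure_display} {Omega : measurableType d}.
Variable P : probability Omega R.
Local Notation L1 f := (P.-integrable setT (EFin \o f)).

Lemma same_law_Rintegral (f g : Omega -> R) (phi : R -> R) (K : R) :
  measurable_fun setT f -> measurable_fun setT g -> measurable_fun setT phi ->
  (forall x, `|phi x| <= K) ->
  (forall C : set R, measurable C -> pushforward P f C = pushforward P g C) ->
  \int[P]_w phi (f w) = \int[P]_w phi (g w).
Proof.
move=> mf mg mphi phiK fg.
have i1 (h : Omega -> R) : measurable_fun setT h -> P.-integrable setT ((EFin \o phi) \o h).
  move=> mh; apply: (@L1_bounded _ _ _ _ _ _ K) => //; last exact: measurableT_comp.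
  by apply: le_lt_trans (probability_le1 _ _) _; rewrite ?ltry.
have mE : measurable_fun setT (EFin \o phi) by exact/measurable_EFinP.
rewrite /Rintegral.
pose pf : {mfun Omega >-> R} := mfun_Sub (mem_set mf).
pose pg : {mfun Omega >-> R} := mfun_Sub (mem_set mg).
rewrite -(@integral_distribution _ _ _ _ _ P pf _ mE (i1 _ mf)).
rewrite -(@integral_distribution _ _ _ _ _ P pg _ mE (i1 _ mg)).
by congr fine; apply: eq_measure_integral => A mA _; exact: fg.
Qed.

(** Only an inequality: the [n] diagonal terms [mu * mu], absent from the exact expansion, are added
    to complete the square [(n * mu - c) ^ 2]. *)
Lemma sum_second_moment (n : nat) (Y : 'I_n -> Omega -> R) (mu K c : R) :
  (forall i, measurable_fun setT (Y i)) -> (forall i w, `|Y i w| <= K) ->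
  (forall i, \int[P]_w Y i w = mu) ->
  (forall i j, i != j -> independent_rv P (Y i) (Y j)) ->
  \int[P]_w (\sum_(i < n) Y i w - c) ^+ 2 <=
  \sum_(i < n) \int[P]_w (Y i w) ^+ 2 + (n%:R * mu - c) ^+ 2.
Proof.
move=> mY YK Ymu iY.
have iL (f : Omega -> R) (M : R) : measurable_fun setT f -> (forall w, `|f w| <= M) -> L1 f.
  move=> mf fM; apply: (@L1_bounded _ _ _ _ _ _ M) => //.
  by apply: le_lt_trans (probability_le1 _ _) _; rewrite ?ltry.
have iY1 i : L1 (Y i) by exact: iL (YK i).
have YKK i j w : `|Y i w * Y j w| <= K * K by rewrite normrM ler_pM.
have iYY i j : L1 (fun w => Y i w * Y j w).
  by apply: iL (YKK i j); exact: measurable_funM.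
have EYY i j : i != j -> \int[P]_w (Y i w * Y j w) = mu * mu.
  by move=> ij; rewrite Rintegral_independentM ?Ymu//; exact: iY.
have iS : L1 (fun w => \sum_(i < n) Y i w) by exact: L1_sum.
have iSS : L1 (fun w => \sum_(i < n) \sum_(j < n) Y i w * Y j w).
  by apply: L1_sum => // i; exact: L1_sum.
rewrite (_ : (fun w => _) = (fun w => \sum_(i < n) \sum_(j < n) Y i w * Y j w -
     (2 * c) * (\sum_(i < n) Y i w) + c ^+ 2)); last first.
  apply/funext => w; have -> : \sum_(i < n) \sum_(j < n) Y i w * Y j w = (\sum_(i < n) Y i w) ^+ 2.
    by rewrite expr2 mulr_suml; apply: eq_bigr => i _; rewrite mulr_sumr.
  ring.
have icst : L1 (fun=> c ^+ 2).
  by apply: (@iL _ `|c ^+ 2|).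
rewrite RintegralD//; last by apply: L1B => //; exact: L1Z.
rewrite RintegralB//; last exact: L1Z.
rewrite RintegralZl// Rintegral_prob_cst.
rewrite (Rintegral_sum _ measurableT iY1).
rewrite (Rintegral_sum _ measurableT (fun i : 'I_n => L1_sum _ measurableT (iYY i))).
have -> : \sum_(k < n) \int[P]_x Y k x = n%:R * mu.
  by rewrite (eq_bigr (fun=> mu))// sumr_const card_ord mulr_natl.
have h : \sum_(k < n) \int[P]_x (\sum_(j < n) Y k x * Y j x) <=
   \sum_(i < n) \int[P]_w Y i w ^+ 2 + n%:R * mu * (n%:R * mu).
  have -> : n%:R * mu * (n%:R * mu) = \sum_(i < n) \sum_(j < n) mu * mu.
    by rewrite !sumr_const !card_ord -[RHS]mulr_natl -(mulr_natl (mu * mu)); ring.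
  rewrite -big_split/=; apply: ler_sum => i _.
  rewrite (Rintegral_sum _ measurableT (iYY i)) (bigD1 i)//= lerD//.
  rewrite [leRHS](bigD1 i)//= (eq_bigr (fun=> mu * mu)); last by move=> j ji; apply: EYY; rewrite eq_sym.
  by rewrite lerDr -expr2 sqr_ge0.
move: h; rewrite (_ : (n%:R * mu - c) ^+ 2 = n%:R * mu * (n%:R * mu) - 2 * c * (n%:R * mu) + c ^+ 2); last ring.
lra.
Qed.

Lemma increments_independent_rv (T : R) (Z : R -> Omega -> R) (n : nat) (t : nat -> R) (i j : 'I_n) :
  independent_increments P T Z -> 
  (forall k, (k <= n)%N -> 0 <= t k <= T) -> (forall k, (k < n)%N -> t k <= t k.+1) ->
  i != j -> independent_rv P (incr Z t i) (incr Z t j).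
Proof.
move=> iiZ tT tm ij A B mA mB.
pose C k := if k == i :> nat then A else if k == j :> nat then B else setT.
have mC k : measurable (C k) by rewrite /C; case: ifP => // _; case: ifP.
have := iiZ n t C tT tm mC.
have -> : \bigcap_(i0 < n) [set w | C i0 (Z (t i0.+1) w - Z (t i0) w)] =
    incr Z t i @^-1` A `&` incr Z t j @^-1` B.
  apply/seteqP; split => w /= h.
    split; first by have := h i (ltn_ord i); rewrite /C eqxx.
    by have := h j (ltn_ord j); rewrite /C eqxx; case: eqP => // e; move: ij; rewrite -val_eqE/= e eqxx.
  move=> k _; rewrite /C; case: eqP => [->|_]; first exact: h.1.
  by case: eqP => [->|_] //; exact: h.2.
move=> ->; rewrite (bigD1 i)//= (bigD1 j)//= 1?eq_sym// big1 ?mule1.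
  rewrite /C !eqxx; congr (_ * _)%E; case: eqP => // e.
  by move: ij; rewrite -val_eqE/= e eqxx.
move=> k /andP[]; rewrite -!val_eqE/= => /negbTE ki /negbTE kj; rewrite /C ki kj.
by rewrite (_ : [set w | _] = setT) ?probability_setT//; apply/seteqP; split.
Qed.

End variance.

Section levy_ito.
Context {R : realType} {d : measure_display} {Omega : measurableType d}.
Variable P : probability Omega R.
Variables (T lam : R) (nu : {measure set R -> \bar R}) (X : R -> Omega -> R).
Hypotheses (lX : levy_process P T X) (chX : has_characteristics P T lam 0 nu X).
Hypothesis nu_int : (\int[nu]_(x in [set~ 0%R]) `|x|%:E < +oo)%E.
Local Notation re := (levy_exponent_re 0 nu).
Local Notation im := (levy_exponent_im lam nu).
Local Notation L1nu f := (nu.-integrable setT (EFin \o f)).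

Let pX : process T X. Proof. by case: lX. Qed.

(** At high frequency [sin (u * x) / u] tends to 0, dominated by [|x|]. The jumps disappear and what
    is left of [im u / u] is [lam] minus the truncation integral, that is the drift. *)
Lemma cvg_levy_im_infty : n.+1%:R^-1 * im n.+1%:R @[n --> \oo] --> drift0 lam nu.
Proof.
have ms : measurable [set y : R | `|y| < 1].
  rewrite (_ : [set y | _] = `]-1, 1[%classic); first exact: measurable_itv.
  by apply/seteqP; split => y /=; rewrite in_itv/= ltr_norml.
have iid := nu_id_integrable nu_int.
have mid : measurable_fun setT (fun x : R => x) by exact: measurable_id.
have small_int : L1nu (fun x => x * \1_[set y : R | `|y| < 1] x).
  apply: (@L1Mr _ _ _ _ _ _ _ 1) => // x _; rewrite indicE; by case: (_ \in _); rewrite ?normr1 ?normr0.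
have E n : n.+1%:R^-1 * im n.+1%:R = drift0 lam nu + \int[nu]_x (n.+1%:R^-1 * sin (n.+1%:R * x)).
  have n0 : n.+1%:R != 0 :> R by rewrite pnatr_eq0.
  have msin : measurable_fun setT (fun x : R => n.+1%:R^-1 * sin (n.+1%:R * x)).
    by apply: measurable_funM => //; apply: measurable_sin_comp; exact: measurable_funM.
  have isin : L1nu (fun x => n.+1%:R^-1 * sin (n.+1%:R * x)).
    apply: (nu_L1_le nu_int (M := 1) msin _).1 => x.
    rewrite normrM gtr0_norm ?invr_gt0// ler_pdivrMl// mul1r.
    by apply: le_trans (sin_le_norm _) _; rewrite normrM gtr0_norm.
  rewrite /levy_exponent_im mulrDr mulrCA mulVf// mulr1 /drift0 -addrA; congr (_ + _).
  rewrite -RintegralZl//; last by case: (levy_im_integrand nu_int n.+1%:R).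
  rewrite [X in - X + _]Rintegral_mkcond.
  transitivity (\int[nu]_x (n.+1%:R^-1 * sin (n.+1%:R * x) - x * \1_[set y : R | `|y| < 1] x)).
    by apply: eq_Rintegral => x _; rewrite mulrBr -!mulrA mulKf.
  rewrite RintegralB// addrC; congr (- _ + _).
  by apply: eq_Rintegral => x _; rewrite patchE indicE; case: (_ \in _); rewrite ?mulr1 ?mulr0.
under eq_fun do rewrite E.
suff h : \int[nu]_x (n.+1%:R^-1 * sin (n.+1%:R * x)) @[n --> \oo] --> (0 : R).
  by have := cvgD (@cvg_cst _ (drift0 lam nu) _ \oo _) h; rewrite addr0; exact.
rewrite -[X in _ --> X](_ : \int[nu]_x (0 : R) = 0); last first.
  by rewrite /Rintegral integral0.
have [||||_] // := @Rintegral_dominated _ _ R nu setT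
  (fun n x => n.+1%:R^-1 * sin (n.+1%:R * x)) (fun=> 0) (fun x => `|x|) measurableT.
- move=> n; by apply: measurable_funM => //; apply: measurable_sin_comp; exact: measurable_funM.
- move=> x _; apply/norm_cvg0P.
  apply: (@squeeze_cvgr _ _ _ _ (fun=> 0) (fun n => n.+1%:R^-1)).
  + near=> n; rewrite normr_ge0/= normrM gtr0_norm ?invr_gt0// ler_piMr//.
    by rewrite ler_norml sin_le1 sin_geN1.
  + exact: cvg_cst.
  + exact: cvg_harmonic.
- exact: integrable_norm.
- move=> n x _; rewrite normrM gtr0_norm ?invr_gt0// ler_pdivrMl//.
  by apply: le_trans (sin_le_norm _) _; rewrite normrM gtr0_norm.
Unshelve. all: by end_near. Qed.

Section fixed_time.
Variable t : R.
Hypothesis tT : 0 <= t <= T.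

Definition sin_sum (e : R) (n : nat) (w : Omega) : R := \sum_(i < n)
  e * sin ((X (subdiv 0 t n i.+1) w - X (subdiv 0 t n i) w) / e).

Let t0 : 0 <= t. Proof. by case/andP: tT. Qed.

Let sub_in n k : (k <= n)%N -> 0 <= subdiv 0 t n k <= T.
Proof.
by move=> kn; have /andP[-> h] := subdiv_itv t0 kn; case/andP: tT => _; exact: le_trans.
Qed.

Let minc n (i : 'I_n) : measurable_fun setT (incr X (subdiv 0 t n) i).
Proof. by apply: measurable_funB; apply: pX; apply: sub_in => //; exact: ltnW. Qed.

Let tn n : (0 < n)%N -> 0 <= t / n%:R <= T.
Proof.
move=> n0; rewrite divr_ge0//=; case/andP: tT => _; apply: le_trans.
by rewrite ler_pdivrMr ?ltr0n// ler_peMr// ler1n.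
Qed.

Let law n (i : 'I_n) (phi : R -> R) : measurable_fun setT phi -> (forall x, `|phi x| <= 1) ->
  \int[P]_w phi (incr X (subdiv 0 t n) i w) = \int[P]_w phi (X (t / n%:R) w).
Proof.
move=> mphi phi1; have n0 : (0 < n)%N by exact: leq_ltn_trans (ltn_ord i).
apply: (@same_law_Rintegral _ _ _ _ _ _ _ 1) => //; first by apply: pX; exact: tn.
move=> C mC; have [_ _ _ stX _] := lX.
have := stX (subdiv 0 t n i) (subdiv 0 t n i.+1) _ (subdiv_mono n i t0) _ C mC.
rewrite subdivS subr0 => -> //.
- by have /andP[] := sub_in (ltnW (ltn_ord i)).
- by have /andP[] := sub_in (ltn_ord i).
Qed.

Lemma measurable_sin_sum e n : measurable_fun setT (sin_sum e n).
Proof.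
apply: measurable_sum => i; apply: measurable_funM => //; apply: measurable_sin_comp.
by apply: measurable_funM => //; exact: (minc i).
Qed.

(** The first two terms bound the second moments of the summands through [sin^2 = (1 - cos of the
    double angle) / 2], which is why the exponent appears at [2 / e]. The last one is the bias: a
    summand has mean [e * expR a * sin b] with [a] and [b] of order [1 / n], and replacing it by
    [e * b] costs order [1 / n] in total. *)
Lemma sin_sum_second_moment (e c : R) n : 0 < e -> (0 < n)%N ->
  \int[P]_w (sin_sum e n w - c) ^+ 2 <=
  e * t * nu_norm nu + (e * t * im (2 / e)) ^+ 2 / n%:R +
  (`|t * (e * im e^-1) - c| + e * t ^+ 2 * (`|re e^-1| * `|im e^-1| + im e^-1 ^+ 2) / n%:R) ^+ 2.
Proof.
move=> e0 n0.
have nr0 : 0 < n%:R :> R by rewrite ltr0n.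
pose mu := e * (expR (t / n%:R * re e^-1) * sin (t / n%:R * im e^-1)).
have msin (a : R) : measurable_fun setT (fun x : R => sin (a * x)).
  by apply: measurable_sin_comp; exact: measurable_funM.
have mcos (a : R) : measurable_fun setT (fun x : R => cos (a * x)).
  by apply: measurable_cos_comp; exact: measurable_funM.
have sin1 (x : R) : `|sin x| <= 1 by rewrite ler_norml sin_le1 sin_geN1.
have cos1 (x : R) : `|cos x| <= 1 by rewrite ler_norml cos_le1 cos_geN1.
pose Y (i : 'I_n) w := e * sin (e^-1 * incr X (subdiv 0 t n) i w).
have isin (a : R) f : measurable_fun setT f -> P.-integrable setT (EFin \o (fun w => sin (a * f w))).
  by move=> mf; apply: L1_bound1 => //; apply: measurable_sin_comp; exact: measurable_funM.
have icos (a : R) f : measurable_fun setT f -> P.-integrable setT (EFin \o (fun w => cos (a * f w))).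
  by move=> mf; apply: L1_bound1 => //; apply: measurable_cos_comp; exact: measurable_funM.
have ione : P.-integrable setT (EFin \o (fun=> (1 : R))).
  by apply: L1_bound1 => // w; rewrite normr1.
have mY i : measurable_fun setT (Y i).
  by apply: measurable_funM => //; apply: measurableT_comp (msin e^-1) _; exact: minc.
have Emu i : \int[P]_w Y i w = mu.
  rewrite /Y RintegralZl//; last exact: isin.
  rewrite (law i (msin e^-1))// (levy_sin chX)//; exact: tn.
have YK i w : `|Y i w| <= e by rewrite normrM (gtr0_norm e0) ler_piMr// ltW.
have iY i j : i != j -> independent_rv P (Y i) (Y j).
  move=> ij.
  have h : independent_rv P (incr X (subdiv 0 t n) i) (incr X (subdiv 0 t n) j).
    apply: (@increments_independent_rv _ _ _ _ T) => //.
    - by case: lX.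
    - by move=> k; exact: sub_in.
    - by move=> k _; exact: subdiv_mono.
  have m1 : measurable_fun setT (fun x : R => e * sin (e^-1 * x)) by exact: measurable_funM.
  exact: (independent_rv_comp m1 m1 h).
have := sum_second_moment c mY YK Emu iY.
rewrite (_ : (fun w => (\sum_(i < n) Y i w - c) ^+ 2) = (fun w => (sin_sum e n w - c) ^+ 2)); last first.
  apply/funext => w; congr ((_ - _) ^+ 2); apply: eq_bigr => i _.
  by rewrite /Y /incr (mulrC e^-1).
move/le_trans; apply; apply: lerD.
  have tnn := tn n0.
  have E2 i : \int[P]_w Y i w ^+ 2 <= e ^+ 2 / 2 * (- (t / n%:R * re (2 / e)) + (t / n%:R * im (2 / e)) ^+ 2).
    rewrite (_ : (fun w => Y i w ^+ 2) = (fun w => e ^+ 2 / 2 * (1 - cos (2 / e * incr X (subdiv 0 t n) i w)))); last first.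
      apply/funext => w; rewrite /Y (_ : 2 / e * _ = (e^-1 * incr X (subdiv 0 t n) i w) *+ 2); last by rewrite mulr2n; ring.
      by rewrite cos_mulr2n; have := cos2Dsin2 (e^-1 * incr X (subdiv 0 t n) i w); nra.
    have i1 f : measurable_fun setT f -> P.-integrable setT (EFin \o (fun w => 1 - cos (2 / e * f w))).
      by move=> mf; apply: L1B => //; exact: icos.
    rewrite RintegralZl//; last exact: i1.
    rewrite ler_wpM2l ?divr_ge0 ?sqr_ge0//.
    apply: le_trans (levy_onem_cos_le pX chX nu_int (2 / e) tnn).
    rewrite le_eqVlt; apply/orP; left; apply/eqP.
    have mX' : measurable_fun setT (X (t / n%:R)) by exact: pX.
    rewrite RintegralB ?[RHS]RintegralB//; try exact: icos.
    by congr (_ - _); exact: (law i (mcos (2 / e))).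
  apply: le_trans (ler_sum _ (fun i _ => E2 i)) _.
  rewrite sumr_const card_ord -[leLHS]mulr_natl.
  have hre : - re (2 / e) <= 2 / e * nu_norm nu.
    have := levy_re_norm_le nu_int (2 / e); rewrite (gtr0_norm (divr_gt0 _ e0))//.
    by apply: le_trans; rewrite -normrN ler_norm.
  have h1 : e ^+ 2 / 2 * t * (- re (2 / e)) <= e ^+ 2 / 2 * t * (2 / e * nu_norm nu).
    by rewrite ler_wpM2l// mulr_ge0// divr_ge0// sqr_ge0.
  rewrite (_ : e ^+ 2 / 2 * t * (2 / e * nu_norm nu) = e * t * nu_norm nu) in h1; last by field; rewrite gt_eqF.
  rewrite (_ : n%:R * _ = e ^+ 2 / 2 * t * (- re (2 / e)) + (e * t * im (2 / e)) ^+ 2 / n%:R / 2); last by field; rewrite gt_eqF.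
  apply: lerD => //; have : 0 <= (e * t * im (2 / e)) ^+ 2 / n%:R by rewrite divr_ge0// sqr_ge0.
  lra.
rewrite -real_normK ?num_real//; rewrite ler_pXn2r ?nnegrE ?normr_ge0//; last first.
  rewrite addr_ge0// divr_ge0// mulr_ge0//; first by rewrite mulr_ge0 ?(ltW e0) ?sqr_ge0.
  by rewrite addr_ge0 ?sqr_ge0 ?mulr_ge0.
set a := t / n%:R * re e^-1 in mu Emu *; set b := t / n%:R * im e^-1 in mu Emu *.
have a0 : a <= 0.
  by rewrite mulr_ge0_le0 ?divr_ge0//; exact: levy_re_le0.
have h : `|expR a * sin b - b| <= `|a| * `|b| + b ^+ 2.
  rewrite (_ : _ - b = expR a * (sin b - b) + (expR a - 1) * b); last ring.
  rewrite addrC; apply: le_trans (ler_normD _ _) _.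
  rewrite (normrM (expR a - 1)) (normrM (expR a)).
  have e1 : expR a <= 1 by rewrite -expR0 ler_expR.
  have ea := expR_ge1Dx a; have ep := expR_ge0 a.
  apply: lerD.
    rewrite ler_wpM2r// ler_norml (ler0_norm a0) opprK; lra.
  rewrite ger0_norm// -[leRHS]mul1r; apply: ler_pM => //; exact: sin_sub_id_le_sqr.
rewrite (_ : n%:R * mu - c = (t * (e * im e^-1) - c) + n%:R * e * (expR a * sin b - b)); last first.
  by rewrite /mu /b; field; rewrite gt_eqF.
apply: le_trans (ler_normD _ _) _; rewrite lerD2l normrM ger0_norm ?mulr_ge0 ?(ltW e0)//.
apply: (le_trans (ler_wpM2l _ h)); first by rewrite mulr_ge0 ?(ltW e0).
rewrite /a /b !normrM (ger0_norm t0) (@gtr0_norm _ n%:R^-1) ?invr_gt0//.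
by rewrite le_eqVlt; apply/orP; left; apply/eqP; field; rewrite gt_eqF.
Qed.

Lemma levy_ito_limit (C : Omega -> R) :
  {ae P, forall w, forall eta : R, 0 < eta -> exists2 e0, 0 < e0 & forall e, 0 < e < e0 ->
    \forall n \near \oo, `|sin_sum e n w - C w| <= eta} ->
  {ae P, forall w, C w = drift0 lam nu * t}.
Proof.
move=> SC; pose b := drift0 lam nu * t.
have ev n : 0 < n.+1%:R^-1 :> R by rewrite invr_gt0.
(* Half of the square is used because [(C - b)^2 / 2 <= (S - b)^2 + (S - C)^2] for every sum [S];
   the last term is small pathwise, which yields the lower bound wanted by [iterated_fatou]. *)
suff : {ae P, forall w, (C w - b) ^+ 2 / 2 = 0}.
  by apply: filterS => w /eqP; rewrite mulf_eq0 invr_eq0 pnatr_eq0 orbF sqrf_eq0 subr_eq0 => /eqP.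
apply: (@iterated_fatou _ _ _ P (fun m n w => (sin_sum m.+1%:R^-1 n w - b) ^+ 2)).
- move=> m n; apply: measurable_funX; apply: measurable_funB => //; exact: measurable_sin_sum.
- by move=> *; exact: sqr_ge0.
- by move=> w; rewrite divr_ge0 ?sqr_ge0.
- move=> eps eps0.
  (* The limit in [n] of the second moment bound at [e = 1 / (m + 1)]. *)
  pose q (m : nat) : R := m.+1%:R^-1 * t * nu_norm nu + (t * (m.+1%:R^-1 * im m.+1%:R) - b) ^+ 2.
  have cq : q m @[m --> \oo] --> 0.
    rewrite -[X in _ --> X](_ : 0 * t * nu_norm nu + (t * drift0 lam nu - b) ^+ 2 = 0).
      apply: cvgD; first by do 2 apply: cvgMl; exact: cvg_harmonic.
      rewrite /q expr2; under eq_fun do rewrite expr2.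
      by apply: cvgM; (apply: cvgB; [apply: cvgMr; exact: cvg_levy_im_infty|exact: cvg_cst]).
    by rewrite /b mulrC; ring.
  near=> m.
  have qm : q m < eps by near: m; exact: cvgr_lt cq _ eps0.
  pose e : R := m.+1%:R^-1; pose A := (e * t * im (2 / e)) ^+ 2.
  pose B := e * t ^+ 2 * (`|re e^-1| * `|im e^-1| + im e^-1 ^+ 2).
  have cb : e * t * nu_norm nu + A / n%:R + (`|t * (e * im e^-1) - b| + B / n%:R) ^+ 2 @[n --> \oo] --> q m.
    rewrite (_ : q m = e * t * nu_norm nu + 0 + (`|t * (e * im e^-1) - b| + 0) ^+ 2).
      apply: cvgD; first by apply: cvgD; [exact: cvg_cst|exact: cvg_div_natr].
      rewrite expr2; under eq_fun do rewrite expr2.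
      by apply: cvgM; (apply: cvgD; [exact: cvg_cst|exact: cvg_div_natr]).
    by rewrite /q !addr0 real_normK ?num_real// /e invrK.
  near=> n.
  have n0 : (0 < n)%N by near: n; exact: nbhs_infty_gt.
  have isq : P.-integrable setT (EFin \o (fun w => (sin_sum m.+1%:R^-1 n w - b) ^+ 2)).
    have sK w : `|sin_sum m.+1%:R^-1 n w| <= n%:R.
      apply: le_trans (ler_norm_sum _ _ _) _.
      rewrite -[X in _ <= X%:R]card_ord -[leRHS]sumr_const; apply: ler_sum => i _.
      rewrite normrM (gtr0_norm (ev m)) mulr_ile1// ?ler_norml ?sin_le1 ?sin_geN1//.
      by rewrite invf_le1// ler1n.
    apply: (@L1_bounded _ _ _ _ _ _ ((n%:R + `|b|) ^+ 2)) => //.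
    - by apply: le_lt_trans (probability_le1 _ _) _; rewrite ?ltry.
    - apply: measurable_funX; apply: measurable_funB => //; exact: measurable_sin_sum.
    move=> w _; rewrite normrX ler_pXn2r ?nnegrE ?addr_ge0//.
    by apply: le_trans (ler_normB _ _) _; rewrite lerD2r.
  rewrite -[leLHS]fineK; last exact: integrable_fin_num.
  rewrite lee_fin -[fine _]/(\int[P]_w _).
  apply: le_trans (sin_sum_second_moment b (ev m) n0) _; apply/ltW.
  near: n; exact: cvgr_lt cb _ qm.
move: SC; apply: filterS => w SC eps eps0.
have s0 : 0 < Num.sqrt eps by rewrite sqrtr_gt0.
have [e0 e00 He] := SC _ s0.
near=> m.
have em : 0 < (m.+1%:R^-1 : R) < e0.
  rewrite ev/= invf_plt ?posrE// (@lt_trans _ _ m%:R) ?ltr_nat//.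
  by near: m; exact: nbhs_infty_gtr.
have := He _ em; apply: filterS => n h.
have h2 : (sin_sum m.+1%:R^-1 n w - C w) ^+ 2 <= eps.
  rewrite -real_normK ?num_real// -[leRHS]sqr_sqrtr ?(ltW eps0)//.
  by rewrite ler_pXn2r ?nnegrE ?sqrtr_ge0.
have := sqr_ge0 ((C w - sin_sum m.+1%:R^-1 n w) - (sin_sum m.+1%:R^-1 n w - b)); nra.
Unshelve. all: by end_near. Qed.

End fixed_time.
End levy_ito.

(** * The kernel and the pathwise representation *)

Section kernel.
Context {R : realType}.
Local Notation lambda := (@lebesgue_measure R).
Variable T : R.
Hypothesis T0 : 0 < T.

Definition kern' (u : R) : R := 2 * T ^+ 3 / (u ^+ 2 + T ^+ 2) ^+ 2.

Definition denom (s : R) : R := T - s + s * atan (s / T).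

Let pos (u : R) : 0 < u ^+ 2 + T ^+ 2.
Proof. by rewrite ltr_wpDl ?sqr_ge0// exprn_gt0. Qed.

Let dinv (u : R) : is_derive u 1 (fun u => (u ^+ 2 + T ^+ 2)^-1) (- (2 * u) / (u ^+ 2 + T ^+ 2) ^+ 2).
Proof.
have nz : (fun u : R => u ^+ 2 + T ^+ 2) u != 0 by rewrite gt_eqF.
have d1 : is_derive u 1 (fun u : R => u ^+ 2 + T ^+ 2) (2 * u).
  by apply: is_derive_eq; rewrite /GRing.scale/=; ring.
have d2 := @is_deriveV _ (fun u : R => u ^+ 2 + T ^+ 2) _ _ _ nz d1.
apply: (is_derive_eq d2); rewrite /GRing.scale/=; field; exact: lt0r_neq0.
Qed.

Lemma is_derive_atan_div (u : R) : is_derive u 1 (fun u => atan (u / T)) (T / (u ^+ 2 + T ^+ 2)).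
Proof.
have d1 : is_derive u 1 (fun u : R => u / T) T^-1.
  by apply: is_derive_eq; rewrite /GRing.scale/=; ring.
have d2 := @is_derive1_comp _ (@atan R) (fun u : R => u / T) u _ _ (is_derive1_atan _) d1.
apply: (is_derive_eq d2); rewrite /GRing.scale/=; field.
by rewrite !gt_eqF//= addrC.
Qed.

Lemma is_derive_kern (u : R) : is_derive u 1 (kern T) (kern' u).
Proof.
have d1 := dinv u; have d2 := is_derive_atan_div u.
have d3 : is_derive u 1 (fun u : R => T * u) T.
  by apply: is_derive_eq; rewrite /GRing.scale/= mulr1.
have d4 : is_derive u 1 (fun u => T * u * (u ^+ 2 + T ^+ 2)^-1 + atan (u / T))
   (T * u * (- (2 * u) / (u ^+ 2 + T ^+ 2) ^+ 2) + (u ^+ 2 + T ^+ 2)^-1 * T + T / (u ^+ 2 + T ^+ 2)).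
  exact: (is_deriveD (is_deriveM d3 d1) d2).
apply: (is_derive_eq d4); rewrite /kern'; field; exact: lt0r_neq0.
Qed.

Lemma is_derive_mul_kern (u : R) : is_derive u 1 (fun u => u * kern T u) (u * kern' u + kern T u).
Proof.
have d := is_derive_kern u.
apply: (is_derive_eq (is_deriveM (is_derive_id u 1) d)).
by rewrite /GRing.scale/= mulr1.
Qed.

(** Since [kern] is the derivative of [u * atan (u / T)], this primitive comes from one integration
    by parts. It is the origin of the closed terms in [atan (s / T)] attached to the drift in
    [frakR]. *)
Lemma is_derive_kern_primitive (u : R) :
  is_derive u 1 (fun u => (u ^+ 2 - T ^+ 2) / 2 * atan (u / T) + T * u / 2) (u * kern T u).
Proof.
have d1 := is_derive_atan_div u.
have d2 : is_derive u 1 (fun u : R => (u ^+ 2 - T ^+ 2) / 2) u.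
  by apply: is_derive_eq; rewrite /GRing.scale/=; field.
have d3 : is_derive u 1 (fun u : R => T * u / 2) (T / 2).
  by apply: is_derive_eq; rewrite /GRing.scale/=; ring.
apply: (is_derive_eq (is_deriveD (is_deriveM d2 d1) d3)).
by rewrite /GRing.scale/= /kern; field; exact: lt0r_neq0.
Qed.

Lemma continuous_kern' : continuous kern'.
Proof.
move=> u; have cu : (fun u : R => u ^+ 2 + T ^+ 2) v @[v --> u] --> u ^+ 2 + T ^+ 2.
  apply: cvgD; last exact: cvg_cst.
  by rewrite expr2; under eq_fun do rewrite expr2; apply: cvgM; exact: cvg_id.
apply: cvgMr; apply: cvgV; first by rewrite expf_neq0// gt_eqF.
by rewrite expr2; under eq_fun do rewrite expr2; exact: cvgM.
Qed.

Lemma continuous_kern : continuous (kern T).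
Proof. exact: is_derive_continuous is_derive_kern. Qed.

Lemma kern_ge0 u : 0 <= u -> 0 <= kern T u.
Proof.
move=> u0; rewrite /kern addr_ge0 ?divr_ge0 ?mulr_ge0 ?(ltW T0) ?(ltW (pos u))//.
by rewrite -atan0 le_atan// divr_ge0// ltW.
Qed.

Lemma atan_ge_half (x : R) : 0 <= x <= 1 -> x / 2 <= atan x.
Proof.
move=> /andP[x0 x1]; rewrite -subr_ge0.
pose f (v : R) := atan v - v / 2; rewrite -/(f x).
have df (v : R) : is_derive v 1 f ((1 + v ^+ 2)^-1 - 2^-1).
  by apply: is_derive_eq; rewrite /GRing.scale/=; ring.
have cf := is_derive_continuous df.
have -> : 0 = f 0 by rewrite /f atan0 mul0r subr0.
have [->//|xn] := eqVneq x 0.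
have x0' : 0 < x by rewrite lt0r xn.
have [c /[!in_itv]/= /andP[c0 cx] E] := MVT x0' (fun v _ => df v) (continuous_subspaceT cf).
rewrite -subr_ge0 E mulr_ge0//; last by rewrite subr0.
rewrite subr_ge0 lef_pV2 ?posrE ?ltr_wpDr ?sqr_ge0//.
have : c ^+ 2 <= 1 by rewrite -(expr1n _ 2) ler_pXn2r ?nnegrE ?(ltW c0)// (le_trans (ltW cx)).
lra.
Qed.

(** From [atan x >= x / 2] on [[0, 1]] the denominator is at least [T - s + s^2 / (2 * T)], which is
    [T / 2] plus the square [(T - s)^2 / (2 * T)]. *)
Lemma denom_ge s : 0 <= s <= T -> T / 2 <= denom s.
Proof.
move=> /andP[s0 sT]; have sT1 : 0 <= s / T <= 1.
  by rewrite divr_ge0 ?(ltW T0)//= ler_pdivrMr// mul1r.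
have := ler_wpM2l s0 (atan_ge_half sT1); rewrite /denom => h.
have h2 : s * (s / T / 2) + T / 2 - s >= 0.
  rewrite (_ : _ - s = (T - s) ^+ 2 / (2 * T)); last by field; rewrite gt_eqF.
  by rewrite divr_ge0 ?sqr_ge0// mulr_ge0 ?(ltW T0).
lra.
Qed.

Lemma denom_gt0 s : 0 <= s <= T -> 0 < denom s.
Proof. by move=> sT; apply: lt_le_trans (denom_ge sT); rewrite divr_gt0. Qed.

Lemma continuous_denom : continuous denom.
Proof.
have d (u : R) : is_derive u 1 denom (kern T u - 1).
  have d1 := is_derive_atan_div u.
  have d2 : is_derive u 1 (fun u : R => T - u) (- 1) by apply: is_derive_eq; ring.
  apply: (is_derive_eq (is_deriveD d2 (is_deriveM (is_derive_id u 1) d1))).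
  by rewrite /GRing.scale/= /kern; field; exact: lt0r_neq0.
exact: is_derive_continuous d.
Qed.

End kernel.

Import HBNNSimple.

Lemma continuous_mul {R : realType} (f g : R -> R) :
  continuous f -> continuous g -> continuous (fun u : R => f u * g u).
Proof. by move=> cf cg u; apply: cvgM; [exact: cf|exact: cg]. Qed.

Section sums_of_diracs.
Context {R : realType} {d : measure_display} {V : measurableType d}.
Variables (mu : {measure set V -> \bar R}) (I : choiceType) (S : set I) (pt : I -> V).
Local Open Scope ereal_scope.
Hypothesis muE : forall A, measurable A -> mu A = \esum_(i in S) \d_(pt i) A.

Lemma esumZl (a : I -> \bar R) (r : R) : (0 <= r)%R -> (forall u, 0 <= a u) ->
  r%:E * (\esum_(u in S) a u) = \esum_(u in S) (r%:E * a u).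
Proof.
move=> r0 a0; rewrite /esum -ereal_supZl//; last first.
  apply/set0P; exists 0; exists set0; first by split => //; exact: finite_set0.
  by rewrite fsbig_set0.
congr ereal_sup; apply/seteqP; split => [_ [_ [X XS <-] <-]|_ [X XS <-]].
  by exists X => //; rewrite ge0_mule_fsumr.
eexists; first by exists X; [exact: XS|reflexivity].
rewrite ge0_mule_fsumr//.
Qed.

(** For simple functions this is an exchange with a finite sum. The increasing limit is then
    compared from above termwise and from below on each finite set of atoms, where limit and sum
    commute. *)
Lemma ge0_integral_esum_dirac (h : V -> \bar R) : measurable_fun setT h ->
  (forall p, 0 <= h p) -> \int[mu]_p h p = \esum_(r in S) h (pt r).
Proof.
move=> mh h0; pose f := nnsfun_approx measurableT mh.
have fh p : (f n p)%:E @[n --> \oo] --> h p.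
  by apply: (@cvg_nnsfun_approx _ _ _ _ measurableT _ mh (fun p _ => h0 p)).
have fm p : nondecreasing_seq (fun n => (f n p)%:E).
  by move=> m n mn; rewrite lee_fin; exact/lefP/nd_nnsfun_approx.
have fle n p : (f n p)%:E <= h p.
  rewrite -(cvg_lim _ (fh p))//; apply: lime_ge; first by apply/cvg_ex; eexists; exact: fh.
  by exists n => // m nm; exact: fm.
have If n : \int[mu]_p (f n p)%:E = \esum_(r in S) (f n (pt r))%:E.
  rewrite integralT_nnsfun sintegralE fsbig_finite//=.
  have y0 y : y \in finmap.enum_fset (fset_set (range (f n))) -> (0 <= y)%R.
    by rewrite in_fset_set// inE => -[p _ <-].
  rewrite (eq_big_seq (fun y => \esum_(r in S) (y%:E * \d_(pt r) (f n @^-1` [set y])))); last first.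
    move=> y yf; rewrite muE//; apply: esumZl; first exact: y0.
    by move=> *; exact: measure_ge0.
  rewrite big_seq -esum_sum; last by move=> i j _ jf; rewrite mule_ge0// lee_fin y0.
  apply: eq_esum => r _; rewrite -big_seq.
  transitivity (sintegral (\d_(pt r)) (f n)).
    by rewrite sintegralE fsbig_finite.
  rewrite -integralT_nnsfun integral_dirac ?diracT ?mul1e//.
  exact/measurable_EFinP.
have cI : \int[mu]_p (f n p)%:E @[n --> \oo] --> \int[mu]_p h p.
  have -> : \int[mu]_p h p = \int[mu]_p limn (fun n => (f n p)%:E).
    by apply: eq_integral => p _; apply/esym/cvg_lim => //; exact: fh.
  apply: cvg_monotone_convergence => //.
  - by move=> n; exact/measurable_EFinP.
  - by move=> n p _; rewrite lee_fin.
apply/eqP; rewrite eq_le; apply/andP; split.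
  rewrite -(cvg_lim _ cI)//; apply: lime_le; first by apply/cvg_ex; eexists; exact: cI.
  apply: nearW => n; rewrite If; apply: le_esum => r _; exact: fle.
apply: ge_ereal_sup => _ [X [finX XS] <-].
rewrite (fsbig_finite _ _ finX)/=.
have cX : \sum_(r <- finmap.enum_fset (fset_set X)) (f n (pt r))%:E @[n --> \oo] -->
    \sum_(r <- finmap.enum_fset (fset_set X)) h (pt r).
  by apply: cvg_nnesum => // r _; apply: nearW => n; rewrite lee_fin.
rewrite -(cvg_lim _ cX)// -(cvg_lim _ cI)//; apply: lee_lim.
- by apply/cvg_ex; eexists; exact: cX.
- by apply/cvg_ex; eexists; exact: cI.
apply: nearW => n; rewrite If; apply: esum_ge; exists X => //.
by rewrite fsbig_finite.
Qed.

End sums_of_diracs.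

Section integrals_along_jumps.
Context {R : realType}.
Local Notation lambda := (@lebesgue_measure R).
Variables (T : R) (x y G : R -> R) (L : R).
Hypotheses (T0 : 0 < T)
  (yr : forall u : R, y s @[s --> u^'+] --> y u)
  (yl : forall u : R, cvg (y s @[s --> u^'-]))
  (G0L : forall u, 0 <= G u <= L)
  (yG : forall s t : R, s <= t -> `|y t - y s| <= G t - G s).
Hypotheses (jxy : forall u, 0 < u <= T -> jump x u = jump y u)
  (jy0 : forall u, ~~ (0 < u <= T) -> jump y u = 0).

Let p0 := jump_pos_ge0 y.
Let n0 := jump_neg_ge0 y.
Let pf := jump_pos_summable yl G0L yG.
Let nf := jump_neg_summable yl G0L yG.

Let pT u : ~~ (0 < u <= T) -> (jump y)^\+ u = 0.
Proof. by move=> uT; rewrite /funrpos jy0// maxxx. Qed.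

Let nT u : ~~ (0 < u <= T) -> (jump y)^\- u = 0.
Proof. by move=> uT; rewrite /funrneg jy0// oppr0 maxxx. Qed.

(** The integral of [f (u) * jump] over the jumps up to [s], split by the sign of the jump because
    the underlying sums are of nonnegative terms. Here [y] stands for the regularized path, whose
    jumps vanish outside []0, T]], and [x] for the original one. *)
Definition weighted_jumps (f : R -> R) (s : R) : R :=
  jump_sum (fun u => f u * (jump y)^\+ u) s - jump_sum (fun u => f u * (jump y)^\- u) s.

Lemma weighted_jumps_by_parts (f df : R -> R) s :
  (forall u : R, is_derive u 1 f (df u)) -> continuous df ->
  (forall u, 0 <= u <= T -> 0 <= f u) -> 0 <= s <= T ->
  weighted_jumps f s + \int[lambda]_(u in `[0, s]) (df u * path_jumps y u) =
  f s * path_jumps y s.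
Proof.
move=> dF cdf f0 sT.
have h1 := jump_sum_by_parts p0 pf pT dF cdf f0 sT.
have h2 := jump_sum_by_parts n0 nf nT dF cdf f0 sT.
have [M dfM] := continuous_itv_bounded (ltW T0) (continuous_subspaceT cdf).
have mdf := continuous_measurable_fun cdf.
have ig (a : R -> R) (a0 : forall u, 0 <= a u) (af : (\esum_(u in [set: R]) (a u)%:E < +oo)%E) :
    lambda.-integrable `[0, s] (EFin \o (fun u => df u * jump_sum a u)).
  apply: (@bounded_integrable_itv _ _ _ _ (M * jump_total a)).
    by apply: measurable_funM => //; exact: measurable_jump_sum.
  move=> u /andP[u0 us]; rewrite normrM; apply: ler_pM => //.
    by apply: dfM; rewrite u0 (le_trans us)//; case/andP: sT.
  by rewrite ger0_norm ?jump_sum_ge0// jump_sum_le.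
rewrite /weighted_jumps (_ : \int[lambda]_(u in `[0, s]) (df u * path_jumps y u) =
   \int[lambda]_(u in `[0, s]) (df u * jump_sum (jump y)^\+ u - df u * jump_sum (jump y)^\- u)).
  rewrite RintegralB ?ig//; rewrite /path_jumps; move: h1 h2; lra.
by apply: eq_Rintegral => u _; rewrite mulrBr.
Qed.

Lemma summable_mul (g a : R -> R) (M : R) : 0 <= M -> (forall u, 0 <= a u) ->
  (forall u, g u * a u <= M * a u) ->
  (\esum_(u in [set: R]) (a u)%:E < +oo)%E ->
  (\esum_(u in [set: R]) (g u * a u)%:E < +oo)%E.
Proof.
move=> M0 a0 ga af; apply: (@le_lt_trans _ _ (M * jump_total a)%:E); last exact: ltry.
apply: esum_le_bound => F uF _; apply: (@le_trans _ _ (M * \sum_(r <- F) a r)).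
  by rewrite mulr_sumr; apply: ler_sum.
rewrite ler_wpM2l// -lee_fin /jump_total fineK; first exact: esum_seq_ge.
by rewrite ge0_fin_numE// esum_ge0// => u _; rewrite lee_fin.
Qed.

Lemma jump_measure_integral (g : R -> R) s : continuous g ->
  (forall u, 0 <= u <= T -> 0 <= g u) -> 0 <= s <= T ->
  \int[jump_measure T x]_(p in `]0, s] `*` setT) (g p.1 * p.2) = weighted_jumps g s.
Proof.
move=> cg g0 /andP[s0 sT].
have [M gM] := continuous_itv_bounded (ltW T0) (continuous_subspaceT cg).
have M0 : 0 <= M by apply: le_trans (gM 0 _); rewrite ?lexx ?(ltW T0).
have mg := continuous_measurable_fun cg.
have mh : measurable_fun setT (fun p : R * R => g p.1 * p.2).
  by apply: measurable_funM => //; exact: measurableT_comp.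
have mD : measurable (`]0, s]%classic `*` [set: R]).
  by apply: measurableX => //; exact: measurable_itv.
pose F (p : R * R) := g p.1 * p.2.
pose D : set (R * R) := `]0, s]%classic `*` setT; rewrite -/D in mD *.
(* Applied once with the positive parts of the integrand and of the jumps, once with the negative
   ones; they correspond because [g] is nonnegative on [[0, T]]. Null jumps are absent from
   [jump_times] and contribute 0 on the other side. *)
have key (a : R -> R) (h : R * R -> R) : measurable_fun setT h -> (forall p, 0 <= h p) ->
    (forall u, 0 <= a u) -> (forall u, ~~ (0 < u <= T) -> a u = 0) ->
    (\esum_(u in [set: R]) (a u)%:E < +oo)%E ->
    (forall u, 0 < u <= T -> jump y u = 0 -> a u = 0) ->
    (forall u, 0 < u <= T -> h (u, jump x u) = g u * a u) ->
    (\int[jump_measure T x]_(p in D) (h p)%:E = (jump_sum (fun u => g u * a u) s)%:E)%E.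
  move=> mh' h0 a0 aT af aj ha.
  have ga0 u : 0 <= g u * a u.
    have [uT|uT] := boolP (0 < u <= T); last by rewrite aT ?mulr0.
    by rewrite mulr_ge0// g0//; have /andP[/ltW -> ->] := uT.
  have gaM u : g u * a u <= M * a u.
    have [uT|uT] := boolP (0 < u <= T); last by rewrite aT ?mulr0.
    rewrite ler_wpM2r// (le_trans (ler_norm _))// gM//.
    by have /andP[/ltW -> ->] := uT.
  have gaf := summable_mul M0 a0 gaM af.
  rewrite integral_mkcond (@ge0_integral_esum_dirac _ _ _ _ _ (jump_times T x) (fun r => (r, jump x r)))//; last 2 first.
  - by apply/(measurable_restrictT _ mD); apply/measurable_funTS; exact/measurable_EFinP.
  - by move=> p; rewrite patchE; case: ifP => // _; rewrite lee_fin.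
  rewrite /jump_sum fineK; last first.
    rewrite ge0_fin_numE; first exact: le_lt_trans (le_esum_subset (@subsetT _ _) ga0) gaf.
    by apply: esum_ge0 => u _; rewrite lee_fin.
  rewrite esum_mkcond [RHS]esum_mkcond; apply: eq_esum => u _.
  have [uT|uT] := boolP (0 < u <= T); last first.
    rewrite aT// mulr0 if_same; case: ifP => // /set_mem[uT' _]; by rewrite uT' in uT.
  have mem1 : ((u, jump x u) \in D) = (u <= s).
    rewrite /D; apply/idP/idP; rewrite inE /= in_itv/=; first by move=> [/andP[]].
    by move=> us; split => //; rewrite us andbT; have /andP[] := uT.
  have mem2 : (u \in [set u | (u <= s)%R]) = (u <= s) by apply/idP/idP; rewrite inE.
  rewrite patchE mem1 mem2 /= ha//.
  have [j0|j0] := eqVneq (jump x u) 0.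
    have -> : u \in jump_times T x = false.
      by apply/negP => /set_mem[_]; rewrite j0 eqxx.
    by case: ifP => // _; rewrite aj ?mulr0// -jxy.
  by have -> : u \in jump_times T x by apply/mem_set.
have Fp : (fun p => F p)^\+ = fun p => Num.max (F p) 0 by [].
rewrite /Rintegral integralE.
have mF : measurable_fun setT F by [].
have EP : (\int[jump_measure T x]_(p in D) (EFin \o F)^\+ p =
    (jump_sum (fun u => g u * (jump y)^\+ u) s)%:E)%E.
  rewrite -(key (jump y)^\+ (fun p => Num.max (F p) 0))//.
  - by apply: eq_integral => p _; rewrite funeposE/= EFin_max.
  - exact: (measurable_funrpos mF).
  - by move=> p; rewrite le_max lexx orbT.
  - by move=> u _ ju; rewrite /funrpos ju maxxx.
  - move=> u uT; have gu : 0 <= g u by apply: g0; have /andP[/ltW -> ->] := uT.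
    by rewrite /F /= jxy// /funrpos maxr_pMr// mulr0.
have EN : (\int[jump_measure T x]_(p in D) (EFin \o F)^\- p =
    (jump_sum (fun u => g u * (jump y)^\- u) s)%:E)%E.
  rewrite -(key (jump y)^\- (fun p => Num.max (- F p) 0))//.
  - by apply: eq_integral => p _; rewrite funenegE/= EFin_max.
  - exact: (measurable_funrneg mF).
  - by move=> p; rewrite le_max lexx orbT.
  - by move=> u _ ju; rewrite /funrneg ju oppr0 maxxx.
  - move=> u uT; have gu : 0 <= g u by apply: g0; have /andP[/ltW -> ->] := uT.
    by rewrite /F /= jxy// /funrneg -mulrN maxr_pMr// mulr0.
by rewrite EP EN.
Qed.

Lemma jump_ratio_sum_path (e : R -> R) s :
  (forall u, 0 < u <= T -> jump e u = u / T * jump y u) -> 0 <= s <= T ->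
  jump_ratio_sum e s = path_jumps y s / T.
Proof.
move=> je /andP[s0 sT].
have key (a g : R -> R) : (forall u, 0 <= a u) -> (forall u, ~~ (0 < u <= T) -> a u = 0) ->
    (forall u, 0 < u <= s -> g u = T^-1 * a u) ->
    fine (\esum_(u in `]0, s]) (g u)%:E) = T^-1 * jump_sum a s.
  move=> a0 aT ga; have Ti : 0 <= T^-1 by rewrite invr_ge0 ltW.
  transitivity (fine ((T^-1)%:E * (\esum_(u in [set u : R | (u <= s)%R]) (a u)%:E))%E).
    rewrite esumZl//; congr fine; rewrite esum_mkcond [RHS]esum_mkcond; apply: eq_esum => u _.
    have -> : (u \in [set u : R | (u <= s)%R]) = (u <= s) by apply/idP/idP; rewrite inE.
    rewrite mem_setE in_itv/=; have [u0|u0] := ltP 0 u; last first.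
      by rewrite /= aT ?mule0 ?if_same// negb_and -leNgt u0.
    by rewrite /=; have [us|//] := leP u s; rewrite ga ?u0 ?us.
  (* [fine] sends infinite values to 0, so the scaling is checked without discussing summability. *)
  rewrite /jump_sum; set E := esum _ _; case: E => [r||] //=; rewrite ?mulr0.
    by rewrite mulry; case: (sgrP T^-1) => //=; rewrite ?mul0e//= ?mul1e// mulN1e.
  by rewrite mulrNy; case: (sgrP T^-1) => //=; rewrite ?mul0e//= ?mul1e// mulN1e.
have je' u : 0 < u <= s -> jump e u / u = T^-1 * jump y u.
  move=> /andP[u0 us]; rewrite je ?u0 ?(le_trans us)//; field; rewrite !gt_eqF//.
rewrite /jump_ratio_sum /abs_sum (key (jump y)^\+)//; last first.
  by move=> u us; rewrite /funrpos je'// maxr_pMr ?mulr0 ?invr_ge0 ?(ltW T0).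
rewrite (key (jump y)^\-)//; last first.
  by move=> u us; rewrite /funrneg je'// -mulrN maxr_pMr ?mulr0 ?invr_ge0 ?(ltW T0).
by rewrite /path_jumps; ring.
Qed.

Let J := path_jumps y.

Let mJ : measurable_fun setT J.
Proof. exact: measurable_path_jumps yl G0L yG. Qed.

Let JK u : `|J u| <= jump_total (jump y)^\+ + jump_total (jump y)^\-.
Proof. exact: path_jumps_norm_le yl G0L yG u. Qed.

Let iJ (f : R -> R) s : continuous f -> 0 <= s ->
  lambda.-integrable `[0, s] (EFin \o (fun u => f u * J u)).
Proof.
move=> cf s0; have [M fM] := continuous_itv_bounded s0 (continuous_subspaceT cf).
apply: (@bounded_integrable_itv _ _ _ _ (M * (jump_total (jump y)^\+ + jump_total (jump y)^\-))).
  by apply: measurable_funM => //; exact: continuous_measurable_fun.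
by move=> u us; rewrite normrM ler_pM// fM.
Qed.

(* [z |-> kern T s * z s - int_0^s z kern'] is the integration by parts form of
   [int_0^s kern dz]. *)
Definition kern_int (z : R -> R) (s : R) : R :=
  kern T s * z s - \int[lambda]_(u in `[0, s]) (z u * kern' T u).

(** With [e = xi + u / T * (b * u + J)], the integrals of [J] against [u * kern'] and [kern] coming
    from [i] and the jump measure cancel those of the time integrals, and likewise in the second
    bracket. The terms in [b] reduce to the integral of [u * kern], whose closed form is compensated
    by the last line of [frakR]. *)
Lemma frakR_path (b : R) (e i xi : R -> R) s : 0 <= s <= T -> continuous xi ->
  (forall u, 0 < u <= T -> jump e u = u / T * jump y u) ->
  (forall u, 0 <= u <= T -> e u = xi u + u / T * (b * u + J u)) ->
  i s = kern_int e s ->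
  frakR T b x e i s = ((T - s) * kern_int xi s + s * atan (s / T) * xi s) / denom T s.
Proof.
move=> sT cxi je eE iE; have /andP[s0 sT'] := sT.
have cid : continuous (fun u : R => u) by move=> u; exact: cvg_id.
have ck := continuous_kern T0; have ck' := continuous_kern' T0.
have cuk : continuous (fun u : R => u * kern T u) by exact: is_derive_continuous (is_derive_mul_kern T0).
have csq : continuous (fun u : R => u ^+ 2) by move=> u; exact: exprn_continuous.
have cuk' : continuous (fun u : R => u * kern' T u) by exact: continuous_mul.
have cm (c : R) (f : R -> R) : continuous f -> continuous (fun u : R => c * f u).
  by move=> cf u; apply: cvgMr; exact: cf.
have D0 := denom_gt0 T0 sT.
have kg0 u : 0 <= u <= T -> 0 <= u * kern T u.
  by move=> /andP[u0 _]; rewrite mulr_ge0// kern_ge0.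
have JR u : 0 <= u <= s -> jump_ratio_sum e u = J u / T.
  by move=> /andP[u0 us]; apply: jump_ratio_sum_path => //; rewrite u0 (le_trans us).
(* the three occurrences of the jump measure, after integration by parts *)
have W1 : weighted_jumps (fun u : R => u * kern T u) s =
    s * kern T s * J s - \int[lambda]_(u in `[0, s]) ((u * kern' T u + kern T u) * J u).
  apply/eqP; rewrite eq_sym subr_eq; apply/eqP/esym.
  apply: weighted_jumps_by_parts => //; first exact: is_derive_mul_kern.
  by move=> u; apply: cvgD; [exact: cuk'|exact: ck].
have W2 : weighted_jumps (fun u : R => T^-1 * u) s =
    T^-1 * s * J s - \int[lambda]_(u in `[0, s]) (T^-1 * J u).
  apply/eqP; rewrite eq_sym subr_eq; apply/eqP/esym.
  apply: weighted_jumps_by_parts => //.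
  - by move=> u; apply: is_derive_eq; rewrite /GRing.scale/=; ring.
  - by move=> u; exact: cvg_cst.
  - by move=> u /andP[u0 _]; rewrite mulr_ge0// invr_ge0 ltW.
have E1 : \int[jump_measure T x]_(p in `]0, s] `*` setT)
    ((T * p.1 ^+ 2 / (p.1 ^+ 2 + T ^+ 2) + p.1 * atan (p.1 / T)) * p.2) =
    weighted_jumps (fun u : R => u * kern T u) s.
  rewrite -jump_measure_integral//; apply: eq_Rintegral => p _; congr (_ * _).
  by rewrite /kern; ring.
have E2 : \int[jump_measure T x]_(p in `]0, s] `*` setT) (p.1 * p.2 / T) =
    weighted_jumps (fun u : R => T^-1 * u) s.
  rewrite -jump_measure_integral//; first by apply: eq_Rintegral => p _; ring.
    by apply: cm.
  by move=> u /andP[u0 _]; rewrite mulr_ge0// invr_ge0 ltW.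
have Ik : \int[lambda]_(u in `[0, s]) (u * kern T u) =
    (s ^+ 2 - T ^+ 2) / 2 * atan (s / T) + T * s / 2.
  rewrite (Rintegral_FTC s0 (is_derive_kern_primitive T0) cuk).
  by rewrite mul0r atan0; ring.
have Iuk : \int[lambda]_(u in `[0, s]) (u ^+ 2 * kern' T u) =
    s ^+ 2 * kern T s - 2 * \int[lambda]_(u in `[0, s]) (u * kern T u).
  have cF : continuous (fun u : R => 2 * (u * kern T u) + u ^+ 2 * kern' T u).
    move=> u; apply: cvgD; first exact: (cm 2 _ cuk).
    exact: (continuous_mul csq ck').
  have dF (u : R) : is_derive u 1 (fun u : R => u ^+ 2 * kern T u) (2 * (u * kern T u) + u ^+ 2 * kern' T u).
    have d1 : is_derive u 1 (fun u : R => u ^+ 2) (2 * u).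
      by apply: is_derive_eq; rewrite /GRing.scale/=; ring.
    apply: (is_derive_eq (is_deriveM d1 (is_derive_kern T0 u))).
    by rewrite /GRing.scale/=; ring.
  have := Rintegral_FTC s0 dF cF; rewrite expr0n/= mul0r subr0 => <-.
  have c2 : continuous (fun u : R => u ^+ 2 * kern' T u).
    exact: continuous_mul.
  rewrite RintegralD ?RintegralZl//; try exact: continuous_integrable_itv.
    by ring.
  by apply: continuous_integrable_itv; apply: cm.
have Ie : kern_int e s = kern_int xi s + b / T * (2 * \int[lambda]_(u in `[0, s]) (u * kern T u)) +
    kern T s * s / T * J s - T^-1 * \int[lambda]_(u in `[0, s]) (u * kern' T u * J u).
  rewrite /kern_int eE// (_ : \int[lambda]_(u in `[0, s]) (e u * kern' T u) =
     \int[lambda]_(u in `[0, s]) (xi u * kern' T u + b / T * (u ^+ 2 * kern' T u) + T^-1 * (u * kern' T u * J u))).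
    have c1 : continuous (fun u : R => xi u * kern' T u) by exact: continuous_mul.
    have c2 : continuous (fun u : R => u ^+ 2 * kern' T u).
      exact: continuous_mul.
    have i1 := @continuous_integrable_itv _ _ 0 s c1.
    have i2 := @continuous_integrable_itv _ _ 0 s c2.
    have i3 := iJ cuk' s0.
    rewrite RintegralD//; [|by apply: L1D => //; exact: L1Z|exact: L1Z].
    rewrite RintegralD//; last exact: L1Z.
    rewrite !RintegralZl// Iuk; field; exact: lt0r_neq0.
  apply: eq_Rintegral => u; rewrite inE/= in_itv/= => /andP[u0 us].
  by rewrite eE ?u0 ?(le_trans us)//; field; exact: lt0r_neq0.
have Jk : \int[lambda]_(u in `[0, s]) (kern T u * jump_ratio_sum e u) =
    T^-1 * \int[lambda]_(u in `[0, s]) (kern T u * J u).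
  rewrite -RintegralZl//; last exact: iJ.
  by apply: eq_Rintegral => u; rewrite inE/= in_itv/= => us; rewrite JR//; ring.
have J1 : \int[lambda]_(u in `[0, s]) jump_ratio_sum e u = \int[lambda]_(u in `[0, s]) (T^-1 * J u).
  by apply: eq_Rintegral => u; rewrite inE/= in_itv/= => us; rewrite JR//; ring.
have Isum : \int[lambda]_(u in `[0, s]) ((u * kern' T u + kern T u) * J u) =
    \int[lambda]_(u in `[0, s]) (u * kern' T u * J u) + \int[lambda]_(u in `[0, s]) (kern T u * J u).
  rewrite -RintegralD//; try exact: iJ.
  by apply: eq_Rintegral => u _; rewrite mulrDl.
rewrite /frakR E1 E2 W1 W2 Jk J1 iE Ie Ik Isum eE//.
rewrite -[T - s + _]/(denom T s).
have Dn : denom T s != 0 by rewrite gt_eqF.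
have Tn : T != 0 by rewrite gt_eqF.
move: (\int[lambda]_(u in _) (u * kern' T u * J u)) (\int[lambda]_(u in _) (kern T u * J u)) => I1 I2.
move: (\int[lambda]_(u in _) (T^-1 * J u)) => I3.
move: (kern_int xi s) (kern T s) (J s) (xi s) => KI k Js xs.
by move: Dn; rewrite /denom; move: (atan (s / T)) => A Dn; field; rewrite Tn Dn.
Qed.

End integrals_along_jumps.

(** * The stochastic integral of the kernel *)

Section stieltjes.
Context {R : realType}.
Local Notation lambda := (@lebesgue_measure R).

Lemma Rintegral_itv_split (f : R -> R) (a v w : R) : a <= v -> v <= w ->
  lambda.-integrable `[a, w] (EFin \o f) ->
  \int[lambda]_(u in `[a, w]) f u = \int[lambda]_(u in `[a, v]) f u + \int[lambda]_(u in `[v, w]) f u.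
Proof.
move=> av vw if_; apply/eqP; rewrite addrC -subr_eq; apply/eqP.
rewrite Rintegral_itvB ?bnd_simp//.
rewrite Rintegral_itv_obnd_cbnd//; apply: integrableS if_ => //.
by move=> u /=; rewrite !in_itv/= => /andP[h ->]; rewrite (ltW (le_lt_trans av h)).
Qed.

(** On a cell the error is the integral of [(z (right end) - z u) * df u]. It is bounded by the mesh
    times a bound on [df] times the oscillation of [c] plus the growth of [H]. Summed up, the first
    part is small by uniform continuity and the second is of order [(H b - H a) / n]. *)
Lemma stieltjes_by_parts (z c y H f df : R -> R) (a b : R) : a <= b ->
  continuous c -> (forall s t : R, s <= t -> `|y t - y s| <= H t - H s) ->
  (forall u, z u = c u + y u) -> measurable_fun setT z ->
  (forall u : R, is_derive u 1 f (df u)) -> continuous df ->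
  \sum_(i < n) f (subdiv a b n i) * (z (subdiv a b n i.+1) - z (subdiv a b n i)) @[n --> \oo] -->
  f b * z b - f a * z a - \int[lambda]_(u in `[a, b]) (z u * df u).
Proof.
move=> ab cc yH zE mz dF cdf.
have [M dfM] := continuous_itv_bounded ab (continuous_subspaceT cdf).
have M0 : 0 <= M by apply: le_trans (dfM a _); rewrite ?lexx.
have Hm (s t : R) : s <= t -> H s <= H t by move=> st; rewrite -subr_ge0 (le_trans _ (yH _ _ st)).
have [K cK] := continuous_itv_bounded ab (continuous_subspaceT cc).
pose K' := K + (`|y a| + (H b - H a)).
have zK u : a <= u <= b -> `|z u| <= K'.
  move=> /andP[au ub]; rewrite zE; apply: le_trans (ler_normD _ _) _; apply: lerD.
    by apply: cK; rewrite au.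
  rewrite -[y u](subrK (y a)) addrC; apply: le_trans (ler_normD _ _) _; rewrite lerD2l.
  by apply: (le_trans (yH _ _ au)); rewrite lerB// Hm.
have mdf := continuous_measurable_fun cdf.
have mzd : measurable_fun setT (fun u => z u * df u) by exact: measurable_funM.
have izd (v w : R) : a <= v -> w <= b -> lambda.-integrable `[v, w] (EFin \o (fun u => z u * df u)).
  move=> av wb; apply: (@bounded_integrable_itv _ _ _ _ (K' * M)) => // u /andP[vu uw].
  have uab : a <= u <= b by rewrite (le_trans av vu) (le_trans uw wb).
  by rewrite normrM ler_pM ?zK ?dfM.
pose F (v : R) := \int[lambda]_(u in `[a, v]) (z u * df u).
have F0 : F a = 0 by rewrite /F set_itv1 Rintegral_set1.
have FB (v w : R) : a <= v -> v <= w -> w <= b -> F w - F v = \int[lambda]_(u in `[v, w]) (z u * df u).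
  by move=> av vw wb; rewrite /F (Rintegral_itv_split av vw) ?izd// addrC addKr.
apply/cvgrPdist_le => e e0.
pose Cst := M * (b - a).
have C0 : 0 <= Cst by rewrite mulr_ge0// subr_ge0.
have e1 : 0 < e / (2 * (Cst + 1)) by rewrite divr_gt0// mulr_gt0// ltr_wpDl.
have e2 : 0 < e / 2 by lra.
have /cvgrPdist_le/(_ _ e2) hn := cvg_div_natr (Cst * (H b - H a)).
near=> n.
have n0 : (0 < n)%N by near: n; exact: nbhs_infty_gt.
have nr : 0 < n%:R :> R by rewrite ltr0n.
have cell : forall i u, (i < n)%N -> subdiv a b n i <= u <= subdiv a b n i.+1 ->
    `|c (subdiv a b n i.+1) - c u| <= e / (2 * (Cst + 1)).
  by near: n; exact: continuous_subdiv_cell.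
have small : Cst * (H b - H a) / n%:R <= e / 2.
  rewrite (le_trans (ler_norm _))// -normrN -sub0r; near: n; exact: hn.
pose t := subdiv a b n.
have tel (g : R -> R) : \sum_(i < n) (g (t i.+1) - g (t i)) = g b - g a.
  rewrite -(big_mkord predT (fun i => g (t i.+1) - g (t i))).
  by rewrite (telescope_sumr (fun i => g (t i)))// /t subdiv0 subdivn.
rewrite (_ : f b * z b - f a * z a - _ = \sum_(i < n) ((f (t i.+1) * z (t i.+1) - F (t i.+1)) - (f (t i) * z (t i) - F (t i)))); last first.
  by rewrite (tel (fun u => f u * z u - F u)) F0 -/(F b); ring.
rewrite -sumrB; apply: le_trans (ler_norm_sum _ _ _) _.
apply: (@le_trans _ _ (\sum_(i < n) (M * (b - a) / n%:R * (e / (2 * (Cst + 1))) + M * (b - a) / n%:R * (H (t i.+1) - H (t i))))); last first.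
  rewrite big_split/= -[X in _ + X]mulr_sumr (tel H) sumr_const card_ord -[X in X + _]mulr_natr.
  rewrite (_ : _ * n%:R = Cst * e / (2 * (Cst + 1))); last first.
    by rewrite /Cst; field; rewrite !gt_eqF// ltr_wpDl.
  have : Cst * e / (2 * (Cst + 1)) <= e / 2.
    rewrite ler_pdivrMr ?mulr_gt0 ?ltr_wpDl//; nra.
  move: small; rewrite /Cst mulrAC; lra.
apply: ler_sum => i _.
have ti : t i <= t i.+1 by exact: subdiv_mono.
have /andP[ai _] : a <= t i <= b by apply: subdiv_itv => //; exact: ltnW.
have /andP[_ bi] : a <= t i.+1 <= b by exact: subdiv_itv.
have zi : \int[lambda]_(u in `[t i, t i.+1]) (z (t i.+1) * df u) = z (t i.+1) * (f (t i.+1) - f (t i)).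
  by rewrite RintegralZl ?(Rintegral_FTC ti dF cdf)//; exact: continuous_integrable_itv.
rewrite (_ : _ - _ = \int[lambda]_(u in `[t i, t i.+1]) (z (t i.+1) * df u) -
    \int[lambda]_(u in `[t i, t i.+1]) (z u * df u)); last first.
  by rewrite zi -FB//; ring.
rewrite -RintegralB//; last 2 first.
- by apply: L1Z => //; exact: continuous_integrable_itv.
- exact: izd.
rewrite [leRHS](_ : _ = (M * (e / (2 * (Cst + 1)) + (H (t i.+1) - H (t i)))) * (t i.+1 - t i)); last first.
  by rewrite /t subdivS; ring.
apply: Rintegral_itv_norm_le => //.
  by apply: measurable_funB => //; exact: measurable_funM.
move=> u /andP[iu ui]; rewrite -mulrBl mulrC normrM; apply: ler_pM => //.
  by apply: dfM; rewrite (le_trans ai iu) (le_trans ui bi).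
rewrite !zE (_ : _ - _ = (c (t i.+1) - c u) + (y (t i.+1) - y u)); last ring.
apply: le_trans (ler_normD _ _) _; apply: lerD; first by apply: cell; rewrite ?iu.
by apply: (le_trans (yH _ _ ui)); rewrite lerB// Hm.
Unshelve. all: by end_near. Qed.

Lemma right_continuous_eq (T : R) (z z' : R -> R) :
  (forall q : rat, 0 <= (ratr q : R) <= T -> z (ratr q) = z' (ratr q)) -> z T = z' T ->
  (forall t : R, 0 <= t < T -> z s @[s --> t^'+] --> z t) ->
  (forall t : R, 0 <= t < T -> z' s @[s --> t^'+] --> z' t) ->
  forall t, 0 <= t <= T -> z t = z' t.
Proof.
move=> zq zT rz rz' t /andP[t0]; rewrite le_eqVlt => /predU1P[->//|tT].
have tt : 0 <= t < T by rewrite t0.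
apply/eqP; rewrite -subr_eq0 -normr_le0; apply/ler_addgt0Pr => e e0; rewrite add0r.
have e2 : 0 < e / 2 by lra.
have /cvgrPdist_le/(_ _ e2) h1 := rz _ tt; have /cvgrPdist_le/(_ _ e2) h2 := rz' _ tt.
have : \forall s \near t^'+, `|z t - z s| <= e / 2 /\ `|z' t - z' s| <= e / 2.
  by near=> s; split; [near: s; exact: h1|near: s; exact: h2].
move=> [r /= r0 Hr].
have tr : t < Num.min (t + r) T by rewrite lt_min tT ltrDl r0.
have [q] := rat_in_itvoo tr; rewrite in_itv/= lt_min => /and3P[tq qr qT].
have [|k1 k2] := Hr (ratr q) _ tq.
  by rewrite /ball_/= distrC gtr0_norm ?subr_gt0//; lra.
have zz : z (ratr q) = z' (ratr q) by apply: zq; rewrite (ltW qT) (le_trans t0 (ltW tq)).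
rewrite (_ : _ - _ = (z t - z (ratr q)) - (z' t - z' (ratr q))); last by rewrite zz; ring.
by apply: le_trans (ler_normB _ _) _; lra.
Unshelve. all: by end_near. Qed.

End stieltjes.

Section almost_sure.
Context {R : realType} {d : measure_display} {Omega : measurableType d}.
Variable P : probability Omega R.

(** The exceptional sets are united over the rationals of [[0, T]] and the end point [T], which no
    right limit within the interval reaches. *)
Lemma ae_all_times (T : R) (Z Z' : R -> Omega -> R) : 0 < T ->
  (forall t, 0 <= t <= T -> {ae P, forall w, Z t w = Z' t w}) ->
  {ae P, forall w, forall t : R, 0 <= t < T -> Z s w @[s --> t^'+] --> Z t w} ->
  {ae P, forall w, forall t : R, 0 <= t < T -> Z' s w @[s --> t^'+] --> Z' t w} ->
  {ae P, forall w, forall t, 0 <= t <= T -> Z t w = Z' t w}.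
Proof.
move=> T0 ZZ rZ rZ'.
have hq : {ae P, forall w, forall n, forall q : rat, unpickle n = Some q -> 0 <= (ratr q : R) <= T ->
    Z (ratr q) w = Z' (ratr q) w}.
  apply/ae_foralln => n; case: (unpickle n) => [q|]; last exact: aeW.
  have [qT|qT] := boolP (0 <= (ratr q : R) <= T); last first.
    by apply: aeW => w q' [<-] h; rewrite h in qT.
  by have := ZZ _ qT; apply: filterS => w h q' [<-].
have hT := ZZ T _.
have : {ae P, forall w, Z T w = Z' T w} by apply: hT; rewrite ltW ?lexx.
move=> /(filterI hq); move: rZ rZ'; apply: filterS3 => w rz rz' [hq' hT'].
apply: right_continuous_eq => // q; apply: (hq' (pickle q)); exact: pickleK.
Qed.

(** Convergence in probability provides for all [m] and large [n] an event of probability at most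
    [1 / (m + 1)] off which the processes are close. If the almost sure limit differed from [U t],
    these events would have to occur; [iterated_fatou] applied to their indicators excludes it. *)
Lemma ucp_cvg_ae (D : set R) (U_ : nat -> R -> Omega -> R) (U : R -> Omega -> R)
    (V : Omega -> R) (t : R) :
  D t -> ucp_cvg P D U_ U -> {ae P, forall w, U_ n t w @[n --> \oo] --> V w} ->
  {ae P, forall w, U t w = V w}.
Proof.
move=> Dt ucp UV.
have key (e : R) : 0 < e -> {ae P, forall w, `|U t w - V w| <= e}.
  move=> e0; have e2 : 0 < e / 2 by lra.
  pose Q m n (A : set Omega) := [/\ measurable A, (P A <= (m.+1%:R^-1)%:E)%E &
    forall w, ~ A w -> forall t, D t -> `|U_ n t w - U t w| <= e / 2].
  (* The default [set0] keeps the chosen event measurable for those small [n] at which none is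
     provided. *)
  pose A m n := xget set0 (Q m n).
  have mA m n : measurable (A m n).
    by rewrite /A; case: xgetP => [B _ []|_].
  pose g w : R := (~~ (`|U t w - V w| <= e))%:R.
  suff : {ae P, forall w, g w = 0}.
    by apply: filterS => w; rewrite /g; case: (`|U t w - V w| <= e) => //= /eqP; rewrite oner_eq0.
  apply: (@iterated_fatou _ _ _ P (fun m n => \1_(A m n))) => //.
  - move=> eps eps0; near=> m.
    have m0 : 0 < m.+1%:R^-1 :> R by rewrite invr_gt0.
    have em : m.+1%:R^-1 <= eps.
      rewrite invf_ple ?posrE//; apply: (@le_trans _ _ m%:R); last by rewrite ler_nat.
      by near: m; exact: nbhs_infty_ger.
    have := ucp _ _ e2 m0; apply: filterS => n [B QB].
    rewrite integral_indic// setIT; have : Q m n (A m n) by rewrite /A; exact: (xgetI set0 QB).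
    by move=> [_ h _]; apply: (le_trans h); rewrite lee_fin.
  move: UV; apply: filterS => w UV eps eps0; near=> m.
  have m0 : 0 < m.+1%:R^-1 :> R by rewrite invr_gt0.
  have := ucp _ _ e2 m0; move/cvgrPdist_le : UV => /(_ _ e2); apply: filterS2 => n h [B QB].
  have [_ _ qa] : Q m n (A m n) by rewrite /A; exact: (xgetI set0 QB).
  rewrite /g indicE; have [wA|/negP wA] := boolP (w \in A m n).
    by case: (_ <= e); rewrite /=; lra.
  have := qa w (fun h => wA (mem_set h)) t Dt; rewrite distrC => h2.
  have -> : `|U t w - V w| <= e.
    rewrite (_ : _ - _ = (U t w - U_ n t w) - (V w - U_ n t w)); last ring.
    by apply: le_trans (ler_normB _ _) _; lra.
  by rewrite /=; lra.
have : {ae P, forall w, forall n, `|U t w - V w| <= n.+1%:R^-1}.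
  by apply/ae_foralln => n; apply: key; rewrite invr_gt0.
apply: filterS => w h; apply/eqP; rewrite -subr_eq0 -normr_le0.
apply/ler_addgt0Pr => e e0; rewrite add0r.
near \oo => n; apply: le_trans (h n) _; rewrite invf_ple ?posrE//.
apply: (@le_trans _ _ n%:R); last by rewrite ler_nat.
by near: n; exact: nbhs_infty_ger.
Unshelve. all: by end_near. Qed.

Section kern_integral.
Variables (T : R) (F : R -> set (set Omega)) (eta : R -> Omega -> R).
Hypotheses (T0 : 0 < T) (F0 : forall t, F t set0) (FT : forall t, F t setT).

Let const_stopping (c : R) : 0 <= c <= T -> stopping_time T F (fun=> c).
Proof.
move=> cT; split => // t _; have [ct|tc] := leP c t.
  by rewrite (_ : [set w | _] = setT)//; apply/seteqP; split.
by rewrite (_ : [set w | _] = set0)//; apply/seteqP; split.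
Qed.

Let const_measurable (c k : R) : measurable_wrt (stopped_sigma T F (fun=> c)) (fun=> k).
Proof.
move=> C mC t tT; rewrite (_ : _ `&` _ = if (c <= t) && (k \in C) then setT else set0).
  by case: ifP.
have [ct|tc] := leP c t; last by apply/seteqP; split => // w [].
have [kC|kC] := boolP (k \in C); apply/seteqP; split => //= w.
  by split => //; exact: set_mem.
by move=> [h _]; rewrite (mem_set (h : C k)) in kC.
Qed.

Let tgrid n i : (i <= n)%N -> 0 <= subdiv 0 T n i <= T.
Proof. by apply: subdiv_itv; exact: ltW. Qed.

(** Times and coefficients are deterministic, so all measurability conditions reduce to [set0] and
    [setT] belonging to each [F t]. *)
Definition grid_predictable (n : nat) : simple_predictable T F :=
  @SimplePredictable _ _ _ T F n (fun i _ => subdiv 0 T n i)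
    (fun i _ => kern T (subdiv 0 T n i))
    (fun i ni => const_stopping (tgrid ni))
    (fun i w _ => subdiv_mono n i (ltW T0))
    (fun i _ => const_measurable _ _).

(** A time in []0, T]] lies in exactly one cell, whose left end carries the coefficient. The
    approximation is uniform and free of chance, so the exceptional event is empty. *)
Lemma grid_predictable_ucp :
  ucp_cvg P `]0, T] (fun n => simple_eval (grid_predictable n)) (fun u _ => kern T u).
Proof.
move=> e del e0 del0; have e2 : 0 < e / 2 by lra.
near=> n.
have n0 : (0 < n)%N by near: n; exact: nbhs_infty_gt.
have cell : forall i u, (i < n)%N -> subdiv 0 T n i <= u <= subdiv 0 T n i.+1 ->
    `|kern T (subdiv 0 T n i.+1) - kern T u| <= e / 2.
  near: n; exact: (continuous_subdiv_cell (continuous_kern T0) (ltW T0) e2).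
exists set0; split; [exact: measurable0|by rewrite measure0 lee_fin ltW|].
move=> w _ t; rewrite /= in_itv/= => /andP[t0 tT].
pose s := subdiv 0 T n.
pose ind i : R := (s i < t <= s i.+1)%R%:R.
have indE i : (i < n)%N -> ind i = (s i < t)%R%:R - (s i.+1 < t)%R%:R.
  move=> _; rewrite /ind; have := subdiv_mono n i (ltW T0); rewrite -/s.
  by case: (ltP (s i) t) => h1; case: (ltP (s i.+1) t) => h2 /= h; rewrite ?subr0 ?subrr//; lra.
have ind1 : \sum_(i < n) ind i = 1.
  rewrite (eq_bigr (fun i : 'I_n => - ((s i.+1 < t)%R%:R - (s i < t)%R%:R))); last first.
    by move=> i _; rewrite indE// opprB.
  rewrite sumrN -(big_mkord predT (fun i => ((s i.+1 < t)%R%:R - (s i < t)%R%:R : R))).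
  rewrite (telescope_sumr (fun i => ((s i < t)%R%:R : R)))// /s subdiv0 subdivn// t0.
  by rewrite ltNge tT/= sub0r opprK.
have -> : kern T t = \sum_(i < n) kern T t * ind i by rewrite -mulr_sumr ind1 mulr1.
rewrite /simple_eval/= -/s -sumrB.
apply: le_trans (ler_norm_sum _ _ _) _.
apply: (@le_trans _ _ (\sum_(i < n) e * ind i)); last by rewrite -mulr_sumr ind1 mulr1.
apply: ler_sum => i _; rewrite -/(ind i) -mulrBl normrM.
have [st|st] := boolP (s i < t <= s i.+1); last by rewrite /ind (negbTE st) normr0 !mulr0.
rewrite /ind st normr1 !mulr1.
have /andP[h1 h2] := st.
have k1 := cell i t (ltn_ord i); rewrite (ltW h1) h2 in k1.
have k2 := cell i (s i) (ltn_ord i); rewrite lexx (subdiv_mono _ _ (ltW T0)) in k2.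
rewrite (_ : _ - _ = (kern T (s i.+1) - kern T t) - (kern T (s i.+1) - kern T (s i))); last ring.
by apply: le_trans (ler_normB _ _) _; have := k1 isT; have := k2 isT; lra.
Unshelve. all: by end_near. Qed.

(** The integral up to [t] uses the path stopped at [t], which is again a continuous function plus
    one of finite variation; by parts on [[0, T]], the stretch after [t] gives
    [z t * (kern T - kern t)] and corrects the boundary term from [T] to [t]. *)
Lemma stochastic_integral_kern (I : R -> Omega -> R) (t : R) : 0 <= t <= T ->
  is_stochastic_integral P T F eta (fun u _ => kern T u) I ->
  {ae P, forall w, exists z c y H : R -> R, [/\ continuous c,
    forall s t : R, s <= t -> `|y t - y s| <= H t - H s,
    forall u, z u = c u + y u, measurable_fun setT z &
    forall u, 0 <= u <= T -> eta u w = z u]} ->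
  {ae P, forall w, I t w = kern_int T (eta ^~ w) t}.
Proof.
move=> /andP[t0 tT] [_ _ /(_ _ grid_predictable_ucp) ucp] nice.
have Dt : `[0, T]%classic t by rewrite /= in_itv/= t0.
apply: (ucp_cvg_ae Dt ucp).
move: nice; apply: filterS => w [z [c [y [H [cc yH zE mz ez]]]]].
have cmin : continuous (fun u : R => Num.min u t).
  by move=> u; apply: (@continuous_min _ _ (fun u => u) (fun=> t) u); [exact: cvg_id|exact: cvg_cst].
have mmin : measurable_fun setT (fun u : R => Num.min u t) by exact: continuous_measurable_fun.
have ckt : continuous (fun u => c (Num.min u t)) by move=> u; apply: continuous_comp; [exact: cmin|exact: cc].
have yHt (s r : R) : s <= r -> `|y (Num.min r t) - y (Num.min s t)| <= H (Num.min r t) - H (Num.min s t).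
  by move=> sr; apply: yH; rewrite le_min !ge_min sr lexx orbT.
have mzt : measurable_fun setT (fun u : R => z (Num.min u t)) by exact: (measurableT_comp mz mmin).
have := stieltjes_by_parts (ltW T0) ckt yHt (fun u => zE (Num.min u t)) mzt
  (is_derive_kern T0) (continuous_kern' T0).
have kern0 : kern T 0 = 0 by rewrite /kern mulr0 mul0r mul0r atan0 addr0.
rewrite kern0 mul0r subr0 (min_idPr tT).
have [K zK] : exists K, forall u, 0 <= u <= T -> `|z (Num.min u t)| <= K.
  have [K cK] := continuous_itv_bounded (ltW T0) (continuous_subspaceT cc).
  exists (K + (`|y 0| + (H t - H 0))) => u /andP[u0 uT]; rewrite zE.
  have m0 : 0 <= Num.min u t by rewrite le_min u0.
  apply: le_trans (ler_normD _ _) _; apply: lerD.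
    by apply: cK; rewrite m0 ge_min uT.
  rewrite -[y (Num.min u t)](subrK (y 0)) addrC; apply: le_trans (ler_normD _ _) _; rewrite lerD2l.
  apply: (le_trans (yH _ _ m0)); rewrite lerB// -subr_ge0.
  by apply: le_trans (yH (Num.min u t) t _); rewrite ?ge_min ?lexx ?orbT.
have [M dM] := continuous_itv_bounded (ltW T0) (continuous_subspaceT (continuous_kern' T0)).
have mk' := continuous_measurable_fun (continuous_kern' T0).
have int0T : (@lebesgue_measure R).-integrable `[0, T] (EFin \o (fun u => z (Num.min u t) * kern' T u)).
  apply: (@bounded_integrable_itv _ _ _ _ (K * M)); first exact: measurable_funM.
  by move=> u uT; rewrite normrM ler_pM ?zK ?dM.
rewrite (Rintegral_itv_split t0 tT int0T).
have -> : \int[lebesgue_measure]_(u in `[0, t]) (z (Num.min u t) * kern' T u) =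
    \int[lebesgue_measure]_(u in `[0, t]) (eta u w * kern' T u).
  apply: eq_Rintegral => u; rewrite inE/= in_itv/= => /andP[u0 ut].
  by rewrite (min_idPl ut) ez// u0 (le_trans ut).
have -> : \int[lebesgue_measure]_(u in `[t, T]) (z (Num.min u t) * kern' T u) =
    z t * (kern T T - kern T t).
  rewrite -(Rintegral_FTC tT (is_derive_kern T0) (continuous_kern' T0)) -RintegralZl//; last first.
    by apply: continuous_integrable_itv; exact: continuous_kern'.
  by apply: eq_Rintegral => u; rewrite inE/= in_itv/= => /andP[tu _]; rewrite (min_idPr tu).
rewrite /kern_int (ez t) ?t0// => h.
rewrite (_ : _ - _ = kern T T * z t - (\int[lebesgue_measure]_(u in `[0, t]) (eta u w * kern' T u) +
   z t * (kern T T - kern T t))); last by ring.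
apply: cvg_trans h; apply: near_eq_cvg; near=> n.
apply: eq_bigr => i _; rewrite /=; congr (_ * _).
have s1 := tgrid (ltnW (ltn_ord i)); have s2 := tgrid (ltn_ord i).
have mm (v : R) : 0 <= v <= T -> 0 <= Num.min v t <= T.
  by move=> /andP[v0 vT]; rewrite le_min v0 t0 ge_min vT.
by rewrite !ez ?mm.
Unshelve. all: by end_near. Qed.

End kern_integral.
End almost_sure.

(** * Regularized processes *)

Section clamping.
Context {R : realType}.
Local Notation lambda := (@lebesgue_measure R).
Variable T : R.
Hypothesis T0 : 0 < T.

Definition clamp (u : R) : R := Num.max 0 (Num.min u T).

Lemma clamp_itv u : 0 <= clamp u <= T.
Proof. by rewrite /clamp le_max lexx/= ge_max (ltW T0)/= ge_min lexx orbT. Qed.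

Lemma clamp_id u : 0 <= u <= T -> clamp u = u.
Proof. by move=> /andP[u0 uT]; rewrite /clamp (min_idPl uT) (max_idPr u0). Qed.

Lemma clamp_left u : u <= 0 -> clamp u = 0.
Proof. by move=> u0; rewrite /clamp (max_idPl _)// ge_min u0. Qed.

Lemma clamp_right u : T <= u -> clamp u = T.
Proof. by move=> uT; rewrite /clamp (min_idPr uT) (max_idPr (ltW T0)). Qed.

Lemma clamp_mono s t : s <= t -> clamp s <= clamp t.
Proof.
move=> st; rewrite /clamp ge_max le_max lexx/= le_max le_min !ge_min st lexx !orbT//.
Qed.

Lemma continuous_clamp : continuous clamp.
Proof.
move=> u; apply: (@continuous_max _ _ (fun=> 0) (fun u => Num.min u T) u); first exact: cvg_cst.
by apply: (@continuous_min _ _ (fun u => u) (fun=> T) u); [exact: cvg_id|exact: cvg_cst].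
Qed.

Lemma continuous_comp_clamp (z : R -> R) : {within `[0, T], continuous z} ->
  continuous (z \o clamp).
Proof.
move=> /continuous_within_itvP => /(_ T0)[ci cr cl] u.
apply/left_right_continuousP.
split.
  have [u0|u0] := leP u 0.
    apply: cvg_near_cst; near=> s; rewrite /= !clamp_left//.
    by rewrite (le_trans _ u0)// ltW//; near: s; exact: nbhs_left_lt.
  have [uT|uT] := ltP T u.
    apply: cvg_near_cst; near=> s; rewrite /= !clamp_right ?(ltW uT)//.
    near: s; exact: nbhs_left_ge.
  have E : z u = (z \o clamp) u by rewrite /= clamp_id// ltW.
  have zl : z s @[s --> u^'-] --> z u.
    have [->//|uT'] := eqVneq u T.
    apply: cvg_at_left_filter; apply: ci; rewrite in_itv/= u0 lt_neqAle uT' //.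
  rewrite -E; apply: cvg_trans zl; apply: near_eq_cvg; near=> s.
  rewrite /= clamp_id//; apply/andP; split; first by near: s; exact: nbhs_left_ge.
  by apply: le_trans uT; apply: ltW; near: s; exact: nbhs_left_lt.
have [u0|u0] := ltP u 0.
  apply: cvg_near_cst; near=> s; rewrite /= !clamp_left ?(ltW u0)//.
  near: s; exact: nbhs_right_le.
have [uT|uT] := leP T u.
  apply: cvg_near_cst; near=> s; rewrite /= !clamp_right//.
  by apply: le_trans uT _; apply: ltW; near: s; exact: nbhs_right_gt.
have E : z u = (z \o clamp) u by rewrite /= clamp_id// u0 ltW.
have zr : z s @[s --> u^'+] --> z u.
  have [->//|u0'] := eqVneq u 0.
  apply: cvg_at_right_filter; apply: ci; rewrite in_itv/= uT lt_neqAle eq_sym u0' u0//.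
rewrite -E; apply: cvg_trans zr; apply: near_eq_cvg; near=> s.
rewrite /= clamp_id//; apply/andP; split; last by near: s; exact: nbhs_right_le.
by apply: (le_trans u0); apply: ltW; near: s; exact: nbhs_right_gt.
Unshelve. all: by end_near. Qed.

Lemma right_continuous_clamp (z : R -> R) :
  (forall t : R, 0 <= t < T -> z s @[s --> t^'+] --> z t) ->
  forall u : R, (z \o clamp) s @[s --> u^'+] --> (z \o clamp) u.
Proof.
move=> rz u; have [u0|u0] := ltP u 0.
  apply: cvg_near_cst; near=> s; rewrite /= !clamp_left ?(ltW u0)//.
  near: s; exact: nbhs_right_le.
have [uT|uT] := leP T u.
  apply: cvg_near_cst; near=> s; rewrite /= !clamp_right//.
  by apply: le_trans uT _; apply: ltW; near: s; exact: nbhs_right_gt.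
have E : z u = (z \o clamp) u by rewrite /= clamp_id// u0 ltW.
have zr : z s @[s --> u^'+] --> z u by apply: rz; rewrite u0.
rewrite -E; apply: cvg_trans zr; apply: near_eq_cvg; near=> s.
rewrite /= clamp_id//; apply/andP; split; last by near: s; exact: nbhs_right_le.
by apply: (le_trans u0); apply: ltW; near: s; exact: nbhs_right_gt.
Unshelve. all: by end_near. Qed.

Section cadlag.
Variable z : R -> R.
Hypothesis cz : cadlag T z.

Lemma cadlag_clamp_right u : (z \o clamp) s @[s --> u^'+] --> (z \o clamp) u.
Proof. by case: cz => rz _; exact: right_continuous_clamp. Qed.

Let left_in u : 0 < u <= T -> (z \o clamp) s @[s --> u^'-] --> lim (z s @[s --> u^'-]).
Proof.
move=> /andP[u0 uT]; have zl : cvg (z s @[s --> u^'-]) by case: cz => _; apply; rewrite u0.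
apply: cvg_trans zl; apply: near_eq_cvg; near=> s.
rewrite /= clamp_id//; apply/andP; split; first by near: s; exact: nbhs_left_ge.
by apply: le_trans uT; apply: ltW; near: s; exact: nbhs_left_lt.
Unshelve. all: by end_near. Qed.

Let left_out u : ~~ (0 < u <= T) -> (z \o clamp) s @[s --> u^'-] --> (z \o clamp) u.
Proof.
rewrite negb_and -leNgt -ltNge => /orP[u0|uT].
  apply: cvg_near_cst; near=> s; rewrite /= !clamp_left//.
  by rewrite (le_trans _ u0)// ltW//; near: s; exact: nbhs_left_lt.
apply: cvg_near_cst; near=> s; rewrite /= !clamp_right ?(ltW uT)//.
near: s; exact: nbhs_left_ge.
Unshelve. all: by end_near. Qed.

Lemma cadlag_clamp_left u : cvg ((z \o clamp) s @[s --> u^'-]).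
Proof.
have [uT|uT] := boolP (0 < u <= T); apply/cvg_ex; eexists; first exact: left_in.
exact: left_out.
Qed.

Lemma jump_clamp_in u : 0 < u <= T -> jump (z \o clamp) u = jump z u.
Proof.
move=> uT; rewrite /jump (cvg_lim _ (left_in uT))//= clamp_id//.
by have /andP[/ltW -> ->] := uT.
Qed.

Lemma jump_clamp_out u : ~~ (0 < u <= T) -> jump (z \o clamp) u = 0.
Proof. by move=> uT; rewrite /jump (cvg_lim _ (left_out uT))// subrr. Qed.

End cadlag.

Lemma bounded_variation_clamp (z : R -> R) : bounded_variation 0 T z ->
  exists (G : R -> R) (L : R), (forall u, 0 <= G u <= L) /\
    forall s t : R, s <= t -> `|(z \o clamp) t - (z \o clamp) s| <= G t - G s.
Proof.
move=> bz; have TVfin (u v : R) : 0 <= u -> u <= v -> v <= T -> total_variation u v z \is a fin_num.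
  move=> u0 uv vT; have /bounded_variationP h : 0 <= T by exact: ltW.
  have := (h z).1 bz; rewrite !ge0_fin_numE ?total_variation_ge0 ?(ltW T0)//.
  apply: le_lt_trans.
  rewrite (total_variationD z u0 (le_trans uv vT)) (total_variationD z uv vT).
  apply: (@le_trans _ _ (total_variation u v z + total_variation v T z)%E).
    by rewrite leeDl// total_variation_ge0.
  by rewrite leeDr// total_variation_ge0.
pose G u := fine (total_variation 0 (clamp u) z).
have TVm (s t : R) : s <= t -> 0 <= s -> t <= T ->
    fine (total_variation 0 t z) - fine (total_variation 0 s z) = fine (total_variation s t z).
  move=> st s0 tT; rewrite (total_variationD z s0 st) fineD ?TVfin//; first ring.
  by rewrite (le_trans st).
have ge0 (s t : R) : s <= t -> 0 <= fine (total_variation s t z).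
  by move=> st; rewrite fine_ge0// total_variation_ge0.
exists G, (fine (total_variation 0 T z)); split => [u|s t st].
  have /andP[c0 cT] := clamp_itv u; rewrite ge0//= -subr_ge0 TVm//; exact: ge0.
have /andP[c0 _] := clamp_itv s; have /andP[_ cT] := clamp_itv t.
have cst := clamp_mono st.
rewrite /G TVm// -lee_fin fineK ?TVfin//; exact: total_variation_ge.
Qed.

End clamping.

Section primitives.
Context {R : realType}.
Local Notation lambda := (@lebesgue_measure R).

Lemma continuous_primitive (f : R -> R) : measurable_fun setT f ->
  (forall K : R, exists M, forall u, 0 <= u <= K -> `|f u| <= M) ->
  continuous (fun s : R => \int[lambda]_(u in `[0, s]) f u).
Proof.
move=> mf bf; pose F (s : R) := \int[lambda]_(u in `[0, s]) f u.
have Fneg s : s < 0 -> F s = 0.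
  by move=> s0; rewrite /F set_itv_ge ?Rintegral_set0// bnd_simp -ltNge.
have lip (K M : R) : (forall u, 0 <= u <= K -> `|f u| <= M) -> 0 <= M ->
    forall r s : R, r <= s -> s <= K -> `|F s - F r| <= M * (s - r).
  move=> fM M0 r s rs sK.
  have [s0|s0] := ltP s 0.
    by rewrite !Fneg ?(le_lt_trans rs)// subrr normr0 mulr_ge0// subr_ge0.
  have [r0|r0] := ltP r 0.
    rewrite (Fneg r)// subr0; apply: (@le_trans _ _ (M * (s - 0))).
      by apply: Rintegral_itv_norm_le => // u /andP[u0 us]; rewrite fM ?u0 ?(le_trans us).
    by rewrite ler_wpM2l// lerB// ltW.
  have if_ : lambda.-integrable `[0, s] (EFin \o f).
    by apply: (@bounded_integrable_itv _ _ _ _ M) => // u /andP[u0 us]; rewrite fM ?u0 ?(le_trans us).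
  rewrite /F (Rintegral_itv_split r0 rs if_) addrC addKr.
  by apply: Rintegral_itv_norm_le => // u /andP[ru us]; rewrite fM ?(le_trans r0) ?(le_trans us).
move=> x; have [M fM] := bf (`|x| + 1).
have fM' : forall u, 0 <= u <= `|x| + 1 -> `|f u| <= `|M|.
  by move=> u uK; rewrite (le_trans (fM _ uK))// ler_norm.
have L := lip _ _ fM' (normr_ge0 M).
apply/cvgrPdist_le => e e0.
have M1 : 0 < `|M| + 1 by rewrite ltr_wpDl.
near=> y.
have yx : `|x - y| <= e / (`|M| + 1).
  by near: y; apply: cvgr_dist_le; [exact: cvg_id|rewrite divr_gt0].
have y1 : `|x - y| <= 1 by near: y; apply: cvgr_dist_le; [exact: cvg_id|].
have yK : y <= `|x| + 1.
  by have := ler_norm x; move: y1; rewrite ler_norml; lra.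
have xK : x <= `|x| + 1 by have := ler_norm x; lra.
apply: (@le_trans _ _ (`|M| * `|x - y|)).
  have [xy|/ltW yx'] := leP x y.
    by rewrite distrC (distrC x) (ger0_norm (_ : 0 <= y - x)) ?subr_ge0// L.
  by rewrite (ger0_norm (_ : 0 <= x - y)) ?subr_ge0// L.
apply: (le_trans (ler_wpM2l (normr_ge0 M) yx)).
rewrite mulrA ler_pdivrMr// mulrC ler_wpM2l ?(ltW e0)//.
by rewrite lerDl.
Unshelve. all: by end_near. Qed.

Lemma continuous_locally_bounded (f : R -> R) : continuous f ->
  forall K : R, exists M, forall u, 0 <= u <= K -> `|f u| <= M.
Proof.
move=> cf K; have [K0|K0] := leP 0 K.
  exact: continuous_itv_bounded K0 (continuous_subspaceT cf).
by exists 0 => u /andP[u0 uK]; move: K0; rewrite ltNge (le_trans u0 uK).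
Qed.

End primitives.

(** * Almost sure representation of the processes by regular paths *)

Section regularized_processes.
Context {R : realType} {d : measure_display} {Omega : measurableType d}.
Variable P : probability Omega R.
Local Notation lambda := (@lebesgue_measure R).
Hypothesis Pcomplete : measure_is_complete P.
Variables (T lam : R) (nu : {measure set R -> \bar R}) (W B X : R -> Omega -> R).
Hypothesis T0 : 0 < T.
Hypotheses (W_bm : standard_brownian_motion P T W) (B_bm : standard_brownian_motion P T B).
Hypotheses (X_levy : levy_process P T X) (X_char : has_characteristics P T lam 0 nu X).
Hypothesis X_fv : {ae P, forall w, bounded_variation 0 T (X ^~ w)}.
Hypothesis nu_int : (\int[nu]_(x in [set~ 0%R]) `|x|%:E < +oo)%E.

Definition regular_paths : set Omega := [set w |
  [/\ {within `[0, T], continuous (W ^~ w)}, {within `[0, T], continuous (B ^~ w)},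
      cadlag T (X ^~ w), bounded_variation 0 T (X ^~ w) & X 0 w = 0]].

Lemma ae_regular_paths : {ae P, forall w, regular_paths w}.
Proof.
have [_ _ _ _ cW] := W_bm; have [_ _ _ _ cB] := B_bm; have [_ X0 _ _ cX] := X_levy.
have cWB : {ae P, forall w, {within `[0, T], continuous (W ^~ w)} /\ {within `[0, T], continuous (B ^~ w)}}.
  by move: cW cB; apply: filterS2.
have X0v : {ae P, forall w, X 0 w = 0 /\ bounded_variation 0 T (X ^~ w)}.
  by move: X0 X_fv; apply: filterS2.
by move: cWB cX X0v; apply: filterS3 => w [h1 h2] h3 [h4 h5].
Qed.

(** The complement is negligible, hence measurable by completeness. This lets the paths be changed
    on it while the variables remain measurable. *)
Lemma measurable_regular_paths : measurable regular_paths.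
Proof. by rewrite -[X in measurable X]setCK; apply: measurableC; exact: Pcomplete ae_regular_paths. Qed.

(* Paths frozen outside [0, T], and replaced by [0] on the null set of irregular paths. *)
Definition regularize (Z : R -> Omega -> R) (t : R) (w : Omega) : R :=
  Z (clamp T t) w * \1_regular_paths w.

Local Notation Wr := (regularize W).
Local Notation Br := (regularize B).
Local Notation Xr := (regularize X).

Lemma regularizeE Z w : regular_paths w -> regularize Z ^~ w = (Z ^~ w) \o clamp T.
Proof. by move=> gw; apply/funext => t; rewrite /regularize indicE (mem_set gw) mulr1. Qed.

Lemma regularize_out Z w : ~ regular_paths w -> regularize Z ^~ w = fun=> 0.
Proof. by move=> gw; apply/funext => t; rewrite /regularize indicE (memNset gw) mulr0. Qed.

Lemma regularize_id Z w t : regular_paths w -> 0 <= t <= T -> regularize Z t w = Z t w.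
Proof. by move=> gw tT; rewrite /regularize indicE (mem_set gw) mulr1 clamp_id. Qed.

Lemma measurable_regularize Z t : process T Z -> measurable_fun setT (regularize Z t).
Proof.
move=> pZ; apply: measurable_funM; first by apply: pZ; exact: clamp_itv.
by apply: measurable_indic; exact: measurable_regular_paths.
Qed.

Lemma ae_regularize Z t : 0 <= t <= T -> {ae P, forall w, regularize Z t w = Z t w}.
Proof. by move=> tT; have := ae_regular_paths; apply: filterS => w gw; exact: regularize_id. Qed.

Lemma continuous_Wr w : continuous (Wr ^~ w).
Proof.
have [gw|gw] := pselect (regular_paths w).
  by rewrite (regularizeE _ gw); case: gw => h _ _ _ _; exact: continuous_comp_clamp.
by rewrite (regularize_out _ gw) => u; exact: cvg_cst.
Qed.

Lemma continuous_Br w : continuous (Br ^~ w).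
Proof.
have [gw|gw] := pselect (regular_paths w).
  by rewrite (regularizeE _ gw); case: gw => _ h _ _ _; exact: continuous_comp_clamp.
by rewrite (regularize_out _ gw) => u; exact: cvg_cst.
Qed.

Lemma right_continuous_Xr w (u : R) : Xr s w @[s --> u^'+] --> Xr u w.
Proof.
have [gw|gw] := pselect (regular_paths w); last first.
  rewrite (_ : Xr ^~ w = fun=> 0); last exact: regularize_out.
  by rewrite -[Xr u w]/((Xr ^~ w) u) (regularize_out _ gw); exact: cvg_cst.
have E := regularizeE X gw; rewrite -[Xr u w]/((Xr ^~ w) u) -[X in X @ _]/(Xr ^~ w) E.
by case: gw => _ _ h _ _; exact: cadlag_clamp_right.
Qed.

Lemma left_limit_Xr w (u : R) : cvg (Xr s w @[s --> u^'-]).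
Proof.
have [gw|gw] := pselect (regular_paths w); last first.
  apply/cvg_ex; exists 0.
  rewrite (_ : Xr ^~ w = fun=> 0); last exact: regularize_out.
  exact: cvg_cst.
have E := regularizeE X gw; rewrite -[X in X @ _]/(Xr ^~ w) E.
by case: gw => _ _ h _ _; apply: (cadlag_clamp_left T0 h).
Qed.

Lemma variation_Xr w : exists (G : R -> R) (L : R), (forall u, 0 <= G u <= L) /\
  forall s t : R, s <= t -> `|Xr t w - Xr s w| <= G t - G s.
Proof.
have [gw|gw] := pselect (regular_paths w); last first.
  exists (fun=> 0), 0; split => [u|s t _]; first by rewrite lexx.
  rewrite -[Xr t w]/((Xr ^~ w) t) -[Xr s w]/((Xr ^~ w) s) (regularize_out _ gw).
  by rewrite subrr normr0.
have E := regularizeE X gw; case: (gw) => _ _ _ h _.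
have [G [L [GL h2]]] := bounded_variation_clamp T0 h.
exists G, L; split => // s t st.
by rewrite -[Xr t w]/((Xr ^~ w) t) -[Xr s w]/((Xr ^~ w) s) E; exact: h2.
Qed.

Lemma bounded_Xr w : exists K, forall u, `|Xr u w| <= K.
Proof.
have [G [L [GL h]]] := variation_Xr w; exists (`|Xr 0 w| + L) => u.
rewrite -[Xr u w](subrK (Xr 0 w)) addrC; apply: le_trans (ler_normD _ _) _; rewrite lerD2l.
have := GL u; have := GL 0; have [u0|/ltW u0] := leP 0 u.
  by have := h _ _ u0; lra.
by rewrite distrC; have := h _ _ u0; lra.
Qed.

Lemma jump_Xr_out w u : ~~ (0 < u <= T) -> jump (Xr ^~ w) u = 0.
Proof.
move=> uT; have [gw|gw] := pselect (regular_paths w).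
  by rewrite (regularizeE X gw); exact: jump_clamp_out.
by rewrite (regularize_out _ gw) /jump lim_cst// subrr.
Qed.

Lemma jump_Xr_in w u : regular_paths w -> 0 < u <= T -> jump (X ^~ w) u = jump (Xr ^~ w) u.
Proof.
by move=> gw uT; rewrite (regularizeE X gw) jump_clamp_in//; case: gw.
Qed.

Local Notation Jr w := (path_jumps (Xr ^~ w)).

Lemma path_jumps0 w : Jr w 0 = 0.
Proof.
have z (a : R -> R) : (forall u, u <= 0 -> a u = 0) -> jump_sum a 0 = 0.
  by move=> a0; rewrite /jump_sum esum1// => u /= u0; rewrite a0.
rewrite /path_jumps !z ?subrr// => u u0; rewrite /funrpos /funrneg jump_Xr_out ?oppr0 ?maxxx//.
all: by rewrite negb_and -leNgt u0.
Qed.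

Lemma measurable_Xr_path w : measurable_fun setT (Xr ^~ w).
Proof.
have [G [L [GL h]]] := variation_Xr w.
rewrite (_ : (Xr ^~ w) = (fun s => (Xr s w - Jr w s) + Jr w s)); last first.
  by apply/funext => s; rewrite subrK.
apply: measurable_funD; last exact: measurable_path_jumps (@left_limit_Xr w) GL h.
apply: continuous_measurable_fun.
exact: continuous_path_subr_jumps (@right_continuous_Xr w) (@left_limit_Xr w) GL h.
Qed.

(** At a fixed time, the path minus its jumps is continuous and of finite variation, so the sine
    sums converge pathwise to its increment from 0, and [levy_ito_limit] identifies that increment.
    Right continuity of both sides extends the identity to all times. *)
Lemma levy_ito : {ae P, forall w, forall t, 0 <= t <= T ->
  Xr t w = drift0 lam nu * t + Jr w t}.
Proof.
apply: ae_all_times => //.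
- move=> t tT; have /andP[t0 tT'] := tT.
  suff : {ae P, forall w, Xr t w - Jr w t = drift0 lam nu * t}.
    by apply: filterS => w <-; rewrite subrK.
  apply: (levy_ito_limit X_levy X_char nu_int tT).
  have := ae_regular_paths; apply: filterS => w gw.
  have [G [L [GL h]]] := variation_Xr w.
  have [H cH] := path_subr_jumps_variation (@left_limit_Xr w) GL h.
  have := sin_sum_limit (pure_jump_path_jumps (@left_limit_Xr w) GL h)
    (continuous_path_subr_jumps (@right_continuous_Xr w) (@left_limit_Xr w) GL h) t0 cH.
  rewrite path_jumps0 subr0 (regularize_id _ gw (t := 0)) ?lexx ?(ltW T0)//.
  have X00 : X 0 w = 0 by case: gw.
  rewrite X00 subr0 => lim eta eta0; have [e0 e00 He] := lim _ eta0.
  exists e0 => // e ee; have := He _ ee; apply: filterS => n.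
  congr (`|_ - _| <= _); apply: eq_bigr => i _; congr (_ * sin (_ / _)).
  have s1 := subdiv_itv t0 (ltnW (ltn_ord i)); have s2 := subdiv_itv t0 (ltn_ord i).
  have r1 : Xr (subdiv 0 t n i) w = X (subdiv 0 t n i) w.
    by apply: regularize_id => //; case/andP: s1 => -> /le_trans ->.
  have r2 : Xr (subdiv 0 t n i.+1) w = X (subdiv 0 t n i.+1) w.
    by apply: regularize_id => //; case/andP: s2 => -> /le_trans ->.
  by rewrite -r1 -r2; ring.
- by apply: aeW => w t _; exact: right_continuous_Xr.
apply: aeW => w t _; have [G [L [GL h]]] := variation_Xr w.
apply: cvgD; first by apply: cvgMr; apply: cvg_at_right_filter; exact: cvg_id.
exact: path_jumps_right (@left_limit_Xr w) GL h t.
Qed.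

Definition ratio (t : R) : R := clamp T t / T.

Definition xi (t : R) (w : Omega) : R := Wr t w - ratio t * Wr T w + ratio t * Br t w.

Definition eta_r (t : R) (w : Omega) : R := xi t w + ratio t * Xr t w.

Local Notation eta := (etahat T W (fun t w => B t w + X t w)).

Lemma ratio_itv t : 0 <= ratio t <= 1.
Proof.
have /andP[c0 cT] := clamp_itv T0 t; rewrite /ratio divr_ge0 ?(ltW T0)//=.
by rewrite ler_pdivrMr// mul1r.
Qed.

Lemma ratio_id t : 0 <= t <= T -> ratio t = t / T.
Proof. by move=> tT; rewrite /ratio clamp_id. Qed.

Lemma continuous_ratio : continuous ratio.
Proof. by move=> u; apply: cvgMl; exact: continuous_clamp. Qed.

Lemma continuous_xi w : continuous (xi ^~ w).
Proof.
move=> u; apply: cvgD; first apply: cvgB.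
- exact: continuous_Wr.
- by apply: cvgMl; exact: continuous_ratio.
- by apply: cvgM; [exact: continuous_ratio|exact: continuous_Br].
Qed.

Lemma eta_rE w t : regular_paths w -> 0 <= t <= T -> eta t w = eta_r t w.
Proof.
move=> gw tT; rewrite /eta_r /xi !regularize_id ?ratio_id//; last by rewrite lexx ltW.
by rewrite /etahat; ring.
Qed.

Lemma right_continuous_eta_r w (u : R) : eta_r s w @[s --> u^'+] --> eta_r u w.
Proof.
apply: cvgD; first by apply: cvg_at_right_filter; exact: continuous_xi.
apply: cvgM; last exact: right_continuous_Xr.
by apply: cvg_at_right_filter; exact: continuous_ratio.
Qed.

Lemma measurable_eta_r_path w : measurable_fun setT (eta_r ^~ w).
Proof.
apply: measurable_funD; first exact: continuous_measurable_fun (@continuous_xi w).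
apply: measurable_funM; last exact: measurable_Xr_path.
exact: continuous_measurable_fun continuous_ratio.
Qed.

Lemma bounded_eta_r w (K : R) : exists M, forall u, 0 <= u <= K -> `|eta_r u w| <= M.
Proof.
have [M1 h1] := continuous_locally_bounded (@continuous_xi w) K.
have [M2 h2] := bounded_Xr w.
exists (M1 + M2) => u uK; apply: le_trans (ler_normD _ _) _; apply: lerD; first exact: h1.
have /andP[r0 r1] := ratio_itv u.
rewrite normrM (ger0_norm r0) -[leRHS]mul1r; exact: ler_pM.
Qed.

Lemma eta_r_nice w : exists z c y H : R -> R, [/\ continuous c,
    forall s t : R, s <= t -> `|y t - y s| <= H t - H s,
    forall u, z u = c u + y u, measurable_fun setT z &
    forall u, eta_r u w = z u].
Proof.
have [G [L [GL h]]] := variation_Xr w; have [K hK] := bounded_Xr w.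
(* The variation of the product [ratio * Xr]: the ratio is at most 1 and increases like [clamp / T],
   while [Xr] is bounded by [K] and varies by at most [G]. *)
exists (eta_r ^~ w), (xi ^~ w), (fun u => ratio u * Xr u w), (fun u => G u + K / T * clamp T u).
split => //; first exact: continuous_xi; last exact: measurable_eta_r_path.
move=> s t st; have /andP[r0 r1] := ratio_itv t.
have rs : ratio s <= ratio t by rewrite /ratio ler_pM2r ?invr_gt0// clamp_mono.
rewrite (_ : _ - _ = ratio t * (Xr t w - Xr s w) + (ratio t - ratio s) * Xr s w); last ring.
apply: le_trans (ler_normD _ _) _; rewrite (normrM (ratio t)) (normrM (ratio t - _)) (ger0_norm r0).
rewrite (@ger0_norm _ (ratio t - ratio s)) ?subr_ge0//.
rewrite [leRHS](_ : _ = (G t - G s) + (ratio t - ratio s) * K); last by rewrite /ratio; ring.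
apply: lerD; last by rewrite ler_wpM2l// subr_ge0.
by rewrite -[leRHS]mul1r ler_pM// h.
Qed.

Lemma right_continuous_kern_int (z : R -> R) : measurable_fun setT z ->
  (forall u : R, z s @[s --> u^'+] --> z u) ->
  (forall K : R, exists M, forall u, 0 <= u <= K -> `|z u| <= M) ->
  forall u : R, kern_int T z s @[s --> u^'+] --> kern_int T z u.
Proof.
move=> mz rz bz u; have ck := continuous_kern' T0; apply: cvgB.
  by apply: cvgM; [apply: cvg_at_right_filter; exact: continuous_kern|exact: rz].
apply: cvg_at_right_filter; apply: continuous_primitive.
  by apply: measurable_funM => //; exact: continuous_measurable_fun.
move=> K; have [M1 h1] := bz K; have [M2 h2] := continuous_locally_bounded ck K.
by exists (M1 * M2) => v vK; rewrite normrM ler_pM ?h1 ?h2.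
Qed.

Variable I : R -> Omega -> R.
Hypothesis II : is_stochastic_integral P T (natural_filtration P eta) eta (fun u _ => kern T u) I.

Lemma integral_representation : {ae P, forall w, forall t, 0 <= t <= T ->
  I t w = kern_int T (eta_r ^~ w) t}.
Proof.
apply: ae_all_times => //.
- move=> t tT.
  have F0 u : natural_filtration P eta u set0 by exact: sigma_algebra0.
  have FT u : natural_filtration P eta u setT.
    by rewrite -setC0 -setTD; apply: sigma_algebraCD; exact: sigma_algebra0.
  have nice : {ae P, forall w, exists z c y H : R -> R, [/\ continuous c,
      forall s t : R, s <= t -> `|y t - y s| <= H t - H s,
      forall u, z u = c u + y u, measurable_fun setT z &
      forall u, 0 <= u <= T -> eta u w = z u]}.
    have := ae_regular_paths; apply: filterS => w gw.
    have [z [c [y [H [h1 h2 h3 h4 h5]]]]] := eta_r_nice w.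
    by exists z, c, y, H; split => // u uT; rewrite eta_rE.
  have := stochastic_integral_kern T0 F0 FT tT II nice.
  have := ae_regular_paths; apply: filterS2 => w gw ->.
  have /andP[t0 tT'] := tT.
  rewrite /kern_int eta_rE//; congr (_ - _); apply: eq_Rintegral => u.
  by rewrite inE/= in_itv/= => /andP[u0 ut]; rewrite eta_rE// u0 (le_trans ut).
- by case: II => _ + _; apply: filterS => w [h _].
apply: aeW => w t _; apply: right_continuous_kern_int.
- exact: measurable_eta_r_path.
- exact: right_continuous_eta_r.
- exact: bounded_eta_r.
Qed.

(* On [0, T] the maximum is [denom T s]; it keeps the denominator positive at every [s]. *)
Definition drift_rate (s : R) (w : Omega) : R :=
  Xr s w / T + (kern_int T (xi ^~ w) s - xi s w) / Num.max (denom T s) (T / 2).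

Definition mart (t : R) (w : Omega) : R :=
  eta_r t w - \int[lambda]_(s in `[0, t]) drift_rate s w - t ^+ 2 / (2 * T) * levy_mean lam nu.

Lemma drift_rateE s w : 0 <= s <= T ->
  drift_rate s w = Xr s w / T + (kern_int T (xi ^~ w) s - xi s w) / denom T s.
Proof. by move=> sT; rewrite /drift_rate (max_idPl _)// denom_ge. Qed.

Lemma kern_int_xi_bounded w (K : R) : exists M, forall u, 0 <= u <= K -> `|kern_int T (xi ^~ w) u| <= M.
Proof.
apply: continuous_locally_bounded => u.
have ck := continuous_kern' T0; apply: cvgB.
  by apply: cvgM; [exact: continuous_kern|exact: continuous_xi].
have cxk := continuous_mul (@continuous_xi w) ck.
apply: continuous_primitive; first exact: continuous_measurable_fun.
exact: continuous_locally_bounded.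
Qed.

Lemma right_continuous_drift_rate w (u : R) : drift_rate s w @[s --> u^'+] --> drift_rate u w.
Proof.
apply: cvgD; first by apply: cvgMl; exact: right_continuous_Xr.
apply: cvgM.
  apply: cvgB; last by apply: cvg_at_right_filter; exact: continuous_xi.
  apply: right_continuous_kern_int.
  - exact: continuous_measurable_fun (@continuous_xi w).
  - by move=> v; apply: cvg_at_right_filter; exact: continuous_xi.
  - exact: continuous_locally_bounded (@continuous_xi w).
apply: cvg_at_right_filter; apply: cvgV.
  by rewrite gt_eqF// lt_max divr_gt0 ?orbT.
apply: (@continuous_max _ _ (denom T) (fun=> T / 2) u); last exact: cvg_cst.
exact: continuous_denom.
Qed.

Lemma integrable_drift_rate w t : 0 <= t -> lambda.-integrable `[0, t] (EFin \o (drift_rate ^~ w)).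
Proof.
move=> t0.
have mrate : measurable_fun setT (drift_rate ^~ w).
  apply: measurable_funD; first by apply: measurable_funM => //; exact: measurable_Xr_path.
  apply: measurable_funM.
    apply: measurable_funB; last exact: continuous_measurable_fun (@continuous_xi w).
    apply: continuous_measurable_fun => u; have ck := continuous_kern' T0; apply: cvgB.
      by apply: cvgM; [exact: continuous_kern|exact: continuous_xi].
    have cxk := continuous_mul (@continuous_xi w) ck.
    apply: continuous_primitive; first exact: continuous_measurable_fun.
    exact: continuous_locally_bounded.
  apply: continuous_measurable_fun => u; apply: cvgV.
    by rewrite gt_eqF// lt_max divr_gt0 ?orbT.
  apply: (@continuous_max _ _ (denom T) (fun=> T / 2) u); last exact: cvg_cst.
  exact: continuous_denom.
have [M1 h1] := bounded_Xr w; have [M2 h2] := kern_int_xi_bounded w t.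
have [M3 h3] := continuous_locally_bounded (@continuous_xi w) t.
have T2 : 0 < T / 2 by rewrite divr_gt0.
apply: (@bounded_integrable_itv _ _ _ _ (M1 / T + (M2 + M3) / (T / 2))) => // u ut.
apply: le_trans (ler_normD _ _) _; rewrite (normrM (Xr u w)) (normrM (_ - _)); apply: lerD.
  by rewrite (@gtr0_norm _ T^-1) ?invr_gt0// ler_pM2r ?invr_gt0.
have m0 : 0 < Num.max (denom T u) (T / 2) by rewrite lt_max T2 orbT.
rewrite (@gtr0_norm _ (_ ^-1)) ?invr_gt0//; apply: ler_pM => //; first by rewrite invr_ge0 ltW.
  by apply: le_trans (ler_normB _ _) _; rewrite lerD ?h2 ?h3.
by rewrite lef_pV2 ?posrE// le_max lexx orbT.
Qed.

(** With [A = atan (s / T)] and [s * A - D = - (T - s)], the numerator becomes [(T - s) * (X_s / T +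
    (K xi s - xi_s) / D)], so the factor [T - s] cancels. *)
Lemma mhat_representation : {ae P, forall w, forall t, 0 <= t <= T ->
  mhat T lam nu X eta I t w = mart t w}.
Proof.
have := integral_representation; have := levy_ito; have := ae_regular_paths.
apply: filterS3 => w gw levy Irep t /andP[t0 tT].
have [G [L [GL h]]] := variation_Xr w.
have Txx : 0 <= T <= T by rewrite lexx ltW.
have je u : 0 < u <= T -> jump (eta ^~ w) u = u / T * jump (Xr ^~ w) u.
  move=> /andP[u0 uT].
  have cl : eta s w @[s --> u^'-] --> xi u w + u / T * (Xr u w - jump (Xr ^~ w) u).
    have c1 : xi s w + ratio s * Xr s w @[s --> u^'-] --> xi u w + ratio u * (Xr u w - jump (Xr ^~ w) u).
      apply: cvgD; first by apply: cvg_at_left_filter; exact: continuous_xi.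
      apply: cvgM; first by apply: cvg_at_left_filter; exact: continuous_ratio.
      exact: (jump_left (@left_limit_Xr w)).
    rewrite -ratio_id ?(ltW u0)//; apply: cvg_trans c1; apply: near_eq_cvg; near=> s.
    rewrite eta_rE//; apply/andP; split; first by near: s; exact: nbhs_left_ge.
    by apply: le_trans uT; apply: ltW; near: s; exact: nbhs_left_lt.
  rewrite {1}/jump (cvg_lim _ cl)// eta_rE ?(ltW u0)// /eta_r ratio_id ?(ltW u0)//.
  by ring.
have eE u : 0 <= u <= T -> eta u w = xi u w + u / T * (drift0 lam nu * u + Jr w u).
  by move=> uT; rewrite eta_rE// /eta_r ratio_id// levy.
have iE s : 0 <= s <= T -> I s w = kern_int T (eta ^~ w) s.
  move=> sT; rewrite Irep// /kern_int eta_rE//; congr (_ - _); apply: eq_Rintegral => u.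
  by rewrite inE/= in_itv/= => /andP[u0 us]; rewrite eta_rE// u0 (le_trans us)//; case/andP: sT.
rewrite /mhat /mart eta_rE ?t0//; congr (_ - _ - _).
have irate := integrable_drift_rate w t0.
(* At [s = T] division by [T - s] returns 0 by convention, so the two integrands are compared on the
   half-open interval; the end point has measure 0. *)
have irate' : lambda.-integrable `[0, t[ (EFin \o (drift_rate ^~ w)).
  by apply: integrableS irate => // u /=; rewrite !in_itv/= => /andP[-> /ltW].
pose f s := (drift0 lam nu * s + T * jump_ratio_sum (eta ^~ w) s
        + frakR T (drift0 lam nu) (X ^~ w) (eta ^~ w) (I ^~ w) s
        - eta s w) / (T - s).
have fE s : 0 <= s < t -> f s = drift_rate s w.
  move=> /andP[s0 st]; have sT : s < T by exact: lt_le_trans tT.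
  have sT' : 0 <= s <= T by rewrite s0 ltW.
  rewrite /f drift_rateE//.
  rewrite (@frakR_path _ _ (X ^~ w) (Xr ^~ w) G L T0
    (@left_limit_Xr w) GL h (fun u => jump_Xr_in gw) (@jump_Xr_out w)
    _ _ _ (xi ^~ w) _ sT' (@continuous_xi w) je eE (iE _ sT')).
  rewrite (jump_ratio_sum_path T0 (@jump_Xr_out w) je sT').
  rewrite eE// levy//.
  have D0 := denom_gt0 T0 sT'; move: (D0); rewrite /denom.
  move: (kern_int T (xi ^~ w) s) (xi s w) (Jr w s) (atan (s / T)) => KI x J A D1.
  by field; rewrite !gt_eqF// subr_gt0.
have fI : lambda.-integrable `[0, t[ (EFin \o f).
  apply: eq_integrable irate' => //.
  by move=> s; rewrite inE/= in_itv/= => st; rewrite fE.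
rewrite -(Rintegral_itv_bndo_bndc fI) -(Rintegral_itv_bndo_bndc irate').
by apply: eq_Rintegral => s; rewrite inE/= in_itv/=; exact: fE.
Unshelve. all: by end_near. Qed.

End regularized_processes.

(** * Adaptedness *)

Section measurability_of_limits.
Context {R : realType}.
Local Notation lambda := (@lebesgue_measure R).

(** Lower limits are measurable whether or not the inner limits exist, and they equal the iterated
    limit as soon as the estimate holds. *)
Lemma iterated_limn_einf (f : nat -> nat -> R) (l : R) :
  (forall e : R, 0 < e -> \forall m \near \oo, \forall n \near \oo, `|f m n - l| <= e) ->
  limn_einf (fun m => limn_einf (fun n => (f m n)%:E)) = l%:E.
Proof.
move=> fl; apply/eqP; rewrite eq_le; apply/andP; split.
  apply/lee_addgt0Pr => e e0; apply: limn_einf_le; have := fl _ e0.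
  apply: filterS => m h; apply: limn_einf_le; move: h; apply: filterS => n.
  by rewrite -EFinD lee_fin ler_norml; lra.
apply/lee_subgt0Pr => e e0; apply: limn_einf_ge; have := fl _ e0.
apply: filterS => m h; apply: limn_einf_ge; move: h; apply: filterS => n.
by rewrite -EFinB lee_fin ler_norml; lra.
Qed.

(** Measurability is known for times up to [t] only, as happens for an adapted process; freezing the
    process at [t] makes it jointly measurable on the whole line without changing the integral. *)
Lemma measurable_clamped_time_integral d (Omega : measurableType d) (Z : R -> Omega -> R) (t : R) :
  0 <= t -> (forall s, 0 <= s <= t -> measurable_fun setT (Z s)) ->
  (forall w (s : R), Z r w @[r --> s^'+] --> Z s w) ->
  measurable_fun setT (fun w => \int[lambda]_(s in `[0, t]) Z s w).
Proof.
move=> t0 mZ rZ; have [t0'|tn] := eqVneq t 0.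
  rewrite (_ : (fun w => _) = cst 0)//; apply/funext => w.
  by rewrite t0' set_itv1 Rintegral_set1.
have tp : 0 < t by rewrite lt0r tn.
rewrite (_ : (fun w => _) = (fun w => \int[lambda]_(s in `[0, t]) Z (clamp t s) w)); last first.
  apply/funext => w; apply: eq_Rintegral => s; rewrite inE/= in_itv/= => st.
  by rewrite clamp_id.
apply: (@measurable_time_integral _ _ _ (fun s => Z (clamp t s)))=> //.
apply: (@measurable_right_continuous _ _ _ (fun s => Z (clamp t s))) => [s|w s]; first by apply: mZ; exact: clamp_itv.
by apply: (@right_continuous_clamp _ _ tp (Z ^~ w)) => r _; exact: rZ.
Qed.

Lemma measurable_clip d (Omega : measurableType d) (f : Omega -> R) (e : R) :
  measurable_fun setT f -> measurable_fun setT (fun w => clip e (f w)).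
Proof. by move=> mf; apply: measurable_maxr => //; exact: measurable_minr. Qed.

End measurability_of_limits.

Section adaptedness.
Context {R : realType} {d : measure_display} {Omega : measurableType d}.
Variable P : probability Omega R.
Local Notation lambda := (@lebesgue_measure R).
Variables (T lam : R) (nu : {measure set R -> \bar R}) (W B X : R -> Omega -> R).
Hypothesis T0 : 0 < T.
Hypotheses (W_bm : standard_brownian_motion P T W) (B_bm : standard_brownian_motion P T B).
Hypotheses (X_levy : levy_process P T X) (X_char : has_characteristics P T lam 0 nu X).
Hypothesis X_fv : {ae P, forall w, bounded_variation 0 T (X ^~ w)}.
Hypothesis nu_int : (\int[nu]_(x in [set~ 0%R]) `|x|%:E < +oo)%E.

Local Notation eta := (etahat T W (fun t w => B t w + X t w)).
Local Notation F := (natural_filtration P eta).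
Local Notation Xr := (regularize T W B X X).
Local Notation xir := (xi T W B X).
Local Notation etar := (eta_r T W B X).
Local Notation Jr w := (path_jumps (Xr ^~ w)).

Let levy : {ae P, forall w, forall t, 0 <= t <= T ->
  Xr t w = drift0 lam nu * t + Jr w t}.
Proof. by apply: levy_ito. Qed.

Let good : {ae P, forall w, regular_paths T W B X w}.
Proof. by apply: ae_regular_paths. Qed.

(** Changing a variable on a null set is harmless because every subset of a null set is among the
    generators. *)
Lemma measurable_wrt_ae (G : set (set Omega)) (f g : Omega -> R) :
  measurable_wrt <<s G `|` P.-negligible >> f -> {ae P, forall w, f w = g w} ->
  measurable_wrt <<s G `|` P.-negligible >> g.
Proof.
move=> mf fg C mC.
pose N := [set w | f w <> g w].
have nN : P.-negligible N by [].
have sub A : P.-negligible A -> <<s G `|` P.-negligible >> A.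
  by move=> nA; apply: sub_sigma_algebra; right.
have -> : g @^-1` C = (f @^-1` C `\` N) `|` (g @^-1` C `&` N).
  apply/seteqP; split => w /=; last by move=> [[fC /contrapT <-]|[]].
  by move=> gC; have [e|ne] := pselect (f w = g w); [left|right] => //; split; [rewrite /= e|move=> h; exact: h].
apply: (@measurableU _ (g_sigma_algebraType (G `|` P.-negligible))).
  by apply: (@measurableD _ (g_sigma_algebraType (G `|` P.-negligible))); [exact: mf|exact: sub].
by apply: sub; apply: negligibleS nN; exact: subIsetr.
Qed.

Section fixed_time.
Variable t : R.
Hypothesis tT : 0 <= t <= T.

(** The sigma-algebra at time [t] is turned into a measurable structure of its own on [Omega], so
    that being adapted becomes plain measurability and limits, sums and time integrals are handled
    by the general lemmas. *)
Local Notation gen := ([set A | exists2 s : R, 0 <= s <= t &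
       exists2 C : set R, measurable C & A = eta s @^-1` C] `|` P.-negligible).
Local Notation Om := (g_sigma_algebraType gen).

Let mae (f g : Omega -> R) : measurable_fun (setT : set Om) f -> {ae P, forall w, f w = g w} ->
  measurable_fun (setT : set Om) g.
Proof. by move=> /measurable_wrtP mf fg; apply/measurable_wrtP; exact: measurable_wrt_ae fg. Qed.

Let st_T s : 0 <= s <= t -> 0 <= s <= T.
Proof. by move=> /andP[-> st]; case/andP: tT => _; exact: le_trans. Qed.

Lemma adapted_eta_r s : 0 <= s <= t -> measurable_fun (setT : set Om) (etar s).
Proof.
move=> st; apply: (@mae (eta s)).
  apply/measurable_wrtP => C mC; apply: sub_sigma_algebra; left.
  by exists s => //; exists C.
by move: good; apply: filterS => w gw; apply: eta_rE => //; exact: st_T.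
Qed.

(** On [[dl, s]] the observed process [T * eta_u / u] is [X_u] plus the continuous [T * xi_u / u].
    Sums of its clipped increments converge to the increment of its continuous part; subtracting
    this from the full increment leaves the jumps of [X] between [dl] and [s]. Division by [u]
    forces the start away from 0, and [dl] tends to 0 last. The drift being deterministic, the jumps
    determine [X_s]. *)
Lemma adapted_Xr s : 0 <= s <= t -> measurable_fun (setT : set Om) (Xr s).
Proof.
move=> st; have sT := st_T st; have /andP[s0' _] := st.
have [s0|sn] := eqVneq s 0.
  apply: (@mae (fun=> 0)); first exact: measurable_cst.
  move: levy; apply: filterS => w /(_ _ sT) ->.
  by rewrite s0 mulr0 add0r path_jumps0.
have sp : 0 < s by rewrite lt0r sn.
pose dl (k : nat) : R := s / k.+1%:R.
have dl0 k : 0 < dl k by rewrite divr_gt0.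
have dls k : dl k <= s by rewrite ler_pdivrMr// ler_peMr ?(ltW sp)// ler1n.
pose zeta (u : R) (w : Omega) : R := T * etar u w / u.
have mzeta u : 0 <= u <= t -> measurable_fun (setT : set Om) (zeta u).
  by move=> ut; apply: measurable_funM => //; apply: measurable_funM => //; exact: adapted_eta_r.
have sub k n i : (i <= n)%N -> dl k <= subdiv (dl k) s n i <= s.
  exact: subdiv_itv.
have subt k n i : (i <= n)%N -> 0 <= subdiv (dl k) s n i <= t.
  move=> /(sub k) /andP[h1 h2]; rewrite (le_trans (ltW (dl0 k)) h1)/=.
  by case/andP: st => _; exact: le_trans.
pose f k m n w : R := \sum_(i < n) clip m.+1%:R^-1
   (zeta (subdiv (dl k) s n i.+1) w - zeta (subdiv (dl k) s n i) w).
(* Lower limits in [n], [m] and [k]: the grid is refined first, then the clipping level and finally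
   the starting point go to 0. *)
pose V w := limn_einf (fun k => (zeta s w - zeta (dl k) w)%:E -
  limn_einf (fun m => limn_einf (fun n => (f k m n w)%:E)))%E.
have mV : measurable_fun (setT : set Om) V.
  apply: (@measurable_limn_einf _ _ Om) => k; apply: emeasurable_funB.
    apply/measurable_EFinP; apply: measurable_funB; apply: mzeta => //.
    by rewrite (ltW (dl0 k)) (le_trans (dls k))//; case/andP: st.
  apply: (@measurable_limn_einf _ _ Om) => m; apply: (@measurable_limn_einf _ _ Om) => n.
  apply/measurable_EFinP; apply: measurable_sum => i; apply: measurable_clip.
  by apply: measurable_funB; apply: mzeta; apply: subt => //; exact: ltnW.
apply: (@mae (fun w => drift0 lam nu * s + fine (V w))).
  by apply: measurable_funD => //; apply: measurableT_comp.
move: levy good; apply: filterS2 => w lw gw; rewrite lw//; congr (_ + _).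
suff -> : V w = (Jr w s)%:E by [].
have [G [L [GL h]]] := variation_Xr W B X T0 w.
have ll := @left_limit_Xr _ _ _ _ W B X T0 w.
have pJ := pure_jump_path_jumps ll GL h.
have zetaE u : 0 < u <= s -> zeta u w = T * xir u w / u + drift0 lam nu * u + Jr w u.
  move=> /andP[u0 us]; have uT : 0 <= u <= T by rewrite (ltW u0)/= (le_trans us)//; case/andP: sT.
  rewrite /zeta /eta_r ratio_id// lw//; field; rewrite !gt_eqF//.
have E k : ((zeta s w - zeta (dl k) w)%:E -
    limn_einf (fun m => limn_einf (fun n => (f k m n w)%:E)))%E = (Jr w s - Jr w (dl k))%:E.
  (* The maximum with [dl k] changes nothing on [[dl k, s]] and makes [c] continuous on the whole
     line. *)
  pose c (u : R) := T * xir u w / Num.max u (dl k) + drift0 lam nu * u.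
  have cE u : dl k <= u <= s -> c u + Jr w u = zeta u w.
    move=> /andP[h1 h2]; rewrite zetaE; last by rewrite h2 (lt_le_trans (dl0 k) h1).
    by rewrite /c (max_idPl h1).
  have cc : continuous c.
    move=> u; apply: cvgD; last by apply: cvgMr; exact: cvg_id.
    apply: cvgM; first by apply: cvgMr; exact: continuous_xi.
    apply: cvgV; first by rewrite gt_eqF// lt_max dl0 orbT.
    by apply: (@continuous_max _ _ (fun u => u) (fun=> dl k) u); [exact: cvg_id|exact: cvg_cst].
  rewrite (@iterated_limn_einf _ _ (c s - c (dl k))).
    rewrite -EFinB; congr EFin; rewrite -!cE ?lexx ?dls//; ring.
  move=> e e0; have [e1 e10 He] := clip_sum_limit pJ cc (dls k) e0.
  near=> m.
  have me : 0 < (m.+1%:R^-1 : R) < e1.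
    rewrite invr_gt0 ltr0n/= invf_plt ?posrE// (@lt_trans _ _ m%:R) ?ltr_nat//.
    by near: m; exact: nbhs_infty_gtr.
  have := He _ me; apply: filterS => n; congr (`|_ - _| <= _).
  by apply: eq_bigr => i _; rewrite !cE ?sub// ltnW.
rewrite /V; under eq_fun do rewrite E.
have cJ : (Jr w s - Jr w (dl k))%:E @[k --> \oo] --> (Jr w s)%:E.
  apply: cvg_EFin; first exact: nearW.
  rewrite -[X in _ --> X]subr0 -(path_jumps0 W B X T0 w); apply: cvgB; first exact: cvg_cst.
  have JR : Jr w u @[u --> (0 : R)^'+] --> Jr w 0 by apply: path_jumps_right; [exact: ll|exact: GL|exact: h].
  move/cvg_at_rightP : JR; apply; split => //.
  have := @cvg_div_natr R s; rewrite -(cvg_shiftS (fun k => s / k%:R)); exact.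
by rewrite is_cvg_limn_einfE; [apply/cvg_lim|apply/cvg_ex; eexists; exact: cJ].
Unshelve. all: by end_near. Qed.

Lemma adapted_xi s : 0 <= s <= t -> measurable_fun (setT : set Om) (xir s).
Proof.
move=> st; rewrite (_ : xir s = (fun w => etar s w - ratio T s * Xr s w)); last first.
  by apply/funext => w; rewrite /eta_r addrK.
apply: measurable_funB; first exact: adapted_eta_r.
by apply: measurable_funM => //; exact: adapted_Xr.
Qed.

Lemma adapted_kern_int s : 0 <= s <= t ->
  measurable_fun (setT : set Om) (fun w => kern_int T (xir ^~ w) s).
Proof.
move=> st; have /andP[s0 st'] := st; apply: measurable_funB.
  by apply: measurable_funM => //; exact: adapted_xi.
apply: (@measurable_clamped_time_integral _ _ Om (fun u w => xir u w * kern' T u)) => //.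
  move=> u /andP[u0 us]; apply: measurable_funM => //; apply: adapted_xi.
  by rewrite u0 (le_trans us).
move=> w u; apply: cvg_at_right_filter; apply: cvgM; first exact: continuous_xi.
exact: continuous_kern'.
Qed.

Lemma adapted_mart : measurable_fun (setT : set Om) (mart T lam nu W B X t).
Proof.
have /andP[t0 _] := tT; have tt : 0 <= t <= t by rewrite t0 lexx.
apply: measurable_funB => //; apply: measurable_funB; first exact: adapted_eta_r.
apply: (@measurable_clamped_time_integral _ _ Om (drift_rate T W B X)) => //.
  move=> s st; apply: measurable_funD; first by apply: measurable_funM => //; exact: adapted_Xr.
  apply: measurable_funM => //; apply: measurable_funB; [exact: adapted_kern_int|exact: adapted_xi].
by move=> w s; exact: right_continuous_drift_rate.
Qed.

End fixed_time.
End adaptedness.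

(** * The martingale property *)

Section bridge_covariance.
Context {R : realType}.
Local Notation lambda := (@lebesgue_measure R).
Variable T : R.
Hypothesis T0 : 0 < T.

(* covariance of [W_r - r/T W_T + r/T B_r] and [W_u - u/T W_T + u/T B_u] *)
Definition cov (r u : R) : R :=
  Num.min r u - r * u / T + r / T * (u / T) * Num.min r u.

Lemma cov_ge r u : u <= r -> cov r u = u - r * u / T + r / T * (u / T) * u.
Proof. by move=> ur; rewrite /cov (min_idPr ur). Qed.

Lemma continuous_cov u : continuous (cov ^~ u).
Proof.
have cm : continuous (fun r : R => Num.min r u).
  by move=> r; apply: (@continuous_min _ _ (fun r => r) (fun=> u) r); [exact: cvg_id|exact: cvg_cst].
move=> r; apply: cvgD; first apply: cvgB; first exact: cm.
  by do 2 apply: cvgMl; exact: cvg_id.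
by apply: cvgM; [apply: cvgMl; apply: cvgMl; exact: cvg_id|exact: cm].
Qed.

Let is_derive_satan (v : R) : is_derive v 1 (fun s => s * atan (s / T)) (kern T v).
Proof.
apply: (is_derive_eq (is_deriveM (is_derive_id v 1) (is_derive_atan_div T0 v))).
rewrite /GRing.scale/= /kern; field.
by rewrite lt0r_neq0// ltr_wpDl ?sqr_ge0// exprn_gt0.
Qed.

(** For [r >= u] the covariance is affine in [r] with slope [u^2 / T^2 - u / T], and [kern - 1] is
    the derivative of the denominator, so both sides grow alike beyond [u]; agreement at [r = u] is
    the condition singling out [kern]. The verification integrates the two polynomial pieces of the
    covariance explicitly. *)
Lemma kern_int_cov u r : 0 <= u -> u <= r ->
  kern_int T (cov ^~ u) r - cov r u = denom T r * (u ^+ 2 / T ^+ 2 - u / T).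
Proof.
move=> u0 ur; have r0 := le_trans u0 ur.
have Tn : T != 0 by rewrite gt_eqF.
have ck' := continuous_kern' T0; have cc := continuous_mul (@continuous_cov u) ck'.
have icc (a b : R) := @continuous_integrable_itv _ _ a b cc.
pose q (v : R) := (v ^+ 2 - T ^+ 2) / 2 * atan (v / T) + T * v / 2.
pose K (s : R) := s * atan (s / T).
pose k1 : R := 1 - u / T; pose k2 : R := 2 * u / T ^+ 2.
pose k3 : R := u ^+ 2 / T ^+ 2 - u / T.
have part (c0 c1 c2 a b : R) : a <= b ->
    \int[lambda]_(v in `[a, b]) ((c0 + c1 * v + c2 * v ^+ 2) * kern' T v) =
    ((c0 + c1 * b + c2 * b ^+ 2) * kern T b - c1 * K b - 2 * c2 * q b) -
    ((c0 + c1 * a + c2 * a ^+ 2) * kern T a - c1 * K a - 2 * c2 * q a).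
  move=> ab.
  have dp (v : R) : is_derive v 1 (fun v : R => c0 + c1 * v + c2 * v ^+ 2) (c1 + 2 * c2 * v).
    by apply: is_derive_eq; rewrite /GRing.scale/=; ring.
  have dk : forall v : R, is_derive v 1 (fun v : R => (c0 + c1 * v + c2 * v ^+ 2) * kern T v - c1 * K v - 2 * c2 * q v)
      ((c0 + c1 * v + c2 * v ^+ 2) * kern' T v).
    move=> v; have d1 := is_deriveM (dp v) (is_derive_kern T0 v).
    have d2 := @is_deriveZ _ _ _ _ c1 _ _ _ (is_derive_satan v).
    have d3 := @is_deriveZ _ _ _ _ (2 * c2) _ _ _ (is_derive_kern_primitive T0 v).
    apply: (is_derive_eq (is_deriveB (is_deriveB d1 d2) d3)).
    by rewrite /GRing.scale/=; ring.
  rewrite (Rintegral_FTC ab dk)//; apply: continuous_mul => //.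
  exact: is_derive_continuous dp.
rewrite /kern_int (Rintegral_itv_split u0 ur)//.
have -> : \int[lambda]_(v in `[0, u]) (cov v u * kern' T v) =
    \int[lambda]_(v in `[0, u]) ((0 + k1 * v + u / T ^+ 2 * v ^+ 2) * kern' T v).
  apply: eq_Rintegral => v; rewrite inE/= in_itv/= => /andP[v0 vu]; congr (_ * _).
  by rewrite /cov (min_idPl vu) /k1; field.
have -> : \int[lambda]_(v in `[u, r]) (cov v u * kern' T v) =
    \int[lambda]_(v in `[u, r]) ((u + k3 * v + 0 * v ^+ 2) * kern' T v).
  apply: eq_Rintegral => v; rewrite inE/= in_itv/= => /andP[uv _]; congr (_ * _).
  by rewrite cov_ge// /k3; field.
rewrite !part// cov_ge// /K /q /k1 /k3 /denom.
have kern0 : kern T 0 = 0 by rewrite /kern mulr0 mul0r mul0r atan0 addr0.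
rewrite kern0 !mul0r atan0.
have P : u ^+ 2 + T ^+ 2 != 0 by rewrite gt_eqF// ltr_wpDl ?sqr_ge0// exprn_gt0.
by field.
Qed.

End bridge_covariance.

Section triple_independence.
Context {R : realType} {d : measure_display} {Omega : measurableType d}.
Variable P : probability Omega R.
Variable T : R.
Implicit Types (Z : R -> Omega -> R).

Lemma independent3_rotate (G1 G2 G3 : set (set Omega)) :
  independent3 P G1 G2 G3 -> independent3 P G2 G3 G1.
Proof.
by move=> h A2 A3 A1 g2 g3 g1; rewrite setIC setIA h// -muleA muleC.
Qed.

Lemma sigma_process_setI Z : setI_closed (sigma_process T Z).
Proof.
move=> A C hA hC; exact: (@measurableI _ (g_sigma_algebraType [set A | exists2 s : R, 0 <= s <= T &
       exists2 C : set R, measurable C & A = Z s @^-1` C])).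
Qed.

Lemma sigma_processT Z : sigma_process T Z setT.
Proof. exact: (@measurableT _ (g_sigma_algebraType [set A | exists2 s : R, 0 <= s <= T &
       exists2 C : set R, measurable C & A = Z s @^-1` C])). Qed.

(** Intersections of an event of [Z1] with one of [Z2] form a pi-system independent of [Z3], and the
    combination is measurable for the sigma-algebra they generate. *)
Lemma independent_time_combs Z1 Z2 Z3 l1 l2 (c : R) :
  process T Z1 -> process T Z2 -> process T Z3 ->
  independent3 P (sigma_process T Z1) (sigma_process T Z2) (sigma_process T Z3) ->
  times_in 0 T l1 -> times_in 0 T l2 ->
  forall A (C : set R), sigma_process T Z3 A -> measurable C ->
  P (A `&` (fun w => time_comb Z1 l1 w + time_comb Z2 l2 w + c) @^-1` C) =
  (P A * P ((fun w => time_comb Z1 l1 w + time_comb Z2 l2 w + c)%R @^-1` C))%E.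
Proof.
move=> p1 p2 p3 ind l1T l2T A C sA mC.
pose G := [set A | exists A1 A2, [/\ sigma_process T Z1 A1, sigma_process T Z2 A2 & A = A1 `&` A2]].
have s1 := sigma_process_measurable p1; have s2 := sigma_process_measurable p2.
have s3 := sigma_process_measurable p3.
have indG : independent2 P <<s G >> (sigma_process T Z3).
  apply: independent2_sigmal => //.
  - move=> _ _ [A1 [A2 [a1 a2 ->]]] [B1 [B2 [b1 b2 ->]]].
    exists (A1 `&` B1), (A2 `&` B2); split; [exact: sigma_process_setI|exact: sigma_process_setI|].
    by rewrite setIACA.
  - by move=> _ [A1 [A2 [a1 a2 ->]]]; apply: measurableI; [exact: s1|exact: s2].
  move=> _ B [A1 [A2 [a1 a2 ->]]] sB; rewrite ind//.
  have h : sigma_process T Z3 setT by exact: sigma_processT.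
  by have := ind _ _ _ a1 a2 h; rewrite setIT [X in (_ * X)%E]probability_setT mule1 => ->.
(* Retyping the processes over the generated sigma-algebra lets the measurability of linear
   combinations be reused there. *)
have m1 : process T (Z1 : R -> g_sigma_algebraType G -> R).
  move=> s sT; apply/measurable_wrtP => D mD; apply: sub_sigma_algebra.
  exists (Z1 s @^-1` D), setT; split; [|exact: sigma_processT|by rewrite setIT].
  by apply: sub_sigma_algebra; exists s => //; exists D.
have m2 : process T (Z2 : R -> g_sigma_algebraType G -> R).
  move=> s sT; apply/measurable_wrtP => D mD; apply: sub_sigma_algebra.
  exists setT, (Z2 s @^-1` D); split; [exact: sigma_processT| |by rewrite setTI].
  by apply: sub_sigma_algebra; exists s => //; exists D.
have my : measurable_wrt <<s G >> (fun w => time_comb Z1 l1 w + time_comb Z2 l2 w + c).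
  apply/measurable_wrtP; apply: measurable_funD => //; apply: measurable_funD.
    exact: (measurable_time_comb m1).
  exact: (measurable_time_comb m2).
have h := indG _ _ (my C mC) sA.
by rewrite (setIC A) (muleC (P A)).
Qed.

End triple_independence.

(** * Correlations of the processes with cosine test variables *)

Section test_functions.
Context {R : realType} {d : measure_display} {Omega : measurableType d}.
Variable P : probability Omega R.
Local Notation lambda := (@lebesgue_measure R).
Local Notation L1 f := (P.-integrable setT (EFin \o f)).
Variables (T lam : R) (nu : {measure set R -> \bar R}) (W B X : R -> Omega -> R).
Hypothesis T0 : 0 < T.
Hypotheses (W_bm : standard_brownian_motion P T W) (B_bm : standard_brownian_motion P T B).
Hypotheses (X_levy : levy_process P T X) (X_char : has_characteristics P T lam 0 nu X).
Hypothesis nu_int : (\int[nu]_(x in [set~ 0%R]) `|x|%:E < +oo)%E.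
Hypothesis indep : independent3 P (sigma_process T B) (sigma_process T X) (sigma_process T W).

Local Notation eta := (etahat T W (fun t w => B t w + X t w)).

Let pW : process T W. Proof. by case: W_bm. Qed.
Let pB : process T B. Proof. by case: B_bm. Qed.
Let pX : process T X. Proof. by case: X_levy. Qed.
Let TT : 0 <= T <= T. Proof. by rewrite lexx ltW. Qed.

Lemma process_eta : process T eta.
Proof.
move=> t tT; apply: measurable_funD; first apply: measurable_funB; first exact: pW.
  by apply: measurable_funM => //; exact: pW.
by apply: measurable_funM => //; apply: measurable_funD; [exact: pB|exact: pX].
Qed.

Definition scaled_times (l : seq (R * R)) : seq (R * R) := [seq (q.1 * (q.2 / T), q.2) | q <- l].

(** Pinning the bridge at [T] puts one extra weight on [W T], minus the sum of all
    [q.1 * (q.2 / T)]. *)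
Definition bridge_times (l : seq (R * R)) : seq (R * R) :=
  (- (\sum_(q <- l) q.1 * (q.2 / T)), T) :: l.

Lemma time_comb_eta l w :
  time_comb eta l w = time_comb W (bridge_times l) w + time_comb B (scaled_times l) w +
                      time_comb X (scaled_times l) w.
Proof.
rewrite /time_comb big_cons !big_map mulNr mulr_suml -sumrN -!big_split/=.
by apply: eq_bigr => q _; rewrite /etahat; field; rewrite gt_eqF.
Qed.

Variables (l : seq (R * R)) (c : R).
Hypothesis lT : times_in 0 T l.

Let sT : times_in 0 T (scaled_times l).
Proof. by move=> _ /mapP[q ql ->]; exact: (lT ql). Qed.

Let bT : times_in 0 T (bridge_times l).
Proof. by move=> q; rewrite inE => /predU1P[->|/lT]. Qed.

Definition phase (w : Omega) : R := time_comb eta l w + c.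

Let sin_mean : R := \int[P]_w sin (phase w).

Lemma measurable_phase : measurable_fun setT phase.
Proof. by apply: measurable_funD => //; apply: measurable_time_comb lT; exact: process_eta. Qed.

Lemma W_phase_mean r : 0 <= r <= T -> \int[P]_w (W r w * cos (phase w)) =
  - (\sum_(q <- l) q.1 * Num.min r q.2 - r / T * \sum_(q <- l) q.1 * q.2) * sin_mean.
Proof.
move=> rT.
pose y w := time_comb B (scaled_times l) w + time_comb X (scaled_times l) w + c.
have my : measurable_fun setT y.
  have mB := measurable_time_comb pB sT; have mX := measurable_time_comb pX sT.
  have mW := measurable_time_comb pW bT.
  by apply: measurable_funD => //; exact: measurable_funD.
have iy := independent_time_combs c pB pX pW indep sT sT.
have E w : phase w = time_comb W (bridge_times l) w + y w.
  by rewrite /phase time_comb_eta /y; ring.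
have := brownian_stein W_bm my iy rT bT.
rewrite (_ : (fun w => W r w * cos (time_comb W (bridge_times l) w + y w)) = (fun w => W r w * cos (phase w))).
  move=> ->; rewrite /sin_mean (_ : (fun w => sin (phase w)) = (fun w => sin (time_comb W (bridge_times l) w + y w))).
    congr (- _ * _); rewrite big_cons/= (min_idPl _); last by case/andP: rT.
    rewrite addrC mulNr; congr (_ - _).
    rewrite mulr_suml mulr_sumr; apply: eq_bigr => q _; ring.
  by apply/funext => w; rewrite E.
by apply/funext => w; rewrite E.
Qed.

Lemma B_phase_mean r : 0 <= r <= T -> \int[P]_w (B r w * cos (phase w)) =
  - (\sum_(q <- l) q.1 * (q.2 / T) * Num.min r q.2) * sin_mean.
Proof.
move=> rT.
pose y w := time_comb X (scaled_times l) w + time_comb W (bridge_times l) w + c.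
have my : measurable_fun setT y.
  have mB := measurable_time_comb pB sT; have mX := measurable_time_comb pX sT.
  have mW := measurable_time_comb pW bT.
  by apply: measurable_funD => //; exact: measurable_funD.
have iy := independent_time_combs c pX pW pB (independent3_rotate indep) sT bT.
have E w : phase w = time_comb B (scaled_times l) w + y w.
  by rewrite /phase time_comb_eta /y; ring.
have := brownian_stein B_bm my iy rT sT.
rewrite (_ : (fun w => B r w * cos (time_comb B (scaled_times l) w + y w)) = (fun w => B r w * cos (phase w))).
  move=> ->; rewrite /sin_mean (_ : (fun w => sin (phase w)) = (fun w => sin (time_comb B (scaled_times l) w + y w))).
    by congr (- _ * _); rewrite big_map.
  by apply/funext => w; rewrite E.
by apply/funext => w; rewrite E.
Qed.

Definition raw_xi (r : R) (w : Omega) : R := W r w - r / T * W T w + r / T * B r w.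

Lemma L1_raw_xi r : 0 <= r <= T -> L1 (raw_xi r) /\ \int[P]_w `|raw_xi r w| <= 6 * Num.sqrt T.
Proof.
move=> rT; have [iW WK] := brownian_L1 W_bm rT; have [iB BK] := brownian_L1 B_bm rT.
have [iWT WTK] := brownian_L1 W_bm TT.
have r1 : 0 <= r / T <= 1.
  by case/andP: rT => r0 rT'; rewrite divr_ge0 ?(ltW T0)//= ler_pdivrMr// mul1r.
have /andP[r0 r1'] := r1.
have iL : L1 (raw_xi r).
  by apply: L1D => //; [apply: L1B => //; exact: L1Z|exact: L1Z].
split => //.
have nW := integrable_norm iW; have nB := integrable_norm iB; have nWT := integrable_norm iWT.
have n1 : L1 (fun w => `|W r w| + `|W T w|) by exact: L1D.
apply: (@le_trans _ _ (\int[P]_w (`|W r w| + `|W T w| + `|B r w|))).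
  apply: le_Rintegral => //; [exact: integrable_norm|exact: L1D|].
  move=> w _; apply: le_trans (ler_normD _ _) _; apply: lerD; last first.
    by rewrite normrM ger0_norm// ler_piMl.
  apply: le_trans (ler_normB _ _) _; rewrite lerD2l.
  by rewrite normrM ger0_norm// ler_piMl.
rewrite RintegralD// RintegralD//; lra.
Qed.

Lemma raw_xi_phase_mean r : 0 <= r <= T -> \int[P]_w (raw_xi r w * cos (phase w)) =
  - (\sum_(q <- l) q.1 * cov T r q.2) * sin_mean.
Proof.
move=> rT; have mphi := measurable_phase.
have [iW _] := brownian_L1 W_bm rT; have [iB _] := brownian_L1 B_bm rT.
have [iWT _] := brownian_L1 W_bm TT.
have i1 := L1_cos iW mphi; have i2 := L1_cos iWT mphi; have i3 := L1_cos iB mphi.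
rewrite (_ : (fun w => _) = (fun w => W r w * cos (phase w) - r / T * (W T w * cos (phase w)) +
   r / T * (B r w * cos (phase w)))); last by apply/funext => w; rewrite /raw_xi; ring.
rewrite RintegralD//; [|by apply: L1B => //; exact: L1Z|exact: L1Z].
rewrite RintegralB//; last exact: L1Z.
rewrite !RintegralZl// !W_phase_mean// B_phase_mean// divff ?gt_eqF// mul1r.
(* The end value [W T] is uncorrelated with every value of the bridge, so its term drops out. *)
have -> : \sum_(q <- l) q.1 * Num.min T q.2 = \sum_(q <- l) q.1 * q.2.
  rewrite big_seq [RHS]big_seq; apply: eq_bigr => q /lT/andP[_ qT].
  by rewrite (min_idPr qT).
rewrite subrr oppr0 mul0r mulr0 subr0.
rewrite (_ : r / T * (- _ * sin_mean) = - (r / T * (\sum_(q <- l) q.1 * (q.2 / T) * Num.min r q.2)) * sin_mean); last ring.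
rewrite -mulrDl -opprD; congr (- _ * _).
rewrite !mulr_sumr -sumrB -big_split/=; apply: eq_bigr => q _; rewrite /cov; ring.
Qed.

Lemma X_phase_mean s r : 0 <= s -> s <= r -> r <= T -> times_in 0 s l ->
  \int[P]_w (X r w * cos (phase w)) = \int[P]_w (X s w * cos (phase w)) +
  (r - s) * levy_mean lam nu * \int[P]_w cos (phase w).
Proof.
move=> s0 sr rT ls; have s_T : 0 <= s <= T by rewrite s0 (le_trans sr).
have r_T : 0 <= r <= T by rewrite (le_trans s0 sr).
have [iXr _] := levy_L1 pX X_char nu_int r_T; have [iXs _] := levy_L1 pX X_char nu_int s_T.
have mphi := measurable_phase.
have i1 := L1_cos iXr mphi; have i2 := L1_cos iXs mphi.
pose y w := time_comb W (bridge_times l) w + time_comb B (scaled_times l) w + 0.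
have my : measurable_fun setT y.
  have mB := measurable_time_comb pB sT; have mX := measurable_time_comb pX sT.
  have mW := measurable_time_comb pW bT.
  by apply: measurable_funD => //; exact: measurable_funD.
have iy := independent_time_combs 0 pW pB pX (independent3_rotate (independent3_rotate indep)) bT sT.
have ls' : times_in 0 s (scaled_times l) by move=> _ /mapP[q ql ->]; exact: (ls _ ql).
have iinc : L1 (fun w => X r w - X s w) by exact: L1B.
have [_ X0 iiX _ _] := X_levy.
have := future_increment_mean pX iiX X0 my iy c s0 sr rT ls' iinc.
rewrite (_ : (fun w => (X r w - X s w) * cos (time_comb X (scaled_times l) w + y w + c)) =
   (fun w => X r w * cos (phase w) - X s w * cos (phase w))); last first.
  by apply/funext => w; rewrite /phase time_comb_eta /y -mulrBl; congr (_ * cos _); ring.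
rewrite (_ : (fun w => cos (time_comb X (scaled_times l) w + y w + c)) = (fun w => cos (phase w))); last first.
  by apply/funext => w; rewrite /phase time_comb_eta /y; congr (cos _); ring.
rewrite RintegralB// RintegralB//.
rewrite !(levy_mean_eq pX X_char nu_int)// -mulrBl => h.
by rewrite -h; ring.
Qed.

End test_functions.

(** * Integrability and orthogonality of increments to the past *)

Section martingale_property.
Context {R : realType} {d : measure_display} {Omega : measurableType d}.
Variable P : probability Omega R.
Local Notation lambda := (@lebesgue_measure R).
Local Notation L1 f := (P.-integrable setT (EFin \o f)).
Hypothesis Pcomplete : measure_is_complete P.
Variables (T lam : R) (nu : {measure set R -> \bar R}) (W B X : R -> Omega -> R).
Hypothesis T0 : 0 < T.
Hypotheses (W_bm : standard_brownian_motion P T W) (B_bm : standard_brownian_motion P T B).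
Hypotheses (X_levy : levy_process P T X) (X_char : has_characteristics P T lam 0 nu X).
Hypothesis X_fv : {ae P, forall w, bounded_variation 0 T (X ^~ w)}.
Hypothesis nu_int : (\int[nu]_(x in [set~ 0%R]) `|x|%:E < +oo)%E.
Hypothesis indep : independent3 P (sigma_process T B) (sigma_process T X) (sigma_process T W).

Local Notation eta := (etahat T W (fun t w => B t w + X t w)).
Local Notation Xr := (regularize T W B X X).
Local Notation xir := (xi T W B X).
Local Notation etar := (eta_r T W B X).
Local Notation drift := (drift_rate T W B X).
Local Notation M := (mart T lam nu W B X).

Let pW : process T W. Proof. by case: W_bm. Qed.
Let pB : process T B. Proof. by case: B_bm. Qed.
Let pX : process T X. Proof. by case: X_levy. Qed.
Let mreg Z t : process T Z -> measurable_fun setT (regularize T W B X Z t).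
Proof. by move=> pZ; exact: (measurable_regularize Pcomplete T0 W_bm B_bm X_levy X_fv t pZ). Qed.

Lemma measurable_xi t : measurable_fun setT (xir t).
Proof.
apply: measurable_funD.
  apply: measurable_funB; first exact: (mreg t pW).
  by apply: measurable_funM => //; exact: (mreg T pW).
by apply: measurable_funM => //; exact: (mreg t pB).
Qed.

Let xi_kern (u : R) (w : Omega) : R := xir u w * kern' T u.

Let joint_xi_kern : measurable_fun setT (fun p : Omega * R => xi_kern p.2 p.1).
Proof.
apply: (@measurable_right_continuous _ _ _ xi_kern) => [u|w u].
  by apply: measurable_funM => //; exact: measurable_xi.
by apply: cvg_at_right_filter; apply: cvgM; [exact: continuous_xi|exact: continuous_kern'].
Qed.

Lemma measurable_kern_int_xi s : measurable_fun setT (fun w => kern_int T (xir ^~ w) s).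
Proof.
apply: measurable_funB; first by apply: measurable_funM => //; exact: measurable_xi.
by apply: (@measurable_time_integral _ _ _ xi_kern) => //; exact: measurable_itv.
Qed.

Lemma measurable_drift_rate s : measurable_fun setT (drift s).
Proof.
apply: measurable_funD; first by apply: measurable_funM => //; exact: (mreg s pX).
apply: measurable_funM => //; apply: measurable_funB; first exact: measurable_kern_int_xi.
exact: measurable_xi.
Qed.

Let joint_drift : measurable_fun setT (fun p : Omega * R => drift p.2 p.1).
Proof.
apply: (@measurable_right_continuous _ _ _ drift) => [u|w u]; first exact: measurable_drift_rate.
exact: right_continuous_drift_rate.
Qed.

Let ae_reg Z t : 0 <= t <= T -> {ae P, forall w, regularize T W B X Z t w = Z t w}.
Proof. by move=> tT; apply: ae_regularize. Qed.

Lemma ae_L1 (f g : Omega -> R) (K : R) : measurable_fun setT g -> {ae P, forall w, f w = g w} ->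
  L1 f -> \int[P]_w `|f w| <= K -> L1 g /\ \int[P]_w `|g w| <= K.
Proof.
move=> mg fg if_ fK; have mf : measurable_fun setT f by exact: (L1_measurable measurableT if_).
split.
  apply/integrableP; split; first exact/measurable_EFinP.
  move/integrableP : if_ => [_]; congr (_ < _)%E; apply: ae_eq_integral => //.
  - by apply/measurable_EFinP; exact: measurableT_comp.
  - by apply/measurable_EFinP; exact: measurableT_comp.
  by move: fg; apply: filterS => w /= ->.
rewrite -(@ae_eq_Rintegral _ _ _ _ _ (fun w => `|f w|))//; try exact: measurableT_comp.
by move: fg; apply: filterS => w /= ->.
Qed.

Let ae_xi t : 0 <= t <= T -> {ae P, forall w, raw_xi T W B t w = xir t w}.
Proof.
move=> tT; have TT : 0 <= T <= T by rewrite lexx ltW.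
move: (ae_reg W tT) (ae_reg B tT) (ae_reg W TT); apply: filterS3 => w h1 h2 h3.
by rewrite /raw_xi /xi h1 h2 h3 ratio_id.
Qed.

Definition xi_bound : R := 6 * Num.sqrt T.

Lemma L1_xi t : 0 <= t <= T -> L1 (xir t) /\ \int[P]_w `|xir t w| <= xi_bound.
Proof.
move=> tT; have [i1 K1] := L1_raw_xi T0 W_bm B_bm tT.
exact: ae_L1 (measurable_xi t) (ae_xi tT) i1 K1.
Qed.

Lemma L1_Xr : exists K, forall t, 0 <= t <= T -> L1 (Xr t) /\ \int[P]_w `|Xr t w| <= K.
Proof.
eexists => t tT; have [i1 K1] := levy_L1 pX X_char nu_int tT.
apply: ae_L1 (mreg t pX) _ i1 K1.
by move: (ae_reg X tT); apply: filterS => w ->.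
Qed.

Let kern'_bound : exists K, forall u, 0 <= u <= T -> `|kern' T u| <= K.
Proof. exact: continuous_itv_bounded (ltW T0) (continuous_subspaceT (continuous_kern' T0)). Qed.

Lemma L1_xi_kern : exists2 K, 0 <= K & forall u, 0 <= u <= T -> L1 (xi_kern u) /\ \int[P]_w `|xi_kern u w| <= K.
Proof.
have [K hK] := kern'_bound.
have K0 : 0 <= K by apply: le_trans (hK 0 _); rewrite ?lexx ?(ltW T0).
exists (K * xi_bound); first by rewrite mulr_ge0// mulr_ge0// sqrtr_ge0.
move=> u uT; have [i1 K1] := L1_xi uT.
rewrite (_ : xi_kern u = (fun w => kern' T u * xir u w)); last by apply/funext => w; rewrite mulrC.
split; first exact: L1Z.
have ni := integrable_norm i1.
under eq_Rintegral do rewrite normrM.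
rewrite RintegralZl//; apply: ler_pM => //; last exact: hK.
exact: Rintegral_ge0.
Qed.

Let sub_itv (r : R) : 0 <= r <= T -> forall u, `[0, r]%classic u -> 0 <= u <= T.
Proof. by move=> /andP[_ rT] u /=; rewrite in_itv/= => /andP[-> /le_trans ->]. Qed.

Lemma L1_kern_int : exists K, forall r, 0 <= r <= T ->
  L1 (fun w => kern_int T (xir ^~ w) r) /\ \int[P]_w `|kern_int T (xir ^~ w) r| <= K.
Proof.
have [K1 K10 h1] := L1_xi_kern.
have [K2 h2] := continuous_itv_bounded (ltW T0) (continuous_subspaceT (continuous_kern T0)).
exists (K2 * xi_bound + K1 * T) => r rT; have [ix xK] := L1_xi rT.
have K20 : 0 <= K2 by apply: le_trans (h2 _ rT).
have mD : measurable `[0, r]%classic by exact: measurable_itv.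
have lD := lebesgue_itv_lty (0 : R) r.
have iK s : `[0, r]%classic s -> L1 (xi_kern s) by move=> /(sub_itv rT)/h1[].
have KK s : `[0, r]%classic s -> \int[P]_w `|xi_kern s w| <= K1 by move=> /(sub_itv rT)/h1[].
have i2 : L1 (fun w => \int[lambda]_(u in `[0, r]) xi_kern u w).
  exact: (L1_time_integral mD lD joint_xi_kern iK KK).
have n2 : \int[P]_w `|\int[lambda]_(u in `[0, r]) xi_kern u w| <= K1 * T.
  apply: le_trans (Rintegral_time_integral_norm mD lD joint_xi_kern iK KK) _.
  rewrite ler_wpM2l// lebesgue_measure_itv/=; have /andP[r0 r1] := rT.
  by case: ifP => _ /=; rewrite ?subr0// ltW.
have i3 : L1 (fun w => kern T r * xir r w) by exact: L1Z.
split; first exact: L1B.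
have ni1 := integrable_norm i3; have ni2 := integrable_norm i2.
apply: (@le_trans _ _ (\int[P]_w (`|kern T r * xir r w| + `|\int[lambda]_(u in `[0, r]) xi_kern u w|))).
  apply: le_Rintegral => //; [by apply: integrable_norm; exact: L1B|exact: L1D|].
  by move=> w _; exact: ler_normB.
rewrite RintegralD//; apply: lerD => //.
under eq_Rintegral do rewrite normrM.
have nx := integrable_norm ix.
rewrite RintegralZl//; apply: ler_pM => //; last exact: h2.
exact: Rintegral_ge0.
Qed.

Lemma L1_drift : exists K, forall r, 0 <= r <= T -> L1 (drift r) /\ \int[P]_w `|drift r w| <= K.
Proof.
have [K1 h1] := L1_Xr; have [K2 h2] := L1_kern_int.
exists (T^-1 * K1 + (T / 2)^-1 * (K2 + xi_bound)) => r rT.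
have [i1 n1] := h1 _ rT; have [i2 n2] := h2 _ rT; have [i3 n3] := L1_xi rT.
have T2 : 0 < T / 2 by rewrite divr_gt0.
pose dn := Num.max (denom T r) (T / 2).
have dn0 : 0 < dn by rewrite lt_max T2 orbT.
have dnle : dn^-1 <= (T / 2)^-1 by rewrite lef_pV2 ?posrE// le_max lexx orbT.
have E : drift r = (fun w => T^-1 * Xr r w + dn^-1 * (kern_int T (xir ^~ w) r - xir r w)).
  by apply/funext => w; rewrite /drift_rate -/dn; ring.
have i23 : L1 (fun w => kern_int T (xir ^~ w) r - xir r w) by exact: L1B.
have j1 : L1 (fun w => T^-1 * Xr r w) by exact: L1Z.
have j2 : L1 (fun w => dn^-1 * (kern_int T (xir ^~ w) r - xir r w)) by exact: L1Z.
rewrite E; split; first exact: L1D.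
have m1 := integrable_norm i1; have m2 := integrable_norm i2; have m3 := integrable_norm i3.
have m23 : L1 (fun w => `|kern_int T (xir ^~ w) r| + `|xir r w|) by exact: L1D.
apply: (@le_trans _ _ (\int[P]_w (T^-1 * `|Xr r w| + (T / 2)^-1 * (`|kern_int T (xir ^~ w) r| + `|xir r w|)))).
  apply: le_Rintegral => //; [by apply: integrable_norm; exact: L1D|by apply: L1D => //; exact: L1Z|].
  move=> w _; apply: le_trans (ler_normD _ _) _; apply: lerD.
    by rewrite normrM (@gtr0_norm _ T^-1) ?invr_gt0.
  rewrite normrM (@gtr0_norm _ dn^-1) ?invr_gt0//; apply: ler_pM => //.
    by rewrite invr_ge0 ltW.
  exact: ler_normB.
rewrite RintegralD//; [|exact: L1Z|exact: L1Z].
rewrite !RintegralZl// RintegralD//; apply: lerD; rewrite ler_wpM2l ?invr_ge0 ?(ltW T0) ?(ltW T2)//.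
exact: lerD.
Qed.

Lemma L1_drift_integral t : 0 <= t <= T -> L1 (fun w => \int[lambda]_(s in `[0, t]) drift s w).
Proof.
move=> tT; have [K h] := L1_drift.
have mD : measurable `[0, t]%classic by exact: measurable_itv.
apply: (@L1_time_integral _ _ _ _ _ _ K mD (lebesgue_itv_lty 0 t) joint_drift).
  by move=> s /(sub_itv tT)/h[].
by move=> s /(sub_itv tT)/h[].
Qed.

Lemma L1_eta_r t : 0 <= t <= T -> L1 (etar t).
Proof.
move=> tT; have [K h] := L1_Xr; apply: L1D => //; first by case: (L1_xi tT).
by apply: L1Z => //; case: (h _ tT).
Qed.

Lemma L1_mart t : 0 <= t <= T -> L1 (M t).
Proof.
move=> tT; apply: L1B => //; first apply: L1B => //; first exact: L1_eta_r.
  exact: L1_drift_integral.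
apply: (@L1_bounded _ _ _ _ _ _ `|t ^+ 2 / (2 * T) * levy_mean lam nu|) => //.
by apply: le_lt_trans (probability_le1 _ _) _; rewrite ?ltry.
Qed.

Section test.
Variables (l : seq (R * R)) (c s : R).
Hypotheses (s0 : 0 <= s) (ls : times_in 0 s l).
Local Notation U w := (cos (phase T W B X l c w)).
Let S : R := \int[P]_w sin (phase T W B X l c w).
Let e : R := \int[P]_w U w.
Let x0 : R := \int[P]_w (X s w * U w).
Let m : R := levy_mean lam nu.
Let h (r : R) : R := - (\sum_(q <- l) q.1 * cov T r q.2) * S.
(** The slope of [h] on [[s, T]], where all covariances are affine. By the kernel identity it is
    also the expectation of [(K xi r - xi_r) / D r] against the test variable, which is why the
    increments of [xi] are compensated. *)
Let kappa : R := - (\sum_(q <- l) q.1 * (q.2 ^+ 2 / T ^+ 2 - q.2 / T)) * S.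

Section times.
Hypothesis sT : s <= T.

Let lT : times_in 0 T l.
Proof. by move=> q /ls/andP[-> qs]; exact: le_trans sT. Qed.

Let mphase : measurable_fun setT (phase T W B X l c).
Proof. exact: (measurable_phase T0 W_bm B_bm X_levy c lT). Qed.

Let mU : measurable_fun setT (fun w => U w).
Proof. exact: (measurable_cos_comp mphase). Qed.

Let U1 w : `|U w| <= 1. Proof. by rewrite ler_norml cos_le1 cos_geN1. Qed.

Let L1U f : L1 f -> L1 (fun w => f w * U w).
Proof. by move=> if_; exact: (L1_cos if_ mphase). Qed.

Lemma xi_test r : 0 <= r <= T -> \int[P]_w (xir r w * U w) = h r.
Proof.
move=> rT; rewrite /h /S -(raw_xi_phase_mean T0 W_bm B_bm X_levy indep c lT rT).
apply: ae_eq_Rintegral => //.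
- by apply: measurable_funM => //; exact: (measurable_xi r).
- have [i1 _] := L1_raw_xi T0 W_bm B_bm rT.
  by apply: measurable_funM => //; exact: (L1_measurable measurableT i1).
by move: (ae_xi rT); apply: filterS => w ->.
Qed.

Lemma Xr_test r : s <= r -> r <= T -> \int[P]_w (Xr r w * U w) = x0 + (r - s) * m * e.
Proof.
move=> sr rT; have r0T : 0 <= r <= T by rewrite (le_trans s0 sr).
rewrite /x0 /e /m -(X_phase_mean T0 W_bm B_bm X_levy X_char nu_int indep c lT s0 sr rT ls).
apply: ae_eq_Rintegral => //.
- by apply: measurable_funM => //; exact: (mreg r pX).
- by apply: measurable_funM => //; exact: pX.
by move: (ae_reg X r0T); apply: filterS => w ->.
Qed.

Lemma kern_int_test r : 0 <= r <= T -> \int[P]_w (kern_int T (xir ^~ w) r * U w) = kern_int T h r.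
Proof.
move=> rT; have [K K0 hK] := L1_xi_kern.
have mD : measurable `[0, r]%classic by exact: measurable_itv.
have lD := lebesgue_itv_lty (0 : R) r.
have iK v : `[0, r]%classic v -> L1 (xi_kern v) by move=> /(sub_itv rT)/hK[].
have KK v : `[0, r]%classic v -> \int[P]_w `|xi_kern v w| <= K by move=> /(sub_itv rT)/hK[].
have i2 := L1_time_integral mD lD joint_xi_kern iK KK.
have [i1 _] := L1_xi rT.
rewrite (_ : (fun w => _) = (fun w => kern T r * (xir r w * U w) -
    (\int[lambda]_(u in `[0, r]) xi_kern u w) * U w)); last first.
  by apply/funext => w; rewrite /kern_int mulrBl mulrA.
rewrite RintegralB//; [|by apply: L1Z => //; exact: L1U|exact: L1U].
rewrite RintegralZl//; last exact: L1U.
rewrite xi_test// /kern_int; congr (_ - _).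
rewrite (_ : (fun w => _) = (fun w => U w * \int[lambda]_(u in `[0, r]) xi_kern u w)); last first.
  by apply/funext => w; rewrite mulrC.
rewrite (Rintegral_bounded_time_integral mD lD joint_xi_kern iK KK mU U1).
apply: eq_Rintegral => v /set_mem/(sub_itv rT) vT.
rewrite -xi_test// -RintegralZr//; last by apply: L1U; case: (L1_xi vT).
by apply: eq_Rintegral => w _; rewrite /xi_kern; ring.
Qed.

Lemma kern_int_h r : s <= r -> r <= T -> (kern_int T h r - h r) / denom T r = kappa.
Proof.
move=> sr rT; have r0 := le_trans s0 sr; have r0T : 0 <= r <= T by rewrite r0.
have D0 : denom T r != 0 by rewrite gt_eqF// denom_gt0.
have ick u : lambda.-integrable `[0, r] (EFin \o (fun v => cov T v u * kern' T v)).
  by apply: continuous_integrable_itv; apply: continuous_mul;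
    [exact: continuous_cov|exact: continuous_kern'].
have -> : kern_int T h r = - (\sum_(q <- l) q.1 * kern_int T (cov T ^~ q.2) r) * S.
  have Ih : \int[lambda]_(v in `[0, r]) (h v * kern' T v) =
      - (\sum_(q <- l) q.1 * \int[lambda]_(v in `[0, r]) (cov T v q.2 * kern' T v)) * S.
    rewrite (_ : \int[lambda]_(v in `[0, r]) (h v * kern' T v) =
      \int[lambda]_(v in `[0, r]) (- S * \sum_(q <- l) q.1 * (cov T v q.2 * kern' T v))).
      rewrite RintegralZl//; last by apply: L1_sum => // q; exact: L1Z.
      rewrite Rintegral_sum//; last by move=> q; exact: L1Z.
      rewrite mulNr [RHS]mulNr mulrC; congr (- (_ * _)).
      by apply: eq_bigr => q _; rewrite RintegralZl.
    apply: eq_Rintegral => v _; rewrite /h.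
    rewrite (_ : \sum_(q <- l) q.1 * (cov T v q.2 * kern' T v) = (\sum_(q <- l) q.1 * cov T v q.2) * kern' T v).
      by ring.
    by rewrite mulr_suml; apply: eq_bigr => q _; rewrite mulrA.
  rewrite {1}/kern_int Ih /h.
  rewrite (_ : \sum_(q <- l) q.1 * kern_int T (cov T ^~ q.2) r =
    kern T r * (\sum_(q <- l) q.1 * cov T r q.2) -
    \sum_(q <- l) q.1 * \int[lambda]_(v in `[0, r]) (cov T v q.2 * kern' T v)); first ring.
  by rewrite mulr_sumr -sumrB; apply: eq_bigr => q _; rewrite /kern_int; ring.
apply/eqP; rewrite -(inj_eq (mulIf D0)) divfK//; apply/eqP.
rewrite /kappa /h.
rewrite (_ : \sum_(q <- l) q.1 * kern_int T (cov T ^~ q.2) r = \sum_(q <- l) q.1 * cov T r q.2 +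
    denom T r * \sum_(q <- l) q.1 * (q.2 ^+ 2 / T ^+ 2 - q.2 / T)); first ring.
rewrite mulr_sumr -big_split/= big_seq [RHS]big_seq; apply: eq_bigr => q ql.
have /andP[q0 qs] := ls ql.
by have := kern_int_cov T0 q0 (le_trans qs sr) => /eqP; rewrite subr_eq => /eqP ->; ring.
Qed.

Lemma drift_test r : s <= r -> r <= T ->
  \int[P]_w (drift r w * U w) = (x0 + (r - s) * m * e) / T + kappa.
Proof.
move=> sr rT; have r0T : 0 <= r <= T by rewrite (le_trans s0 sr).
have [K1 /(_ _ r0T)[i1 _]] := L1_Xr; have [K2 /(_ _ r0T)[i2 _]] := L1_kern_int.
have [i3 _] := L1_xi r0T.
rewrite (_ : (fun w => _) = (fun w => T^-1 * (Xr r w * U w) +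
    (denom T r)^-1 * (kern_int T (xir ^~ w) r * U w - xir r w * U w))); last first.
  by apply/funext => w; rewrite drift_rateE//; ring.
have j1 := L1U i1; have j2 := L1U i2; have j3 := L1U i3.
have j23 : L1 (fun w => kern_int T (xir ^~ w) r * U w - xir r w * U w) by exact: L1B.
rewrite RintegralD//; [|exact: L1Z|exact: L1Z].
rewrite !RintegralZl// RintegralB// Xr_test// xi_test// kern_int_test// -(kern_int_h sr rT).
by ring.
Qed.

Lemma h_increment t : s <= t -> h t - h s = (t - s) * kappa.
Proof.
move=> st; rewrite /h /kappa.
suff -> : \sum_(q <- l) q.1 * cov T t q.2 = \sum_(q <- l) q.1 * cov T s q.2 +
    (t - s) * \sum_(q <- l) q.1 * (q.2 ^+ 2 / T ^+ 2 - q.2 / T) by ring.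
rewrite mulr_sumr -big_split/= big_seq [RHS]big_seq; apply: eq_bigr => q ql.
have /andP[q0 qs] := ls ql.
by rewrite !cov_ge//; [field; rewrite gt_eqF|exact: le_trans st].
Qed.

Lemma drift_integral_test t : s <= t -> t <= T ->
  \int[P]_w ((\int[lambda]_(r in `[s, t]) drift r w) * U w) =
  (t - s) * (x0 / T + kappa) + m * e * ((t - s) ^+ 2 / (2 * T)).
Proof.
move=> st tT; have [K hK] := L1_drift.
have mD : measurable `[s, t]%classic by exact: measurable_itv.
have sub r : `[s, t]%classic r -> s <= r /\ r <= T.
  by move=> /=; rewrite in_itv/= => /andP[-> /le_trans ->].
have iK r : `[s, t]%classic r -> L1 (drift r).
  by move=> /sub[sr rT]; apply: (hK r _).1; rewrite (le_trans s0 sr).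
have KK r : `[s, t]%classic r -> \int[P]_w `|drift r w| <= K.
  by move=> /sub[sr rT]; apply: (hK r _).2; rewrite (le_trans s0 sr).
rewrite (_ : (fun w => _) = (fun w => U w * \int[lambda]_(r in `[s, t]) drift r w)); last first.
  by apply/funext => w; rewrite mulrC.
rewrite (Rintegral_bounded_time_integral mD (lebesgue_itv_lty s t) joint_drift iK KK mU U1).
transitivity (\int[lambda]_(r in `[s, t]) ((x0 / T + kappa - s * m * e / T) + m * e / T * r)).
  apply: eq_Rintegral => r /set_mem/sub[sr rT].
  rewrite (_ : \int[P]_w (U w * drift r w) = \int[P]_w (drift r w * U w)).
    by rewrite drift_test//; ring.
  by apply: eq_Rintegral => w _; rewrite mulrC.
pose k := x0 / T + kappa - s * m * e / T.
have dF (r : R) : is_derive r 1 (fun r : R => k * r + m * e / T / 2 * r ^+ 2) (k + m * e / T * r).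
  by apply: is_derive_eq; rewrite /GRing.scale/=; field; rewrite gt_eqF.
rewrite (Rintegral_FTC st dF).
  by rewrite /k; field; rewrite gt_eqF.
by move=> r; apply: cvgD; [exact: cvg_cst|apply: cvgMr; exact: cvg_id].
Qed.

(** The terms in [kappa] and [x0] cancel against the drift integral. Of [m * e / T] there remains
    [t * (t - s)] from [t / T * X_t], against [(t - s)^2 / 2] from the drift and [(t^2 - s^2) / 2]
    from the deterministic term. The two halves add up to it; this is the origin of
    [t^2 / (2 * T)]. *)
Lemma mart_test t : s <= t -> t <= T -> \int[P]_w ((M t w - M s w) * U w) = 0.
Proof.
move=> st tT; have t0 := le_trans s0 st.
have t0T : 0 <= t <= T by rewrite t0.
have s0T : 0 <= s <= T by rewrite s0.
have [K h1] := L1_Xr; have [i1 _] := h1 _ t0T; have [i2 _] := h1 _ s0T.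
have [i3 _] := L1_xi t0T; have [i4 _] := L1_xi s0T.
have i5 : L1 (fun w => \int[lambda]_(r in `[s, t]) drift r w).
  have -> : (fun w => \int[lambda]_(r in `[s, t]) drift r w) =
      (fun w => (\int[lambda]_(r in `[0, t]) drift r w) - (\int[lambda]_(r in `[0, s]) drift r w)).
    apply/funext => w.
    by rewrite (Rintegral_itv_split s0 st (integrable_drift_rate W B X T0 w t0)); ring.
  by apply: L1B => //; exact: L1_drift_integral.
have iU : L1 (fun w => U w) by apply: L1_bounded => //; apply: le_lt_trans (probability_le1 _ _) _; rewrite ?ltry.
pose a := fun w => xir t w * U w - xir s w * U w.
pose b := fun w => t / T * (Xr t w * U w) - s / T * (Xr s w * U w).
pose f := fun w => (\int[lambda]_(r in `[s, t]) drift r w) * U w.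
pose g := fun w => (t ^+ 2 - s ^+ 2) / (2 * T) * m * U w.
have -> : (fun w => (M t w - M s w) * U w) = (fun w => a w + b w - (f w + g w)).
  apply/funext => w; rewrite /a /b /f /g /mart /eta_r !ratio_id//.
  rewrite (Rintegral_itv_split s0 st (integrable_drift_rate W B X T0 w t0)) -/m.
  by field; rewrite gt_eqF.
have j1 := L1U i1; have j2 := L1U i2; have j3 := L1U i3; have j4 := L1U i4; have j5 := L1U i5.
have k1 : L1 (fun w => t / T * (Xr t w * U w)) by exact: L1Z.
have k2 : L1 (fun w => s / T * (Xr s w * U w)) by exact: L1Z.
have ia : L1 a by exact: L1B.
have ib : L1 b by exact: L1B.
have ig : L1 g by exact: L1Z.
have iab : L1 (fun w => a w + b w) by exact: L1D.
have ifg : L1 (fun w => f w + g w) by exact: L1D.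
rewrite RintegralB// RintegralD// [X in _ - X]RintegralD// /a /b /f /g.
rewrite !RintegralB// !RintegralZl// drift_integral_test// !xi_test// !Xr_test// h_increment// -/e.
by field; rewrite gt_eqF.
Qed.

End times.
End test.

Lemma mart_set_integral s t A : 0 <= s -> s <= t -> t <= T -> natural_filtration P eta s A ->
  measurable A /\ (\int[P]_(w in A) (M s w)%:E = \int[P]_(w in A) (M t w)%:E)%E.
Proof.
move=> s0 st tT; have sT := le_trans st tT; have t0 := le_trans s0 st.
(* Indexing by the times up to [s] makes the cylinder generators coincide with those of the natural
   filtration at [s]. *)
pose I := {u : R | 0 <= u <= s}.
pose Y (i : I) : Omega -> R := eta (sval i).
have mY i : measurable_fun setT (Y i).
  have /andP[u0 us] := svalP i; apply: (process_eta T0 W_bm B_bm X_levy).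
  by rewrite u0 (le_trans us).
have iMt : L1 (M t) by apply: L1_mart; rewrite t0.
have iMs : L1 (M s) by apply: L1_mart; rewrite s0.
have iZ : L1 (fun w => M t w - M s w) by exact: L1B.
have Z0 (l : seq (R * I)) c : \int[P]_w ((M t w - M s w) * cos (lincomb Y l w + c)) = 0.
  pose l' := [seq (q.1, sval q.2) | q <- l].
  have ls : times_in 0 s l' by move=> q /mapP[[a [u us]] _ ->].
  rewrite -(mart_test c s0 ls sT st tT); apply: eq_Rintegral => w _.
  by rewrite /phase /time_comb /lincomb big_map.
rewrite /natural_filtration.
rewrite (_ : [set A | exists2 u, 0 <= u <= s & _] =
   [set A | exists i : I, exists2 C : set R, measurable C & A = Y i @^-1` C]); last first.
  apply/seteqP; split => [D [u us [C mC ->]]|D [[u us] [C mC ->]]].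
    by exists (exist _ u us), C.
  by exists u => //; exists C.
move=> /(Rintegral_sigma_trig_uniqueness mY iZ Z0 Pcomplete)[mA zA]; split=> //.
have iMtA : P.-integrable A (EFin \o M t) by exact: integrableS iMt.
have iMsA : P.-integrable A (EFin \o M s) by exact: integrableS iMs.
have E f : P.-integrable A (EFin \o f) -> (\int[P]_(w in A) (f w)%:E = (\int[P]_(w in A) f w)%:E)%E.
  by move=> fA; rewrite fineK//; exact: integrable_fin_num.
rewrite !E//; congr (_%:E); apply/esym/eqP; rewrite -subr_eq0 -RintegralB//; apply/eqP.
rewrite -zA Rintegral_mkcond; apply: eq_Rintegral => w _.
by rewrite patch_indic.
Qed.

End martingale_property.

(** Almost surely [mhat] agrees with [mart] at all times. Adaptedness passes over because the
    filtration contains the null sets, and integrals over events are unchanged. *)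
Theorem proposition3p4 (R : realType) (d : measure_display)
    (Omega : measurableType d) (P : probability Omega R)
    (Pcomplete : measure_is_complete P)
    (T : R) (T_gt0 : 0 < T)
    (lam : R) (nu : {measure set R -> \bar R})
    (W B X : R -> Omega -> R)
    (W_bm : standard_brownian_motion P T W)
    (B_bm : standard_brownian_motion P T B)
    (X_levy : levy_process P T X)
    (X_char : has_characteristics P T lam 0 nu X)
    (X_fv : {ae P, forall w, bounded_variation 0 T (X ^~ w)})
    (nu_int : (\int[nu]_(x in [set~ 0%R]) `|x|%:E < +oo)%E)
    (indep : independent3 P
       (sigma_process T B) (sigma_process T X) (sigma_process T W)) :
  let Y := fun t w => B t w + X t w in
  let eta := etahat T W Y in
  let F := natural_filtration P eta in
  forall I : R -> Omega -> R,
    is_stochastic_integral P T F eta (fun u _ => kern T u) I ->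
    martingale P T F (mhat T lam nu X eta I).
Proof.
move=> Y eta F I II.
have rep := mhat_representation T_gt0 W_bm B_bm X_levy X_char X_fv nu_int II.
have repT t : 0 <= t <= T -> {ae P, forall w, mart T lam nu W B X t w = mhat T lam nu X eta I t w}.
  by move=> tT; move: rep; apply: filterS => w /(_ _ tT) ->.
(* The degenerate case of equal times is used for its first half, the measurability of the events of
   [F s]. *)
have FM s A : 0 <= s -> s <= T -> F s A -> measurable A.
  move=> s0 sT FA.
  by case: (mart_set_integral Pcomplete T_gt0 W_bm B_bm X_levy X_char X_fv nu_int indep s0 (lexx s) sT FA).
have adapted t : 0 <= t <= T -> measurable_wrt (F t) (mhat T lam nu X eta I t).
  move=> tT; apply: measurable_wrt_ae (repT t tT).
  by apply/measurable_wrtP; exact: (adapted_mart T_gt0 W_bm B_bm X_levy X_char X_fv nu_int tT).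
have meas t : 0 <= t <= T -> measurable_fun setT (mhat T lam nu X eta I t).
  move=> /[dup] tT /andP[t0 t1] _ C mC; rewrite setTI; apply: (FM t) => //.
  exact: adapted.
have int t : 0 <= t <= T -> P.-integrable setT (EFin \o mhat T lam nu X eta I t).
  (* [ae_L1] transports a bound along with integrability; the integral itself serves as the
     bound. *)
  move=> tT; have [K iM] : exists K, \int[P]_w `|mart T lam nu W B X t w| <= K by eexists.
  have iM' := L1_mart Pcomplete T_gt0 W_bm B_bm X_levy X_char X_fv nu_int tT.
  by case: (ae_L1 (meas t tT) (repT t tT) iM' iM).
split=> // s t s0 st tT; have sT := le_trans st tT; have t0 := le_trans s0 st.
have sT' : 0 <= s <= T by rewrite s0.
have tT' : 0 <= t <= T by rewrite t0.
split; [exact: adapted|exact: int|move=> A FA].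
have [mA E] := mart_set_integral Pcomplete T_gt0 W_bm B_bm X_levy X_char X_fv nu_int indep s0 st tT FA.
have tr r : 0 <= r <= T ->
    (\int[P]_(w in A) (mhat T lam nu X eta I r w)%:E = \int[P]_(w in A) (mart T lam nu W B X r w)%:E)%E.
  move=> rT; apply: ae_eq_integral => //.
  - by apply/measurable_EFinP; exact: measurable_funTS (meas r rT).
  - have iM := L1_mart Pcomplete T_gt0 W_bm B_bm X_levy X_char X_fv nu_int rT.
    by apply/measurable_EFinP; exact: measurable_funTS (L1_measurable measurableT iM).
  by move: (repT r rT); apply: filterS => w -> _.
by rewrite !tr.
Qed.
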